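(* Let $A$ be a finite set of complex variables, $\alpha^*,\beta^*\in A$, $A'=A\setminus\{\alpha^*,\beta^*\}$, and regard $J_E^*(A,\emptyset)$ as a meromorphic function of the elements of $A$. Then $$\operatorname{Res}_{\alpha^*=-\beta^*}J_E^*(A,\emptyset)=J_E^*(A'\cup\{\beta^*\},\emptyset)+J_E^*(A'\cup\{-\beta^*\},\emptyset)-J_E^*(A',\{\beta^*\}),$$ i.e. the last term is $\sum^\flat_{0<d\le X}\frac{\psi'}{\psi}(\frac12+\beta^*,\chi_d)$ times the summand of $J_E^*(A',\emptyset)$; and $\operatorname{Res}_{\alpha^*=0}J_E^*(A,\emptyset)=0$.
   Context: $E/\mathbb Q$ elliptic curve with prime conductor $M$, root number $\omega_E$, normalized $L$-function $L_E(s)=\sum\lambda(n)n^{-s}$. For fundamental $d$, $\chi_d=(d/\cdot)$ and $\psi(s,\chi_d)=\chi_d(-M)\omega_E\left(\frac{2\pi}{\sqrt M|d|}\right)^{2s-1}\frac{\Gamma(3/2-s)}{\Gamma(s+1/2)}$. $\sum^\flat_{0<d\le X}$ is over fundamental discriminants $0<d\le X$ with $\chi_d(-M)\omega_E=+1$. $Z_\zeta(A,B)=\prod\zeta(1+\alpha+\beta)$, $Y_\zeta(A)=\prod\zeta(1+2\alpha)$, $Z^\dagger_\zeta$ omits factors $\zeta(1)$, $D^-=\{-\delta:\delta\in D\}$. For prime $p$: $U_\pm(A)=\prod_{\alpha\in A}(1\pm\lambda(p)p^{-1/2-\alpha}+p^{-1-2\alpha})$, $V(A)=\prod_{\alpha\in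 A}(1-\lambda(p)p^{-1/2-\alpha})$. With $S=(A\setminus D)\cup D^-$: $Y_E(A,B,D)=\sqrt{\frac{Z_\zeta(S,S)Z_\zeta(B,B)Y_\zeta(B)}{Z_\zeta(S,B)^2Y_\zeta(A\setminus D)Y_\zeta(D^-)}}$, $A_{E,1}=1/Y_E$, $A_{E,2}=\prod_{p\nmid M}\frac1{1+1/p}\left(\frac{U_-(B)}{2U_-(S)}+\frac{U_+(B)}{2U_+(S)}+\frac1p\right)$, $A_{E,3}=\prod_{p\mid M}\frac{V(B)}{V(S)}$, $A_E=A_{E,1}A_{E,2}A_{E,3}$ (analytic). For nonempty $W\subseteq A\setminus D$: $A_{D,i}(W)=\prod_{w\in W}\frac{\partial}{\partial w}\log A_{E,i}(A,B,D)\big|_{B=A}$; $H_D(\{a\})=\sum_{\delta\in D}\left(\frac{\zeta'}{\zeta}(1+a-\delta)-\frac{\zeta'}{\zeta}(1+a+\delta)\right)-\frac{\zeta'}{\zeta}(1+2a)$, $H_D(\{a_1,a_2\})=\left(\frac{\zeta'}{\zeta}\right)'(1+a_1+a_2)$, $H_D(W)=0$ if $|W|\ge3$; $\widetilde H_D=H_D+\sum_{i=1}^3A_{D,i}$. Then $J_E^*(A,B)=\sum^\flat_{0<d\le X}\prod_{\beta\in B}\frac{\psi'}{\psi}(\tfrac12+\beta,\chi_d)\sum_{D\subseteq A}\left(\frac{\sqrt M|d|}{2\pi}\right)^{-2\sum_{\delta\in D}\delta}\prod_{\delta\in D}\frac{\Gamma(1-\delta)}{\Gamma(1+\delta)}\sqrt{\frac{Z_\zeta(D^-,D^-)Z_\zeta(D,D)Y_\zeta(D)}{Z^\dagger_\zeta(D^-,D)^2Y_\zeta(D^-)}}(-1)^{|D|}A_E(D,D,D)\sum_{A\setminus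 D=W_1\cup\cdots\cup W_R}\prod_r\widetilde H_D(W_r)$ (set partitions; equal to 1 if $A\setminus D=\emptyset$). *)

(* Defs.v *)
From HB Require Import structures.
From mathcomp Require Import all_boot all_order all_algebra.
From mathcomp Require Import all_classical all_reals all_analysis.
From mathcomp Require Import complex.
From mathcomp Require Import ring.
Set Implicit Arguments.
Unset Strict Implicit.
Unset Printing Implicit Defensive.
Import Order.TTheory GRing.Theory Num.Theory.
Import numFieldNormedType.Exports.
Local Open Scope classical_set_scope.
Local Open Scope complex_scope.
Local Open Scope ring_scope.

(* the topology and norm of R[i] given by its modulus *)
HB.instance Definition _ (R : rcfType) := NormedModule.copy R[i] R[i]^o.

(* Weierstrass equations y^2 + a1 xy + a3 y = x^3 + a2 x^2 + a4 x + a6 over Z *)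
Record weierstrass := Weierstrass { a1 : int; a2 : int; a3 : int; a4 : int; a6 : int }.

Section EllipticCurve.
Variable E : weierstrass.

Definition b2 : int := a1 E ^+ 2 + 4 * a2 E.
Definition b4 : int := 2 * a4 E + a1 E * a3 E.
Definition b6 : int := a3 E ^+ 2 + 4 * a6 E.
Definition b8 : int :=
  a1 E ^+ 2 * a6 E + 4 * a2 E * a6 E - a1 E * a3 E * a4 E
  + a2 E * a3 E ^+ 2 - a4 E ^+ 2.
Definition c4 : int := b2 ^+ 2 - 24 * b4.
Definition disc : int :=
  - b2 ^+ 2 * b8 - 8 * b4 ^+ 3 - 27 * b6 ^+ 2 + 9 * b2 * b4 * b6.

(* E is a global minimal model of an elliptic curve over Q of conductor the
   prime M.  The conductor exponent at p is 0 for good, 1 for multiplicative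
   and at least 2 for additive reduction, so conductor M means: good reduction
   away from M, multiplicative reduction (M | disc, M not dividing c4) at M.
   These conditions force the integral model to be minimal at every prime, and
   the global minimal model of a curve of conductor M satisfies them. *)
Definition prime_conductor (M : nat) : Prop :=
  [/\ prime M, (M%:Z %| disc)%Z, ~~ (M%:Z %| c4)%Z &
      forall p : nat, prime p -> p != M -> ~~ (p%:Z %| disc)%Z].

Definition affine_points (p : nat) : {set 'F_p * 'F_p} :=
  [set P | P.2 ^+ 2 + (a1 E)%:~R * P.1 * P.2 + (a3 E)%:~R * P.2
        == P.1 ^+ 3 + (a2 E)%:~R * P.1 ^+ 2 + (a4 E)%:~R * P.1 + (a6 E)%:~R]%SET.

(* p + 1 - #E(F_p); at p = M the singular point is counted, which gives
   1 or -1 according to split or nonsplit reduction. *)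
Definition frob_trace (p : nat) : int := p%:Z - #|affine_points p|%:Z.

End EllipticCurve.

Definition legendre (d : int) (p : nat) : int :=
  if (p%:Z %| d)%Z then 0
  else if [exists x : 'I_p, ((x%:Z ^+ 2 == d %[mod p%:Z])%Z)] then 1 else -1.

Definition kronecker_prime (d : int) (p : nat) : int :=
  if p == 2%N then
    if (2%:Z %| d)%Z then 0
    else if ((d %% 8%:Z)%Z == 1) || ((d %% 8%:Z)%Z == 7) then 1 else -1
  else legendre d p.

(* Kronecker symbol (d/n) *)
Definition kronecker (d n : int) : int :=
  if n == 0 then (`|d|%N == 1%N)%:Z
  else (if (n < 0) && (d < 0) then -1 else 1)
       * \prod_(p <- primes `|n|%N) kronecker_prime d p ^+ logn p `|n|%N.

Definition squarefree (n : nat) : bool :=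
  (0 < n)%N && all (fun p => logn p n == 1%N) (primes n).

(* positive fundamental discriminants, d = 1 included *)
Definition fundamental (d : nat) : bool :=
  (squarefree d && (d %% 4 == 1)%N)
  || [&& (4 %| d)%N, squarefree (d %/ 4)%N
       & ((d %/ 4) %% 4 == 2)%N || ((d %/ 4) %% 4 == 3)%N].

Section ComplexFunctions.
Variable R : realType.
Local Notation C := R[i].

Definition cexp (z : C) : C :=
  (expR (complex.Re z) * cos (complex.Im z))
  +i* (expR (complex.Re z) * sin (complex.Im z)).

(* a ^ z, for a > 0 *)
Definition cpow (a : R) (z : C) : C := cexp ((ln a)%:C * z).

(* Gauss's product, convergent for z <> 0, -1, -2, ... *)
Definition Gamma (z : C) : C :=
  lim ((fun n : nat =>
          (n`!)%:R * cpow n%:R z / \prod_(k < n.+1) (z + k%:R) : C) @ \oo).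

(* f, as a function of the variables (z i), is the sum of an absolutely
   convergent power series on a polydisc around a.  Note that 0 < r in R[i]
   says that r is a positive real. *)
Definition analytic_at (I : finType) (f : (I -> C) -> C) (a : I -> C) : Prop :=
  exists (c : {ffun I -> nat} -> C) (r B : C),
    [/\ 0 < r,
        forall N : nat,
          \sum_(m : {ffun I -> 'I_N})
             `|c [ffun i => m i : nat]| * r ^+ (\sum_i m i) <= B
      & forall z : I -> C, (forall i, `|z i - a i| < r) ->
          (fun N : nat => \sum_(m : {ffun I -> 'I_N})
             c [ffun i => m i : nat] * \prod_i (z i - a i) ^+ m i)
          @ \oo --> f z].

Definition analytic1_at (f : C -> C) (a : C) : Prop :=
  analytic_at (fun z : 'I_1 -> C => f (z ord0)) (fun=> a).

(* f has at most a pole at z0, and r is the coefficient of (z - z0)^-1 in its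
   Laurent expansion there. *)
Definition is_residue (f : C -> C) (z0 r : C) : Prop :=
  exists (m : nat) (c : nat -> C) (g : C -> C),
    [/\ analytic1_at g z0, c 0%N = r
      & \forall z \near z0^',
          f z = \sum_(k < m.+1) c k * (z - z0) ^- k.+1 + g z].

(* the meromorphic continuation of \sum_n n^-s; its value at 1 is irrelevant *)
Definition is_riemann_zeta (zeta : C -> C) : Prop :=
  (forall s : C, 1 < complex.Re s ->
     (fun N : nat => \sum_(1 <= n < N) cpow n%:R (- s)) @ \oo --> zeta s)
  /\ exists2 f : C -> C, (forall s, analytic1_at f s)
       & forall s, s != 1 -> zeta s = f s / (s - 1).

Definition logder (f : C -> C) (s : C) : C := derive1 f s / f s.

End ComplexFunctions.

Section LFunction.
Variables (R : realType) (E : weierstrass) (M : nat).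
Local Notation C := R[i].

Definition lambda_p (p : nat) : R := (frob_trace E p)%:~R / Num.sqrt p%:R.

Fixpoint lambda_pk (p k : nat) : R :=
  match k with
  | 0 => 1
  | k1.+1 =>
    lambda_p p * lambda_pk p k1
    - match k1 with
      | 0 => 0
      | k2.+1 => if (p %| M)%N then 0 else lambda_pk p k2
      end
  end.

Definition lambda (n : nat) : R := \prod_(p <- primes n) lambda_pk p (logn p n).

Definition psi (omega : int) (d : nat) (s : C) : C :=
  (kronecker d%:Z (- M%:Z) * omega)%:~R
  * cpow (2 * pi / (Num.sqrt M%:R * d%:R)) (2 * s - 1)
  * Gamma (3%:R / 2%:R - s) / Gamma (s + 1 / 2%:R).

(* omega is the sign of the functional equation L_E(s) = psi(s) L_E(1 - s) of
   the entire continuation of \sum_n lambda(n) n^-s; here psi = psi(., chi_1). *)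
Definition is_root_number (omega : int) : Prop :=
  (omega = 1 \/ omega = -1) /\
  exists L : C -> C,
    [/\ forall s, analytic1_at L s,
        forall s, 1 < complex.Re s ->
          (fun N : nat => \sum_(1 <= n < N) (lambda n)%:C * cpow n%:R (- s))
          @ \oo --> L s
      & forall s, (forall k : nat, 3%:R / 2%:R - s != - k%:R) ->
                  (forall k : nat, s + 1 / 2%:R != - k%:R) ->
          L s = psi omega 1 s * L (1 - s)].

End LFunction.

(* The variables are indexed by 'I_n; x : 'I_n -> R[i] is a point, and sets of
   variables are sets of indices. *)
Section Ratios.
Variables (R : realType) (n : nat).
Local Notation C := R[i].
Local Notation I := 'I_n.
Local Notation point := (I -> C).
Implicit Types (A B D W : {set I}) (x s b : point).

(* With x the values of the variables, (flip D x i) for i in A lists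
   S = (A \ D) u D^-. *)
Definition flip D x : point := fun i => if i \in D then - x i else x i.

Section Zeta.
Variable zeta : C -> C.

Definition Zz A B s b : C := \prod_(i in A) \prod_(j in B) zeta (1 + s i + b j).
Definition Yz A s : C := \prod_(i in A) zeta (1 + 2 * s i).
(* used with s = - b only, where the omitted factors are the zeta(1) *)
Definition Zdag A s b : C :=
  \prod_(i in A) \prod_(j in A | j != i) zeta (1 + s i + b j).

(* The functions under both radicals are squares of meromorphic functions; the
   roots meant are the ones which are positive when the variables are small
   distinct positive reals (in YE, when all the s i and b j are positive). *)
Definition sqrtZ_lt A s : C :=
  \prod_(i in A) \prod_(j in A | (i < j)%N) zeta (1 + s i + s j).
Definition sqrtZ_le A s : C :=
  \prod_(i in A) \prod_(j in A | (i <= j)%N) zeta (1 + s i + s j).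

(* Y_E as a function of S (given by A, s) and B (given by B, b) *)
Definition YE A B s b : C := sqrtZ_lt A s * sqrtZ_le B b / Zz A B s b.

Definition sqrtZD D x : C :=
  sqrtZ_lt D (\- x) * sqrtZ_le D x / Zdag D (\- x) x.

Lemma Zz_sqrtZ A s : Zz A A s s = sqrtZ_lt A s ^+ 2 * Yz A s.
Proof.
pose F i j := zeta (1 + s i + s j).
have sw : \prod_(i in A) \prod_(j in A | (j < i)%N) F i j = sqrtZ_lt A s.
  rewrite (exchange_big_dep (mem A)) /=; last by move=> ? ? ? /andP[].
  apply: eq_bigr => j jA; apply: eq_big => [i|i _]; first by rewrite jA.
  by rewrite /F addrAC.
rewrite expr2 -{1}sw /Zz /Yz /sqrtZ_lt -!big_split /=; apply: eq_bigr => i iA.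
rewrite (bigID (fun j : I => (j < i)%N)) /= -mulrA; congr (_ * _).
rewrite (bigD1 i) /=; last by rewrite iA ltnn.
rewrite mulrC mulr2n mulrDl !mul1r addrA; congr (_ * _).
apply: eq_bigl => j; rewrite -leqNgt -andbA; congr (_ && _).
by rewrite [RHS]ltn_neqAle andbC eq_sym.
Qed.

Lemma sqrtZ_leE A s : sqrtZ_le A s = sqrtZ_lt A s * Yz A s.
Proof.
rewrite /sqrtZ_le /sqrtZ_lt /Yz -big_split /=; apply: eq_bigr => i iA.
rewrite (bigD1 i) /=; last by rewrite iA leqnn.
rewrite mulrC mulr2n mulrDl !mul1r addrA; congr (_ * _).
apply: eq_bigl => j; rewrite -andbA; congr (_ && _).
by rewrite [RHS]ltn_neqAle andbC eq_sym.
Qed.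

Fact sqr_radical (u v w y z : C) : y != 0 ->
  (u * (v * w) / z) ^+ 2 = u ^+ 2 * y * (v ^+ 2 * w) * w / (z ^+ 2 * y).
Proof.
move=> y0; rewrite invfM -exprVn.
transitivity (u ^+ 2 * (v ^+ 2 * w ^+ 2) * z^-1 ^+ 2 * (y * y^-1)); last by ring.
by rewrite divff // mulr1; ring.
Qed.

(* the square of YE, with S = (A \ D) u D^- *)
Lemma YE_sqr A B D x b : D \subset A -> (forall i, i \in A ->
    zeta (1 + 2 * flip D x i) != 0) ->
  YE A B (flip D x) b ^+ 2 =
  Zz A A (flip D x) (flip D x) * Zz B B b b * Yz B b
  / (Zz A B (flip D x) b ^+ 2 * Yz (A :\: D) x * Yz D (\- x)).
Proof.
move=> DA nz.
have YA : Yz A (flip D x) = Yz (A :\: D) x * Yz D (\- x).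
  rewrite /Yz (big_setID D) /= mulrC (finset.setIidPr DA); congr (_ * _).
    by apply: eq_bigr => i; rewrite !inE /flip => /andP[/negPf ->].
  by apply: eq_bigr => i iD; rewrite /flip iD.
have YA0 : Yz A (flip D x) != 0 by apply/prodf_neq0.
by rewrite -[_ * Yz (A :\: D) x * _]mulrA -YA !Zz_sqrtZ /YE sqrtZ_leE (sqr_radical _ _ _ _ YA0).
Qed.

Lemma sqrtZD_sqr D x : (forall i, i \in D -> zeta (1 - 2 * x i) != 0) ->
  sqrtZD D x ^+ 2 =
  Zz D D (\- x) (\- x) * Zz D D x x * Yz D x
  / (Zdag D (\- x) x ^+ 2 * Yz D (\- x)).
Proof.
move=> nz.
have y0 : Yz D (\- x) != 0.
  by apply/prodf_neq0 => i iD; rewrite /= mulrN nz.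
by rewrite !Zz_sqrtZ /sqrtZD sqrtZ_leE (sqr_radical _ _ _ _ y0).
Qed.

Variables (E : weierstrass) (M : nat).
Local Notation lam p := ((lambda_p R E p)%:C).

(* U sg is U_+ for sg = 1 and U_- for sg = -1 *)
Definition U (sg : C) (p : nat) A s : C :=
  \prod_(i in A) (1 + sg * lam p * cpow p%:R (- (1 / 2%:R) - s i)
                  + cpow p%:R (- 1 - 2 * s i)).
Definition V (p : nat) A s : C :=
  \prod_(i in A) (1 - lam p * cpow p%:R (- (1 / 2%:R) - s i)).

Definition AE1 A B s b : C := (YE A B s b)^-1.

Definition AE2_euler A B s b : C :=
  lim ((fun N : nat => \prod_(p < N | prime p && ~~ (p %| M)%N)
      ((1 + (p%:R)^-1)^-1 * (U (-1) p B b / (2 * U (-1) p A s)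
                             + U 1 p B b / (2 * U 1 p A s) + (p%:R)^-1)) : C)
    @ \oo).

Definition AE3 A B s b : C := \prod_(p <- primes M) (V p B b / V p A s).

Definition AE_family := {set I} -> {set I} -> point -> point -> C.

(* AE A B s b is A_E as a function of the elements of S and of B, analytic
   for values in Omega; the Euler product converges when all the variables have
   positive real part, and AE is its analytic continuation from there. *)
Definition is_AE (Omega : set C) (AE : AE_family) : Prop :=
  (forall A B (z : I + I -> C),
     (forall i, i \in A -> Omega (z (inl i))) ->
     (forall j, j \in B -> Omega (z (inr j))) ->
     analytic_at (fun z => AE A B (z \o inl) (z \o inr)) z) /\
  (forall A B s b,
     (forall i, i \in A -> Omega (s i) /\ 0 < complex.Re (s i)) ->
     (forall j, j \in B -> Omega (b j) /\ 0 < complex.Re (b j)) ->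
     AE A B s b = AE1 A B s b * AE2_euler A B s b * AE3 A B s b).

Definition pderiv (i : I) (F : point -> C) : point -> C :=
  fun x => derive1 (fun t : C => F [eta x with i |-> t]) (x i).

(* the iterated derivative, over the nonempty set W of variables, of log F *)
Definition dlog W (F : point -> C) : point -> C :=
  match enum W with
  | [::] => fun=> 0
  | w :: ws => foldr pderiv (fun x => pderiv w F x / F x) ws
  end.

Section Continuation.
Variable AE : AE_family.

(* meromorphic continuation of AE2_euler *)
Definition AE2 A B s b : C := AE A B s b / (AE1 A B s b * AE3 A B s b).

(* A_{D,i}(W) for F = A_{E,i}.  The derivatives do not act on the elements of B.
   Since A_{E,1} and A_{E,2} have a pole and a zero along B = A when D is not
   empty, the (regular) logarithmic derivative is evaluated at B = A by
   continuity, along B = A + e as e -> 0. *)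
Definition AD (F : AE_family) A D W x : C :=
  lim ((fun e : C => dlog W (fun x' => F A A (flip D x') (fun i => x i + e)) x : C)
         @ 0^').

Definition HD D W x : C :=
  match enum W with
  | [:: a] =>
      \sum_(i in D) (logder zeta (1 + x a - x i) - logder zeta (1 + x a + x i))
      - logder zeta (1 + 2 * x a)
  | [:: a; a'] => derive1 (logder zeta) (1 + x a + x a')
  | _ => 0
  end.

Definition Htilde A D W x : C :=
  HD D W x + (AD AE1 A D W x + AD AE2 A D W x + AD AE3 A D W x).

Variables (omega : int) (X : R).

(* J_E^*(A, B) at the point x *)
Definition JE A B x : C :=
  \sum_(1 <= d < (Num.truncn X).+1 |
        fundamental d && (kronecker d%:Z (- M%:Z) * omega == 1))
    (\prod_(j in B) logder (psi M omega d) (1 / 2%:R + x j))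
    * \sum_(D : {set I} | D \subset A)
        cpow (Num.sqrt M%:R * d%:R / (2 * pi)) (- 2 * \sum_(i in D) x i)
        * (\prod_(i in D) (Gamma (1 - x i) / Gamma (1 + x i)))
        * sqrtZD D x * (-1) ^+ #|D| * AE D D (flip D x) x
        * \sum_(P : {set {set I}} | finset.partition P (A :\: D))
            \prod_(W in P) Htilde A D W x.

(* The variables in A take values at which none of the factors of JE A set0 is
   singular; this excludes a proper analytic subset. *)
Definition generic (Omega : set C) A x : Prop :=
  [/\ forall i, i \in A -> Omega (x i) /\ (forall k : int, x i != k%:~R),
      forall i j, i \in A -> j \in A -> i != j -> x i != x j /\ x i != - x j,
      forall u v : C,
        let vals := 0 :: [seq x i | i in A] ++ [seq - x i | i in A] in
        u \in vals -> v \in vals -> u + v != 0 -> zeta (1 + u + v) != 0,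
      forall i, i \in A ->
        V M [set i]%SET x != 0 /\ V M [set i]%SET (\- x) != 0
    & forall D, D \subset A -> AE D D (flip D x) x != 0].

End Continuation.
End Zeta.
End Ratios.

(* Main.v *)
Require Import Defs.
From HB Require Import structures.
From mathcomp Require Import all_boot all_order all_algebra.
From mathcomp Require Import all_classical all_reals all_analysis.
From mathcomp Require Import complex.
From mathcomp Require Import ring lra.
Set Implicit Arguments.
Unset Strict Implicit.
Unset Printing Implicit Defensive.
Import Order.TTheory GRing.Theory Num.Theory.
Import numFieldNormedType.Exports.
Local Open Scope classical_set_scope.
Local Open Scope complex_scope.
Local Open Scope ring_scope.
Import Normc.

(** Write t = alpha* + beta*. Only the terms with D containing both, or exactly
one, of alpha* and beta* are singular at t = 0. If D contains one of them, the
pole 1/t of H_D({other}) multiplies the term of J(A' u {+-beta*}) in which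
beta* belongs to D. If D contains both, zeta(1+t) zeta(1-t) gives a double
pole, and the residue is minus a logarithmic derivative: the Gamma factors and
the power of d give psi'/psi, while the zeta factors, A_E and the H~(W) give
the terms of J(A' u {+-beta*}) in which beta* is not in D; a set partition of
T u {beta*} adds beta* either as a new block or to a block W of a partition of T.

For A_E this uses only that an element common to S and B may be dropped
(by the identity theorem from small positive reals, where it is visible on the
Euler product), so that A_E is symmetric and its derivatives at the collision
are those with alpha* removed. H~_D(W) is H_D(W) plus the logarithmic derivative
of A_E along the S-variables at B = A: the poles of A_{E,1} and the zeros of
A_{E,2} depend only on D.

Complex analysis is done with functions having a first order expansion with a
uniform quadratic error. Averaging over N-th roots of unity gives Cauchy's
formula as N tends to infinity along an ultrafilter, without integrals; hence
this class is stable under derivatives and bounded pointwise limits, and it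
consists of analytic functions. *)

(** A set D containing neither of the two variables also contributes a pole: the block made of both
    carries (zeta'/zeta)'(1 + t) = 1/t^2 + regular. All other factors of that contribution are
    constant in the moving variable, so its residue is 0. At the point 0 the residues cancel in
    pairs: a set D without the variable has 1/2 from -(zeta'/zeta)(1 + 2a), the set D with it
    adjoined has -1/2 from the factor zeta(1 + 2a), both times the same summand over the smaller
    variable set.

    The obstacle is that A_E is known only as a continuation: dependence on the listed variables
    alone, symmetry and cancellation cannot be read off near the collision. They are therefore all
    reduced to one rule, which is transported to the logarithmic derivatives by pulling back along
    affine substitutions. Since A_E(D,D,D) and A_E(A,A,D) agree by the same rule, each summand
    involves one function only.

    No pole exceeds order two, so a term is written h(z)/(z - z0)^2 and its residue is h'(z0); the
    residue calculus becomes the product rule. One variable moves as z, all others stay fixed, and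
    every function is indexed by the same finite set. *)

Section ComplexModulus.
Variable R : realType.
Local Notation C := R[i].
Local Notation nm := (@normc R).
Implicit Types x y z : C.

Lemma nm_ge0 z : 0 <= nm z.
Proof. by case: z => a b; rewrite /= sqrtr_ge0. Qed.

Lemma normrE z : `|z| = (nm z)%:C. Proof. by []. Qed.

Lemma nm_gt0 z : (0 < nm z) = (z != 0).
Proof. by rewrite -ltcR -normrE normr_gt0. Qed.

Lemma nmD x y : nm (x + y) <= nm x + nm y.
Proof. exact: le_normcD. Qed.

Lemma nmN z : nm (- z) = nm z.
Proof. exact: normcN. Qed.

Lemma nmB x y : nm (x - y) <= nm x + nm y.
Proof. by rewrite -(nmN y) nmD. Qed.

Lemma nm_distrC x y : nm (x - y) = nm (y - x).
Proof. by rewrite -nmN opprB. Qed.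

Lemma nm_tri x y z : nm (x - z) <= nm (x - y) + nm (y - z).
Proof. by rewrite (le_trans _ (nmD _ _)) // addrA subrK. Qed.

Lemma nm_real (a : R) : nm a%:C = `|a|.
Proof. by rewrite /= expr0n addr0 sqrtr_sqr. Qed.

Lemma nm_nat n : nm n%:R = n%:R.
Proof. by rewrite -(rmorph_nat (real_complex R)) nm_real normr_nat. Qed.

Lemma nmX z n : nm (z ^+ n) = nm z ^+ n.
Proof. by elim: n => [|n IH]; rewrite ?expr0 ?normc1 // !exprS normcM IH. Qed.

Lemma nm_sum (I : Type) (r : seq I) (P : pred I) (F : I -> C) :
  nm (\sum_(i <- r | P i) F i) <= \sum_(i <- r | P i) nm (F i).
Proof.
elim/big_rec2: _ => [|i y1 y2 _ h]; first by rewrite normc0.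
by apply: le_trans (nmD _ _) _; rewrite lerD2l.
Qed.

Lemma nm_eq0 z : (nm z == 0) = (z == 0).
Proof. by apply/eqP/eqP => [/eq0_normc|->]; rewrite ?normc0. Qed.

Lemma nm_Re z : `|complex.Re z| <= nm z.
Proof. by rewrite -lecR normc_ge_Re. Qed.

Lemma nm_Im z : `|complex.Im z| <= nm z.
Proof.
case: z => a b /=; rewrite -(sqrtr_sqr b) ler_wsqrtr //.
by rewrite lerDr sqr_ge0.
Qed.

Lemma nm_ReIm z : nm z <= `|complex.Re z| + `|complex.Im z|.
Proof.
rewrite {1}(complexE z); apply: le_trans (nmD _ _) _.
by rewrite normcM !nm_real /= expr0n add0r expr1n sqrtr1 mul1r.
Qed.

(** A positive element of [R[i]] is a positive real, so epsilon may be taken in [R]. *)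
Lemma cvgCP (T : Type) (F : set_system T) (FF : Filter F) (u : T -> C) (l : C) :
  u @ F --> l <-> forall e : R, 0 < e -> \forall n \near F, nm (u n - l) < e.
Proof.
split=> [/cvgrPdist_lt h e e0|h].
  have /h : 0 < e%:C by rewrite ltcR.
  by apply: filterS => n; rewrite distrC normrE ltcR.
apply/cvgrPdist_lt => e e0; have re : e = (complex.Re e)%:C.
  by rewrite RRe_real // gtr0_real.
have /h : 0 < complex.Re e by rewrite -ltcR -re.
by apply: filterS => n; rewrite re distrC normrE ltcR.
Qed.

Lemma nbhsCP z (P : C -> Prop) :
  (\forall w \near z, P w) <->
  exists2 r : R, 0 < r & forall w, nm (w - z) < r -> P w.
Proof.
rewrite -nbhs_nearE nbhs_ballP; split=> [[e /= e0 h]|[r r0 h]].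
  have re : e = (complex.Re e)%:C by rewrite RRe_real // gtr0_real.
  exists (complex.Re e); first by rewrite -ltcR -re.
  move=> w hw; apply: h; rewrite -ball_normE /ball_ /=.
  by rewrite re distrC normrE ltcR.
exists r%:C; first by rewrite /= ltcR.
move=> w; rewrite -ball_normE /ball_ /= distrC normrE ltcR; exact: h.
Qed.

Lemma dnbhsCP z (P : C -> Prop) :
  (\forall w \near z^', P w) <->
  exists2 r : R, 0 < r & forall w, w != z -> nm (w - z) < r -> P w.
Proof.
have -> : (\forall w \near z^', P w) = (\forall w \near z, w != z -> P w) by [].
rewrite nbhsCP; split=> [[r r0 h]|[r r0 h]]; exists r => // w; first by move=> ? ?; apply: h.
by move=> ? ?; apply: h.
Qed.

End ComplexModulus.

(** * Limits along a free ultrafilter *)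

Lemma ultra_fmap (T T' : Type) (f : T -> T') (U : set_system T) :
  UltraFilter U -> UltraFilter (f @ U).
Proof.
move=> UU; have PU := ultra_proper.
apply: Build_UltraFilter => G PG sG; apply/seteqP; split=> A GA; last exact: sG.
(* If the preimage of A is not in U then that of its complement is, and G would contain both A and
   its complement. *)
have [//|nA] := in_ultra_setVsetC (f @^-1` A) UU.
have := filterI GA (sG (~` A) nA).
by rewrite setICr => h0; case: (@filter_not_empty _ G PG); apply: h0.
Qed.

Section UltraLimit.
Variable R : realType.
Local Notation C := R[i].
Local Notation nm := (@normc R).

Let ultraP : { U : set_system nat | UltraFilter U /\ \oo `<=` U }.
Proof. by apply: cid; apply: ultraFilterLemma. Qed.

(* Limits along a free ultrafilter make every bounded sequence converge, so that
   no convergence of the averages has to be proved. *)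
Definition free_ultra : set_system nat := sval ultraP.
Local Notation U := free_ultra.
Lemma free_ultra_ultra : UltraFilter U. Proof. by have [] := svalP ultraP. Qed.
#[local] Instance free_ultra_proper : ProperFilter U.
Proof. exact: @ultra_proper _ _ free_ultra_ultra. Qed.
Lemma ooU : \oo `<=` U. Proof. by have [] := svalP ultraP. Qed.

Definition ulim (u : nat -> C) : C := lim (u @ U).

Definition bdd (u : nat -> C) := exists B : R, forall n, nm (u n) <= B.

Lemma bdd_cvg_real (u : nat -> R) (B : R) :
  (forall n, `|u n| <= B) -> exists l : R, u @ U --> l.
Proof.
(* Compactness in its ultrafilter form: the image of [U] contains the segment, hence converges in
   it. *)
move=> h; have := @segment_compact R (- B) B; rewrite compact_ultra /= => /(_ (u @ U)).
move=> /(_ (ultra_fmap _ free_ultra_ultra)) []; last by move=> l [_ hl]; exists l.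
by apply: (@filterE _ U _) => n; rewrite /= in_itv /= -ler_norml.
Qed.

Lemma bdd_ulim u : bdd u -> u @ U --> ulim u.
Proof.
case=> B hB.
have [a ha] : exists l : R, (fun n => complex.Re (u n)) @ U --> l.
  by apply: (@bdd_cvg_real _ B) => n; apply: le_trans (hB n); rewrite nm_Re.
have [b hb] : exists l : R, (fun n => complex.Im (u n)) @ U --> l.
  by apply: (@bdd_cvg_real _ B) => n; apply: le_trans (hB n); rewrite nm_Im.
suff h : u @ U --> (a +i* b : C) by apply: (cvgP _ h).
apply/cvgCP => e e0; have e2 : 0 < e / 2 by rewrite divr_gt0.
move/cvgrPdist_lt : ha => /(_ _ e2) ha; move/cvgrPdist_lt : hb => /(_ _ e2) hb.
apply: filterS2 ha hb => n ha hb.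
apply: le_lt_trans (nm_ReIm _) _.
move: ha hb => /=; rewrite (distrC a) (distrC b); case: (u n) => p q /= ha hb.
lra.
Qed.

Lemma ulim_cvg u l : u @ \oo --> l -> ulim u = l.
Proof.
move=> h; apply: cvg_lim => //.
by apply: cvg_trans h => A /= hA; apply: ooU.
Qed.

Lemma ulim_cst l : ulim (fun=> l) = l.
Proof. by apply: ulim_cvg; apply: cvg_cst. Qed.

Lemma ulimD u v : bdd u -> bdd v -> ulim (fun n => u n + v n) = ulim u + ulim v.
Proof.
move=> hu hv; apply: cvg_lim => //.
exact: (@cvgD _ C _ _ _ u v _ _ (bdd_ulim hu) (bdd_ulim hv)).
Qed.

Lemma ulimM u v : bdd u -> bdd v -> ulim (fun n => u n * v n) = ulim u * ulim v.
Proof.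
move=> hu hv; apply: cvg_lim => //.
exact: (@cvgM _ _ _ _ u v _ _ (bdd_ulim hu) (bdd_ulim hv)).
Qed.

Lemma bdd_cst l : bdd (fun=> l). Proof. by exists (nm l). Qed.

Lemma bddD u v : bdd u -> bdd v -> bdd (fun n => u n + v n).
Proof.
move=> [B hB] [B' hB']; exists (B + B') => n.
by apply: le_trans (nmD _ _) _; apply: lerD.
Qed.

Lemma bddM u v : bdd u -> bdd v -> bdd (fun n => u n * v n).
Proof.
move=> [B hB] [B' hB']; exists (B * B') => n.
by rewrite normcM; apply: ler_pM; rewrite ?nm_ge0.
Qed.

Lemma ulimZ c u : bdd u -> ulim (fun n => c * u n) = c * ulim u.
Proof. by move=> hu; rewrite (@ulimM (fun=> c)) ?ulim_cst //; exact: bdd_cst. Qed.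

Lemma bddZ c u : bdd u -> bdd (fun n => c * u n).
Proof. by move=> hu; apply: bddM hu; exact: bdd_cst. Qed.

Lemma bddN u : bdd u -> bdd (fun n => - u n).
Proof. by move=> [B hB]; exists B => n; rewrite nmN. Qed.

Lemma bddB u v : bdd u -> bdd v -> bdd (fun n => u n - v n).
Proof. by move=> hu hv; apply: bddD => //; apply: bddN. Qed.

Lemma ulimB u v : bdd u -> bdd v -> ulim (fun n => u n - v n) = ulim u - ulim v.
Proof.
move=> hu hv; rewrite ulimD //; last exact: bddN.
rewrite -[- ulim v]mulN1r -ulimZ //; congr (_ + ulim _).
by apply/funext => n; rewrite mulN1r.
Qed.

Lemma ulim_le u (B : R) : (forall n, nm (u n) <= B) -> nm (ulim u) <= B.
Proof.
move=> h; have hu : bdd u by exists B.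
apply/ler_addgt0Pr => e e0.
have /cvgCP /(_ e e0) hc := bdd_ulim hu.
have [n hn] := filter_ex hc.
rewrite -[ulim u](subrK (u n)) addrC.
by apply: le_trans (nmD _ _) _; rewrite lerD // nm_distrC ltW.
Qed.

Lemma ulim_le_near u (B : R) n0 : bdd u -> (forall n, (n0 <= n)%N -> nm (u n) <= B) ->
  nm (ulim u) <= B.
Proof.
move=> hu h; apply/ler_addgt0Pr => e e0.
have /cvgCP /(_ e e0) hc := bdd_ulim hu.
have ho : U [set n | (n0 <= n)%N] by apply: ooU; exists n0.
have [n [hn n0n]] := filter_ex (filterI hc ho).
rewrite -[ulim u](subrK (u n)) addrC.
by apply: le_trans (nmD _ _) _; rewrite lerD ?h // nm_distrC ltW.
Qed.

Lemma bdd_sum (m : nat) (u : nat -> nat -> C) : (forall k, bdd (u k)) ->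
  bdd (fun n => \sum_(k < m) u k n).
Proof.
move=> h; elim: m => [|m [B hB]]; first by exists 0 => n; rewrite big_ord0 normc0.
have [B' hB'] := h m; exists (B + B') => n; rewrite big_ord_recr /=.
by apply: le_trans (nmD _ _) _; apply: lerD.
Qed.

Lemma ulim_sum (m : nat) (u : nat -> nat -> C) : (forall k, bdd (u k)) ->
  ulim (fun n => \sum_(k < m) u k n) = \sum_(k < m) ulim (u k).
Proof.
move=> h; elim: m => [|m IH].
  rewrite big_ord0 -[RHS](ulim_cst 0); congr ulim; apply/funext => n.
  by rewrite big_ord0.
rewrite big_ord_recr /= -IH -ulimD //; last exact: bdd_sum.
by congr ulim; apply/funext => n; rewrite big_ord_recr.
Qed.

End UltraLimit.

(** * Cauchy's formula from roots of unity *)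

Section Cis.
Variable R : realType.
Local Notation C := R[i].
Local Notation nm := (@normc R).

Definition cis (t : R) : C := cos t +i* sin t.

Lemma cisD a b : cis (a + b) = cis a * cis b.
Proof. by rewrite /cis cosD sinD; apply/eqP; rewrite eq_complex /=; apply/andP; split; apply/eqP; ring. Qed.

Lemma cis0 : cis 0 = 1. Proof. by rewrite /cis cos0 sin0. Qed.

Lemma nm_cis t : nm (cis t) = 1.
Proof. by rewrite /= cos2Dsin2 sqrtr1. Qed.

Lemma cisX t n : cis t ^+ n = cis (t *+ n).
Proof. by elim: n => [|n IH]; rewrite ?expr0 ?mulr0n ?cis0 // exprS IH mulrS cisD. Qed.

Definition omega_root (N : nat) : C := cis (2 * pi / N%:R).

Lemma omega_rootX N : (0 < N)%N -> omega_root N ^+ N = 1.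
Proof.
move=> N0; rewrite cisX -[_ *+ N]mulr_natr divfK ?pnatr_eq0 -?lt0n //.
by rewrite /cis mulr_natl cos2pi sin2pi.
Qed.

Lemma nm_omega_root N : nm (omega_root N) = 1. Proof. exact: nm_cis. Qed.

(** Half the angle, s = pi k / N, lies strictly between 0 and pi, and 1 - cos(2s) = 2 sin(s)^2 is
    then positive. *)
Lemma omega_root_prim N k : (0 < k < N)%N -> omega_root N ^+ k != 1.
Proof.
move=> /andP[k0 kN]; have N0 : (0 < N)%N by apply: leq_trans kN.
have N0r : 0 < N%:R :> R by rewrite ltr0n.
rewrite cisX; set t := (_ *+ k).
have tE : t = (pi * (k%:R / N%:R)) *+ 2.
  by rewrite /t -mulr_natr -[RHS]mulr_natr; field; rewrite lt0r_neq0.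
have : 0 < sin (pi * (k%:R / N%:R) : R).
  apply: sin_gt0_pi; rewrite mulr_gt0 ?pi_gt0 ?divr_gt0 ?ltr0n //=.
  by rewrite -[X in _ < X]mulr1 ltr_pM2l ?pi_gt0 // ltr_pdivrMr // mul1r ltr_nat.
move: tE; set s := pi * _ => -> s0; apply/eqP => /(congr1 (@complex.Re _)) /=.
rewrite mulr2n cosD => h.
have := cos2Dsin2 s => h2; suff : 0 < sin s ^+ 2 by nra.
by rewrite exprn_gt0.
Qed.

Lemma omega_root_sum N k : (0 < k < N)%N -> \sum_(j < N) (omega_root N ^+ k) ^+ j = 0.
Proof.
move=> /[dup] /andP[k0 kN] /omega_root_prim; rewrite -subr_eq0 => h.
apply: (mulfI h); rewrite mulr0 -subrX1 -exprM mulnC exprM omega_rootX ?expr1n ?subrr //.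
exact: leq_trans kN.
Qed.

Lemma omega_root_cvg : (fun n => nm (omega_root n.+2 - 1)) @ \oo --> (0 : R).
Proof.
have h0 : (fun n : nat => 2 * pi / n.+2%:R : R) @ \oo --> (0 : R).
  rewrite -[X in _ --> X](mulr0 (2 * pi)); apply: cvgM; first exact: cvg_cst.
  have := @cvg_harmonic R; rewrite -(cvg_shiftn 1) => h.
  by apply: cvg_trans h; apply: near_eq_cvg; near=> n; rewrite /= addn1.
have hc : (fun n : nat => cos (2 * pi / n.+2%:R : R)) @ \oo --> (1 : R).
  by have := @cvg_comp _ _ _ _ cos _ _ _ h0 (@continuous_cos R 0); rewrite cos0.
have hs : (fun n : nat => sin (2 * pi / n.+2%:R : R)) @ \oo --> (0 : R).
  by have := @cvg_comp _ _ _ _ sin _ _ _ h0 (@continuous_sin R 0); rewrite sin0.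
have h : (fun n : nat => `|cos (2 * pi / n.+2%:R : R) - 1| + `|sin (2 * pi / n.+2%:R : R)|) @ \oo --> (0 : R).
  rewrite -[X in _ --> X]addr0; apply: cvgD.
    rewrite -(@normr0 _ R) -(subrr (1 : R)); apply: cvg_norm; apply: cvgB hc _; exact: cvg_cst.
  by rewrite -[X in _ --> X](@normr0 _ R); apply: cvg_norm.
apply/cvgrPdist_lt => e e0; move/cvgrPdist_lt : h => /(_ _ e0); apply: filterS => n.
rewrite !sub0r !normrN => h; rewrite ger0_norm ?nm_ge0 //; apply: le_lt_trans h.
apply: le_trans (ler_norm _); apply: le_trans (nm_ReIm _) _.
by rewrite /omega_root /cis /= oppr0 addr0.
Unshelve. all: by end_near. Qed.

End Cis.

Section Cauchy.
Variable R : realType.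
Local Notation C := R[i].
Local Notation nm := (@normc R).
Variables (f f' : C -> C) (rho K : R).
Hypothesis rho0 : 0 < rho.
Hypothesis K0 : 0 <= K.
Hypothesis hf : forall x y, nm x <= rho -> nm y <= rho ->
  nm (f y - f x - f' x * (y - x)) <= K * nm (y - x) ^+ 2.

Definition circ (N j : nat) : C := rho%:C * omega_root R N ^+ j.
(** The discrete form of (1 / 2 pi i) times the integral of h(w) dw / w over the circle of radius
    [rho]. *)
Definition avg (N : nat) (h : C -> C) : C := N%:R^-1 * \sum_(j < N) h (circ N j).

Lemma nm_circ N j : nm (circ N j) = rho.
Proof. by rewrite normcM nmX nm_omega_root expr1n mulr1 nm_real gtr0_norm. Qed.

Lemma circ_neq0 N j : circ N j != 0.
Proof. by rewrite -nm_gt0 nm_circ. Qed.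

Lemma circ_neq N j z : nm z < rho -> circ N j - z != 0.
Proof. by rewrite subr_eq0; apply: contraTneq => <-; rewrite nm_circ ltxx. Qed.

Lemma circS N j : circ N j.+1 = circ N j * omega_root R N.
Proof. by rewrite /circ exprSr mulrA. Qed.

Lemma circX N j : (0 < N)%N -> circ N j ^+ N = (rho ^+ N)%:C.
Proof. by move=> N0; rewrite exprMn exprAC omega_rootX // expr1n mulr1 -rmorphXn. Qed.

Lemma nm_avg N h B : (0 < N)%N -> (forall x, nm x = rho -> nm (h x) <= B) -> nm (avg N h) <= B.
Proof.
move=> N0 hB; rewrite normcM normcV nm_nat mulrC ler_pdivrMr ?ltr0n //.
apply: le_trans (nm_sum _ _ _) _.
have -> : B * N%:R = \sum_(j < N) B by rewrite sumr_const card_ord mulr_natr.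
by apply: ler_sum => j _; rewrite hB ?nm_circ.
Qed.

Variable z : C.
Hypothesis zr : nm z < rho.
Let gam (N j : nat) (t : R) : C := z + t%:C * (circ N j - z).

Lemma gam_le N j t : 0 <= t <= 1 -> nm (gam N j t) <= rho.
Proof.
move=> /andP[t0 t1]; have -> : gam N j t = (1 - t)%:C * z + t%:C * circ N j.
  by rewrite /gam rmorphB rmorph1; ring.
apply: le_trans (nmD _ _) _; rewrite !(nm_circ, normcM) !nm_real !ger0_norm ?subr_ge0 //.
have : (1 - t) * nm z <= (1 - t) * rho by rewrite ler_wpM2l ?subr_ge0 // ltW.
by lra.
Qed.

(** Multiplied by t (om - 1), the sum is the first-order part of the increments of f around the
    closed polygon with vertices [gam N j t]. These increments add up to 0, so only the N quadratic
    errors remain. *)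
Lemma avg_deriv N t : (1 < N)%N -> 0 < t <= 1 ->
  nm (\sum_(j < N) f' (gam N j t) * circ N j) <= N%:R * (K * rho ^+ 2 * nm (omega_root R N - 1)).
Proof.
move=> N1 /andP[t0 t1]; set om := omega_root R N.
have om1 : 0 < nm (om - 1).
  by rewrite nm_gt0 subr_eq0 -[om]expr1 omega_root_prim.
have t01 : 0 <= t <= 1 by rewrite ltW.
have d j : gam N j.+1 t - gam N j t = t%:C * (om - 1) * circ N j.
  by rewrite /gam circS -/om; ring.
pose err j := f (gam N j.+1 t) - f (gam N j t) - f' (gam N j t) * (gam N j.+1 t - gam N j t).
have herr j : nm (err j) <= K * (t * nm (om - 1) * rho) ^+ 2.
  apply: le_trans (hf (gam_le _ _ t01) (gam_le _ _ t01)) _.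
  by rewrite d !(nm_circ, normcM) nm_real gtr0_norm.
have key : t%:C * (om - 1) * (\sum_(j < N) f' (gam N j t) * circ N j) = - \sum_(j < N) err j.
  rewrite /err sumrB -(big_mkord xpredT (fun j => f (gam N j.+1 t) - f (gam N j t))).
  rewrite telescope_sumr // /gam /circ omega_rootX ?expr0 ?subrr ?sub0r ?opprK; last by case: (N) N1.
  rewrite mulr_sumr; apply: eq_bigr => j _; rewrite -/(circ N j.+1) -/(circ N j).
  rewrite -/(gam N j t) -/(gam N j.+1 t) d; ring.
have : t * nm (om - 1) * nm (\sum_(j < N) f' (gam N j t) * circ N j)
   <= N%:R * (K * (t * nm (om - 1) * rho) ^+ 2).
  have tE : t * nm (om - 1) = nm (t%:C * (om - 1)) by rewrite normcM nm_real gtr0_norm.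
  rewrite [X in X * nm (\sum_(_ < _) _)]tE -normcM key nmN; apply: le_trans (nm_sum _ _ _) _.
  apply: le_trans (ler_sum _ (fun (j : 'I_N) _ => herr j)) _.
  by rewrite sumr_const card_ord mulr_natl.
set S := nm (\sum_(j < N) _); move=> h.
have tp : 0 < t * nm (om - 1) by rewrite mulr_gt0.
rewrite -(ler_pM2l tp); apply: le_trans h _.
have -> : N%:R * (K * (t * nm (om - 1) * rho) ^+ 2) =
  t * nm (om - 1) * (N%:R * (K * rho ^+ 2 * (t * nm (om - 1)))) by ring.
rewrite ler_pM2l // ler_wpM2l ?ler0n // ler_wpM2l ?mulr_ge0 ?sqr_ge0 ?(ltW rho0) //.
by rewrite -[leRHS]mul1r ler_pM2r.
Qed.

(** Up to the factor N this is [cauchyN f] at t = 1 and f(z) times [cauchyN 1] at t = 0. Its formal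
    t-derivative is the sum bounded in [avg_deriv], the denominators having cancelled. *)
Let phi N t := \sum_(j < N) f (gam N j t) * (circ N j / (circ N j - z)).

(** f is expanded at the later time t' and not at t: [avg_deriv] needs a positive parameter, and t
    is 0 for k = 0. The last summand bounds the quadratic errors, using |w - z| <= 2 rho. *)
Lemma phi_step N m k : (1 < N)%N -> (k < m)%N ->
  nm (phi N (k.+1%:R / m%:R) - phi N (k%:R / m%:R)) <=
  N%:R * (K * rho ^+ 2 * nm (omega_root R N - 1)) / m%:R + N%:R * (2 * K * rho ^+ 2) / m%:R ^+ 2.
Proof.
move=> N1 km; have m0 : 0 < m%:R :> R by rewrite ltr0n; apply: leq_ltn_trans km.
have m0C : m%:R != 0 :> C by rewrite pnatr_eq0 -lt0n; apply: leq_ltn_trans km.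
set t := k%:R / m%:R; set t' := k.+1%:R / m%:R.
have t01 : 0 <= t <= 1.
  by rewrite divr_ge0 //= ler_pdivrMr // mul1r ler_nat ltnW.
have t01' : 0 < t' <= 1 by rewrite ler_pdivrMr // mul1r ler_nat km andbT divr_gt0 // ltr0n.
have t02' : 0 <= t' <= 1 by case/andP: t01' => /ltW -> ->.
have dt j : gam N j t - gam N j t' = - (m%:R^-1) * (circ N j - z).
  have -> : t' = t + m%:R^-1 by rewrite /t' -natr1 mulrDl mul1r.
  by rewrite /gam rmorphD fmorphV rmorph_nat; ring.
pose err j := f (gam N j t) - f (gam N j t') - f' (gam N j t') * (gam N j t - gam N j t').
have -> : phi N t' - phi N t = m%:R^-1 * (\sum_(j < N) f' (gam N j t') * circ N j)
    - \sum_(j < N) err j * (circ N j / (circ N j - z)).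
  rewrite /phi -sumrB mulr_sumr -sumrB; apply: eq_bigr => j _; rewrite /err dt.
  by field; rewrite m0C circ_neq.
apply: le_trans (nmB _ _) _; apply: lerD.
  rewrite normcM normcV nm_nat mulrC ler_pM2r ?invr_gt0 //; exact: avg_deriv.
apply: le_trans (nm_sum _ _ _) _.
have h (j : 'I_N) : nm (err j * (circ N j / (circ N j - z))) <= 2 * K * rho ^+ 2 / m%:R ^+ 2.
  have p0 : 0 < nm (circ N j - z) by rewrite nm_gt0 circ_neq.
  rewrite !(nm_circ, normcM) normcV.
  have h1 := hf (gam_le N j t02') (gam_le N j t01); rewrite -/(err j) dt in h1.
  rewrite normcM nmN normcV nm_nat exprMn in h1.
  have p1 : nm (circ N j - z) <= 2 * rho.
    by apply: le_trans (nmB _ _) _; rewrite nm_circ; have := zr; lra.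
  rewrite mulrA ler_pdivrMr //.
  apply: (@le_trans _ _ (K * (m%:R^-1 ^+ 2 * nm (circ N j - z) ^+ 2) * rho)); first by rewrite ler_pM2r.
  have -> : K * (m%:R^-1 ^+ 2 * nm (circ N j - z) ^+ 2) * rho =
    (K * m%:R^-1 ^+ 2 * rho * nm (circ N j - z)) * nm (circ N j - z) by ring.
  have -> : 2 * K * rho ^+ 2 / m%:R ^+ 2 * nm (circ N j - z) =
    (K * m%:R^-1 ^+ 2 * rho * nm (circ N j - z)) * (2 * rho) by rewrite -exprVn; ring.
  by rewrite ler_wpM2l // !mulr_ge0 ?sqr_ge0 // ltW.
apply: le_trans (ler_sum _ (fun j _ => h j)) _.
by rewrite sumr_const card_ord -[leLHS]mulr_natl !mulrA lexx.
Qed.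

(** Adding the m steps leaves the excess b / m, and m is arbitrary. *)
Lemma phi_bound N : (1 < N)%N ->
  nm (phi N 1 - phi N 0) <= N%:R * (K * rho ^+ 2 * nm (omega_root R N - 1)).
Proof.
move=> N1; set a := N%:R * _; set b := N%:R * (2 * K * rho ^+ 2).
have b0 : 0 <= b by rewrite !mulr_ge0 // ltW.
have main m : (0 < m)%N -> nm (phi N 1 - phi N 0) <= a + b / m%:R.
  move=> m0; have m0r : m%:R != 0 :> R by rewrite pnatr_eq0 -lt0n.
  have -> : phi N 1 - phi N 0 = \sum_(k < m) (phi N (k.+1%:R / m%:R) - phi N (k%:R / m%:R)).
    rewrite -(big_mkord xpredT (fun k => phi N (k.+1%:R / m%:R) - phi N (k%:R / m%:R))).
    by rewrite (telescope_sumr (fun k => phi N (k%:R / m%:R))) // divff // mul0r.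
  apply: le_trans (nm_sum _ _ _) _.
  apply: le_trans (ler_sum _ (fun (k : 'I_m) _ => phi_step N1 (ltn_ord k))) _.
  rewrite -/a -/b sumr_const card_ord -mulr_natl le_eqVlt; apply/orP; left; apply/eqP.
  by field.
apply/ler_addgt0Pr => e e0.
have [m hm] : exists m, b / e < m%:R.
  by exists (Num.trunc (b / e)).+1; rewrite truncnS_gt.
have m0 : (0 < m)%N.
  by rewrite -(ltr0n R); apply: le_lt_trans hm; rewrite divr_ge0 // ltW.
apply: le_trans (main m m0) _; rewrite lerD2l ler_pdivrMr ?ltr0n //.
by move: hm; rewrite ltr_pdivrMr // => /ltW; rewrite mulrC.
Qed.

Definition cauchyN N (g : C -> C) (x : C) : C := avg N (fun w => g w * (w / (w - x))).

Lemma cauchyN_bound N : (1 < N)%N ->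
  nm (cauchyN N f z - f z * cauchyN N (fun=> 1) z) <= K * rho ^+ 2 * nm (omega_root R N - 1).
Proof.
move=> N1; have N0r : 0 < N%:R :> R by rewrite ltr0n ltnW.
have := phi_bound N1; rewrite -ler_pdivrMl // => h; apply: le_trans h.
have -> : cauchyN N f z - f z * cauchyN N (fun=> 1) z = N%:R^-1 * (phi N 1 - phi N 0).
  rewrite /cauchyN /avg mulrCA -mulrBr; congr (_ * _); rewrite /phi mulr_sumr -!sumrB.
  apply: eq_bigr => j _; have -> : gam N j 1 = circ N j by rewrite /gam rmorph1; ring.
  have -> : gam N j 0 = z by rewrite /gam rmorph0; ring.
  by rewrite mul1r.
by rewrite normcM normcV nm_nat.
Qed.

(** With w^N = rho^N on the circle, (1 - (z/w)^N) / (1 - z/w) is the sum of (z/w)^k for k < N, and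
    averaging over the N-th roots of unity kills every k except 0. *)
Lemma cauchyN1 N : (1 < N)%N ->
  (1 - z ^+ N / (rho ^+ N)%:C) * cauchyN N (fun=> 1) z = 1.
Proof.
move=> N1; have N0 : (0 < N)%N by apply: ltnW.
have N0r : N%:R != 0 :> C by rewrite pnatr_eq0 -lt0n.
have rN : (rho ^+ N)%:C != 0 :> C by rewrite -nm_gt0 nm_real normrX exprn_gt0 // normr_gt0 gt_eqF.
rewrite /cauchyN /avg mulrCA mulr_sumr.
(* [omega_root N ^+ (N - k)] stands for the inverse of the k-th power, which keeps the exponent a
   natural number. *)
have h (j : 'I_N) : (1 - z ^+ N / (rho ^+ N)%:C) * (1 * (circ N j / (circ N j - z))) =
   \sum_(k < N) (z / rho%:C) ^+ k * (omega_root R N ^+ (N - k)) ^+ j.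
  have c0 := circ_neq0 N j; have cz := circ_neq N j zr.
  have -> : 1 - z ^+ N / (rho ^+ N)%:C = 1 - (z / circ N j) ^+ N.
    by rewrite expr_div_n circX.
  rewrite mul1r -opprB subrX1.
  have -> : circ N j / (circ N j - z) = - (z / circ N j - 1)^-1.
    have -> : z / circ N j - 1 = - ((circ N j - z) / circ N j) by field.
    by rewrite invrN opprK invf_div.
  rewrite mulNr mulrN opprK mulrAC divff ?mul1r; last first.
    have -> : z / circ N j - 1 = - ((circ N j - z) / circ N j) by field.
    by rewrite oppr_eq0 mulf_neq0 ?invr_eq0.
  apply: eq_bigr => k _; rewrite /circ invfM mulrA exprMn; congr (_ * _).
  rewrite -exprVn -!exprM mulnC.
  apply: (mulfI (expf_neq0 (k * j) (_ : omega_root R N != 0))).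
    by rewrite -nm_gt0 nm_omega_root.
  rewrite -exprD -mulnDl subnKC ?(ltnW (ltn_ord k)) //.
  rewrite exprVn mulnC divff ?exprM ?omega_rootX ?expr1n //.
  by rewrite -!exprM expf_neq0 // -nm_gt0 nm_omega_root.
rewrite (eq_bigr _ (fun j _ => h j)) exchange_big /= (bigD1 (Ordinal N0)) //=.
rewrite [X in _ * (_ + X)]big1 ?addr0; last first.
  move=> k k0; rewrite -mulr_sumr omega_root_sum ?mulr0 // subn_gt0 ltn_ord.
  by rewrite ltn_subrL N0 lt0n -val_eqE /= in k0 *; rewrite k0.
rewrite expr0 (eq_bigr (fun=> 1)) ?sumr_const ?card_ord ?mulVf // => j _.
by rewrite subn0 omega_rootX // expr1n mulr1.
Qed.

Lemma cauchyN_bdd B g : (forall x, nm x = rho -> nm (g x) <= B) ->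
  forall n, nm (cauchyN n.+2 g z) <= B * (rho / (rho - nm z)).
Proof.
move=> hg n; apply: nm_avg => // x hx; rewrite normcM.
have hxz : rho - nm z <= nm (x - z).
  by rewrite lerBlDr -hx -{1}(subrK z x) nmD.
have rz : 0 < rho - nm z by rewrite subr_gt0.
apply: ler_pM; rewrite ?nm_ge0 ?hg // normcM normcV hx ler_pM2l //.
by rewrite lef_pV2 // posrE ?(lt_le_trans rz).
Qed.

(** The difference between [cauchyN f] and f(z) times [cauchyN 1] is O(|om - 1|), and [cauchyN 1] =
    1 / (1 - (z/rho)^N) tends to 1. The index n.+2 keeps the number of points above 1. *)
Lemma cauchy_formula : (fun n => cauchyN n.+2 f z) @ \oo --> f z.
Proof.
have q1 : `|nm z / rho| < 1.
  by rewrite ger0_norm ?divr_ge0 ?nm_ge0 ?(ltW rho0) // ltr_pdivrMr // mul1r.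
have h1 : (fun n => cauchyN n.+2 (fun=> 1) z) @ \oo --> (1 : C).
  have hq : (fun n => 1 - z ^+ n.+2 / (rho ^+ n.+2)%:C) @ \oo --> (1 : C).
    rewrite -[X in _ --> X]subr0; apply: cvgB; first exact: cvg_cst.
    apply/cvgCP => e e0; have := cvg_expr q1; rewrite -(cvg_shiftn 2) => /cvgrPdist_lt /(_ e e0).
    apply: filterS => n /=; rewrite sub0r normrN subr0 normcM normcV nm_real nmX addn2.
    by rewrite [`|rho ^+ _|]ger0_norm ?exprn_ge0 ?ltW // -expr_div_n ger0_norm ?exprn_ge0 ?divr_ge0 ?nm_ge0 ?ltW.
  have h : (fun n => (1 - z ^+ n.+2 / (rho ^+ n.+2)%:C)^-1) @ \oo --> (1 : C).
    by rewrite -[X in _ --> X]invr1; apply: cvgV hq; exact: oner_neq0.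
  apply: cvg_trans h.
  apply: near_eq_cvg; near=> n; have hn := @cauchyN1 n.+2 isT.
  set q := 1 - _ in hn *; have q0 : q != 0.
    by apply/eqP => q0; move: hn; rewrite q0 mul0r => /esym/eqP; rewrite oner_eq0.
  by apply: (mulfI q0); rewrite hn divff.
have h2 : (fun n => cauchyN n.+2 f z - f z * cauchyN n.+2 (fun=> 1) z) @ \oo --> (0 : C).
  apply/cvgCP => e e0; have : (fun n => K * rho ^+ 2 * nm (omega_root R n.+2 - 1)) @ \oo --> (0 : R).
    by rewrite -[X in _ --> X](mulr0 (K * rho ^+ 2)); apply: cvgM; [exact: cvg_cst|exact: omega_root_cvg].
  move=> /cvgrPdist_lt /(_ e e0); apply: filterS => n.
  rewrite sub0r normrN subr0 => h; apply: le_lt_trans (cauchyN_bound _) _ => //.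
  exact: le_lt_trans (ler_norm _) h.
have -> : (fun n => cauchyN n.+2 f z) = (fun n => (cauchyN n.+2 f z - f z * cauchyN n.+2 (fun=> 1) z)
    + f z * cauchyN n.+2 (fun=> 1) z).
  by apply/funext => n; rewrite subrK.
have h3 : (fun n => f z * cauchyN n.+2 (fun=> 1) z) @ \oo --> f z.
  by rewrite -[X in _ --> X]mulr1; apply: cvgM; [exact: cvg_cst|exact: h1].
by rewrite -[X in _ --> X](add0r (f z)); apply: cvgD h2 h3.
Unshelve. all: by end_near. Qed.

End Cauchy.

Section CauchyEstimates.
Variable R : realType.
Local Notation C := R[i].
Local Notation nm := (@normc R).

Lemma quad_small (a : C) (M r : R) : 0 < r ->
  (forall h, nm h < r -> nm (a * h) <= M * nm h ^+ 2) -> a = 0.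
Proof.
move=> r0 hM; apply/eqP; rewrite -nm_eq0; apply/eqP/le_anti; rewrite nm_ge0 andbT.
apply/ler_addgt0Pr => e e0; rewrite add0r.
pose M' := `|M| + 1; have M'0 : 0 < M' by rewrite ltr_pwDr.
pose h := Num.min (r / 2) (e / M'); have h0 : 0 < h by rewrite lt_min !divr_gt0.
have hr : nm (h%:C) < r.
  by rewrite nm_real gtr0_norm // gt_min; apply/orP; left; rewrite ltr_pdivrMr //; lra.
have := hM _ hr; rewrite normcM nm_real gtr0_norm // expr2 mulrA ler_pM2r // => h1.
apply: le_trans h1 _; apply: (@le_trans _ _ (M' * h)).
  by rewrite ler_pM2r // /M'; have := ler_norm M; lra.
by rewrite mulrC -ler_pdivlMr // ge_min lexx orbT.
Qed.

Variables (f f' : C -> C) (rho K B : R).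
Hypothesis rho0 : 0 < rho.
Hypothesis K0 : 0 <= K.
Hypothesis hf : forall x y, nm x <= rho -> nm y <= rho ->
  nm (f y - f x - f' x * (y - x)) <= K * nm (y - x) ^+ 2.
Hypothesis hB : forall x, nm x = rho -> nm (f x) <= B.

(** Cauchy's integral for the derivative, as an ultralimit of averages; [deriv_ulim] identifies it
    with f'. *)
Let D x := ulim (fun n => avg rho n.+2 (fun w => f w * (w / (w - x) ^+ 2))).

Lemma circ_far w x : nm w = rho -> nm x <= rho / 2 -> rho / 2 <= nm (w - x).
Proof.
move=> hw hx; have := nmD (w - x) x; rewrite subrK hw; lra.
Qed.

Let B0 : 0 <= B.
Proof. by apply: le_trans (hB (_ : nm rho%:C = _)); rewrite ?nm_ge0 // nm_real gtr0_norm. Qed.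

Lemma dker_bound x w : nm w = rho -> nm x <= rho / 2 ->
  nm (f w * (w / (w - x) ^+ 2)) <= 4 * B / rho.
Proof.
move=> hw hx; have h := circ_far hw hx; have h0 : 0 < rho / 2 by rewrite divr_gt0.
rewrite !normcM normcV nmX hw.
have h2 : (nm (w - x) ^+ 2)^-1 <= ((rho / 2) ^+ 2)^-1.
  by rewrite lef_pV2 ?posrE ?exprn_gt0 ?(lt_le_trans h0) // ler_pXn2r // nnegrE ?nm_ge0 ?ltW.
have -> : 4 * B / rho = B * (rho * ((rho / 2) ^+ 2)^-1) by field; rewrite lt0r_neq0.
apply: ler_pM; rewrite ?nm_ge0 ?hB // ?mulr_ge0 ?(ltW rho0) ?invr_ge0 ?exprn_ge0 ?nm_ge0 //.
by rewrite ler_wpM2l // ltW.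
Qed.

(** 1/(w-y) - 1/(w-x) - (y-x)/(w-x)^2 = (y-x)^2 / ((w-x)^2 (w-y)) exactly. The constant is 4B/rho
    from [dker_bound] times 2/rho for the remaining denominator. *)
Lemma ker_bound x y w : nm w = rho -> nm x <= rho / 2 -> nm y <= rho / 2 ->
  nm (f w * (w / (w - y)) - f w * (w / (w - x)) - f w * (w / (w - x) ^+ 2) * (y - x))
   <= 8 * B / rho ^+ 2 * nm (y - x) ^+ 2.
Proof.
move=> hw hx hy; have h0 : 0 < rho / 2 by rewrite divr_gt0.
have hx' := circ_far hw hx; have hy' := circ_far hw hy.
have wx : w - x != 0 by rewrite -nm_gt0 (lt_le_trans h0).
have wy : w - y != 0 by rewrite -nm_gt0 (lt_le_trans h0).
have -> : f w * (w / (w - y)) - f w * (w / (w - x)) - f w * (w / (w - x) ^+ 2) * (y - x) =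
  f w * (w / (w - x) ^+ 2) * ((w - y)^-1 * (y - x) ^+ 2).
  by field; rewrite wx wy.
rewrite (normcM (f w * _)) (normcM (_^-1)) nmX normcV mulrA ler_wpM2r ?sqr_ge0 //.
have -> : 8 * B / rho ^+ 2 = (4 * B / rho) * (rho / 2)^-1 by field; rewrite lt0r_neq0.
apply: ler_pM; rewrite ?nm_ge0 ?invr_ge0 ?nm_ge0 ?dker_bound //.
by rewrite lef_pV2 ?posrE // (lt_le_trans h0).
Qed.

Lemma bdd_avg M (g : nat -> C -> C) : (forall n x, nm x = rho -> nm (g n x) <= M) ->
  bdd (fun n => avg rho n.+2 (g n)).
Proof. by move=> h; exists M => n; apply: nm_avg => // x; apply: h. Qed.

Lemma half_rho x : nm x <= rho / 2 -> nm x < rho.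
Proof. by move=> h; apply: le_lt_trans h _; rewrite ltr_pdivrMr //; have := rho0; lra. Qed.

Lemma bdd_cauchyN x : nm x < rho -> bdd (fun n => cauchyN rho n.+2 f x).
Proof. by move=> hx; eexists; apply: cauchyN_bdd => //; exact: hB. Qed.

Lemma ulim_quad x y : nm x <= rho / 2 -> nm y <= rho / 2 ->
  nm (f y - f x - D x * (y - x)) <= 8 * B / rho ^+ 2 * nm (y - x) ^+ 2.
Proof.
move=> hx hy.
have bx := bdd_cauchyN (half_rho hx); have by' := bdd_cauchyN (half_rho hy).
have bD : bdd (fun n => avg rho n.+2 (fun w => f w * (w / (w - x) ^+ 2))).
  by apply: bdd_avg => n w hw; apply: dker_bound.
have ey := ulim_cvg (cauchy_formula rho0 K0 hf (half_rho hy)).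
have ex := ulim_cvg (cauchy_formula rho0 K0 hf (half_rho hx)).
rewrite -{1}ey -{1}ex /D [_ * (y - x)]mulrC -ulimZ // -ulimB // -ulimB //; last 2 first.
- exact: bddB.
- exact: bddZ.
apply: ulim_le => n; rewrite /cauchyN /avg -mulrBr mulrCA -mulrBr -sumrB mulr_sumr -sumrB.
have := @nm_avg _ rho rho0 n.+2 (fun w => f w * (w / (w - y)) - f w * (w / (w - x)) -
   (y - x) * (f w * (w / (w - x) ^+ 2))) (8 * B / rho ^+ 2 * nm (y - x) ^+ 2) isT.
apply=> w hw; rewrite [(y - x) * _]mulrC; exact: ker_bound.
Qed.

(** Both f' and [D] give a first-order expansion with quadratic error, so their difference is a
    linear map with a quadratic bound, hence 0. *)
Lemma deriv_ulim x : nm x < rho / 2 -> f' x = D x.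
Proof.
move=> hx; apply/eqP; rewrite -subr_eq0; apply/eqP.
have r0 : 0 < rho / 2 - nm x by rewrite subr_gt0.
apply: (@quad_small _ (8 * B / rho ^+ 2 + K) (rho / 2 - nm x) r0) => h hh.
have hxh : nm (x + h) <= rho / 2 by apply: le_trans (nmD _ _) _; lra.
have h1 := ulim_quad (ltW hx) hxh.
have h2 := hf (ltW (half_rho (ltW hx))) (ltW (half_rho hxh)).
have xh : x + h - x = h by ring.
rewrite xh in h1 h2.
have -> : (f' x - D x) * h = (f (x + h) - f x - D x * h) - (f (x + h) - f x - f' x * h) by ring.
by apply: le_trans (nmB _ _) _; rewrite mulrDl lerD.
Qed.

(** Here and in [cauchy_quad] the constant depends on the bound B and on rho, but not on K. This is
    what makes the class stable under bounded limits, along which K is uncontrolled. *)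
Lemma cauchy_deriv_bound x : nm x < rho / 2 -> nm (f' x) <= 4 * B / rho.
Proof.
move=> hx; rewrite deriv_ulim //; apply: ulim_le => n.
by apply: nm_avg => // w hw; apply: dker_bound => //; exact: ltW.
Qed.

Lemma cauchy_quad x y : nm x < rho / 2 -> nm y <= rho / 2 ->
  nm (f y - f x - f' x * (y - x)) <= 8 * B / rho ^+ 2 * nm (y - x) ^+ 2.
Proof. by move=> hx hy; rewrite deriv_ulim // ulim_quad // ltW. Qed.

Lemma deriv0_ulim : f' 0 = ulim (fun n => avg rho n.+2 (fun w => f w / w)).
Proof.
rewrite deriv_ulim ?normc0 ?divr_gt0 //; congr ulim; apply/funext => n.
rewrite /avg; congr (_ * _); apply: eq_bigr => j _; congr (_ * _).
by rewrite subr0 expr2 invfM mulrA divff ?mul1r // circ_neq0.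
Qed.

Definition tcoef k := ulim (fun n => avg rho n.+2 (fun w => f w * w^-1 ^+ k)).

Lemma tcoef_ker k w : nm w = rho -> nm (f w * w^-1 ^+ k) <= B / rho ^+ k.
Proof.
move=> hw; rewrite normcM nmX normcV hw exprVn ler_wpM2r ?hB //.
by rewrite invr_ge0 exprn_ge0 // ltW.
Qed.

Lemma tcoef_bound k : nm (tcoef k) <= B / rho ^+ k.
Proof. by apply: ulim_le => n; apply: nm_avg => // w; apply: tcoef_ker. Qed.

(** Removing the first m terms of the geometric expansion of w / (w - z) leaves (z/w)^m w / (w - z),
    so the remainder is the Cauchy average of f(w) (z/w)^m. *)
Lemma taylor_bound m z : nm z < rho ->
  nm (f z - \sum_(k < m) tcoef k * z ^+ k) <= B * (nm z / rho) ^+ m * (rho / (rho - nm z)).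
Proof.
move=> hz.
have bk k : bdd (fun n => avg rho n.+2 (fun w => f w * w^-1 ^+ k)).
  by apply: bdd_avg => n w; apply: tcoef_ker.
have -> : \sum_(k < m) tcoef k * z ^+ k =
  ulim (fun n => \sum_(k < m) z ^+ k * avg rho n.+2 (fun w => f w * w^-1 ^+ k)).
  rewrite (@ulim_sum _ m (fun k n => z ^+ k * avg rho n.+2 (fun w => f w * w^-1 ^+ k))).
    by apply: eq_bigr => k _; rewrite ulimZ // mulrC.
  by move=> k; apply: bddZ.
rewrite -{1}(ulim_cvg (cauchy_formula rho0 K0 hf hz)) -ulimB; first last.
- by apply: (@bdd_sum _ m (fun k n => z ^+ k * avg rho n.+2 (fun w => f w * w^-1 ^+ k))) => k; apply: bddZ.
- exact: bdd_cauchyN.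
apply: ulim_le => n.
have -> : cauchyN rho n.+2 f z - \sum_(k < m) z ^+ k * avg rho n.+2 (fun w => f w * w^-1 ^+ k) =
  cauchyN rho n.+2 (fun w => f w * (z / w) ^+ m) z.
  rewrite /cauchyN /avg.
  under [X in _ - X]eq_bigr do rewrite mulrCA mulr_sumr.
  rewrite -mulr_sumr -mulrBr; congr (_ * _); rewrite exchange_big /= -sumrB.
  apply: eq_bigr => j _; set w := circ _ _ _.
  have w0 : w != 0 by exact: circ_neq0.
  have wz : w - z != 0 by exact: circ_neq.
  have -> : \sum_(k < m) z ^+ k * (f w * w^-1 ^+ k) = f w * \sum_(k < m) (z / w) ^+ k.
    by rewrite mulr_sumr; apply: eq_bigr => k _; rewrite exprMn mulrCA.
  have zw : 1 - z / w != 0.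
    have -> : 1 - z / w = (w - z) / w by field.
    by rewrite mulf_neq0 ?invr_eq0.
  have -> : \sum_(k < m) (z / w) ^+ k = (1 - (z / w) ^+ m) / (1 - z / w).
    apply: (mulfI zw); rewrite mulrCA divff // mulr1.
    by rewrite -[in LHS]opprB -[in RHS]opprB mulNr -subrX1.
  have -> : w / (w - z) = (1 - z / w)^-1.
    have -> : 1 - z / w = (w - z) / w by field.
    by rewrite invf_div.
  ring.
apply: cauchyN_bdd => // w hw; rewrite normcM nmX normcM normcV hw.
by rewrite ler_wpM2r ?hB // exprn_ge0 // divr_ge0 ?nm_ge0 // ltW.
Qed.

End CauchyEstimates.

(** * Functions with a quadratic first-order expansion *)

Section QuadraticallyDifferentiable.
Variable R : realType.
Local Notation C := R[i].
Local Notation nm := (@normc R).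

(** A seminorm: a nonzero v with N v = 0 is possible, and [qd_limit] treats this case apart. *)
Record vnorm (V : lmodType C) (N : V -> R) : Prop := VNorm {
  vnD : forall u v, N (u + v) <= N u + N v;
  vnZ : forall a u, N (a *: u) = nm a * N u }.

Section Norm.
Variables (V : lmodType C) (N : V -> R) (NN : vnorm N).

Lemma vn0 : N 0 = 0.
Proof. by rewrite -(scale0r 0) (vnZ NN) normc0 mul0r. Qed.

Lemma vnN u : N (- u) = N u.
Proof. by rewrite -scaleN1r (vnZ NN) nmN normc1 mul1r. Qed.

Lemma vn_ge0 u : 0 <= N u.
Proof. by have := vnD NN u (- u); rewrite subrr vn0 vnN; lra. Qed.

Lemma vn_distrC u v : N (u - v) = N (v - u).
Proof. by rewrite -vnN opprB. Qed.

Lemma vn_tri u v w : N (u - w) <= N (u - v) + N (v - w).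
Proof. by have := vnD NN (u - v) (v - w); rewrite addrA subrK. Qed.

End Norm.

(* G x is the differential of F at x, on the ball of radius r around a. *)
Record qd (V : lmodType C) (N : V -> R) (F : V -> C) (G : V -> V -> C) (a : V) (r K : R) : Prop := Qd {
  qd_K : 0 <= K;
  qd_lin : forall x u v c, N (x - a) < r -> G x (c *: u + v) = c * G x u + G x v;
  qd_bd : forall x v, N (x - a) < r -> nm (G x v) <= K * N v;
  qd_quad : forall x y, N (x - a) < r -> N (y - a) < r ->
     nm (F y - F x - G x (y - x)) <= K * N (y - x) ^+ 2 }.

Section Closure.
Variables (V : lmodType C) (N : V -> R) (NN : vnorm N).
Implicit Types (F : V -> C) (G : V -> V -> C) (a : V) (r K : R).
Local Notation qd := (@qd V N).

Lemma qd_le F G a r K r' K' : qd F G a r K -> r' <= r -> K <= K' -> qd F G a r' K'.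
Proof.
move=> [h0 h1 h2 h3] rr KK; split; first exact: le_trans KK.
- by move=> x u v c hx; apply: h1; apply: lt_le_trans rr.
- move=> x v hx; apply: le_trans (h2 _ _ (lt_le_trans hx rr)) _.
  by rewrite ler_wpM2r // vn_ge0.
- move=> x y hx hy; apply: le_trans (h3 _ _ (lt_le_trans hx rr) (lt_le_trans hy rr)) _.
  by rewrite ler_wpM2r // sqr_ge0.
Qed.

Lemma qd_shift F G a r K b r' : qd F G a r K -> N (b - a) + r' <= r -> qd F G b r' K.
Proof.
move=> [h0 h1 h2 h3] rr.
have s x : N (x - b) < r' -> N (x - a) < r.
  by move=> hx; apply: le_lt_trans (vn_tri NN _ b _) _; lra.
by split=> // [x u v c hx|x v hx|x y hx hy]; [apply: h1|apply: h2|apply: h3]; apply: s.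
Qed.

Lemma qd_scale F G a r K x c u : qd F G a r K -> N (x - a) < r -> G x (c *: u) = c * G x u.
Proof.
move=> h hx; have g0 : G x 0 = 0.
  have := qd_lin h 0 0 1 hx; rewrite scale1r add0r mul1r => /eqP.
  by rewrite -subr_eq0 opprD addrA subrr sub0r oppr_eq0 => /eqP.
by have := qd_lin h u 0 c hx; rewrite !addr0 g0 addr0.
Qed.

(** Two points of the ball are at distance at most 2 r, so one factor N (y - x) of the quadratic
    error is absorbed in 2 r K. *)
Lemma qd_lip F G a r K x y : qd F G a r K -> N (x - a) < r -> N (y - a) < r ->
  nm (F y - F x) <= (K + 2 * r * K) * N (y - x).
Proof.
move=> h hx hy; have K0 := qd_K h.
have -> : F y - F x = (F y - F x - G x (y - x)) + G x (y - x) by rewrite subrK.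
apply: le_trans (nmD _ _) _; have h1 := qd_quad h hx hy; have h2 := qd_bd h (y - x) hx.
have h3 : N (y - x) <= 2 * r.
  by apply: le_trans (vn_tri NN _ a _) _; rewrite (vn_distrC NN a); lra.
have h4 := vn_ge0 NN (y - x).
have : K * N (y - x) ^+ 2 <= 2 * r * K * N (y - x).
  have -> : 2 * r * K * N (y - x) = K * (N (y - x) * (2 * r)) by ring.
  by rewrite ler_wpM2l // expr2 ler_wpM2l.
by lra.
Qed.

Lemma qd_bound F G a r K : 0 < r -> qd F G a r K ->
  exists2 B, 0 <= B & forall x, N (x - a) < r -> nm (F x) <= B.
Proof.
move=> r0 h; have K0 := qd_K h; have c0 : 0 <= K + 2 * r * K by rewrite addr_ge0 // !mulr_ge0 // ltW.
have ha : N (a - a) < r by rewrite subrr vn0.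
exists (nm (F a) + (K + 2 * r * K) * r).
  by rewrite addr_ge0 ?nm_ge0 // mulr_ge0 // ltW.
move=> x hx; rewrite -(subrK (F a) (F x)) addrC; apply: le_trans (nmD _ _) _.
rewrite lerD2l; apply: le_trans (qd_lip h ha hx) _.
by rewrite ler_wpM2l // ltW.
Qed.

Lemma qd_cst c a r : qd (fun=> c) (fun _ _ => 0) a r 0.
Proof.
split=> // [x u v d _|x v _|x y _ _]; first by rewrite mulr0 addr0.
  by rewrite normc0 mul0r.
by rewrite subrr subr0 normc0 mul0r.
Qed.

Lemma qd_add F G F' G' a r K K' : qd F G a r K -> qd F' G' a r K' ->
  qd (fun x => F x + F' x) (fun x v => G x v + G' x v) a r (K + K').
Proof.
move=> h h'; split; first by rewrite addr_ge0 ?(qd_K h) ?(qd_K h').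
- by move=> x u v c hx; rewrite (qd_lin h) // (qd_lin h') //; ring.
- move=> x v hx; apply: le_trans (nmD _ _) _; rewrite mulrDl lerD //.
    exact: (qd_bd h).
  exact: (qd_bd h').
move=> x y hx hy.
have -> : F y + F' y - (F x + F' x) - (G x (y - x) + G' x (y - x)) =
  (F y - F x - G x (y - x)) + (F' y - F' x - G' x (y - x)) by ring.
apply: le_trans (nmD _ _) _; rewrite mulrDl lerD //.
  exact: (qd_quad h).
exact: (qd_quad h').
Qed.

Lemma qd_mul F G F' G' a r K K' : 0 < r -> qd F G a r K -> qd F' G' a r K' ->
  exists K2, qd (fun x => F x * F' x) (fun x v => F x * G' x v + G x v * F' x) a r K2.
Proof.
move=> r0 h h'; have [B B0 hB] := qd_bound r0 h; have [B' B0' hB'] := qd_bound r0 h'.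
have K0 := qd_K h; have K0' := qd_K h'.
have c0 : 0 <= K + 2 * r * K by rewrite addr_ge0 // !mulr_ge0 // ltW.
have c0' : 0 <= K' + 2 * r * K' by rewrite addr_ge0 // !mulr_ge0 // ltW.
exists (B * K' + K * B' + (K + 2 * r * K) * (K' + 2 * r * K')); split.
- by rewrite !addr_ge0 // mulr_ge0.
- by move=> x u v c hx; rewrite (qd_lin h) // (qd_lin h') //; ring.
- move=> x v hx; apply: le_trans (nmD _ _) _; rewrite !normcM.
  have v0 := vn_ge0 NN v.
  apply: (@le_trans _ _ ((B * K' + K * B') * N v)); last first.
    by rewrite ler_wpM2r // lerDl mulr_ge0.
  rewrite mulrDl; apply: lerD.
    by rewrite -mulrA ler_pM ?nm_ge0 ?hB ?(qd_bd h').
  by rewrite mulrAC ler_pM ?nm_ge0 ?hB' ?(qd_bd h).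
move=> x y hx hy.
have -> : F y * F' y - F x * F' x - (F x * G' x (y - x) + G x (y - x) * F' x) =
  F x * (F' y - F' x - G' x (y - x)) + (F y - F x - G x (y - x)) * F' x
  + (F y - F x) * (F' y - F' x) by ring.
apply: le_trans (nmD _ _) _; rewrite [leRHS]mulrDl; apply: lerD.
  rewrite [leRHS]mulrDl; apply: le_trans (nmD _ _) _; apply: lerD; rewrite normcM.
    by rewrite -mulrA ler_pM ?nm_ge0 ?hB ?(qd_quad h').
  by rewrite mulrAC ler_pM ?nm_ge0 ?hB' ?(qd_quad h).
rewrite normcM expr2 mulrACA.
by apply: ler_pM; rewrite ?nm_ge0 ?(qd_lip h) ?(qd_lip h').
Qed.

Lemma qd_comp1 F G a r K (f f' : C -> C) b r' K' : 0 < r -> qd F G a r K ->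
  0 <= K' -> (forall x, nm (x - b) < r' -> nm (f' x) <= K') ->
  (forall x y, nm (x - b) < r' -> nm (y - b) < r' ->
     nm (f y - f x - f' x * (y - x)) <= K' * nm (y - x) ^+ 2) ->
  (forall x, N (x - a) < r -> nm (F x - b) < r') ->
  exists K2, qd (f \o F) (fun x v => f' (F x) * G x v) a r K2.
Proof.
move=> r0 h K0' hb hq hF; have K0 := qd_K h.
have c0 : 0 <= K + 2 * r * K by rewrite addr_ge0 // !mulr_ge0 // ltW.
exists (K' * K + K' * (K + 2 * r * K) ^+ 2); split.
- by rewrite addr_ge0 ?mulr_ge0 // exprn_ge0.
- by move=> x u v c hx; rewrite (qd_lin h) //; ring.
- move=> x v hx; rewrite normcM; apply: (@le_trans _ _ (K' * K * N v)).
    by rewrite -mulrA ler_pM ?nm_ge0 ?hb ?hF ?(qd_bd h).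
  by rewrite ler_wpM2r ?vn_ge0 // lerDl mulr_ge0 // exprn_ge0.
move=> x y hx hy /=.
have -> : f (F y) - f (F x) - f' (F x) * G x (y - x) =
  f' (F x) * (F y - F x - G x (y - x)) + (f (F y) - f (F x) - f' (F x) * (F y - F x)) by ring.
rewrite mulrDl; apply: le_trans (nmD _ _) _; apply: lerD.
  by rewrite normcM -mulrA ler_pM ?nm_ge0 ?hb ?hF ?(qd_quad h).
apply: le_trans (hq _ _ (hF _ hx) (hF _ hy)) _.
rewrite -mulrA ler_wpM2l // -exprMn ler_pXn2r ?nnegrE ?nm_ge0 ?mulr_ge0 ?vn_ge0 //.
exact: (qd_lip h).
Qed.

(** The restriction of F to a complex line satisfies the hypothesis of the one-variable estimates,
    with constant K N(v)^2. *)
Lemma qd_line F G a r K x v (rho : R) : qd F G a r K -> N (x - a) + rho * N v < r ->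
  (forall s t : C, nm s <= rho -> nm t <= rho ->
     nm (F (x + t *: v) - F (x + s *: v) - G (x + s *: v) v * (t - s)) <=
     K * N v ^+ 2 * nm (t - s) ^+ 2).
Proof.
move=> h hr s t hs ht.
have aux (z : C) : nm z <= rho -> N (x + z *: v - a) < r.
  move=> hz; rewrite addrAC; apply: le_lt_trans (vnD NN _ _) _.
  rewrite (vnZ NN); apply: le_lt_trans hr; rewrite lerD2l ler_wpM2r //; exact: vn_ge0.
have d : x + t *: v - (x + s *: v) = (t - s) *: v.
  by rewrite opprD addrACA subrr add0r scalerBl.
have := qd_quad h (aux _ hs) (aux _ ht); rewrite d (qd_scale _ _ h (aux _ hs)) (vnZ NN).
by rewrite exprMn [_ * G _ _]mulrC [nm _ ^+ 2 * _]mulrC mulrA.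
Qed.

(** Weierstrass's theorem for bounded pointwise limits. In direction v the disc of radius rho = r /
    (2 N v) stays in the ball, so Cauchy's estimates bound [Gn] and the quadratic errors by B and r
    alone; G is the ultralimit of the [Gn]. If N v = 0, the bounds of each [Gn] already give 0. *)
Lemma qd_limit (Fn : nat -> V -> C) (Gn : nat -> V -> V -> C) (Kn : nat -> R) F a r B :
  0 < r -> 0 <= B -> (forall n, qd (Fn n) (Gn n) a r (Kn n)) ->
  (forall n x, N (x - a) < r -> nm (Fn n x) <= B) ->
  (forall x, N (x - a) < r -> (fun n => Fn n x) @ \oo --> F x) ->
  exists G K, qd F G a (r / 8%:R) K.
Proof.
move=> r0 B0 hq hB hF.
have bG n x v : N (x - a) < r / 8%:R -> nm (Gn n x v) <= 8%:R * B / r * N v.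
  move=> hx; have [v0|v0] := eqVneq (N v) 0.
    have hxr : N (x - a) < r by apply: lt_le_trans hx _; rewrite ler_pdivrMr //; lra.
    by apply: le_trans (qd_bd (hq n) v hxr) _; rewrite v0 !mulr0.
  have vp : 0 < N v by rewrite lt_neqAle eq_sym v0 vn_ge0.
  pose rho := r / 2 / N v; have rho0 : 0 < rho by rewrite !divr_gt0.
  have rhoN : rho * N v = r / 2 by rewrite /rho divfK // gt_eqF.
  have hr : N (x - a) + rho * N v < r by rewrite rhoN; lra.
  have hl := qd_line (hq n) hr.
  have K0 : 0 <= Kn n * N v ^+ 2 by rewrite mulr_ge0 ?(qd_K (hq n)) ?sqr_ge0.
  have hb t : nm t = rho -> nm (Fn n (x + t *: v)) <= B.
    move=> ht; apply: hB; rewrite addrAC; apply: le_lt_trans (vnD NN _ _) _.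
    by rewrite (vnZ NN) ht.
  have z0 : nm (0 : C) < rho / 2 by rewrite normc0 divr_gt0.
  have := cauchy_deriv_bound rho0 K0 hl hb z0; rewrite scale0r addr0.
  move=> /le_trans; apply; rewrite le_eqVlt; apply/orP; left; apply/eqP.
  by rewrite /rho; field; rewrite v0 gt_eqF.
have bdG x v : N (x - a) < r / 8%:R -> bdd (fun n => Gn n x v).
  by move=> hx; exists (8%:R * B / r * N v) => n; apply: bG.
have qG n x y : N (x - a) < r / 8%:R -> N (y - a) < r / 8%:R ->
   nm (Fn n y - Fn n x - Gn n x (y - x)) <= 32%:R * B / r ^+ 2 * N (y - x) ^+ 2.
  move=> hx hy; set v := y - x.
  have hxr : N (x - a) < r by apply: lt_le_trans hx _; rewrite ler_pdivrMr //; lra.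
  have hyr : N (y - a) < r by apply: lt_le_trans hy _; rewrite ler_pdivrMr //; lra.
  have [v0|v0] := eqVneq (N v) 0.
    apply: le_trans (qd_quad (hq n) hxr hyr) _.
    by rewrite -/v v0 expr0n /= !mulr0.
  have vp : 0 < N v by rewrite lt_neqAle eq_sym v0 vn_ge0.
  (* The radius r / 8 is chosen for this: two points of the smaller ball are within r / 4, hence rho
     > 2 and the parameter 1, which leads from x to y, lies in the half disc where [cauchy_quad]
     applies. *)
  have vr : N v < r / 4%:R.
    apply: le_lt_trans (vn_tri NN _ a _) _; rewrite (vn_distrC NN a); lra.
  pose rho := r / 2 / N v; have rho0 : 0 < rho by rewrite !divr_gt0.
  have rhoN : rho * N v = r / 2 by rewrite /rho divfK // gt_eqF.
  have hr : N (x - a) + rho * N v < r by rewrite rhoN; lra.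
  have hl := qd_line (hq n) hr.
  have K0 : 0 <= Kn n * N v ^+ 2 by rewrite mulr_ge0 ?(qd_K (hq n)) ?sqr_ge0.
  have hb t : nm t = rho -> nm (Fn n (x + t *: v)) <= B.
    move=> ht; apply: hB; rewrite addrAC; apply: le_lt_trans (vnD NN _ _) _.
    by rewrite (vnZ NN) ht.
  have z0 : nm (0 : C) < rho / 2 by rewrite normc0 divr_gt0.
  have z1 : nm (1 : C) <= rho / 2.
    by rewrite normc1 /rho !ler_pdivlMr //; lra.
  have := cauchy_quad rho0 K0 hl hb z0 z1; rewrite scale0r addr0 scale1r.
  have -> : x + v = y by rewrite /v addrC subrK.
  rewrite !subr0 normc1 expr1n !mulr1.
  move=> /le_trans; apply; rewrite le_eqVlt; apply/orP; left; apply/eqP.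
  by rewrite /rho; field; rewrite v0 gt_eqF.
exists (fun x v => ulim (fun n => Gn n x v)), (8%:R * B / r + 32%:R * B / r ^+ 2).
have p1 : 0 <= 8%:R * B / r by rewrite divr_ge0 ?mulr_ge0 // ltW.
have p2 : 0 <= 32%:R * B / r ^+ 2 by rewrite divr_ge0 ?sqr_ge0 // mulr_ge0.
have rr x : N (x - a) < r / 8%:R -> N (x - a) < r.
  by move=> hx; apply: lt_le_trans hx _; rewrite ler_pdivrMr //; lra.
split; first by rewrite addr_ge0.
- move=> x u v c hx; have b1 := bdG x u hx; have b2 := bdG x v hx.
  rewrite -ulimZ // -ulimD //; last by apply: bddZ.
  congr ulim; apply/funext => n; exact: (qd_lin (hq n) _ _ _ (rr _ hx)).
- move=> x v hx; apply: ulim_le => n; apply: le_trans (bG n x v hx) _.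
  by rewrite ler_wpM2r ?vn_ge0 // lerDl.
move=> x y hx hy.
have bF z : N (z - a) < r -> bdd (fun n => Fn n z) by move=> hz; exists B => n; apply: hB.
have b1 := bF x (rr _ hx); have b2 := bF y (rr _ hy); have b3 := bdG x (y - x) hx.
rewrite -(ulim_cvg (hF _ (rr _ hx))) -(ulim_cvg (hF _ (rr _ hy))).
rewrite -!ulimB //; last exact: bddB.
apply: ulim_le => n; apply: le_trans (qG n x y hx hy) _.
by rewrite ler_wpM2r ?sqr_ge0 // lerDr.
Qed.

(** Expresses the differential by values of F alone. This gives its uniqueness and, in [qd_deriv],
    the differentiability of G. *)
Lemma qd_form F G x r K v (s : R) : 0 < r -> qd F G x r K -> 0 < s -> s * N v < r ->
  G x v = ulim (fun n => avg s n.+2 (fun w => F (x + w *: v) / w)).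
Proof.
move=> r0 h s0 hs; have hr : N (x - x) + s * N v < r by rewrite subrr vn0 // add0r.
have K0 : 0 <= K * N v ^+ 2 by rewrite mulr_ge0 ?(qd_K h) ?sqr_ge0.
have [B _ hB] := qd_bound r0 h.
have hb t : nm t = s -> nm (F (x + t *: v)) <= B.
  by move=> ht; apply: hB; rewrite addrAC subrr add0r (vnZ NN) ht.
by have := deriv0_ulim s0 K0 (qd_line h hr) hb; rewrite scale0r addr0.
Qed.

Lemma small_radius r v : 0 < r -> exists2 s : R, 0 < s & s * N v < r.
Proof.
move=> r0; have v1 : 0 < N v + 1 by rewrite ltr_wpDl // vn_ge0.
exists (r / 2 / (N v + 1)); first by rewrite !divr_gt0.
rewrite mulrAC ltr_pdivrMr //; have := vn_ge0 NN v; nra.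
Qed.

Lemma qd_unique F G F' G' a r K r' K' v : 0 < r -> 0 < r' -> qd F G a r K -> qd F' G' a r' K' ->
  (forall x, N (x - a) < r -> F x = F' x) -> G a v = G' a v.
Proof.
move=> r0 r0' h h' e; pose r1 := Num.min r r'.
have r10 : 0 < r1 by rewrite lt_min r0.
have [s s0 sv] := small_radius v r10.
rewrite (qd_form r0 h s0); last by apply: lt_le_trans sv _; rewrite ge_min lexx.
rewrite (qd_form r0' h' s0); last by apply: lt_le_trans sv _; rewrite ge_min lexx orbT.
congr ulim; apply/funext => n; rewrite /avg; congr (_ * _); apply: eq_bigr => j _.
rewrite e // addrAC subrr add0r (vnZ NN) nm_circ //.
by apply: lt_le_trans sv _; rewrite ge_min lexx.
Qed.

(** G x v is an average of F(x + w v) / w over |w| = rho, so the first-order expansions of F at the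
    points x + w v average to one of G(.) v; the factor 1 / w turns K into K / rho. *)
Lemma qd_deriv F G a r K v (rho : R) : 0 < r -> qd F G a r K -> 0 < rho -> rho * N v < r / 2 ->
  qd (fun x => G x v) (fun x u => ulim (fun n => avg rho n.+2 (fun w => G (x + w *: v) u / w)))
     a (r / 2) (K / rho).
Proof.
move=> r0 h rho0 rv; have K0 := qd_K h.
have sub x : N (x - a) < r / 2 -> N (x - a) + rho * N v < r by move=> hx; lra.
have ins x w : N (x - a) < r / 2 -> nm w <= rho -> N (x + w *: v - a) < r.
  move=> hx hw; rewrite addrAC; apply: le_lt_trans (vnD NN _ _) _.
  rewrite (vnZ NN); apply: le_lt_trans (sub _ hx); rewrite lerD2l ler_wpM2r //; exact: vn_ge0.
have [B B0 hB] := qd_bound r0 h.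
have Gform x : N (x - a) < r / 2 -> G x v = ulim (fun n => avg rho n.+2 (fun w => F (x + w *: v) / w)).
  move=> hx; apply: (@qd_form F G x (r / 2) K) => //; first by rewrite divr_gt0.
  by apply: (qd_shift h); lra.
pose H x u := ulim (fun n => avg rho n.+2 (fun w => G (x + w *: v) u / w)).
have kb x u w : N (x - a) < r / 2 -> nm w = rho -> nm (G (x + w *: v) u / w) <= K / rho * N u.
  move=> hx hw; rewrite normcM normcV hw mulrAC ler_wpM2r ?invr_ge0 ?(ltW rho0) //.
  by apply: (qd_bd h); apply: ins; rewrite // hw.
have bF x : N (x - a) < r / 2 -> bdd (fun n => avg rho n.+2 (fun w => F (x + w *: v) / w)).
  move=> hx; apply: (@bdd_avg _ _ rho0 (B / rho)) => n w hw; rewrite normcM normcV hw.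
  by rewrite ler_wpM2r ?invr_ge0 ?(ltW rho0) // hB // ins // hw.
have bH x u : N (x - a) < r / 2 -> bdd (fun n => avg rho n.+2 (fun w => G (x + w *: v) u / w)).
  by move=> hx; apply: (@bdd_avg _ _ rho0 (K / rho * N u)) => n w hw; apply: kb.
split; first by rewrite divr_ge0 // ltW.
- move=> x u1 u2 c hx; have b1 := bH x u1 hx; have b2 := bH x u2 hx.
  rewrite -ulimZ // -ulimD //; last by apply: bddZ.
  congr ulim; apply/funext => n; rewrite /avg [X in _ = X + _]mulrCA -mulrDr.
  rewrite [X in _ = _ * (X + _)]mulr_sumr -big_split /=.
  congr (_ * _); apply: eq_bigr => j _; rewrite (qd_lin h); first by rewrite mulrDl mulrA.
  by apply: ins; rewrite // nm_circ.
- by move=> x u hx; apply: ulim_le => n; apply: nm_avg => // w hw; apply: kb.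
move=> x y hx hy; have b1 := bF x hx; have b2 := bF y hy; have b3 := bH x (y - x) hx.
rewrite !Gform // -!ulimB //; last exact: bddB.
apply: ulim_le => n; rewrite /avg -!mulrBr -!sumrB.
have := @nm_avg _ rho rho0 n.+2 (fun w => F (y + w *: v) / w - F (x + w *: v) / w -
    G (x + w *: v) (y - x) / w) (K / rho * N (y - x) ^+ 2) isT.
apply=> w hw; rewrite -!mulrBl normcM normcV hw [leRHS]mulrAC ler_wpM2r ?invr_ge0 ?(ltW rho0) //.
have := qd_quad h (ins x w hx _) (ins y w hy _); rewrite hw => /(_ (lexx _) (lexx _)).
by rewrite opprD addrACA subrr addr0.
Qed.

(** By [qd_form], the derivative along v of G(.) u is the ultralimit of averages of G(a + w v) u /
    w. This is also the differential at u which [qd_deriv] finds for G(.) v, and differentials are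
    unique. *)
Lemma qd_sym F G a r K u v Hu Hv ru Ku rv Kv : 0 < r -> 0 < ru -> 0 < rv -> qd F G a r K ->
  qd (fun x => G x u) Hu a ru Ku -> qd (fun x => G x v) Hv a rv Kv -> Hu a v = Hv a u.
Proof.
move=> r0 ru0 rv0 h hu hv.
have m0 : 0 < Num.min (r / 2) ru by rewrite lt_min divr_gt0.
have [s s0 sv] := small_radius v m0.
have s1 : s * N v < r / 2 by apply: lt_le_trans sv _; rewrite ge_min lexx.
have s2 : s * N v < ru by apply: lt_le_trans sv _; rewrite ge_min lexx orbT.
rewrite (qd_form ru0 hu s0 s2).
have r2 : 0 < r / 2 by rewrite divr_gt0.
by rewrite (qd_unique u rv0 r2 hv (qd_deriv r0 h s0 s1)).
Qed.

End Closure.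
End QuadraticallyDifferentiable.

(* Locked: unification would otherwise unfold it down to a limit. *)
HB.lock Definition dd (R : realType) (V : lmodType R[i]) (F : V -> R[i]) (a v : V) : R[i] :=
  derive1 (fun t : R[i] => F (a + t *: v)) 0.

(** * Germs of differentiable functions and their calculus *)

Section Germs.
Variable R : realType.
Local Notation C := R[i].
Local Notation nm := (@normc R).

Lemma nm_vnorm : vnorm (nm : R[i]^o -> R).
Proof. by split=> [u v|a u]; [exact: nmD|rewrite normcM]. Qed.

Lemma derive1_quad (f : C -> C) (a d : C) (r K : R) : 0 < r ->
  (forall h, nm h < r -> nm (f (a + h) - f a - d * h) <= K * nm h ^+ 2) -> derive1 f a = d.
Proof.
move=> r0 hq; apply: cvg_lim => //.
apply/cvgCP => e e0; apply/dnbhsCP.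
pose K' := `|K| + 1; have K'0 : 0 < K' by rewrite ltr_pwDr.
exists (Num.min r (e / K')); first by rewrite lt_min r0 divr_gt0.
move=> h h0; rewrite subr0 lt_min => /andP[hr he].
have hp : 0 < nm h by rewrite nm_gt0.
have -> : h^-1 *: (f (h + a) - f a) - d = h^-1 * (f (a + h) - f a - d * h).
  by rewrite [h + a]addrC /GRing.scale /=; field.
rewrite normcM normcV mulrC ltr_pdivrMr //; apply: le_lt_trans (hq _ hr) _.
rewrite expr2 mulrA ltr_pM2r //; apply: le_lt_trans (_ : K' * nm h < e).
  by rewrite ler_pM2r // /K'; have := ler_norm K; lra.
by rewrite mulrC -ltr_pdivlMr.
Qed.

(* The germ property used in place of analyticity; no completeness of V is needed. *)
Definition Q (V : lmodType C) (N : V -> R) (F : V -> C) (a : V) : Prop :=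
  exists G r K, 0 < r /\ qd N F G a r K.

Definition near_at (V : lmodType C) (N : V -> R) (a : V) (P : V -> Prop) : Prop :=
  exists2 r : R, 0 < r & forall x, N (x - a) < r -> P x.

Section One.
Variables (V : lmodType C) (N : V -> R) (NN : vnorm N).
Implicit Types (F : V -> C) (a u v : V) (P : V -> Prop).
Local Notation Q := (@Q V N).
Local Notation near_at := (@near_at V N).

Lemma near_here a P : near_at a P -> P a.
Proof. by move=> [r r0]; apply; rewrite subrr vn0. Qed.

Lemma nearT a P : (forall x, P x) -> near_at a P.
Proof. by move=> h; exists 1. Qed.

Lemma nearI a P P' : near_at a P -> near_at a P' -> near_at a (fun x => P x /\ P' x).
Proof.
move=> [r r0 h] [r' r0' h']; exists (Num.min r r'); first by rewrite lt_min r0.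
by move=> x; rewrite lt_min => /andP[hx hx']; split; [apply: h|apply: h'].
Qed.

Lemma nearS a P P' : (forall x, P x -> P' x) -> near_at a P -> near_at a P'.
Proof. by move=> i [r r0 h]; exists r => // x hx; apply/i/h. Qed.

Lemma near_near a P : near_at a P -> near_at a (fun x => near_at x P).
Proof.
move=> [r r0 h]; exists (r / 2); first by rewrite divr_gt0.
move=> x hx; exists (r / 2); first by rewrite divr_gt0.
by move=> y hy; apply: h; apply: le_lt_trans (vn_tri NN _ x _) _; lra.
Qed.

Lemma near_all (T : finType) a (P : T -> V -> Prop) :
  (forall i, near_at a (P i)) -> near_at a (fun x => forall i, P i x).
Proof.
move=> h; suff : near_at a (fun x => forall i, i \in enum T -> P i x).
  by apply: nearS => x hx i; apply: hx; rewrite mem_enum.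
elim: (enum T) => [|j s IH]; first exact: nearT.
apply: nearS (nearI (h j) IH) => x [h1 h2] i.
by rewrite inE => /orP[/eqP ->|/h2].
Qed.

Lemma Q_near F a : Q F a -> near_at a (Q F).
Proof.
move=> [G [r [K [r0 h]]]]; exists (r / 2); first by rewrite divr_gt0.
move=> x hx; exists G, (r / 2), K; split; first by rewrite divr_gt0.
by apply: (qd_shift NN h); lra.
Qed.

Lemma qd_dd F G a r K x v : qd N F G a r K -> N (x - a) < r -> dd F x v = G x v.
Proof.
move=> h hx.
have r1 : 0 < r - N (x - a) by rewrite subr_gt0.
have [s s0 sv] := small_radius NN v r1.
rewrite dd.unlock; apply: (@derive1_quad _ _ _ s (K * N v ^+ 2) s0) => t ht.
have hl := @qd_line _ _ N NN F G a r K x v s h.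
have := hl _ 0 t; rewrite normc0 add0r subr0 scale0r addr0.
by apply; rewrite ?(ltW ht) ?(ltW s0) //; lra.
Qed.

Lemma Q_ext F F' a : near_at a (fun x => F x = F' x) -> Q F a -> Q F' a.
Proof.
move=> [r1 r10 e] [G [r [K [r0 h]]]]; pose r2 := Num.min r r1.
have r20 : 0 < r2 by rewrite lt_min r0.
exists G, r2, K; split=> //.
have r2r : r2 <= r by rewrite ge_min lexx.
have [k0 k1 k2 k3] := qd_le NN h r2r (lexx K).
split=> // x y hx hy.
rewrite -!e; first exact: k3.
all: by apply: lt_le_trans (_ : r2 <= r1) => //; rewrite ge_min lexx orbT.
Qed.

Lemma dd_ext F F' a v : near_at a (fun x => F x = F' x) -> Q F a -> dd F a v = dd F' a v.
Proof.
move=> e hQ; have [G' [r' [K' [r0' h']]]] := Q_ext e hQ.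
have [G [r [K [r0 h]]]] := hQ; case: e => r1 r10 e.
have a0 (s : R) : 0 < s -> N (a - a) < s by rewrite subrr vn0.
rewrite (qd_dd v h (a0 _ r0)) (qd_dd v h' (a0 _ r0')).
have m0 : 0 < Num.min r r1 by rewrite lt_min r0.
have mr : Num.min r r1 <= r by rewrite ge_min lexx.
have hm := qd_le NN h mr (lexx K).
apply: (qd_unique NN v m0 r0' hm h').
by move=> x; rewrite lt_min => /andP[_]; apply: e.
Qed.

Lemma Q_cont F a (e : R) : 0 < e -> Q F a -> near_at a (fun x => nm (F x - F a) < e).
Proof.
move=> e0 [G [r [K [r0 h]]]]; have K0 := qd_K h.
pose L := K + 2 * r * K; have L0 : 0 <= L by rewrite addr_ge0 // !mulr_ge0 // ltW.
exists (Num.min r (e / (L + 1))).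
  by rewrite lt_min r0 divr_gt0 // ltr_wpDl.
move=> x; rewrite lt_min => /andP[hx he].
have ha : N (a - a) < r by rewrite subrr vn0.
apply: le_lt_trans (qd_lip NN h ha hx) _; rewrite -/L.
move: he; rewrite ltr_pdivlMr; last by rewrite ltr_wpDl.
have := vn_ge0 NN (x - a); nra.
Qed.

Lemma Q_neq F a (c : C) : F a != c -> Q F a -> near_at a (fun x => F x != c).
Proof.
move=> h hQ; have e0 : 0 < nm (F a - c) by rewrite nm_gt0 subr_eq0.
apply: nearS (Q_cont e0 hQ) => x hx; apply/eqP => xc.
by move: hx; rewrite xc nm_distrC ltxx.
Qed.

Lemma Q_cst c a : Q (fun=> c) a.
Proof. by exists (fun _ _ => 0), 1, 0; split=> //; exact: qd_cst. Qed.

Lemma dd_cst c a v : dd (fun=> c) a v = 0.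
Proof. by rewrite dd.unlock; apply: (@derive1_quad _ _ _ 1 0) => // h _; rewrite subrr mul0r subr0 normc0 mul0r. Qed.

Lemma Q_common F F' a : Q F a -> Q F' a -> exists r G K G' K',
  [/\ 0 < r, qd N F G a r K & qd N F' G' a r K'].
Proof.
move=> [G [r [K [r0 h]]]] [G' [r' [K' [r0' h']]]].
exists (Num.min r r'), G, K, G', K'; split; first by rewrite lt_min r0.
  by apply: (qd_le NN h); rewrite ?ge_min ?lexx.
by apply: (qd_le NN h'); rewrite ?ge_min ?lexx ?orbT.
Qed.

Lemma Q_add F F' a : Q F a -> Q F' a -> Q (fun x => F x + F' x) a.
Proof.
move=> h h'; have [r [G [K [G' [K' [r0 k k']]]]]] := Q_common h h'.
by exists (fun x v => G x v + G' x v), r, (K + K'); split=> //; apply: qd_add.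
Qed.

Lemma dd_add F F' a v : Q F a -> Q F' a -> dd (fun x => F x + F' x) a v = dd F a v + dd F' a v.
Proof.
move=> h h'; have [r [G [K [G' [K' [r0 k k']]]]]] := Q_common h h'.
have ha : N (a - a) < r by rewrite subrr vn0.
by rewrite (qd_dd v (qd_add k k') ha) (qd_dd v k ha) (qd_dd v k' ha).
Qed.

Lemma Q_mul F F' a : Q F a -> Q F' a -> Q (fun x => F x * F' x) a.
Proof.
move=> h h'; have [r [G [K [G' [K' [r0 k k']]]]]] := Q_common h h'.
have [K2 k2] := qd_mul NN r0 k k'.
by exists (fun x v => F x * G' x v + G x v * F' x), r, K2.
Qed.

Lemma dd_mul F F' a v : Q F a -> Q F' a ->
  dd (fun x => F x * F' x) a v = F a * dd F' a v + dd F a v * F' a.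
Proof.
move=> h h'; have [r [G [K [G' [K' [r0 k k']]]]]] := Q_common h h'.
have ha : N (a - a) < r by rewrite subrr vn0.
have [K2 k2] := qd_mul NN r0 k k'.
by rewrite (qd_dd v k2 ha) (qd_dd v k ha) (qd_dd v k' ha).
Qed.

Lemma Q_opp F a : Q F a -> Q (fun x => - F x) a.
Proof.
move=> h; apply: Q_ext (Q_mul (Q_cst (-1) a) h).
by apply: nearT => x; rewrite mulN1r.
Qed.

Lemma dd_opp F a v : Q F a -> dd (fun x => - F x) a v = - dd F a v.
Proof.
move=> h; have -> : (fun x => - F x) = (fun x => -1 * F x) by apply/funext => x; rewrite mulN1r.
by rewrite dd_mul ?dd_cst ?mul0r ?addr0 ?mulN1r //; exact: Q_cst.
Qed.

Lemma Q_sub F F' a : Q F a -> Q F' a -> Q (fun x => F x - F' x) a.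
Proof. by move=> h h'; apply: Q_add => //; apply: Q_opp. Qed.

Lemma dd_sub F F' a v : Q F a -> Q F' a -> dd (fun x => F x - F' x) a v = dd F a v - dd F' a v.
Proof. by move=> h h'; rewrite dd_add ?dd_opp //; apply: Q_opp. Qed.

Lemma Q_sum (I : Type) (s : seq I) (P : pred I) (F : I -> V -> C) a :
  (forall i, P i -> Q (F i) a) -> Q (fun x => \sum_(i <- s | P i) F i x) a.
Proof.
move=> h; elim: s => [|i s IH].
  by apply: Q_ext (Q_cst 0 a); apply: nearT => x; rewrite big_nil.
case Pi: (P i); last by apply: Q_ext IH; apply: nearT => x; rewrite big_cons Pi.
by apply: Q_ext (Q_add (h i Pi) IH); apply: nearT => x; rewrite big_cons Pi.
Qed.

Lemma Q_prod (I : eqType) (s : seq I) (P : pred I) (F : I -> V -> C) a :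
  (forall i, i \in s -> P i -> Q (F i) a) -> Q (fun x => \prod_(i <- s | P i) F i x) a.
Proof.
elim: s => [|i s IH] h.
  by apply: Q_ext (Q_cst 1 a); apply: nearT => x; rewrite big_nil.
have {}IH : Q (fun x => \prod_(i <- s | P i) F i x) a.
  by apply: IH => j js; apply: h; rewrite inE js orbT.
case Pi: (P i); last by apply: Q_ext IH; apply: nearT => x; rewrite big_cons Pi.
have hi : Q (F i) a by apply: h => //; rewrite inE eqxx.
by apply: Q_ext (Q_mul hi IH); apply: nearT => x; rewrite big_cons Pi.
Qed.

Lemma dd_sum (I : Type) (s : seq I) (P : pred I) (F : I -> V -> C) a v :
  (forall i, P i -> Q (F i) a) ->
  dd (fun x => \sum_(i <- s | P i) F i x) a v = \sum_(i <- s | P i) dd (F i) a v.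
Proof.
move=> h; elim: s => [|i s IH].
  have -> : (fun x => \sum_(i <- [::] | P i) F i x) = (fun=> 0 : C) by apply/funext => x; rewrite big_nil.
  by rewrite dd_cst big_nil.
rewrite big_cons; case Pi: (P i).
  rewrite -IH -dd_add; [|exact: h|exact: Q_sum].
  by congr dd; apply/funext => x; rewrite big_cons Pi.
by rewrite -IH; congr dd; apply/funext => x; rewrite big_cons Pi.
Qed.

Lemma Q_dd F a v : Q F a -> Q (fun x => dd F x v) a.
Proof.
move=> [G [r [K [r0 h]]]].
have r2 : 0 < r / 2 by rewrite divr_gt0.
have [s s0 sv] := small_radius NN v r2.
apply: (@Q_ext (fun x => G x v)).
  by exists r => // x hx; rewrite (qd_dd v h hx).
by eexists; exists (r / 2); eexists; split=> //; apply: (qd_deriv NN r0 h s0 sv).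
Qed.

Lemma dd_sym F a u v : Q F a -> dd (fun x => dd F x u) a v = dd (fun x => dd F x v) a u.
Proof.
move=> [G [r [K [r0 h]]]].
have r2 : 0 < r / 2 by rewrite divr_gt0.
have [s s0 sv] := small_radius NN v r2.
have [t t0 tu] := small_radius NN u r2.
have hv := qd_deriv NN r0 h s0 sv; have hu := qd_deriv NN r0 h t0 tu.
have e w : near_at a (fun x => G x w = dd F x w).
  by exists r => // x hx; rewrite (qd_dd w h hx).
have ha (z : R) : 0 < z -> N (a - a) < z by rewrite subrr vn0.
have qu : Q (fun x => G x u) a by eexists; exists (r / 2); eexists; split=> //; apply: hu.
have qv : Q (fun x => G x v) a by eexists; exists (r / 2); eexists; split=> //; apply: hv.
have e1 := dd_ext v (e u) qu; have e2 := dd_ext u (e v) qv.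
apply: etrans (esym e1) (etrans _ e2).
rewrite (qd_dd v hu (ha _ r2)) (qd_dd u hv (ha _ r2)).
exact: (qd_sym NN r0 r2 r2 h hu hv).
Qed.

Lemma dd_lin F a c u v : Q F a -> dd F a (c *: u + v) = c * dd F a u + dd F a v.
Proof.
move=> [G [r [K [r0 h]]]]; have ha : N (a - a) < r by rewrite subrr vn0.
by rewrite !(qd_dd _ h ha) (qd_lin h).
Qed.

Lemma dd0 F a : Q F a -> dd F a 0 = 0.
Proof.
move=> h; have := dd_lin 1 0 0 h; rewrite scale1r add0r mul1r => /eqP.
by rewrite -subr_eq0 opprD addrA subrr sub0r oppr_eq0 => /eqP.
Qed.

Lemma dd_scale F a c u : Q F a -> dd F a (c *: u) = c * dd F a u.
Proof. by move=> h; have := dd_lin c u 0 h; rewrite !addr0 dd0 // addr0. Qed.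

Lemma dd_addr F a u v : Q F a -> dd F a (u + v) = dd F a u + dd F a v.
Proof. by move=> h; have := dd_lin 1 u v h; rewrite scale1r mul1r. Qed.

End One.

Lemma dd1E (f : R[i]^o -> C) a : dd f a 1 = derive1 f a.
Proof.
rewrite dd.unlock.
have E (h : C) : h^-1 *: (f (a + (h + 0) *: 1) - f (a + 0 *: 1)) = h^-1 *: (f (h + a) - f a).
  by rewrite addr0 scale0r addr0 /GRing.scale /= mulr1 [a + h]addrC.
exact: (congr1 (fun g : C -> C => lim (g @ 0^')) (funext E)).
Qed.

Lemma Q1E (f : R[i]^o -> C) a : Q (nm : R[i]^o -> R) f a ->
  exists r K, [/\ 0 < r, 0 <= K, forall x, nm (x - a) < r -> nm (derive1 f x) <= K &
   forall x y, nm (x - a) < r -> nm (y - a) < r ->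
    nm (f y - f x - derive1 f x * (y - x)) <= K * nm (y - x) ^+ 2].
Proof.
move=> [G [r [K [r0 h]]]]; exists r, K; split=> //; first exact: qd_K h.
  move=> x hx; rewrite -dd1E (qd_dd nm_vnorm _ h hx).
  by have := qd_bd h 1 hx; rewrite normc1 mulr1.
move=> x y hx hy; have -> : derive1 f x * (y - x) = G x (y - x).
  rewrite -dd1E (qd_dd nm_vnorm _ h hx) mulrC -(qd_scale _ _ h hx).
  by rewrite /GRing.scale /= mulr1.
exact: (qd_quad h).
Qed.

Lemma Q1I (f f' : R[i]^o -> C) a (r K : R) : 0 < r -> 0 <= K ->
  (forall x, nm (x - a) < r -> nm (f' x) <= K) ->
  (forall x y, nm (x - a) < r -> nm (y - a) < r ->
    nm (f y - f x - f' x * (y - x)) <= K * nm (y - x) ^+ 2) ->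
  qd (nm : R[i]^o -> R) f (fun x v => f' x * v) a r K.
Proof.
move=> r0 K0 h1 h2; split=> //.
  by move=> x u v c _; rewrite /GRing.scale /=; ring.
by move=> x v hx; rewrite normcM ler_wpM2r ?nm_ge0 // h1.
Qed.

Section Composition.
Variables (V : lmodType C) (N : V -> R) (NN : vnorm N).
Local Notation nmo := (nm : R[i]^o -> R).

Lemma Q_comp_common (F : V -> C) (g : R[i]^o -> C) a : Q N F a -> Q nmo g (F a) ->
  exists r K K2 G, [/\ 0 < r, qd N F G a r K &
    qd N (g \o F) (fun x v => derive1 g (F x) * G x v) a r K2].
Proof.
move=> hF /Q1E [r' [K' [r0' K0' h1 h2]]].
have [r1 r10 hc] := Q_cont NN r0' hF.
have [G [r [K [r0 h]]]] := hF.
have m0 : 0 < Num.min r r1 by rewrite lt_min r0.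
have mr : Num.min r r1 <= r by rewrite ge_min lexx.
have hm := qd_le NN h mr (lexx K).
have [|K2 k2] := @qd_comp1 _ _ N NN F G a (Num.min r r1) K g (derive1 g) (F a) r' K' m0 hm K0' h1 h2.
  by move=> x; rewrite lt_min => /andP[_ hx]; apply: hc.
by exists (Num.min r r1), K, K2, G.
Qed.

Lemma Q_comp (F : V -> C) (g : R[i]^o -> C) a : Q N F a -> Q nmo g (F a) -> Q N (fun x => g (F x)) a.
Proof.
move=> h h'; have [r [K [K2 [G [r0 _ k]]]]] := Q_comp_common h h'.
by eexists; exists r, K2; split=> //; exact: k.
Qed.

Lemma dd_comp (F : V -> C) (g : R[i]^o -> C) a v : Q N F a -> Q nmo g (F a) ->
  dd (fun x => g (F x)) a v = derive1 g (F a) * dd F a v.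
Proof.
move=> h h'; have [r [K [K2 [G [r0 k k2]]]]] := Q_comp_common h h'.
have ha : N (a - a) < r by rewrite subrr vn0.
by rewrite (qd_dd NN v k2 ha) (qd_dd NN v k ha).
Qed.

Lemma inv_quad (a : C) : a != 0 ->
  qd nmo (fun x => x^-1) (fun x v => - (x ^+ 2)^-1 * v) a (nm a / 2)
    ((nm a / 2) ^- 2 + (nm a / 2) ^- 3).
Proof.
move=> a0; have r0 : 0 < nm a / 2 by rewrite divr_gt0 // nm_gt0.
have far x : nm (x - a) < nm a / 2 -> nm a / 2 <= nm x.
  by move=> hx; have := nmD x (a - x); rewrite addrC subrK nm_distrC; lra.
have iv x k : nm (x - a) < nm a / 2 -> nm x ^- k <= (nm a / 2) ^- k.
  move=> /far hx; rewrite lef_pV2 ?posrE ?exprn_gt0 ?(lt_le_trans r0 hx) //.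
  by rewrite lerXn2r ?nnegrE ?nm_ge0 // ltW.
have p k : 0 <= (nm a / 2) ^- k by rewrite invr_ge0 exprn_ge0 // ltW.
apply: Q1I => //; first by rewrite addr_ge0 ?p.
  move=> x hx; rewrite nmN normcV nmX; apply: le_trans (iv x 2%N hx) _.
  by rewrite lerDl p.
move=> x y hx hy.
have x0 : x != 0 by rewrite -nm_gt0 (lt_le_trans r0) ?far.
have y0 : y != 0 by rewrite -nm_gt0 (lt_le_trans r0) ?far.
have -> : y^-1 - x^-1 - - (x ^+ 2)^-1 * (y - x) = (y^-1 * (x ^+ 2)^-1) * (y - x) ^+ 2.
  by field; rewrite x0 y0.
rewrite normcM nmX ler_wpM2r ?sqr_ge0 // normcM !normcV nmX.
apply: (@le_trans _ _ ((nm a / 2) ^- 3)); last by rewrite lerDr p.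
have -> : (nm a / 2) ^- 3 = (nm a / 2)^-1 * (nm a / 2) ^- 2 by rewrite -invfM -exprS.
apply: ler_pM; rewrite ?invr_ge0 ?exprn_ge0 ?nm_ge0 ?iv //.
by have := iv y 1%N hy; rewrite !expr1.
Qed.

Lemma Q_inv1 (a : C) : a != 0 -> Q nmo (fun x => x^-1) a.
Proof.
move=> a0; eexists; eexists; eexists; split; last exact: inv_quad.
by rewrite divr_gt0 // nm_gt0.
Qed.

Lemma derive1_inv (a : R[i]) : a != 0 -> derive1 (fun x : R[i] => x^-1) a = - (a ^+ 2)^-1.
Proof.
move=> a0; rewrite -(@dd1E (fun x => x^-1)) (qd_dd nm_vnorm _ (inv_quad a0)) ?mulr1 //.
by rewrite subrr normc0 divr_gt0 // nm_gt0.
Qed.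

Lemma Q_inv (F : V -> C) a : F a != 0 -> Q N F a -> Q N (fun x => (F x)^-1) a.
Proof. by move=> a0 h; apply: (Q_comp h (Q_inv1 a0)). Qed.

Lemma dd_inv (F : V -> C) a v : F a != 0 -> Q N F a ->
  dd (fun x => (F x)^-1) a v = - dd F a v / F a ^+ 2.
Proof.
move=> a0 h; rewrite (dd_comp v h (Q_inv1 a0)) derive1_inv //.
by rewrite mulNr mulrC mulNr.
Qed.

Lemma Q_div (F F' : V -> C) a : F' a != 0 -> Q N F a -> Q N F' a -> Q N (fun x => F x / F' x) a.
Proof. by move=> a0 h h'; apply: Q_mul => //; apply: Q_inv. Qed.

End Composition.

Section Affine.
Variables (V1 V2 : lmodType C) (N1 : V1 -> R) (N2 : V2 -> R) (NN1 : vnorm N1) (NN2 : vnorm N2).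
Variables (phi : V1 -> V2) (l : V1 -> V2) (c : R).
Hypothesis philin : forall x y, phi y - phi x = l (y - x).
Hypothesis llin : forall k u v, l (k *: u + v) = k *: l u + l v.
Hypothesis lbd : forall u, N2 (l u) <= c * N1 u.

Let c' := `|c| + 1.
Let c0 : 0 < c'. Proof. by rewrite ltr_pwDr. Qed.
Let lbd' u : N2 (l u) <= c' * N1 u.
Proof.
apply: le_trans (lbd u) _; rewrite ler_wpM2r ?(vn_ge0 NN1) // /c'.
by have := ler_norm c; lra.
Qed.

Lemma qd_aff F G a r K : 0 < r -> qd N2 F G (phi a) r K ->
  qd N1 (F \o phi) (fun x v => G (phi x) (l v)) a (r / c') (K * c' + K * c' ^+ 2).
Proof.
move=> r0 h; have K0 := qd_K h.
have i x : N1 (x - a) < r / c' -> N2 (phi x - phi a) < r.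
  move=> hx; rewrite philin; apply: le_lt_trans (lbd' _) _.
  by rewrite mulrC -ltr_pdivlMr.
have p1 : 0 <= K * c' by rewrite mulr_ge0 // ltW.
have p2 : 0 <= K * c' ^+ 2 by rewrite mulr_ge0 // sqr_ge0.
split; first by rewrite addr_ge0.
- by move=> x u v k hx; rewrite llin (qd_lin h) // i.
- move=> x v hx; apply: le_trans (qd_bd h _ (i _ hx)) _.
  apply: (@le_trans _ _ (K * c' * N1 v)); first by rewrite -mulrA ler_wpM2l.
  by rewrite ler_wpM2r ?(vn_ge0 NN1) // lerDl.
move=> x y hx hy /=; have := qd_quad h (i _ hx) (i _ hy); rewrite philin.
move=> /le_trans; apply; apply: (@le_trans _ _ (K * c' ^+ 2 * N1 (y - x) ^+ 2)).
  rewrite -mulrA ler_wpM2l // -exprMn ler_pXn2r ?nnegrE ?(vn_ge0 NN2) //.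
  by rewrite mulr_ge0 ?(vn_ge0 NN1) // ltW.
by rewrite ler_wpM2r ?sqr_ge0 // lerDr.
Qed.

Lemma Q_aff F a : Q N2 F (phi a) -> Q N1 (fun x => F (phi x)) a.
Proof.
move=> [G [r [K [r0 h]]]]; eexists; exists (r / c'); eexists; split; last exact: qd_aff h.
by rewrite divr_gt0.
Qed.

End Affine.
End Germs.

(** * Power series, Laurent expansions and the identity theorem *)

Section Bridge.
Variable R : realType.
Local Notation C := R[i].
Local Notation nm := (@normc R).
Local Notation nmo := (nm : R[i]^o -> R).

Lemma gt0C (r : C) : 0 < r -> r = (complex.Re r)%:C /\ 0 < complex.Re r.
Proof.
move=> r0; have e : r = (complex.Re r)%:C by rewrite RRe_real // gtr0_real.
by split=> //; rewrite -ltcR -e.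
Qed.

Section FixedBall.
Variables (V : lmodType C) (N : V -> R) (NN : vnorm N).

Definition Qon (F : V -> C) a r := exists G K, qd N F G a r K.

Lemma Qon_mul F F' a r : 0 < r -> Qon F a r -> Qon F' a r -> Qon (fun x => F x * F' x) a r.
Proof.
move=> r0 [G [K h]] [G' [K' h']].
have [K2 k] := qd_mul NN r0 h h'; by exists (fun x v => F x * G' x v + G x v * F' x), K2.
Qed.

Lemma Qon_add F F' a r : Qon F a r -> Qon F' a r -> Qon (fun x => F x + F' x) a r.
Proof. by move=> [G [K h]] [G' [K' h']]; exists (fun x v => G x v + G' x v), (K + K'); exact: qd_add. Qed.

Lemma Qon_cst c a r : Qon (fun=> c) a r.
Proof. by exists (fun _ _ => 0), 0; exact: qd_cst. Qed.

Lemma Qon_big (op : C -> C -> C) idx (J : Type) (s : seq J) (F : J -> V -> C) a r :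
  (forall f g, Qon f a r -> Qon g a r -> Qon (fun x => op (f x) (g x)) a r) ->
  (forall j, Qon (F j) a r) -> Qon (fun x => \big[op/idx]_(j <- s) F j x) a r.
Proof.
move=> hop h; elim: s => [|j s IH].
  have -> : (fun x => \big[op/idx]_(j <- [::]) F j x) = fun=> idx by apply/funext => x; rewrite big_nil.
  exact: Qon_cst.
have -> : (fun x => \big[op/idx]_(j0 <- j :: s) F j0 x) = fun x => op (F j x) (\big[op/idx]_(j <- s) F j x).
  by apply/funext => x; rewrite big_cons.
exact: hop.
Qed.

Lemma Qon_exp F a r n : 0 < r -> Qon F a r -> Qon (fun x => F x ^+ n) a r.
Proof.
move=> r0 h; elim: n => [|n IH]; first exact: Qon_cst.
have -> : (fun x => F x ^+ n.+1) = fun x => F x * F x ^+ n by apply/funext => x; rewrite exprS.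
exact: Qon_mul.
Qed.

End FixedBall.

Section Points.
Variable I : finType.

(** The l^1 norm dominates every coordinate, so its balls lie in the polydiscs of [analytic_at]. *)
Definition pnorm (v : I -> C) : R := \sum_i nm (v i).

Lemma pnorm_vnorm : vnorm pnorm.
Proof.
split=> [u v|a u]; first by rewrite -big_split; apply: ler_sum => i _; exact: nmD.
by rewrite /pnorm mulr_sumr; apply: eq_bigr => i _; rewrite -normcM.
Qed.

Lemma pnorm_coord (v : I -> C) i : nm (v i) <= pnorm v.
Proof. by rewrite /pnorm (bigD1 i) //= lerDl sumr_ge0 // => j _; exact: nm_ge0. Qed.

Definition pdir (i : I) : I -> C := fun j => (j == i)%:R.

Lemma qd_coord i a r : qd pnorm (fun z => z i) (fun _ v => v i) a r 1.
Proof.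
split=> // [x v _|x y _ _]; first by rewrite mul1r pnorm_coord.
by rewrite subrr normc0 mul1r sqr_ge0.
Qed.

Lemma Q_coord i a : Q pnorm (fun z => z i) a.
Proof. by exists (fun _ v => v i), 1, 1; split=> //; exact: qd_coord. Qed.

(** The partial sums are polynomials, bounded on the polydisc by the constant B of the definition,
    and they converge pointwise; [qd_limit] applies. *)
Lemma analytic_at_Q (F : (I -> C) -> C) a : analytic_at F a -> Q pnorm F a.
Proof.
move=> [c [r [B [/gt0C [rE r0] hB hF]]]]; set r1 := complex.Re r in rE r0.
pose Fn N z : C := \sum_(m : {ffun I -> 'I_N}) c [ffun i => m i : nat] * \prod_i (z i - a i) ^+ m i.
have hq N : Qon pnorm (Fn N) a r1.
  apply: Qon_big => [f g|m]; first exact: Qon_add.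
  apply: (Qon_mul pnorm_vnorm) => //; first exact: Qon_cst.
  apply: Qon_big => [f g|i]; first exact: (Qon_mul pnorm_vnorm).
  apply: (Qon_exp pnorm_vnorm) => //; apply: Qon_add; last exact: Qon_cst.
  by exists (fun _ v => v i), 1; exact: qd_coord.
pose Gn N := projT1 (cid (hq N)); pose Kn N := projT1 (cid (projT2 (cid (hq N)))).
have hqd N : qd pnorm (Fn N) (Gn N) a r1 (Kn N) by exact: projT2 (cid (projT2 (cid (hq N)))).
have co x : pnorm (x - a) < r1 -> forall i, nm (x i - a i) < r1.
  by move=> hx i; apply: le_lt_trans hx; exact: pnorm_coord (x - a) i.
have hb N x : pnorm (x - a) < r1 -> nm (Fn N x) <= complex.Re B.
  move=> hx; have : (nm (Fn N x))%:C <= B.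
    rewrite -normrE; apply: le_trans (hB N); apply: le_trans (ler_norm_sum _ _ _) _.
    apply: ler_sum => m _; rewrite normrM ler_wpM2l // normr_prod -prodrXr.
    apply: ler_prod => i _; rewrite normrX exprn_ge0 //= lerXn2r ?nnegrE //.
      by rewrite rE ler0c ltW.
    by rewrite rE normrE lecR ltW // co.
  by rewrite lecE => /andP[_].
have B0 : 0 <= complex.Re B.
  by apply: le_trans (nm_ge0 _) (hb 0%N a _); rewrite subrr (vn0 pnorm_vnorm).
have [|G [K h]] := @qd_limit _ _ _ pnorm_vnorm Fn Gn Kn F a r1 (complex.Re B) r0 B0 hqd hb.
  by move=> x hx; apply: hF => i; rewrite rE normrE ltcR co.
by exists G, (r1 / 8%:R), K; split=> //; rewrite divr_gt0.
Qed.

Lemma with_dir (x : I -> C) i t : ([eta x with i |-> t] : I -> C) = x + (t - x i) *: pdir i.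
Proof.
apply/funext => j; rewrite /= /pdir; change ((if j == i then t else x j) = x j + (t - x i) * (j == i)%:R).
by case: eqP => [->|_]; rewrite ?mulr1 ?mulr0 ?addr0 // addrC subrK.
Qed.

End Points.

Lemma pderivE n (i : 'I_n) (F : ('I_n -> C) -> C) : pderiv i F = fun x => dd F x (pdir i).
Proof.
apply/funext => x; rewrite /pderiv dd.unlock.
have E (h : C) : h^-1 *: (F [eta x with i |-> h + x i] - F [eta x with i |-> x i]) =
   h^-1 *: (F (x + (h + 0) *: pdir i) - F (x + 0 *: pdir i)).
  by rewrite !with_dir addrK subrr addr0.
exact: (congr1 (fun g : C -> C => lim (g @ 0^')) (funext E)).
Qed.

Lemma Q_taylor (f : C -> C) (a : C) : Q nmo f a ->
  exists (c : nat -> C) (rho B : R), [/\ 0 < rho, 0 <= B,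
    c 0%N = f a, c 1%N = derive1 f a &
    (forall k, nm (c k) <= B / rho ^+ k) /\
    (forall m z, nm z < rho ->
      nm (f (a + z) - \sum_(k < m) c k * z ^+ k) <= B * (nm z / rho) ^+ m * (rho / (rho - nm z)))].
Proof.
move=> /Q1E [r [K [r0 K0 h1 h2]]].
pose rho := r / 2; have rho0 : 0 < rho by rewrite divr_gt0.
have rr : rho < r by rewrite /rho; lra.
pose f0 z := f (a + z); pose f0' z := derive1 f (a + z).
have ins z : nm z <= rho -> nm (a + z - a) < r by move=> hz; rewrite addrAC subrr add0r; lra.
have hf x y : nm x <= rho -> nm y <= rho -> nm (f0 y - f0 x - f0' x * (y - x)) <= K * nm (y - x) ^+ 2.
  move=> hx hy; have := h2 _ _ (ins x hx) (ins y hy).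
  by have -> : a + y - (a + x) = y - x by ring.
(* Bounds f on the circle of radius rho from the expansion at the centre: value, derivative term,
   quadratic error. *)
pose B := nm (f a) + K * rho + K * rho ^+ 2.
have B0 : 0 <= B by rewrite !addr_ge0 ?nm_ge0 ?mulr_ge0 // ?exprn_ge0 // ltW.
have z0 : nm (0 : C) <= rho by rewrite normc0 ltW.
have hB x : nm x = rho -> nm (f0 x) <= B.
  move=> hx; have := hf 0 x z0; rewrite hx lexx subr0 hx => /(_ isT) h3.
  have h4 := h1 _ (ins 0 z0).
  have -> : f0 x = f a + f0' 0 * x + (f0 x - f0 0 - f0' 0 * x) by rewrite /f0 addr0; ring.
  apply: le_trans (nmD _ _) _; apply: lerD => //.
  apply: le_trans (nmD _ _) _; rewrite lerD2l normcM hx ler_wpM2r //; exact: ltW.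
have tb := taylor_bound rho0 K0 hf hB.
exists (tcoef f0 rho), rho, B; split=> //.
- have := tb 1%N 0; rewrite normc0 => /(_ rho0); rewrite big_ord1 expr0 mulr1 mul0r expr1 mulr0 mul0r.
  move=> h; apply/eqP; rewrite eq_sym -subr_eq0 -nm_eq0; apply/eqP/le_anti.
  by rewrite nm_ge0 andbT /f0 addr0 in h *.
- rewrite /f0' -[X in derive1 f X]addr0 -/(f0' 0) (deriv0_ulim rho0 K0 hf hB).
  by congr ulim; apply/funext => n; congr avg; apply/funext => w; rewrite expr1.
by split=> [k|m z]; [exact: tcoef_bound|exact: tb].
Qed.

Lemma sum_ffun1 N (F : nat -> C) :
  \sum_(m : {ffun 'I_1 -> 'I_N}) F (m ord0) = \sum_(k < N) F k.
Proof.
rewrite (reindex (fun k : 'I_N => [ffun=> k] : {ffun 'I_1 -> 'I_N})) /=.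
  by apply: eq_bigr => k _; rewrite ffunE.
exists (fun m => m ord0) => [k _|m _]; first by rewrite ffunE.
by apply/ffunP => i; rewrite ffunE (ord1 i).
Qed.

Lemma geo_half N : \sum_(k < N) (2^-1 : R) ^+ k <= 2.
Proof.
suff -> : \sum_(k < N) (2^-1 : R) ^+ k = 2 - 2 * 2^-1 ^+ N.
  by rewrite gerBl mulr_ge0 // exprn_ge0.
elim: N => [|N IH]; first by rewrite big_ord0 expr0 mulr1 subrr.
by rewrite big_ord_recr /= IH exprS; field.
Qed.

(** The radius is halved so that the sum of |c k| (rho/2)^k is at most B times the sum of 2^-k, that
    is 2 B. *)
Lemma ps_analytic (g : C -> C) (a : C) (c : nat -> C) (rho B : R) : 0 < rho -> 0 <= B ->
  (forall k, nm (c k) <= B / rho ^+ k) ->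
  (forall z, nm z < rho -> (fun m => \sum_(k < m) c k * z ^+ k) @ \oo --> g (a + z)) ->
  analytic1_at g a.
Proof.
move=> rho0 B0 hc hg.
exists (fun m : {ffun 'I_1 -> nat} => c (m ord0)), (rho / 2)%:C, (B * 2)%:C; split.
- by rewrite ltcR divr_gt0.
- move=> N.
  have -> : \sum_(m : {ffun 'I_1 -> 'I_N}) `|c ([ffun i => m i : nat] ord0)| * (rho / 2)%:C ^+ (\sum_i m i)
     = (\sum_(k < N) nm (c k) * (rho / 2) ^+ k)%:C.
    rewrite rmorph_sum -(sum_ffun1 N (fun k => (nm (c k) * (rho / 2) ^+ k)%:C)) /=.
    by apply: eq_bigr => m _; rewrite ffunE big_ord1 normrE [in RHS]rmorphM [in RHS]rmorphXn.
  rewrite lecR; apply: le_trans (_ : \sum_(k < N) B * (2^-1) ^+ k <= _); last first.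
    by rewrite -mulr_sumr ler_wpM2l // geo_half.
  apply: ler_sum => k _; apply: le_trans (ler_wpM2r _ (hc k)) _.
    by rewrite exprn_ge0 // divr_ge0 // ltW.
  rewrite exprMn -mulrA ler_wpM2l // mulrA mulVf ?mul1r //.
  by rewrite expf_neq0 // gt_eqF.
move=> z hz; have := hg (z ord0 - a).
have -> : a + (z ord0 - a) = z ord0 by ring.
have hz0 : nm (z ord0 - a) < rho.
  by have := hz ord0; rewrite normrE ltcR; lra.
move=> /(_ hz0); apply: cvg_trans; apply: near_eq_cvg; near=> N.
rewrite -(sum_ffun1 N (fun k => c k * (z ord0 - a) ^+ k)).
by apply: eq_bigr => m _; rewrite ffunE big_ord1.
Unshelve. all: by end_near. Qed.

Lemma Q_taylor_cvg (f : C -> C) (a : C) (c : nat -> C) (rho B : R) : 0 < rho -> 0 <= B ->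
  (forall m z, nm z < rho ->
     nm (f (a + z) - \sum_(k < m) c k * z ^+ k) <= B * (nm z / rho) ^+ m * (rho / (rho - nm z))) ->
  forall z, nm z < rho -> (fun m => \sum_(k < m) c k * z ^+ k) @ \oo --> f (a + z).
Proof.
move=> rho0 B0 h z hz; apply/cvgCP => e e0.
have q1 : `|nm z / rho| < 1.
  by rewrite ger0_norm ?divr_ge0 ?nm_ge0 ?(ltW rho0) // ltr_pdivrMr // mul1r.
pose D := B * (rho / (rho - nm z)) + 1.
have D0 : 0 < D.
  by rewrite ltr_wpDl // mulr_ge0 // divr_ge0 ?(ltW rho0) // subr_ge0 ltW.
have /cvgrPdist_lt /(_ (e / D)) := cvg_expr q1; rewrite divr_gt0 // => /(_ isT).
apply: filterS => m; rewrite sub0r normrN => hm.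
have p0 : 0 <= (nm z / rho) ^+ m by rewrite exprn_ge0 // divr_ge0 ?nm_ge0 // ltW.
rewrite /= ger0_norm // ltr_pdivlMr // in hm.
rewrite nm_distrC; apply: le_lt_trans (h m z hz) _; apply: le_lt_trans hm.
by rewrite -mulrA mulrCA ler_wpM2l // /D; lra.
Qed.

Lemma residue_double (f h : C -> C) (z0 : C) : Q nmo h z0 ->
  (\forall z \near z0^', f z = h z / (z - z0) ^+ 2) -> is_residue f z0 (derive1 h z0).
Proof.
move=> /Q_taylor [c [rho [B [rho0 B0 c0 c1 [hc hh]]]]] hf.
have hcv := Q_taylor_cvg rho0 B0 hh.
(* The regular part of h / (z - z0)^2; its value at z0 is the second Taylor coefficient of h, which
   fills the removable singularity. The two polar coefficients are h'(z0) and h(z0). *)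
pose g z := if z == z0 then c 2%N else (h z - c 0%N - c 1%N * (z - z0)) / (z - z0) ^+ 2.
exists 1%N, (fun k => if k == 0%N then derive1 h z0 else h z0), g; split=> //.
  refine (@ps_analytic g z0 (fun k => c k.+2) rho (B / rho ^+ 2) rho0 _ _ _).
  - by rewrite divr_ge0 // exprn_ge0 // ltW.
  - by move=> k; apply: le_trans (hc k.+2) _; rewrite -mulrA -invfM -exprD add2n.
  move=> z hz; rewrite /g; have [z00|z00] := eqVneq z 0.
    rewrite z00 addr0 eqxx; apply: cvg_near_cst; exists 1%N => // m /= m0.
    by rewrite (bigD1 (Ordinal m0)) //= expr0 mulr1 big1 ?addr0 // => i; rewrite -val_eqE /= => /negPf i0; rewrite expr0n i0 mulr0.
  have zE : z0 + z - z0 = z by ring.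
  have -> : (z0 + z == z0) = false by apply/eqP => e; case/eqP: z00; rewrite -zE e subrr.
  rewrite zE.
  have : (fun m => (\sum_(k < m.+2) c k * z ^+ k - c 0%N - c 1%N * z) / z ^+ 2) @ \oo -->
     (h (z0 + z) - c 0%N - c 1%N * z) / z ^+ 2.
    apply: cvgM; last exact: cvg_cst.
    apply: cvgB; last exact: cvg_cst.
    apply: cvgB; last exact: cvg_cst.
    have := hcv z hz; rewrite -(cvg_shiftn 2); apply: cvg_trans; apply: near_eq_cvg.
    by near=> m; rewrite /= addn2.
  apply: cvg_trans; apply: near_eq_cvg; near=> m.
  rewrite !big_ord_recl /= expr0 mulr1 expr1.
  have -> : c 0%N + (c (bump 0 0) * z + \sum_(i < m) c (bump 0 (bump 0 i)) * z ^+ bump 0 (bump 0 i)) - c 0%N - c 1%N * z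
    = \sum_(i < m) c i.+2 * z ^+ i.+2 by rewrite /bump /= add1n; ring.
  rewrite mulr_suml; apply: eq_bigr => i _; rewrite -addn2 exprD mulrA mulfK //.
  by rewrite expf_neq0.
apply: filterS2 hf (nbhs_dnbhs_neq z0) => z -> zz0.
rewrite big_ord_recl big_ord1 /= /g (negPf zz0) c0 c1 /bump /=.
by field; rewrite subr_eq0.
Unshelve. all: by end_near. Qed.

(** By induction all Taylor coefficients vanish: if those below k do, then |c k| |z|^k is at most a
    constant times |z|^(k+1) at zeros a + z with z arbitrarily small. Near a, f is then a limit of
    zero partial sums. *)
Lemma isolated_zero (f : C -> C) (a : C) : Q nmo f a ->
  (forall e : R, 0 < e -> exists z, [/\ z != a, nm (z - a) < e & f z = 0]) ->
  near_at nmo a (fun z => f z = 0).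
Proof.
move=> /Q_taylor [c [rho [B [rho0 B0 _ _ [hc hh]]]]] hz.
have far z : nm z < rho / 2 -> rho / (rho - nm z) <= 2.
  by move=> h; rewrite ler_pdivrMr ?subr_gt0; lra.
have hh2 m z : nm z < rho / 2 -> nm (f (a + z) - \sum_(k < m) c k * z ^+ k) <= 2 * B / rho ^+ m * nm z ^+ m.
  move=> h; apply: le_trans (hh m z _) _; first by lra.
  apply: (@le_trans _ _ (B * (nm z / rho) ^+ m * 2)).
    by rewrite ler_wpM2l ?far // mulr_ge0 // exprn_ge0 // divr_ge0 ?nm_ge0 // ltW.
  by rewrite expr_div_n le_eqVlt; apply/orP; left; apply/eqP; ring.
have c0 k : c k = 0.
  elim/ltn_ind: k => k IH; apply/eqP; rewrite -nm_eq0; apply/eqP/le_anti; rewrite nm_ge0 andbT.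
  apply/ler_addgt0Pr => e e0; rewrite add0r.
  pose D := 2 * B / rho ^+ k.+1 + 1.
  have D0 : 0 < D by rewrite ltr_wpDl // divr_ge0 ?mulr_ge0 // exprn_ge0 // ltW.
  have m0 : 0 < Num.min (rho / 2) (e / D) by rewrite lt_min !divr_gt0.
  have [w [wa + fw]] := hz _ m0; rewrite lt_min => /andP[w1 w2].
  pose z := w - a; have az : a + z = w by rewrite addrC subrK.
  have z0 : 0 < nm z by rewrite nm_gt0 subr_eq0.
  have := hh2 k.+1 z w1; rewrite az fw sub0r nmN big_ord_recr /= big1 ?add0r; last first.
    by move=> i _; rewrite IH ?mul0r.
  rewrite normcM nmX (exprS (nm z)) mulrA ler_pM2r ?exprn_gt0 // => h; apply: le_trans h _.
  move: w2; rewrite -/z ltr_pdivlMr // => w2; apply: le_trans (ltW w2).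
  by rewrite mulrC ler_wpM2l ?nm_ge0 // /D lerDl.
exists (rho / 2); first by rewrite divr_gt0.
move=> w hw; pose z := w - a; have az : a + z = w by rewrite addrC subrK.
apply/eqP; rewrite -nm_eq0; apply/eqP/le_anti; rewrite nm_ge0 andbT.
have cv := Q_taylor_cvg rho0 B0 hh (_ : nm z < rho).
have : (fun m => \sum_(k < m) c k * z ^+ k) @ \oo --> f (a + z) by apply: cv; rewrite /z; lra.
rewrite az => /cvgCP h; apply/ler_addgt0Pr => e e0; rewrite add0r.
have [m hm] := filter_ex (h e e0); apply: ltW; move: hm; rewrite big1 ?sub0r ?nmN //.
by move=> i _; rewrite c0 mul0r.
Qed.

(** The points of Omega near which f vanishes form a nonempty set, open and closed in Omega. *)
Lemma identity_connected (Omega : set C) (f : C -> C) (p : C) :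
  open Omega -> connected Omega -> Omega p ->
  (forall z, Omega z -> Q nmo f z) ->
  (forall e : R, 0 < e -> exists z, [/\ z != p, nm (z - p) < e & f z = 0]) ->
  forall z, Omega z -> f z = 0.
Proof.
move=> oO cO Op hQ hp.
pose S : set C := [set z | Omega z /\ near_at nmo z (fun w => f w = 0)].
have Op' z : Omega z -> near_at nmo z Omega.
  by move=> Oz; apply/nbhsCP; apply: open_nbhs_nbhs; split.
suff SE : S = Omega by move=> z; rewrite -SE => -[_ h]; exact: (near_here (@nm_vnorm R) h).
apply: cO.
- by exists p; split=> //; apply: isolated_zero => //; apply: hQ.
- exists S; last by apply/seteqP; split=> z; [case=> ? ?; split|case].
  rewrite openE => z [Oz hz]; apply/nbhsCP.
  have [r r0 h] := nearI (Op' z Oz) (near_near (@nm_vnorm R) hz); by exists r.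
exists (closure S); first exact: closed_closure.
apply/seteqP; split=> z; first by move=> Sz; split; [case: Sz|exact: subset_closure].
move=> [Oz cz]; split=> //; apply: isolated_zero; first exact: hQ.
move=> e e0.
have [w [[_ [r r0 hr]] hwe]] : S `&` [set w | nm (w - z) < e] !=set0.
  by apply: cz; apply/nbhsCP; exists e.
(* The point found in S may be z itself; f then vanishes on a ball around z, and a real translate
   supplies a zero different from z. *)
have [wz|wz] := eqVneq w z; last first.
  by exists w; split=> //; apply: hr; rewrite subrr normc0.
pose s := Num.min (r / 2) (e / 2); have s0 : 0 < s by rewrite lt_min !divr_gt0.
exists (z + s%:C); have d : z + s%:C - z = s%:C by rewrite addrAC subrr add0r.
have sr : s < r by rewrite gt_min; apply/orP; left; lra.
have se : s < e by rewrite gt_min; apply/orP; right; lra.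
split; rewrite ?d ?nm_real ?gtr0_norm //.
  by rewrite -subr_eq0 d -nm_gt0 nm_real gtr0_norm.
by apply: hr; rewrite wz d nm_real gtr0_norm.
Qed.

(** The variables are freed one at a time: with the others fixed, F vanishes at positive reals of
    the moved variable arbitrarily close to 0, hence on all of Omega. Separate differentiability is
    enough for this. [S] marks the variables confined to Omega. *)
Lemma identity_multi (T : finType) (S : pred T) (Omega : set C) (F : (T -> C) -> C) :
  open Omega -> connected Omega -> Omega 0 ->
  (forall z, (forall i, S i -> Omega (z i)) -> forall i, S i ->
     Q nmo (fun t => F [eta z with i |-> t]) (z i)) ->
  (exists2 e : R, 0 < e & forall z, (forall i, S i -> exists2 t : R, 0 < t < e & z i = t%:C) ->
     (forall i, S i -> Omega (z i)) -> F z = 0) ->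
  forall z, (forall i, S i -> Omega (z i)) -> F z = 0.
Proof.
move=> oO cO O0 hQ [e0 e00 h0].
have [r r0 hr] : near_at nmo 0 Omega by apply/nbhsCP; apply: open_nbhs_nbhs.
suff main (s : seq T) : forall z, (forall i, S i -> Omega (z i)) ->
    (forall i, S i -> i \notin s -> exists2 t : R, 0 < t < e0 & z i = t%:C) -> F z = 0.
  by move=> z hz; apply: (main (enum T)) => // i _; rewrite mem_enum.
elim: s => [|i s IH] z hz hs; first by apply: h0 => // i Si; apply: hs.
have [Si|nSi] := boolP (S i); last first.
  by apply: IH => // j Sj js; apply: hs => //; rewrite inE negb_or js andbT; apply: contraNneq nSi => <-.
have upd t u : ([eta [eta z with i |-> t] with i |-> u] : T -> C) = [eta z with i |-> u].
  by apply/funext => j /=; case: eqP.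
have Oupd t : Omega t -> forall j, S j -> Omega ([eta z with i |-> t] j).
  by move=> Ot j Sj /=; case: eqP => // _; apply: hz.
have -> : z = ([eta z with i |-> z i] : T -> C) by apply/funext => j /=; case: eqP => [->|].
apply: (@identity_connected Omega (fun t => F [eta z with i |-> t]) 0) => //; last exact: hz.
  move=> t Ot; have := hQ _ (Oupd t Ot) i Si; rewrite /= eqxx.
  by have -> : (fun t0 => F [eta [eta z with i |-> t] with i |-> t0]) = (fun t => F [eta z with i |-> t])
    by apply/funext => u; rewrite upd.
move=> e e0'; pose t := Num.min (Num.min (r / 2) (e0 / 2)) (e / 2).
have t0 : 0 < t by rewrite !lt_min !divr_gt0.
have tr : t < r by rewrite !gt_min; apply/orP; left; apply/orP; left; lra.
have te0 : t < e0 by rewrite !gt_min; apply/orP; left; apply/orP; right; lra.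
have te : t < e by rewrite !gt_min; apply/orP; right; lra.
exists t%:C; split; rewrite ?subr0 ?nm_real ?gtr0_norm //.
  by rewrite -nm_gt0 nm_real gtr0_norm.
have Ot : Omega t%:C by apply: hr; rewrite subr0 nm_real gtr0_norm.
apply: IH; first exact: Oupd.
move=> j Sj js /=; case: eqP => [_|/eqP ji]; first by exists t; rewrite ?t0.
by apply: hs => //; rewrite inE negb_or ji.
Qed.

End Bridge.

(** * Complex powers, zeta and Gamma *)

Section SpecialFunctions.
Variable R : realType.
Local Notation C := R[i].
Local Notation nm := (@normc R).
Local Notation nmo := (nm : R[i]^o -> R).
Let nmV := @nm_vnorm R.

Lemma sqrn (y : R) : `|y| ^+ 2 = y ^+ 2.
Proof. exact: real_normK (num_real y). Qed.

Lemma mvt_bound (f df : R -> R) (c x : R) : (forall t : R, is_derive t 1 f (df t)) ->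
  (forall t, `|t| <= `|x| -> `|df t| <= c) -> `|f x - f 0| <= c * `|x|.
Proof.
move=> hd hb; have cf : continuous f.
  by move=> t; apply: differentiable_continuous; apply/derivable1_diffP; have [] := hd t.
have [x0|x0] := leP 0 x.
  have [z zx ->] := MVT_segment x0 (fun t _ => hd t) (continuous_subspaceT cf).
  rewrite normrM subr0 ler_wpM2r // hb //; move: zx; rewrite in_itv /= => /andP[z0 zx].
  by rewrite !ger0_norm.
have [z zx e] := MVT_segment (ltW x0) (fun t _ => hd t) (continuous_subspaceT cf).
rewrite distrC e normrM sub0r normrN ler_wpM2r // hb //; move: zx; rewrite in_itv /= => /andP[zx z0].
by rewrite !ler0_norm ?lerN2 // ltW.
Qed.

Lemma abs_sin (x : R) : `|sin x| <= `|x|.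
Proof.
have := @mvt_bound sin cos 1 x (@is_derive_sin R) (fun t _ => cos_max t).
by rewrite sin0 subr0 mul1r.
Qed.

Lemma abs_cos1 (x : R) : `|cos x - 1| <= x ^+ 2.
Proof.
have := @mvt_bound cos (fun t => - sin t) `|x| x (@is_derive_cos R).
rewrite cos0 -expr2 sqrn; apply=> t ht; rewrite normrN; exact: le_trans (abs_sin t) ht.
Qed.

Lemma abs_sin2 (x : R) : `|x| <= 1 -> `|sin x - x| <= x ^+ 2.
Proof.
move=> x1; have hd (t : R) : is_derive t 1 (fun t => sin t - t) (cos t - 1).
  by apply: is_deriveB.
have := @mvt_bound (fun t => sin t - t) (fun t => cos t - 1) `|x| x hd.
rewrite sin0 !subr0 -expr2 sqrn; apply=> t ht; apply: le_trans (abs_cos1 t) _.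
by rewrite -sqrn expr2 -[leRHS]mulr1 ler_pM // (le_trans ht).
Qed.

Lemma abs_exp2 (a : R) : `|a| <= 2^-1 -> `|expR a - 1 - a| <= 2 * a ^+ 2.
Proof.
move=> ha; have h1 := expR_ge1Dx a; have h2 := expR_ge1Dx (- a).
(* The upper bound for exp a comes from exp a (1 - a) <= exp a exp(-a) = 1. *)
have e : expR a * expR (- a) = 1 by rewrite -expRD subrr expR0.
have p := expR_gt0 a.
move: ha; rewrite ler_norml => /andP[a1 a2].
rewrite ger0_norm; last by lra.
nra.
Qed.

Lemma cexpD (x y : C) : cexp (x + y) = cexp x * cexp y.
Proof.
case: x => a b; case: y => c d; rewrite /cexp /= expRD cosD sinD.
by apply/eqP; rewrite eq_complex /=; apply/andP; split; apply/eqP; ring.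
Qed.

Lemma cexp0 : cexp (0 : C) = 1.
Proof. by rewrite /cexp /= expR0 cos0 sin0 mulr1 mulr0. Qed.

Lemma nm_cexp (z : C) : nm (cexp z) = expR (complex.Re z).
Proof.
case: z => a b; by rewrite /= !exprMn -mulrDr cos2Dsin2 mulr1 sqrtr_sqr ger0_norm // expR_ge0.
Qed.

Lemma cexp_neq0 (z : C) : cexp z != 0.
Proof. by rewrite -nm_gt0 nm_cexp expR_gt0. Qed.

Lemma cexp_real (a : R) : cexp a%:C = (expR a)%:C.
Proof. by rewrite /cexp /= cos0 sin0 mulr1 mulr0. Qed.

Lemma cexp_quad_small (h : C) : nm h <= 2^-1 -> nm (cexp h - 1 - h) <= 8 * nm h ^+ 2.
Proof.
case: h => a b hh; have ha := le_trans (nm_Re (a +i* b)) hh; have hb := le_trans (nm_Im (a +i* b)) hh.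
have nE : nm (a +i* b) ^+ 2 = a ^+ 2 + b ^+ 2 by rewrite /= sqr_sqrtr // addr_ge0 ?sqr_ge0.
rewrite nE; apply: le_trans (nm_ReIm _) _; rewrite /= in ha hb *.
have b1 : `|b| <= 1 by lra.
have h1 := abs_exp2 ha; have h2 := abs_cos1 b; have h3 := abs_sin2 b1; have h4 := abs_sin b.
have ea2 : expR a <= 2.
  by move: ha h1; rewrite !ler_norml => /andP[? ?] /andP[? ?]; nra.
have -> : expR a * cos b - 1 - a = (expR a - 1 - a) + expR a * (cos b - 1) by ring.
have -> : expR a * sin b - 0 - b = (expR a - 1 - a) * sin b + a * sin b + (sin b - b) by ring.
have t1 : `|expR a - 1 - a + expR a * (cos b - 1)| <= 2 * a ^+ 2 + 2 * b ^+ 2.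
  apply: le_trans (ler_normD _ _) _; apply: lerD => //; rewrite normrM ger0_norm ?expR_ge0 //.
  by apply: ler_pM => //; exact: expR_ge0.
have t2 : `|(expR a - 1 - a) * sin b| <= 2 * a ^+ 2 * 1.
  by rewrite normrM ler_pM // sin_max.
have t3 : `|a * sin b| <= `|a| * `|b| by rewrite normrM ler_wpM2l.
have t4 : `|a| * `|b| <= a ^+ 2 + b ^+ 2.
  by rewrite -(sqrn a) -(sqrn b); have := sqr_ge0 (`|a| - `|b|); nra.
have t5 := ler_normD ((expR a - 1 - a) * sin b + a * sin b) (sin b - b).
have t6 := ler_normD ((expR a - 1 - a) * sin b) (a * sin b).
have := sqr_ge0 a; have := sqr_ge0 b; lra.
Qed.

(** The summand 4 (exp rho + 1 + rho) covers |h| > 1/2, where 4 |h|^2 >= 1 and each term is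
    estimated by its size. *)
Lemma cexp_quad (h : C) (rho : R) : nm h <= rho ->
  nm (cexp h - 1 - h) <= (8 + 4 * (expR rho + 1 + rho)) * nm h ^+ 2.
Proof.
move=> hr; have n0 := nm_ge0 h; have e0 := expR_ge0 rho; have s0 := sqr_ge0 (nm h).
have [h2|h2] := leP (nm h) 2^-1.
  by apply: le_trans (cexp_quad_small h2) _; nra.
have : nm (cexp h - 1 - h) <= expR rho + 1 + rho.
  apply: le_trans (nmB _ _) _; apply: lerD => //; apply: le_trans (nmB _ _) _.
  rewrite normc1 lerD2r nm_cexp ler_expR; apply: le_trans hr.
  exact: le_trans (ler_norm _) (nm_Re h).
move=> /le_trans; apply; have p : 0 <= expR rho + 1 + rho by lra.
have q : 2^-1 ^+ 2 <= nm h ^+ 2 by rewrite ler_pXn2r ?nnegrE // ltW.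
have -> : (8 + 4 * (expR rho + 1 + rho)) * nm h ^+ 2 = 8 * nm h ^+ 2 + (expR rho + 1 + rho) * (4 * nm h ^+ 2) by ring.
apply: (@le_trans _ _ ((expR rho + 1 + rho) * (4 * nm h ^+ 2))); last by nra.
by rewrite -[leLHS]mulr1 ler_wpM2l //; lra.
Qed.

Lemma cexp_qd (a : C) (r : R) : 0 < r -> exists2 K, 0 <= K &
  (forall x, nm (x - a) < r -> nm (cexp x) <= K) /\
  (forall x y, nm (x - a) < r -> nm (y - a) < r ->
    nm (cexp y - cexp x - cexp x * (y - x)) <= K * nm (y - x) ^+ 2).
Proof.
move=> r0; pose B := expR (complex.Re a + r).
have B0 : 0 <= B by exact: expR_ge0.
have hB x : nm (x - a) < r -> nm (cexp x) <= B.
  move=> hx; rewrite nm_cexp ler_expR; have := le_trans (ler_norm _) (nm_Re (x - a)).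
  by rewrite raddfB /=; lra.
pose D := 8 + 4 * (expR (2 * r) + 1 + 2 * r).
have D0 : 0 <= D by rewrite /D; have := expR_ge0 (2 * r); lra.
exists (B * (D + 1)); first by rewrite mulr_ge0 // addr_ge0.
split=> [x hx|x y hx hy].
  by apply: le_trans (hB x hx) _; rewrite -[leLHS]mulr1 ler_wpM2l //; lra.
have -> : cexp y - cexp x - cexp x * (y - x) = cexp x * (cexp (y - x) - 1 - (y - x)).
  by rewrite -{1}(subrK x y) addrC cexpD; ring.
rewrite normcM -mulrA ler_pM ?nm_ge0 ?hB //.
have hyx : nm (y - x) <= 2 * r.
  by apply: le_trans (nm_tri _ a _) _; rewrite (nm_distrC a); lra.
apply: le_trans (cexp_quad hyx) _; rewrite -/D ler_wpM2r ?sqr_ge0 //; lra.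
Qed.

Lemma Q_cexp (a : C) : Q nmo (@cexp R) a.
Proof.
have [K K0 [h1 h2]] := @cexp_qd a 1 ltr01.
by exists (fun x v => cexp x * v), 1, K; split=> //; exact: Q1I.
Qed.

Lemma derive1_cexp (a : C) : derive1 (@cexp R) a = cexp a.
Proof.
have [K K0 [h1 h2]] := @cexp_qd a 1 ltr01.
rewrite -(@dd1E _ (@cexp R)) (qd_dd nmV _ (Q1I ltr01 K0 h1 h2)) ?mulr1 //.
by rewrite subrr normc0.
Qed.

Lemma cpowD (a : R) x y : cpow a (x + y) = cpow a x * cpow a y.
Proof. by rewrite /cpow mulrDr cexpD. Qed.

Lemma cpow_neq0 (a : R) x : cpow a x != 0.
Proof. exact: cexp_neq0. Qed.

Lemma cpow0 (a : R) : cpow a 0 = 1.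
Proof. by rewrite /cpow mulr0 cexp0. Qed.

Lemma cpow_real (a x : R) : cpow a x%:C = (expR (ln a * x))%:C.
Proof. by rewrite /cpow -rmorphM cexp_real. Qed.

Section PowComp.
Variables (V : lmodType C) (N : V -> R) (NN : vnorm N).

Lemma Q_cpow (a : R) (F : V -> C) x : Q N F x -> Q N (fun x => cpow a (F x)) x.
Proof.
move=> h; apply: (Q_comp NN _ (Q_cexp _)); apply: (Q_mul NN) => //; exact: Q_cst.
Qed.

Lemma dd_cpow (a : R) (F : V -> C) x v : Q N F x ->
  dd (fun x => cpow a (F x)) x v = (ln a)%:C * cpow a (F x) * dd F x v.
Proof.
move=> h; have hc : Q N (fun=> (ln a)%:C) x by exact: Q_cst.
have hm : Q N (fun x => (ln a)%:C * F x) x by exact: Q_mul.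
rewrite (dd_comp NN v hm (Q_cexp _)) derive1_cexp (dd_mul NN) // dd_cst mul0r addr0.
by rewrite /cpow; ring.
Qed.

Lemma Qon_cpow (b : R) (F : V -> C) a (r : R) : 0 < r -> Qon N F a r ->
  Qon N (fun x => cpow b (F x)) a r.
Proof.
move=> r0 [G [K h]].
have [B B0 hB] := qd_bound NN r0 h.
have [K' K0' [h1 h2]] := @cexp_qd 0 (`|ln b| * B + 1) (ltr_wpDl (mulr_ge0 (normr_ge0 _) B0) ltr01).
have [G' [K2 h']] := Qon_mul NN r0 (Qon_cst N (ln b)%:C a r) (ex_intro _ G (ex_intro _ K h)).
have hF x : N (x - a) < r -> nm ((ln b)%:C * F x - 0) < `|ln b| * B + 1.
  by move=> hx; rewrite subr0 normcM nm_real ltr_pwDr // ler_wpM2l // hB.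
have [K3 h3] := qd_comp1 NN r0 h' K0' h1 h2 hF.
by eexists; eexists; exact: h3.
Qed.

End PowComp.
End SpecialFunctions.

(** * The pole of zeta at 1 *)

Section Zeta.
Variable R : realType.
Local Notation C := R[i].
Local Notation nm := (@normc R).
Local Notation nmo := (nm : R[i]^o -> R).
Let nmV := @nm_vnorm R.

Lemma analytic1_Q (f : C -> C) (a : C) : analytic1_at f a -> Q nmo f a.
Proof.
move=> /analytic_at_Q h.
apply: (@Q_aff _ _ _ nmo (@pnorm R 'I_1) nmV (pnorm_vnorm R 'I_1) (fun t _ => t) (fun t _ => t) 1 _ _ _
  (fun z : 'I_1 -> C => f (z ord0)) a) => //.
by move=> u; rewrite /pnorm big_ord1 mul1r.
Qed.

Lemma Q_id (a : C) : Q nmo (fun t : R[i]^o => t : C) a.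
Proof.
exists (fun _ v => v), 1, 1; split=> //; split=> // [x v _|x y _ _]; first by rewrite mul1r.
by rewrite subrr normc0 mul1r sqr_ge0.
Qed.

Section ZetaPole.
Variable s : R.
Hypothesis s0 : 0 < s.
Let u n : R := expR (- (1 + s) * ln n%:R).
Let v n : R := expR (- s * ln n%:R).

Let vu n : (0 < n)%N -> v n = u n * n%:R.
Proof.
move=> n0; have e : ln n%:R = ln n%:R :> R by [].
rewrite /u /v -{3}(@lnK _ n%:R) ?posrE ?ltr0n // -expRD; congr expR; ring.
Qed.

(** With u n = n^-(1+s) and v n = n^-s, this and [step2] are the integral test: s u is squeezed
    between successive differences of v, from 1 + x <= exp x and 1/(n+1) <= log(1 + 1/n) <= 1/n. *)
Let step1 n : (0 < n)%N -> v n - v n.+1 <= s * u n.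
Proof.
move=> n0; have n0r : 0 < n%:R :> R by rewrite ltr0n.
have -> : v n.+1 = v n * expR (- s * (ln n.+1%:R - ln n%:R)).
  by rewrite /v -expRD; congr expR; ring.
have h1 := expR_ge1Dx (- s * (ln n.+1%:R - ln n%:R)).
have h2 : ln n.+1%:R - ln n%:R <= n%:R^-1 :> R.
  rewrite -ln_div ?posrE ?ltr0n //.
  have -> : n.+1%:R / n%:R = 1 + n%:R^-1 :> R by rewrite -natr1 mulrDl mul1r divff // gt_eqF.
  by apply: le_ln1Dx; apply: lt_trans (_ : 0 < _); rewrite ?ltrN10 // invr_gt0.
have p := expR_gt0 (- s * ln n%:R); rewrite -/(v n) in p.
have -> : s * u n = v n * (s * n%:R^-1) by rewrite vu // mulrCA mulfK // gt_eqF.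
have h3 : s * (ln n.+1%:R - ln n%:R) <= s * n%:R^-1 by rewrite ler_wpM2l // ltW.
rewrite -[X in X - _]mulr1 -mulrBr ler_wpM2l //; first exact: ltW.
by move: h1 h3; rewrite mulNr; lra.
Qed.

Let step2 n : (0 < n)%N -> s * u n.+1 <= v n - v n.+1.
Proof.
move=> n0; have n0r : 0 < n%:R :> R by rewrite ltr0n.
have n1r : 0 < n.+1%:R :> R by rewrite ltr0n.
have -> : v n = v n.+1 * expR (s * (ln n.+1%:R - ln n%:R)).
  by rewrite /v -expRD; congr expR; ring.
have h1 := expR_ge1Dx (s * (ln n.+1%:R - ln n%:R)).
have h2 : n.+1%:R^-1 <= ln n.+1%:R - ln n%:R :> R.
  rewrite -lerN2 opprB -ln_div ?posrE ?ltr0n //.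
  have -> : n%:R / n.+1%:R = 1 + - n.+1%:R^-1 :> R.
    by rewrite -[n.+1%:R]natr1; field; rewrite natr1 gt_eqF.
  apply: le_ln1Dx; rewrite ltrN2 invf_lt1 // ltr1n //.
have p := expR_gt0 (- s * ln n.+1%:R); rewrite -/(v n.+1) in p.
have -> : s * u n.+1 = v n.+1 * (s * n.+1%:R^-1) by rewrite vu // mulrCA mulfK // gt_eqF.
have h3 : s * n.+1%:R^-1 <= s * (ln n.+1%:R - ln n%:R) by rewrite ler_wpM2l // ltW.
rewrite -[X in _ - X]mulr1 -mulrBr ler_wpM2l //; first exact: ltW.
by apply: (le_trans h3); rewrite lerBrDl.
Qed.

Let S N : R := \sum_(1 <= n < N.+1) u n.

(** Telescoped; as N grows it reads 1 <= s zeta(1 + s) <= 1 + s. *)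
Lemma zeta_sum_bounds N : 1 - v N.+1 <= s * S N.+1 - s * u N.+1 /\ s * S N.+1 <= s + 1 - v N.+1.
Proof.
have v1 : v 1%N = 1 by rewrite /v ln1 mulr0 expR0.
have u1 : u 1%N = 1 by rewrite /u ln1 mulr0 expR0.
elim: N => [|N [IH1 IH2]]; first by rewrite /S big_nat1 v1 u1; split; lra.
have e : S N.+2 = S N.+1 + u N.+2 by rewrite /S big_nat_recr.
have h1 := @step1 N.+1 isT; have h2 := @step2 N.+1 isT.
by rewrite e; split; lra.
Qed.

Lemma v_small (e : R) : 0 < e -> exists N0, forall N, (N0 <= N)%N -> v N.+1 <= e.
Proof.
move=> e0; pose x := expR (- (ln e) / s); exists (Num.trunc x).+1 => N hN.
have hx : x < N.+1%:R.
  apply: lt_le_trans (truncnS_gt x) _; rewrite ler_nat; exact: leq_trans hN _.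
have N0 : 0 < N.+1%:R :> R by rewrite ltr0n.
have : - ln e / s < ln N.+1%:R by rewrite -ltr_expR lnK.
rewrite ltr_pdivrMr // => h; rewrite /v -[leRHS]lnK // ler_expR; lra.
Qed.

Lemma zeta_near_pole (z : C) :
  (fun N : nat => \sum_(1 <= n < N) cpow n%:R (- (1 + s)%:C)) @ \oo --> z ->
  nm (s%:C * z - 1) <= s.
Proof.
move=> /cvgCP hz; apply/ler_addgt0Pr => e e0.
have e3 : 0 < e / (2 * s) by rewrite divr_gt0 // mulr_gt0.
have [N0 hv] := @v_small (e / 2) (divr_gt0 e0 (ltr0n _ 2)).
have hn : \forall N \near \oo, (N0.+2 <= N)%N by exists N0.+2.
have [N [hN n0N]] := filter_ex (filterI (hz _ e3) hn).
have [M NM] : exists M, N = M.+2 by exists N.-2; case: (N) n0N => [|[|?]].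
have N0M : (N0 <= M)%N by move: n0N; rewrite NM /= !ltnS.
have sumE : \sum_(1 <= n < N) cpow n%:R (- (1 + s)%:C) = (S M.+1)%:C.
  rewrite NM /S rmorph_sum; apply: eq_big_nat => n _.
  by rewrite -rmorphN cpow_real /u mulrC.
rewrite sumE in hN.
have [b1 b2] := zeta_sum_bounds M; have v0 := hv M N0M.
have u0 : 0 <= s * u M.+1 by rewrite mulr_ge0 ?(ltW s0) // expR_ge0.
have vp : 0 <= v M.+1 by exact: expR_ge0.
have -> : s%:C * z - 1 = (s * S M.+1 - 1)%:C - s%:C * ((S M.+1)%:C - z).
  by rewrite rmorphB rmorphM rmorph1; ring.
apply: le_trans (nmB _ _) _; rewrite normcM !nm_real (gtr0_norm s0).
have h1 : s * nm ((S M.+1)%:C - z) <= e / 2.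
  have -> : e / 2 = s * (e / (2 * s)) by field; rewrite gt_eqF.
  by rewrite ler_wpM2l ?(ltW s0) // ltW.
have h2 : `|s * S M.+1 - 1| <= s + e / 2.
  by rewrite ler_norml; apply/andP; split; lra.
lra.
Qed.

End ZetaPole.

(** The definition of zeta posits an entire numerator f without its value at 1. That f(1) = 1
    follows from |s zeta(1 + s) - 1| <= s as the real number s decreases to 0. *)
Lemma zeta_laurent (zeta : C -> C) : is_riemann_zeta zeta ->
  exists Zr : C -> C, [/\ forall t, Q nmo Zr t, Zr 0 = 1 &
    forall t, t != 0 -> zeta (1 + t) = Zr t / t].
Proof.
move=> [h1 [f hf hz]].
have aff a : Q nmo (fun t : R[i]^o => f (1 + t)) a.
  apply: (Q_comp nmV (F := fun t : R[i]^o => 1 + t) (g := f)); last exact: analytic1_Q.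
  apply: (Q_add nmV); first exact: Q_cst.
  exact: Q_id.
exists (fun t => f (1 + t)); split=> //; last first.
  move=> t t0; have t1 : 1 + t != 1 by rewrite -subr_eq0 addrAC subrr add0r.
  by rewrite hz // addrAC subrr add0r.
apply/eqP; rewrite -subr_eq0 -nm_eq0; apply/eqP/le_anti; rewrite nm_ge0 andbT.
apply/ler_addgt0Pr => e e0; rewrite add0r.
have e2 : 0 < e / 2 by rewrite divr_gt0.
have [r r0 hr] := Q_cont nmV e2 (aff 0).
pose s := Num.min (r / 2) (e / 2); have s0 : 0 < s by rewrite lt_min !divr_gt0.
have sC : s%:C != 0 by rewrite -nm_gt0 nm_real gtr0_norm.
have s1 : nm (s%:C - 0) < r by rewrite subr0 nm_real gtr0_norm // gt_min; apply/orP; left; lra.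
have se : s <= e / 2 by rewrite ge_min lexx orbT.
have h3 := hr _ s1; rewrite addr0 in h3 *.
have h4 : nm (f (1 + s%:C) - 1) <= s.
  have t1 : 1 + s%:C != 1 by rewrite -subr_eq0 addrAC subrr add0r.
  have -> : f (1 + s%:C) = s%:C * zeta (1 + s%:C) by rewrite hz // addrAC subrr add0r mulrCA divff ?mulr1.
  apply: (zeta_near_pole s0); rewrite rmorphD rmorph1; apply: h1 => /=.
  by rewrite ltrDl.
have -> : f 1 - 1 = (f (1 + s%:C) - 1) - (f (1 + s%:C) - f 1) by ring.
apply: le_trans (nmB _ _) _; lra.
Qed.

End Zeta.

(** * Gauss's product for Gamma *)

Section Products.
Variable R : realType.
Local Notation C := R[i].
Local Notation nm := (@normc R).
Local Notation nmo := (nm : R[i]^o -> R).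
Let nmV := @nm_vnorm R.

Section InfiniteProduct.
Variables (P q : nat -> C) (c : R) (n0 : nat).
Hypothesis c0 : 0 <= c.
Hypothesis n00 : (0 < n0)%N.
Hypothesis hP : forall n, (n0 <= n)%N -> P n.+1 = P n * q n.
Hypothesis hq : forall n, (n0 <= n)%N -> nm (q n - 1) <= c / n%:R ^+ 2.

(** Majorises 1 / n^2 by a telescoping difference, which keeps all constants of the product
    estimates explicit. *)
Let inv2 n : (0 < n)%N -> (n%:R ^+ 2)^-1 <= 2 * (n%:R^-1 - n.+1%:R^-1) :> R.
Proof.
move=> n1; have n0r : 0 < n%:R :> R by rewrite ltr0n.
have n1r : 1 <= n%:R :> R by rewrite ler1n.
have -> : 2 * (n%:R^-1 - n.+1%:R^-1) = (n%:R ^+ 2)^-1 * (2 * n%:R / n.+1%:R) :> R.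
  by rewrite -[n.+1%:R]natr1; field; rewrite natr1 !gt_eqF // ltr0n.
rewrite -[leLHS]mulr1 ler_wpM2l ?invr_ge0 ?exprn_ge0 ?(ltW n0r) //.
by rewrite ler_pdivlMr ?ltr0n // mul1r -natr1; lra.
Qed.

Lemma prod_bound n : (n0 <= n)%N ->
  nm (P n) <= nm (P n0) * expR (2 * c * (n0%:R^-1 - n%:R^-1)).
Proof.
elim: n => [|n IH]; first by rewrite leqn0 => /eqP e; move: n00; rewrite e.
rewrite leq_eqVlt => /orP[/eqP <-|]; first by rewrite subrr mulr0 expR0 mulr1.
rewrite ltnS => h; rewrite hP // normcM.
have n1 : (0 < n)%N by apply: leq_trans h.
have q1 : nm (q n) <= expR (2 * c * (n%:R^-1 - n.+1%:R^-1)).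
  apply: le_trans (expR_ge1Dx _); rewrite -[q n](subrK 1) addrC.
  apply: le_trans (nmD _ _) _; rewrite normc1 lerD2l; apply: le_trans (hq h) _.
  by rewrite -mulrA mulrCA ler_wpM2l // inv2.
have -> : 2 * c * (n0%:R^-1 - n.+1%:R^-1) = 2 * c * (n0%:R^-1 - n%:R^-1) + 2 * c * (n%:R^-1 - n.+1%:R^-1) by ring.
by rewrite expRD mulrA ler_pM ?nm_ge0 ?IH.
Qed.

Let B := nm (P n0) * expR (2 * c).

Lemma prod_bound2 n : (n0 <= n)%N -> nm (P n) <= B.
Proof.
move=> h; apply: le_trans (prod_bound h) _; rewrite ler_wpM2l ?nm_ge0 // ler_expR.
rewrite -[leRHS]mulr1 ler_wpM2l ?mulr_ge0 //.
have n1 : n0%:R^-1 <= 1 :> R by rewrite invf_le1 ?ltr0n // ler1n.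
have : 0 <= n%:R^-1 :> R by rewrite invr_ge0.
lra.
Qed.

Let B0 : 0 <= B. Proof. by rewrite mulr_ge0 ?nm_ge0 ?expR_ge0. Qed.

Lemma prod_cauchy n m : (n0 <= n)%N -> (n <= m)%N ->
  nm (P m - P n) <= 2 * B * c * (n%:R^-1 - m%:R^-1).
Proof.
move=> h; elim: m => [|m IH].
  by rewrite leqn0 => /eqP e; move: h n00; rewrite e leqn0 => /eqP ->.
rewrite leq_eqVlt => /orP[/eqP <-|]; first by rewrite !subrr normc0 mulr0.
rewrite ltnS => nm'; have n0m := leq_trans h nm'.
have m1 : (0 < m)%N by apply: leq_trans n0m.
have -> : P m.+1 - P n = P m * (q m - 1) + (P m - P n) by rewrite hP //; ring.
apply: le_trans (nmD _ _) _.
have -> : 2 * B * c * (n%:R^-1 - m.+1%:R^-1) = 2 * B * c * (m%:R^-1 - m.+1%:R^-1) + 2 * B * c * (n%:R^-1 - m%:R^-1) by ring.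
rewrite lerD ?IH // normcM; apply: (@le_trans _ _ (B * (c / m%:R ^+ 2))).
  by rewrite ler_pM ?nm_ge0 ?prod_bound2 ?hq.
have -> : 2 * B * c * (m%:R^-1 - m.+1%:R^-1) = B * (c * (2 * (m%:R^-1 - m.+1%:R^-1))) by ring.
by rewrite !ler_wpM2l // inv2.
Qed.

(** The ultralimit is the candidate; the Cauchy estimate with its far index sent along the
    ultrafilter turns it into an ordinary limit. *)
Lemma prod_cvg : exists L : C, P @ \oo --> L.
Proof.
pose P' n := P (n + n0)%N; exists (ulim P').
have bP : bdd P' by exists B => n; apply: prod_bound2; exact: leq_addl.
have D0 : 0 <= 2 * B * c by apply: mulr_ge0 => //; apply: mulr_ge0.
have est n : nm (P' n - ulim P') <= (2 * B * c + 1) / (n + n0)%:R.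
  rewrite -[P' n](ulim_cst (P' n)) -ulimB //; last exact: bdd_cst.
  apply: (@ulim_le_near _ _ _ n); first by apply: bddB => //; exact: bdd_cst.
  move=> m hm; rewrite nm_distrC; apply: le_trans (prod_cauchy _ _) _; rewrite ?leq_addl ?leq_add2r //.
  have : 0 <= (m + n0)%:R^-1 :> R by rewrite invr_ge0.
  have : 0 <= (n + n0)%:R^-1 :> R by rewrite invr_ge0.
  nra.
apply/cvgCP => e e0; pose K := (2 * B * c + 1) / e.
exists (maxn (Num.trunc K).+1 n0) => // n; rewrite /= geq_max => /andP[n1 n2].
have -> : P n = P' (n - n0)%N by rewrite /P' subnK.
apply: le_lt_trans (est _) _; rewrite subnK // ltr_pdivrMr ?ltr0n; last exact: leq_trans n2.
have -> : 2 * B * c + 1 = K * e by rewrite /K divfK // gt_eqF.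
rewrite [e * _]mulrC ltr_pM2r //; apply: lt_le_trans (truncnS_gt _) _.
by rewrite ler_nat.
Qed.

End InfiniteProduct.

Definition gauss (n : nat) (z : C) : C := n`!%:R * cpow n%:R z / \prod_(k < n.+1) (z + k%:R).
Definition gratio (n : nat) (z : C) : C :=
  cexp ((ln n.+1%:R - ln n%:R)%:C * z) / (1 + z / n.+1%:R).

Lemma GammaE z : Gamma z = lim ((fun n => gauss n z) @ \oo).
Proof. by []. Qed.

Lemma gaussS n z : (0 < n)%N -> z + n.+1%:R != 0 -> gauss n.+1 z = gauss n z * gratio n z.
Proof.
move=> n0 hz; have n1 : n.+1%:R != 0 :> C by rewrite pnatr_eq0.
rewrite /gauss /gratio big_ord_recr /= factS natrM.
have -> : cpow n.+1%:R z = cpow n%:R z * cexp ((ln n.+1%:R - ln n%:R)%:C * z) :> C.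
  by rewrite /cpow -cexpD; congr cexp; rewrite rmorphB; ring.
have -> : 1 + z / n.+1%:R = (z + n.+1%:R) / n.+1%:R by field.
rewrite invf_div invfM.
set p := (\prod_(_ < _) _)^-1; set a := cexp _; set b := cpow _ _.
by ring.
Qed.

(** With w = z log(1 + 1/n), the numerator exp w - (1 + z/(n+1)) is at most 8 |w|^2 plus |z| times
    log(1 + 1/n) - 1/(n+1), both O(1/n^2). The condition 4 M <= n keeps exp w and 1 + z/(n+1) away
    from 0. The inverse ratio is estimated as well, for the non-vanishing of Gamma. *)
Lemma gratio_bound (M : R) (n : nat) (z : C) : 1 <= M -> nm z <= M -> 4 * M <= n%:R ->
  nm (gratio n z - 1) <= 64 * M ^+ 2 / n%:R ^+ 2 /\ nm ((gratio n z)^-1 - 1) <= 512 * M ^+ 2 / n%:R ^+ 2.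
Proof.
move=> M1 zM nM; have n0r : 0 < n%:R :> R by lra.
have n0 : (0 < n)%N by rewrite -(ltr0n R).
have n1r : 0 < n.+1%:R :> R by rewrite ltr0n.
pose iN := n%:R^-1 : R; have i0 : 0 < iN by rewrite invr_gt0.
have iM : M * iN <= 4^-1 by rewrite ler_pdivrMr //; lra.
pose d := ln n.+1%:R - ln n%:R : R.
have d1 : d <= iN.
  rewrite /d -ln_div ?posrE //.
  have -> : n.+1%:R / n%:R = 1 + n%:R^-1 :> R by rewrite -natr1 mulrDl mul1r divff // gt_eqF.
  by apply: le_ln1Dx; apply: lt_trans (_ : 0 < _); rewrite ?ltrN10 // invr_gt0.
have d2 : n.+1%:R^-1 <= d.
  rewrite -lerN2 opprB -ln_div ?posrE //.
  have -> : n%:R / n.+1%:R = 1 + - n.+1%:R^-1 :> R.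
    by rewrite -[n.+1%:R]natr1; field; rewrite natr1 gt_eqF.
  by apply: le_ln1Dx; rewrite ltrN2 invf_lt1 // ltr1n.
pose j := n.+1%:R^-1 : R; have j0 : 0 < j by rewrite invr_gt0.
have ij : iN - j <= iN ^+ 2.
  have -> : iN - j = iN * j by rewrite /iN /j -[n.+1%:R]natr1; field; rewrite natr1 !gt_eqF.
  by rewrite expr2 ler_wpM2l ?(ltW i0) // lef_pV2 ?posrE // ler_nat.
have ji : j <= iN by rewrite lef_pV2 ?posrE // ler_nat.
pose w := d%:C * z; have wM : nm w <= M * iN.
  rewrite normcM nm_real ger0_norm; last by apply: le_trans d2; exact: ltW.
  by rewrite mulrC ler_pM ?nm_ge0 //; apply: le_trans d2; exact: ltW.
have jC : z / n.+1%:R = j%:C * z by rewrite /j fmorphV rmorph_nat mulrC.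
pose D := 1 + z / n.+1%:R.
have D1 : nm (D - 1) <= M * iN.
  by rewrite /D addrAC subrr add0r jC normcM nm_real gtr0_norm // mulrC ler_pM ?nm_ge0 // ltW.
have Dl : 2^-1 <= nm D.
  have := nmB D (D - 1); rewrite opprB addrC subrK normc1; lra.
have D0 : D != 0 by rewrite -nm_gt0; lra.
have Dinv : (nm D)^-1 <= 2 by rewrite invf_ple ?posrE ?nm_gt0.
have num : nm (cexp w - D) <= 9 * M ^+ 2 * iN ^+ 2.
  have -> : cexp w - D = (cexp w - 1 - w) + (d - j)%:C * z by rewrite /D jC rmorphB /w; ring.
  apply: le_trans (nmD _ _) _.
  have h1 : nm w <= 2^-1 by lra.
  have h2 := cexp_quad_small h1.
  have h3 : nm w ^+ 2 <= (M * iN) ^+ 2 by rewrite ler_pXn2r ?nnegrE ?nm_ge0 ?mulr_ge0 //; lra.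
  have h4 : nm ((d - j)%:C * z) <= iN ^+ 2 * M.
    rewrite normcM nm_real ger0_norm ?subr_ge0 // ler_pM ?nm_ge0 ?subr_ge0 //.
    by apply: le_trans ij; rewrite lerD2r.
  have h5 : iN ^+ 2 * M <= iN ^+ 2 * M ^+ 2.
    by rewrite ler_wpM2l ?sqr_ge0 // expr2 -{1}[M]mulr1 ler_wpM2l //; lra.
  move: h2 h3 h4 h5; rewrite exprMn; lra.
have iE : n%:R ^- 2 = iN ^+ 2 by rewrite exprVn.
have s0 : 0 <= M ^+ 2 * iN ^+ 2 by rewrite mulr_ge0 ?sqr_ge0.
have e1 : gratio n z - 1 = (cexp w - D) * D^-1.
  by rewrite /gratio -/d -/w -/D mulrBl divff.
have b1 : nm (gratio n z - 1) <= 18 * M ^+ 2 * iN ^+ 2.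
  rewrite e1 normcM normcV; apply: le_trans (_ : 9 * M ^+ 2 * iN ^+ 2 * 2 <= _); last by lra.
  by rewrite ler_pM ?nm_ge0 ?invr_ge0 ?nm_ge0.
split; first by rewrite iE; lra.
have g0 : gratio n z != 0 by rewrite /gratio mulf_neq0 ?cexp_neq0 ?invr_eq0.
have e2 : (gratio n z)^-1 - 1 = - (cexp w - D) / cexp w.
  by rewrite /gratio -/d -/w -/D invf_div; field; rewrite cexp_neq0.
have cw : 2^-1 ^+ 2 <= nm (cexp w).
  have h1 : nm w <= 2^-1 by lra.
  have h2 := cexp_quad_small h1.
  have h3 : nm w ^+ 2 <= 4^-1 * nm w by rewrite expr2 ler_wpM2r ?nm_ge0 //; lra.
  have := nmB 1 (- (cexp w - 1)); rewrite opprK addrC subrK.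
  have := nmB (cexp w) (cexp w - 1); rewrite opprB addrC subrK normc1.
  rewrite nm_cexp; have : - nm w <= complex.Re w.
    by have := nm_Re w; rewrite ler_norml => /andP[].
  have := expR_ge1Dx (complex.Re w); lra.
have cinv : (nm (cexp w))^-1 <= 4.
  by rewrite invf_ple ?posrE ?nm_gt0 ?cexp_neq0 //; lra.
rewrite iE e2 normcM nmN normcV; apply: le_trans (_ : 9 * M ^+ 2 * iN ^+ 2 * 4 <= _); last by lra.
by rewrite ler_pM ?nm_ge0 ?invr_ge0 ?nm_ge0.
Qed.

Lemma gauss_neq0 n z : (forall k : nat, z + k%:R != 0) -> gauss n z != 0.
Proof.
move=> hz; rewrite /gauss !mulf_neq0 ?cpow_neq0 ?invr_eq0 //.
by apply/prodf_neq0 => k _; apply: hz.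
Qed.

Lemma big_nat_exists (M : R) : exists2 n0 : nat, (0 < n0)%N & forall n, (n0 <= n)%N -> 4 * M <= n%:R.
Proof.
exists (Num.trunc (4 * M)).+1 => // n hn; apply: ltW; apply: lt_le_trans (truncnS_gt _) _.
by rewrite ler_nat.
Qed.

Lemma cvgC_lim (u : nat -> C) (l : C) : u @ \oo --> l -> lim (u @ \oo) = l.
Proof. by move=> h; apply: cvg_lim. Qed.

Lemma cvgC_mul (u v : nat -> C) (l l' : C) : u @ \oo --> l -> v @ \oo --> l' ->
  (fun n => u n * v n) @ \oo --> l * l'.
Proof. by move=> h h'; exact: (@cvgM _ _ _ _ u v _ _ h h'). Qed.

(** The inverse products converge too, and the two limits multiply to 1; this gives the
    non-vanishing. *)
Lemma Gamma_cvg z : (forall k : nat, z + k%:R != 0) ->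
  ((fun n => gauss n z) @ \oo --> Gamma z) /\ Gamma z != 0.
Proof.
move=> hz; pose M := nm z + 1; have M1 : 1 <= M by rewrite lerDr nm_ge0.
have zM : nm z <= M by rewrite lerDl.
have [n0 n00 hn] := big_nat_exists M.
have c0 k : 0 <= k%:R * M ^+ 2 :> R by rewrite mulr_ge0 ?sqr_ge0.
have hP n : (n0 <= n)%N -> gauss n.+1 z = gauss n z * gratio n z.
  by move=> h; apply: gaussS => //; apply: leq_trans h.
have hP' n : (n0 <= n)%N -> (gauss n.+1 z)^-1 = (gauss n z)^-1 * (gratio n z)^-1.
  by move=> h; rewrite hP // invfM.
have [L hL] := prod_cvg (c0 64%N) n00 hP (fun n h => (gratio_bound M1 zM (hn n h)).1).
have [L' hL'] := prod_cvg (c0 512%N) n00 hP' (fun n h => (gratio_bound M1 zM (hn n h)).2).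
have GL0 := cvgC_lim hL.
have GL : Gamma z = L by rewrite GammaE.
have LL : L * L' = 1.
  have h1 := cvgC_mul hL hL'.
  have h2 : (fun n => gauss n z * (gauss n z)^-1) @ \oo --> (1 : C).
    apply: cvg_near_cst; near=> n; by rewrite divff // gauss_neq0.
  by rewrite -(cvgC_lim h1) (cvgC_lim h2).
rewrite GL; split=> //; apply/eqP => L0; move: LL; rewrite L0 mul0r => /esym/eqP.
by rewrite oner_eq0.
Unshelve. all: by end_near. Qed.

Lemma far_from_poles z : (forall k : nat, z + k%:R != 0) ->
  exists2 r : R, 0 < r & forall k : nat, 2 * r <= nm (z + k%:R).
Proof.
move=> hz; have [n0 _ hn] := big_nat_exists (nm z + 1).
have fin (m : nat) : exists2 r : R, 0 < r & forall k : nat, (k < m)%N -> 2 * r <= nm (z + k%:R).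
  elim: m => [|m [r r0 h]]; first by exists 1.
  exists (Num.min r (nm (z + m%:R) / 2)); first by rewrite lt_min r0 divr_gt0 // nm_gt0.
  move=> k; rewrite ltnS leq_eqVlt => /orP[/eqP ->|/h hk].
    by rewrite mulrC -ler_pdivlMr // ge_min lexx orbT.
  by apply: le_trans hk; rewrite ler_pM2l // ge_min lexx.
have [r r0 h] := fin n0; exists (Num.min r 2^-1); first by rewrite lt_min r0 invr_gt0 ltr0n.
move=> k; have [kn|kn] := ltnP k n0.
  by apply: le_trans (h k kn); rewrite ler_pM2l // ge_min lexx.
have h1 : Num.min r 2^-1 <= 2^-1 by rewrite ge_min lexx orbT.
have := hn k kn; have := nmB (z + k%:R) z; rewrite addrAC subrr add0r nm_nat.
have := nm_ge0 z; lra.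
Qed.

(** On a small ball away from the poles the Gauss products with n >= n0 are bounded by the bound of
    the n0-th times a fixed factor; [qd_limit] then applies to the sequence shifted by n0. *)
Lemma Q_Gamma z : (forall k : nat, z + k%:R != 0) -> Q nmo (@Gamma R) z.
Proof.
move=> hz; have [r1 r10 hr1] := far_from_poles hz.
pose r := Num.min r1 1; have r0 : 0 < r by rewrite lt_min r10 ltr01.
have rr1 : r <= r1 by rewrite ge_min lexx.
have rr2 : r <= 1 by rewrite ge_min lexx orbT.
have away x : nm (x - z) < r -> forall k : nat, x + k%:R != 0.
  move=> hx k; rewrite -nm_gt0; have := hr1 k.
  have := nmB (x + k%:R) (x - z); have -> : x + k%:R - (x - z) = z + k%:R by ring.
  lra.
pose M := nm z + 2; have M1 : 1 <= M by have := nm_ge0 z; rewrite /M; lra.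
have xM x : nm (x - z) < r -> nm x <= M.
  by move=> hx; have := nmD (x - z) z; rewrite subrK /M; lra.
have [n0 n00 hn] := big_nat_exists M.
have idon : Qon nmo (fun x : R[i]^o => x : C) z r.
  exists (fun _ v => v), 1; split=> // [x v _|x y _ _]; first by rewrite mul1r.
  by rewrite subrr normc0 mul1r sqr_ge0.
have invon (k : nat) : Qon nmo (fun x : R[i]^o => (x + k%:R)^-1) z r.
  have [G [K h]] := Qon_add idon (Qon_cst nmo k%:R z r).
  have zk : z + k%:R != 0 by exact: hz.
  pose Ki := (nm (z + k%:R) / 2) ^- 2 + (nm (z + k%:R) / 2) ^- 3.
  have hi : qd nmo (fun x => x^-1) (fun x v => - (x ^+ 2)^-1 * v) (z + k%:R) (nm (z + k%:R) / 2) Ki by exact: inv_quad.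
  have b1 x : nm (x - (z + k%:R)) < r -> nm (- (x ^+ 2)^-1) <= Ki.
    move=> hx; have := qd_bd hi 1 (_ : nm (x - (z + k%:R)) < nm (z + k%:R) / 2).
    rewrite normc1 !mulr1; apply; have := hr1 k; lra.
  have b2 x y : nm (x - (z + k%:R)) < r -> nm (y - (z + k%:R)) < r ->
     nm (y^-1 - x^-1 - - (x ^+ 2)^-1 * (y - x)) <= Ki * nm (y - x) ^+ 2.
    by move=> hx hy; apply: (qd_quad hi); have := hr1 k; lra.
  have b3 (x : R[i]^o) : nm (x - z) < r -> nm (x + k%:R - (z + k%:R)) < r.
    by have -> : (x : C) + k%:R - (z + k%:R) = x - z by ring.
  have [K2 h2] := qd_comp1 nmV r0 h (qd_K hi) b1 b2 b3.
  by eexists; eexists; exact: h2.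
have gon n : Qon nmo (gauss n : R[i]^o -> C) z r.
  have -> : (gauss n : R[i]^o -> C) = fun x : R[i]^o => n`!%:R * cpow n%:R x * \prod_(k < n.+1) (x + k%:R)^-1.
    by apply/funext => x; rewrite /gauss prodfV.
  apply: (Qon_mul nmV r0); last first.
    apply: Qon_big => [f g|k]; [exact: (Qon_mul nmV r0)|exact: invon].
  by apply: (Qon_mul nmV r0); [exact: Qon_cst|exact: (Qon_cpow nmV)].
have bnd : exists B, forall n x, (n0 <= n)%N -> nm (x - z) < r -> nm (gauss n x) <= B.
  have [B B0 hB] : exists2 B, 0 <= B & forall x : R[i]^o, nm (x - z) < r -> nm (gauss n0 x) <= B.
    by have [G [K h]] := gon n0; have := qd_bound nmV r0 h.
  have c0 : 0 <= 64 * M ^+ 2 by rewrite mulr_ge0 ?sqr_ge0.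
  exists (B * expR (2 * (64 * M ^+ 2))) => n x h hx.
  have hP m : (n0 <= m)%N -> gauss m.+1 x = gauss m x * gratio m x.
    by move=> hm; apply: gaussS; [exact: leq_trans hm|exact: away].
  have := prod_bound2 c0 n00 hP (fun m hm => (gratio_bound M1 (xM x hx) (hn m hm)).1) h.
  by move=> /le_trans; apply; rewrite ler_wpM2r ?expR_ge0 // hB.
have [B hB] := bnd.
have B0 : 0 <= B.
  by apply: le_trans (nm_ge0 _) (hB n0 z (leqnn _) _); rewrite subrr normc0.
pose Fn n := gauss (n + n0).
pose Gn n := projT1 (cid (gon (n + n0)%N)); pose Kn n := projT1 (cid (projT2 (cid (gon (n + n0)%N)))).
have hqd n : qd nmo (Fn n) (Gn n) z r (Kn n) by exact: projT2 (cid (projT2 (cid (gon (n + n0)%N)))).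
have [||G [K h]] := @qd_limit _ _ _ nmV Fn Gn Kn (@Gamma R) z r B r0 B0 hqd.
- by move=> n x hx; apply: hB => //; exact: leq_addl.
- move=> x hx; have [hc _] := Gamma_cvg (away x hx).
  by have := hc; rewrite -(cvg_shiftn n0).
by exists G, (r / 8%:R), K; split=> //; rewrite divr_gt0.
Qed.

End Products.

(** * Composition with maps into several variables *)

Section VectorComposition.
Variable R : realType.
Local Notation C := R[i].
Variables (V : lmodType C) (N : V -> R) (NN : vnorm N).
Variable I : finType.
Local Notation pnorm := (@pnorm R I).
Let pV := @pnorm_vnorm R I.

(** The coordinate differentials are bundled with one radius and one constant, the index set being
    finite. *)
Lemma qd_vec (phi : V -> I -> C) a : (forall i, Q N (fun x => phi x i) a) ->
  exists L r K, [/\ 0 < r /\ 0 <= K,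
   forall x u v c, N (x - a) < r -> L x (c *: u + v) = c *: L x u + L x v,
   forall x v, N (x - a) < r -> pnorm (L x v) <= K * N v,
   forall x y, N (x - a) < r -> N (y - a) < r -> pnorm (phi y - phi x - L x (y - x)) <= K * N (y - x) ^+ 2 &
   forall x y, N (x - a) < r -> N (y - a) < r -> pnorm (phi y - phi x) <= K * N (y - x)].
Proof.
move=> hphi.
pose G i := projT1 (cid (hphi i)).
pose hG i := projT2 (cid (hphi i)).
pose ri i := projT1 (cid (hG i)); pose hr i := projT2 (cid (hG i)).
pose Ki i := projT1 (cid (hr i)); pose hK i := projT2 (cid (hr i)).
have r0 i : 0 < ri i by have [] := hK i.
have hq i : qd N (fun x => phi x i) (G i) a (ri i) (Ki i) by have [] := hK i.
have K0 i : 0 <= Ki i by exact: qd_K (hq i).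
have [r rp hrr] : exists2 r : R, 0 < r & forall i, r <= ri i.
  suff [r rp h] : exists2 r : R, 0 < r & forall i, i \in enum I -> r <= ri i.
    by exists r => // i; apply: h; rewrite mem_enum.
  elim: (enum I) => [|i s [r rp h]]; first by exists 1.
  exists (Num.min r (ri i)); first by rewrite lt_min rp r0.
  move=> j; rewrite inE => /orP[/eqP ->|/h hj]; first by rewrite ge_min lexx orbT.
  by apply: le_trans hj; rewrite ge_min lexx.
have sm x i : N (x - a) < r -> N (x - a) < ri i by move=> h; apply: lt_le_trans (hrr i).
pose K1 := \sum_i Ki i; pose K2 := \sum_i (Ki i + 2 * ri i * Ki i).
have K10 : 0 <= K1 by apply: sumr_ge0.
have K20 : 0 <= K2 by apply: sumr_ge0 => i _; rewrite addr_ge0 // !mulr_ge0 // ltW.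
exists (fun x v i => G i x v), r, (K1 + K2); split=> //.
- by split=> //; rewrite addr_ge0.
- by move=> x u v c hx; apply/funext => i; rewrite (qd_lin (hq i)) // sm.
- move=> x v hx; apply: (@le_trans _ _ (K1 * N v)); last by rewrite ler_wpM2r ?(vn_ge0 NN) // lerDl.
  by rewrite /K1 mulr_suml; apply: ler_sum => i _; apply: (qd_bd (hq i)); exact: sm.
- move=> x y hx hy; apply: (@le_trans _ _ (K1 * N (y - x) ^+ 2)); last by rewrite ler_wpM2r ?sqr_ge0 // lerDl.
  by rewrite /K1 mulr_suml; apply: ler_sum => i _; apply: (qd_quad (hq i)); exact: sm.
move=> x y hx hy; apply: (@le_trans _ _ (K2 * N (y - x))); last by rewrite ler_wpM2r ?(vn_ge0 NN) // lerDr.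
by rewrite /K2 mulr_suml; apply: ler_sum => i _; apply: (qd_lip NN (hq i)); exact: sm.
Qed.

Lemma qd_compn (F : (I -> C) -> C) (phi : V -> I -> C) a :
  (forall i, Q N (fun x => phi x i) a) -> Q pnorm F (phi a) ->
  exists L G r K, [/\ 0 < r, qd N (fun x => F (phi x)) (fun x v => G (phi x) (L x v)) a r K,
    forall v, dd F (phi a) (L a v) = G (phi a) (L a v) &
    forall v i, L a v i = dd (fun x => phi x i) a v].
Proof.
move=> hphi [G [r' [K' [r'0 h]]]].
have [L [r [K [[r0 K0] l1 l2 l3 l4]]]] := qd_vec hphi.
have K'0 := qd_K h.
pose rho := Num.min r (r' / (K + 1)).
have K1 : 0 < K + 1 by rewrite ltr_wpDl.
have rho0 : 0 < rho by rewrite lt_min r0 divr_gt0.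
have rr x : N (x - a) < rho -> N (x - a) < r by rewrite lt_min => /andP[].
have ar : N (a - a) < r by rewrite subrr (vn0 NN).
have ins x : N (x - a) < rho -> pnorm (phi x - phi a) < r'.
  move=> hx; apply: le_lt_trans (l4 _ _ ar (rr _ hx)) _.
  move: hx; rewrite lt_min => /andP[_]; rewrite ltr_pdivlMr //.
  have := vn_ge0 NN (x - a); nra.
exists L, G, rho, (K' * K + K' * K ^+ 2 + K' * K); split=> //; last first.
- move=> v i; have q1 : qd N (fun x => phi x i) (fun x v => L x v i) a r K.
    split=> //.
    + by move=> x u w c hx; rewrite l1.
    + by move=> x w hx; apply: le_trans (l2 _ _ hx); exact: pnorm_coord.
    by move=> x y hx hy; apply: le_trans (l3 _ _ hx hy); exact: pnorm_coord (phi y - phi x - L x (y - x)) i.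
  by rewrite (qd_dd NN v q1 ar).
- by move=> v; rewrite (qd_dd pV _ h) // subrr (vn0 pV).
split.
- by rewrite !addr_ge0 ?mulr_ge0 ?sqr_ge0.
- by move=> x u v c hx; rewrite l1 ?rr // (qd_lin h) // ins.
- move=> x v hx; apply: le_trans (qd_bd h _ (ins _ hx)) _.
  apply: (@le_trans _ _ (K' * K * N v)); first by rewrite -mulrA ler_wpM2l // l2 ?rr.
  by rewrite ler_wpM2r ?(vn_ge0 NN) // lerDr addr_ge0 ?mulr_ge0 ?sqr_ge0.
move=> x y hx hy; set d := phi y - phi x.
have -> : F (phi y) - F (phi x) - G (phi x) (L x (y - x)) =
   (F (phi y) - F (phi x) - G (phi x) d) + G (phi x) (d - L x (y - x)).
  have := qd_lin h (L x (y - x)) d (-1) (ins _ hx); rewrite scaleN1r addrC => ->; ring.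
apply: le_trans (nmD _ _) _.
apply: (@le_trans _ _ (K' * K ^+ 2 * N (y - x) ^+ 2 + K' * K * N (y - x) ^+ 2)); last first.
  by rewrite -mulrDl ler_wpM2r ?sqr_ge0 // -addrA lerDr mulr_ge0.
apply: lerD.
  apply: le_trans (qd_quad h (ins _ hx) (ins _ hy)) _; rewrite -mulrA ler_wpM2l // -exprMn.
  by rewrite ler_pXn2r ?nnegrE ?(vn_ge0 pV) ?mulr_ge0 ?(vn_ge0 NN) // l4 ?rr.
apply: le_trans (qd_bd h _ (ins _ hx)) _; rewrite -mulrA ler_wpM2l // l3 ?rr //.
Qed.

Lemma Q_compn (F : (I -> C) -> C) (phi : V -> I -> C) a :
  (forall i, Q N (fun x => phi x i) a) -> Q pnorm F (phi a) -> Q N (fun x => F (phi x)) a.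
Proof.
move=> h1 h2; have [L [G [r [K [r0 h _ _]]]]] := qd_compn h1 h2.
by exists (fun x v => G (phi x) (L x v)), r, K.
Qed.

End VectorComposition.

(** * An elementary bound for the trace of Frobenius *)

Section FrobeniusBound.
Variable E : weierstrass.

Lemma quadratic_roots (F : finFieldType) (a c : F) : (#|[set y : F | (y ^+ 2 + a * y == c)%R]%SET| <= 2)%N.
Proof.
pose P : {poly F} := ('X^2 + (a *: 'X + (- c)%:P))%R.
have sP : size P = 3%N.
  rewrite /P size_polyDl ?size_polyXn //; apply: leq_ltn_trans (size_polyD _ _) _.
  rewrite gtn_max; apply/andP; split; first by apply: leq_ltn_trans (size_scale_leq _ _) _; rewrite size_polyX.
  by apply: leq_ltn_trans (size_polyC_leq1 _) _.
have P0 : P != 0 by rewrite -size_poly_eq0 sP.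
rewrite cardE -ltnS -sP; apply: max_poly_roots => //; last exact: enum_uniq.
apply/allP => y; rewrite mem_enum inE => /eqP h.
by rewrite rootE /P !(hornerD, hornerXn, hornerZ, hornerX, hornerC) addrA h subrr.
Qed.

Lemma card_affine_points p : prime p -> (#|affine_points E p| <= p * 2)%N.
Proof.
move=> pp; rewrite -sum1_card.
rewrite (eq_bigl (fun P : 'F_p * 'F_p => true && (P \in affine_points E p))) //.
have -> : (\sum_(P | true && (P \in affine_points E p)) 1 =
   \sum_(x : 'F_p) \sum_(y | (x, y) \in affine_points E p) 1)%N.
  by rewrite (pair_big_dep xpredT (fun x y => (x, y) \in affine_points E p)); apply: eq_bigl => -[x y].
apply: (@leq_trans (\sum_(x : 'F_p) 2)%N); last first.
  by rewrite sum_nat_const cardT -cardE card_Fp.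
apply: leq_sum => x _; rewrite sum1_card.
apply: leq_trans (quadratic_roots ((a1 E)%:~R * x + (a3 E)%:~R)
  (x ^+ 3 + (a2 E)%:~R * x ^+ 2 + (a4 E)%:~R * x + (a6 E)%:~R)).
apply: subset_leq_card; apply/fintype.subsetP => y hy.
have : (x, y) \in affine_points E p by exact: hy.
by rewrite !inE /= => /eqP <-; apply/eqP; ring.
Qed.

(** At most two y for each x. Already this gives |lambda(p) p^(-1/2-t)| <= p^-t < 1 for t > 0, so
    the local factors of A_E do not vanish at positive reals. *)
Lemma frob_trace_bound p : prime p -> `|frob_trace E p| <= p%:Z.
Proof.
move=> pp; have := card_affine_points pp; rewrite /frob_trace => h.
have h1 : #|affine_points E p|%:Z <= p%:Z + p%:Z.
  by rewrite -PoszD lez_nat addnn -muln2.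
move: h1 (isT : 0 <= #|affine_points E p|%:Z).
move: (#|affine_points E p|%:Z) (p%:Z) => m q h1 h0.
rewrite ler_norml; apply/andP; split; last by rewrite lerBlDr lerDl.
by rewrite lerNl opprB lerBlDr.
Qed.

End FrobeniusBound.

(** * Cancellation of common elements in A_E *)

Section PairProducts.
Variables (F : comPzRingType) (n : nat).
Local Notation I := 'I_n.
Implicit Types (A : {set I}) (f : I -> I -> F).

Definition pairs_lt A f : F := \prod_(i in A) \prod_(j in A | (i < j)%N) f i j.

Lemma pairs_ltD1 A i f : (forall j k, f j k = f k j) -> i \in A ->
  pairs_lt A f = pairs_lt (A :\ i)%SET f * \prod_(k in (A :\ i)%SET) f i k.
Proof.
move=> fC iA; rewrite /pairs_lt (big_setD1 i iA) /=.
have -> : \prod_(k in (A :\ i)%SET) \prod_(j in A | (k < j)%N) f k j =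
   \prod_(k in (A :\ i)%SET) ((if (k < i)%N then f k i else 1) * \prod_(j in (A :\ i)%SET | (k < j)%N) f k j).
  apply: eq_bigr => k; rewrite !inE => /andP[ki kA].
  case: ifP => kl.
    rewrite (bigD1 i) ?iA //=; congr (_ * _); apply: eq_bigl => j; rewrite !inE.
    by case: eqP; rewrite ?andbF ?andbT.
  rewrite mul1r; apply: eq_bigl => j; rewrite !inE.
  by case: eqP => [->|]; rewrite ?kl ?andbF ?andbT.
rewrite big_split /= mulrA [RHS]mulrC; congr (_ * _).
have -> : \prod_(j in A | (i < j)%N) f i j = \prod_(j in (A :\ i)%SET) (if (i < j)%N then f i j else 1).
  rewrite -big_mkcondr /=; apply: eq_bigl => j; rewrite !inE.
  by case: eqP => [->|]; rewrite ?ltnn ?andbF.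
rewrite -big_split; apply: eq_bigr => k; rewrite !inE => /andP[ki _].
case: (ltngtP i k) => [h|h|/val_inj h] /=; [by rewrite mulr1|by rewrite mul1r fC|].
by rewrite h eqxx in ki.
Qed.

End PairProducts.

Section Cancellation.
Variables (R : realType) (n : nat).
Local Notation C := R[i].
Local Notation nm := (@normc R).
Local Notation nmo := (nm : R[i]^o -> R).
Local Notation I := 'I_n.
Let nmV := @nm_vnorm R.
Variables (zeta Zr : C -> C).
Hypothesis ZrQ : forall t, Q nmo Zr t.
Hypothesis Zr0 : Zr 0 = 1.
Hypothesis zetaE : forall t, t != 0 -> zeta (1 + t) = Zr t / t.
Variables (E : weierstrass) (M : nat).
Variables (Omega : set C) (AE : AE_family R n).
Hypothesis oO : open Omega.
Hypothesis cO : connected Omega.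
Hypothesis O0 : Omega 0.
Hypothesis hAE : is_AE zeta E M Omega AE.
Implicit Types (A B D W : {set I}) (s b x : I -> C).

Lemma Zz_D1 A B i j s b : i \in A -> j \in B -> Zz zeta A B s b =
  Zz zeta (A :\ i)%SET (B :\ j)%SET s b * (zeta (1 + s i + b j) *
  (\prod_(k in (B :\ j)%SET) zeta (1 + s i + b k)) * (\prod_(k in (A :\ i)%SET) zeta (1 + s k + b j))).
Proof.
move=> iA jB; have e : \prod_(k in (A :\ i)%SET) \prod_(l in B) zeta (1 + s k + b l) =
   \prod_(k in (A :\ i)%SET) (zeta (1 + s k + b j) * \prod_(l in (B :\ j)%SET) zeta (1 + s k + b l)).
  by apply: eq_bigr => k _; rewrite (big_setD1 j jB).
by rewrite /Zz (big_setD1 i iA) /= (big_setD1 j jB) /= e big_split /=; ring.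
Qed.

Lemma sqrtZ_ltD1 A i s : i \in A -> sqrtZ_lt zeta A s =
  sqrtZ_lt zeta (A :\ i)%SET s * \prod_(k in (A :\ i)%SET) zeta (1 + s i + s k).
Proof.
by move=> iA; apply: (pairs_ltD1 (f := fun i j => zeta (1 + s i + s j))) => // j k; rewrite addrAC.
Qed.

Lemma sqrtZ_leD1 A i s : i \in A -> sqrtZ_le zeta A s =
  sqrtZ_le zeta (A :\ i)%SET s * (zeta (1 + s i + s i) * \prod_(k in (A :\ i)%SET) zeta (1 + s i + s k)).
Proof.
move=> iA; rewrite !sqrtZ_leE (sqrtZ_ltD1 s iA) /Yz (big_setD1 i iA) /=.
have -> : 1 + 2 * s i = 1 + s i + s i by ring.
by ring.
Qed.

(** Dropping i from S divides [sqrtZ_lt] by P1, dropping j from B divides [sqrtZ_le] by z P2 with z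
    = zeta(1 + 2 b j), and dropping both divides [Zz] by z P2 P1. *)
Lemma YE_cancel A B i j s b : i \in A -> j \in B -> s i = b j ->
  (forall k l, k \in A -> l \in B -> zeta (1 + s k + b l) != 0) ->
  (forall k, k \in B -> zeta (1 + b j + b k) != 0) ->
  YE zeta A B s b = YE zeta (A :\ i)%SET (B :\ j)%SET s b.
Proof.
move=> iA jB e h1 h2; rewrite /YE (sqrtZ_ltD1 s iA) (sqrtZ_leD1 b jB) (Zz_D1 s b iA jB) e.
set P1 := \prod_(k in (A :\ i)%SET) zeta (1 + b j + s k).
have -> : \prod_(k in (A :\ i)%SET) zeta (1 + s k + b j) = P1.
  by apply: eq_bigr => k _; rewrite addrAC.
set P2 := \prod_(k in (B :\ j)%SET) _; set z := zeta _.
have P10 : P1 != 0.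
  by apply/prodf_neq0 => k; rewrite !inE => /andP[_ kA]; rewrite addrAC h1.
have P20 : P2 != 0.
  by apply/prodf_neq0 => k; rewrite !inE => /andP[_ kB]; rewrite h2.
have z0 : z != 0 by rewrite /z h2.
rewrite invfM; set Z := (Zz _ _ _ _ _)^-1.
transitivity (sqrtZ_lt zeta (A :\ i)%SET s * sqrtZ_le zeta (B :\ j)%SET b * Z * ((z * P2 * P1) * (z * P2 * P1)^-1)).
  by ring.
by rewrite divff ?mulr1 // !mulf_neq0.
Qed.

Lemma lambda_small p (t : R) : prime p -> 0 < t ->
  exists l : R, `|l| < 1 /\ (lambda_p R E p)%:C * cpow p%:R (- (1 / 2%:R) - t%:C) = l%:C.
Proof.
move=> pp t0; have p0 : 0 < p%:R :> R by rewrite ltr0n prime_gt0.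
have p1 : 1 < p%:R :> R by rewrite ltr1n prime_gt1.
exists (lambda_p R E p * expR (ln p%:R * (- (1 / 2) - t))); split; last first.
  have -> : - (1 / 2%:R) - t%:C = (- (1 / 2) - t)%:C :> C.
    by rewrite rmorphB rmorphN fmorph_div rmorph1 rmorph_nat.
  by rewrite cpow_real -rmorphM.
rewrite normrM (ger0_norm (expR_ge0 _)) /lambda_p normrM normfV.
rewrite (ger0_norm (sqrtr_ge0 _)).
have sE : Num.sqrt (p%:R : R) = expR (ln p%:R / 2).
  have e2 : (p%:R : R) = expR (ln p%:R / 2) ^+ 2.
    by rewrite expr2 -expRD -[LHS]lnK ?posrE //; congr expR; field.
  by rewrite {1}e2 sqrtr_sqr ger0_norm ?expR_ge0.
have aE : `|(frob_trace E p)%:~R| <= p%:R :> R.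
  by rewrite -intr_norm; have := frob_trace_bound E pp; rewrite -(ler_int R).
have -> : expR (ln p%:R * (- (1 / 2) - t)) = (expR (ln p%:R / 2))^-1 * expR (- (ln p%:R * t)) :> R.
  by rewrite -expRN -expRD; congr expR; field.
have eP : 0 < expR (ln p%:R / 2) :> R by exact: expR_gt0.
apply: (@le_lt_trans _ _ (p%:R / expR (ln p%:R / 2) * ((expR (ln p%:R / 2))^-1 * expR (- (ln p%:R * t))))).
  by rewrite sE !ler_wpM2r ?mulr_ge0 ?invr_ge0 ?expR_ge0.
have -> : p%:R / expR (ln p%:R / 2) * ((expR (ln p%:R / 2))^-1 * expR (- (ln p%:R * t))) = expR (- (ln p%:R * t)) :> R.
  have e2 : (p%:R : R) = expR (ln p%:R / 2) ^+ 2.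
    by rewrite expr2 -expRD -[LHS]lnK ?posrE //; congr expR; field.
  by rewrite {1}e2; field; rewrite gt_eqF.
by rewrite expR_lt1 oppr_lt0 mulr_gt0 // ln_gt0.
Qed.

Lemma Ufactor_neq0 (sg : C) p (t : R) : (sg = 1 \/ sg = -1) -> prime p -> 0 < t ->
  1 + sg * (lambda_p R E p)%:C * cpow p%:R (- (1 / 2%:R) - t%:C) + cpow p%:R (- 1 - 2 * t%:C) != 0.
Proof.
move=> hsg pp t0; have [l [l1 le]] := lambda_small pp t0.
have -> : - 1 - 2 * t%:C = (- 1 - 2 * t)%:C :> C.
  by rewrite rmorphB rmorphN rmorph1 rmorphM rmorph_nat.
rewrite -mulrA le cpow_real; set e := expR _; have e0 : 0 < e by exact: expR_gt0.
move: l1; rewrite ltr_norml => /andP[l1 l2].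
have aux (u : R) : 0 < u -> u%:C != 0 :> C by move=> u0; rewrite -nm_gt0 nm_real gtr0_norm.
case: hsg => ->.
  have -> : 1 + 1 * l%:C + e%:C = (1 + l + e)%:C :> C by rewrite !rmorphD rmorph1; ring.
  by apply: aux; lra.
have -> : 1 + -1 * l%:C + e%:C = (1 - l + e)%:C :> C by rewrite !rmorphD rmorphN rmorph1; ring.
by apply: aux; lra.
Qed.

Lemma Vfactor_neq0 p (t : R) : prime p -> 0 < t ->
  1 - (lambda_p R E p)%:C * cpow p%:R (- (1 / 2%:R) - t%:C) != 0.
Proof.
move=> pp t0; have [l [l1 ->]] := lambda_small pp t0.
move: l1; rewrite ltr_norml => /andP[l1 l2].
by rewrite -(rmorph1 (real_complex R)) -rmorphB -nm_gt0 nm_real normr_gt0 gt_eqF //; lra.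
Qed.

Lemma zeta_neq0_small : exists2 e : R, 0 < e & forall t : R, 0 < t < e -> zeta (1 + t%:C) != 0.
Proof.
have z0 : Zr 0 != 0 by rewrite Zr0 oner_eq0.
have [r r0 hr] := Q_neq nmV z0 (ZrQ 0).
exists r => // t /andP[t0 tr].
have tC : t%:C != 0 :> C by rewrite -nm_gt0 nm_real gtr0_norm.
by rewrite zetaE // mulf_neq0 ?invr_eq0 // hr // subr0 nm_real gtr0_norm.
Qed.

Lemma frac_cancel (u v w c : C) : w != 0 -> (w * u) / (c * (w * v)) = u / (c * v).
Proof. by move=> w0; rewrite mulrCA invfM mulrACA divff // mul1r. Qed.

Lemma frac_cancel1 (u v w : C) : w != 0 -> (w * u) / (w * v) = u / v.
Proof. by move=> w0; rewrite invfM mulrACA divff // mul1r. Qed.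

(* A_E where its Euler product converges. *)
Definition explicitA A B s b : C := AE1 zeta A B s b * AE2_euler E M A B s b * AE3 E M A B s b.

Lemma explicitA_cancel : exists2 e : R, 0 < e & forall A B i j s b, i \in A -> j \in B -> s i = b j ->
  (forall k, k \in A -> exists2 t : R, 0 < t < e & s k = t%:C) ->
  (forall k, k \in B -> exists2 t : R, 0 < t < e & b k = t%:C) ->
  explicitA A B s b = explicitA (A :\ i)%SET (B :\ j)%SET s b.
Proof.
(* zeta is taken at 1 plus a sum of two variables, hence each is kept below half the radius. *)
have [e e0 hz] := zeta_neq0_small; exists (e / 2); first by rewrite divr_gt0.
move=> A B i j s b iA jB sb hs hb.
have zz (z w : C) : (exists2 t : R, 0 < t < e / 2 & z = t%:C) ->
    (exists2 t : R, 0 < t < e / 2 & w = t%:C) -> zeta (1 + z + w) != 0.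
  move=> [t /andP[t0 t1] ->] [u /andP[u0 u1] ->]; rewrite -addrA -rmorphD; apply: hz.
  by apply/andP; split; lra.
rewrite /explicitA; congr (_ * _ * _).
- rewrite /AE1 (YE_cancel iA jB sb) // => [k l kA lB|k kB]; apply: zz; [exact: hs|exact: hb|exact: hb|exact: hb].
(* The two sequences of partial products agree factor by factor, so their limits are the same
   term. *)
- rewrite /AE2_euler; apply: (congr1 (fun g : nat -> C => lim (g @ \oo))); apply/funext => N; apply: eq_bigr => p /andP[pp _].
  congr (_ * (_ + _ + _)).
    rewrite /U (big_setD1 i iA) (big_setD1 j jB) /= sb.
    have [t /andP[t0 _] bt] := hb j jB; rewrite bt.
    have w0 := Ufactor_neq0 (or_intror (erefl (-1 : C))) pp t0.
    exact: frac_cancel.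
  rewrite /U (big_setD1 i iA) (big_setD1 j jB) /= sb.
  have [t /andP[t0 _] bt] := hb j jB; rewrite bt.
  have w0 := Ufactor_neq0 (or_introl (erefl (1 : C))) pp t0.
  exact: frac_cancel.
rewrite /AE3; apply: eq_big_seq => p pM.
have pp : prime p by move: pM; rewrite mem_primes => /andP[].
rewrite /V (big_setD1 i iA) (big_setD1 j jB) /= sb.
have [t /andP[t0 _] bt] := hb j jB; rewrite bt; have w0 := Vfactor_neq0 pp t0.
exact: frac_cancel1.
Qed.

Lemma explicitA_local A B s b s' b' : (forall i, i \in A -> s i = s' i) ->
  (forall j, j \in B -> b j = b' j) -> explicitA A B s b = explicitA A B s' b'.
Proof.
move=> hs hb; have hU sg p : U E sg p A s = U E sg p A s' by apply: eq_bigr => i iA; rewrite hs.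
have hU' sg p : U E sg p B b = U E sg p B b' by apply: eq_bigr => i iA; rewrite hb.
have hV p : V E p A s = V E p A s' by apply: eq_bigr => i iA; rewrite hs.
have hV' p : V E p B b = V E p B b' by apply: eq_bigr => i iA; rewrite hb.
rewrite /explicitA; congr (_ * _ * _).
- rewrite /AE1 /YE; congr (_ * _ / _)^-1.
  + by apply: eq_bigr => i iA; apply: eq_bigr => j /andP[jA _]; rewrite !hs.
  + by apply: eq_bigr => i iA; apply: eq_bigr => j /andP[jA _]; rewrite !hb.
  by apply: eq_bigr => i iA; apply: eq_bigr => j jB; rewrite hs // hb.
- rewrite /AE2_euler; apply: (congr1 (fun g : nat -> C => lim (g @ \oo))); apply/funext => N; apply: eq_bigr => p _.
  by rewrite !hU !hU'.
by apply: eq_bigr => p _; rewrite hV hV'.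
Qed.

Definition pt s b : I + I -> C := fun k => match k with inl i => s i | inr j => b j end.

Lemma AE_Q A B s b : (forall i, i \in A -> Omega (s i)) -> (forall j, j \in B -> Omega (b j)) ->
  Q (@pnorm R _) (fun z : I + I -> C => AE A B (z \o inl) (z \o inr)) (pt s b).
Proof. by move=> hs hb; apply: analytic_at_Q; apply: (hAE.1 A B (pt s b)). Qed.

Lemma AE_Qc (W : lmodType C) (N : W -> R) (NN : vnorm N) A B (s b : W -> I -> C) a :
  (forall i, Q N (fun x : W => s x i) a) -> (forall j, Q N (fun x : W => b x j) a) ->
  (forall i, i \in A -> Omega (s a i)) -> (forall j, j \in B -> Omega (b a j)) ->
  Q N (fun x : W => AE A B (s x) (b x)) a.
Proof.
move=> qs qb hs hb.
by apply: (Q_compn NN (phi := fun x : W => pt (s x) (b x)) (F := fun z => AE A B (z \o inl) (z \o inr)));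
  [case|exact: AE_Q].
Qed.

Lemma AE_explicit A B s b : (forall i, i \in A -> Omega (s i)) -> (forall j, j \in B -> Omega (b j)) ->
  (forall k, k \in A -> exists2 t : R, 0 < t & s k = t%:C) ->
  (forall k, k \in B -> exists2 t : R, 0 < t & b k = t%:C) ->
  AE A B s b = explicitA A B s b.
Proof.
move=> hs hb ps pb; apply: (hAE.2 A B s b) => k kS; split.
- exact: hs.
- by have [t t0 ->] := ps k kS.
- exact: hb.
- by have [t t0 ->] := pb k kS.
Qed.

Lemma Q_upd (T : finType) (z : T -> C) k m (t : R[i]^o) : Q nmo (fun t : R[i]^o => [eta z with k |-> t] m) t.
Proof.
rewrite /=; case: (m =P k) => _; [exact: Q_id|exact: Q_cst].
Qed.

(** [AE] takes values for all indices, and its defining property does not say that the entries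
    outside A and B are ignored. The explicit product ignores them, and the identity theorem carries
    this over to Omega. *)
Lemma AE_local A B s b s' b' : (forall i, i \in A -> Omega (s i)) -> (forall j, j \in B -> Omega (b j)) ->
  (forall i, i \in A -> s i = s' i) -> (forall j, j \in B -> b j = b' j) ->
  AE A B s b = AE A B s' b'.
Proof.
move=> Os Ob hs hb.
(* Free variables on the set, the given values outside it. *)
pose mg (S : {set I}) (z y : I -> C) : I -> C := fun i => if i \in S then z i else y i.
pose F (z : I + I -> C) := AE A B (mg A (z \o inl) s) (mg B (z \o inr) b)
   - AE A B (mg A (z \o inl) s') (mg B (z \o inr) b').
pose S : pred (I + I) := fun k => match k with inl i => i \in A | inr j => j \in B end.
have mgO (S0 : {set I}) z y : (forall i, i \in S0 -> Omega (z i)) -> forall i, i \in S0 -> Omega (mg S0 z y i).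
  by move=> h i iS; rewrite /mg iS; apply: h.
have : F (pt s b) = 0.
  apply: (@identity_multi _ _ S Omega F oO cO O0) => [z hz k Sk||k]; last first.
  - by case: k => k /= kS; [apply: Os|apply: Ob].
  - exists 1 => // z hz Oz; rewrite /F.
    have e y y' : explicitA A B (mg A (z \o inl) y) (mg B (z \o inr) y') =
        explicitA A B (z \o inl) (z \o inr).
      by apply: explicitA_local => i iS; rewrite /mg iS.
    rewrite !AE_explicit ?e ?subrr //.
    all: try by apply: mgO => i iS; apply: Oz.
    + by move=> i iA; have [t /andP[t0 _] zt] := hz (inl i) iA; exists t => //; rewrite /mg iA.
    + by move=> i iA; have [t /andP[t0 _] zt] := hz (inr i) iA; exists t => //; rewrite /mg iA.
    + by move=> i iA; have [t /andP[t0 _] zt] := hz (inl i) iA; exists t => //; rewrite /mg iA.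
    + by move=> i iA; have [t /andP[t0 _] zt] := hz (inr i) iA; exists t => //; rewrite /mg iA.
  have uk : ([eta z with k |-> z k] : I + I -> C) = z by apply/funext => m /=; case: eqP => [->|].
  apply: (Q_sub nmV); apply: (AE_Qc nmV).
  all: try by move=> i; rewrite /mg; case: (i \in _); [exact: Q_upd|exact: Q_cst].
  1-4: by apply: mgO => i iS; rewrite uk; apply: hz.
rewrite /F => /eqP; rewrite subr_eq0 => /eqP.
have e (S0 : {set I}) y z : (forall i, i \in S0 -> y i = z i) -> mg S0 y z = z.
  by move=> h; apply/funext => i; rewrite /mg; case: ifP => // /h.
by rewrite !e.
Qed.

(** The relation s i = b j is built into the substitution [up], which leaves independent variables;
    the identity theorem applies to these, starting from the cancellation in the explicit
    product. *)
Lemma AE_cancel_same A B i j s b : (forall i, i \in A -> Omega (s i)) -> (forall j, j \in B -> Omega (b j)) ->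
  i \in A -> j \in B -> s i = b j -> AE A B s b = AE (A :\ i)%SET (B :\ j)%SET s b.
Proof.
move=> Os Ob iA jB sb.
pose up (z : I + I -> C) : I -> C := fun k => if k == j then z (inl i) else z (inr k).
pose F (z : I + I -> C) := AE A B (z \o inl) (up z) - AE (A :\ i)%SET (B :\ j)%SET (z \o inl) (up z).
pose S : pred (I + I) := fun k => match k with inl i => i \in A | inr k => (k \in B) && (k != j) end.
have upO z : (forall k, S k -> Omega (z k)) -> forall k, k \in B -> Omega (up z k).
  move=> h k kB; rewrite /up; case: eqP => [_|/eqP kj]; first exact: (h (inl i)).
  by apply: (h (inr k)); rewrite /S kB.
have inA k : k \in (A :\ i)%SET -> k \in A by rewrite !inE => /andP[].
have inB k : k \in (B :\ j)%SET -> k \in B by rewrite !inE => /andP[].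
have [e e0 hcan] := explicitA_cancel.
have : F (pt s b) = 0.
  apply: (@identity_multi _ _ S Omega F oO cO O0) => [z hz k Sk||k]; last first.
  - by case: k => k /=; [apply: Os|move=> /andP[kB _]; apply: Ob].
  - exists e => // z hz Oz; rewrite /F.
    have pA k : k \in A -> exists2 t : R, 0 < t < e & (z \o inl) k = t%:C by move=> kA; exact: (hz (inl k)).
    have pB k : k \in B -> exists2 t : R, 0 < t < e & up z k = t%:C.
      move=> kB; rewrite /up; case: eqP => [_|/eqP kj]; first exact: (hz (inl i)).
      by apply: (hz (inr k)); rewrite /S kB.
    have w y : (exists2 t : R, 0 < t < e & y = t%:C) -> exists2 t : R, 0 < t & y = t%:C.
      by move=> [t /andP[t0 _] ->]; exists t.
    rewrite !AE_explicit ?(hcan A B i j) ?subrr //.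
    all: try by move=> k kS; apply: w; first [exact: pA|exact: pB|apply: pA; exact: inA|apply: pB; exact: inB].
    all: try by move=> k kS; apply: upO => //; exact: inB.
    all: try by move=> k kS; apply: Oz => /=; first [exact: kS|exact: inA].
    all: try exact: upO.
    by rewrite /up eqxx.
  have uk : ([eta z with k |-> z k] : I + I -> C) = z by apply/funext => m /=; case: eqP => [->|].
  have qup l : Q nmo (fun t : R[i]^o => up [eta z with k |-> t] l) (z k).
    by rewrite /up; case: (l == j); exact: Q_upd.
  apply: (Q_sub nmV); apply: (AE_Qc nmV) => //.
  all: try by move=> l; exact: Q_upd.
  1-4: rewrite uk.
  + by move=> l lA; apply: (hz (inl l)).
  + exact: upO.
  + by move=> l lA; apply: (hz (inl l)); exact: inA.
  by move=> l lB; apply: upO => //; exact: inB.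
have -> : F (pt s b) = AE A B s b - AE (A :\ i)%SET (B :\ j)%SET s b.
  rewrite /F; have -> : up (pt s b) = b by apply/funext => k; rewrite /up; case: eqP => [->|].
  by [].
by move=> /eqP; rewrite subr_eq0 => /eqP.
Qed.

Lemma AE_cancel A B i j s b s' b' : (forall i, i \in A -> Omega (s i)) -> (forall j, j \in B -> Omega (b j)) ->
  i \in A -> j \in B -> s i = b j ->
  (forall k, k \in (A :\ i)%SET -> s k = s' k) -> (forall k, k \in (B :\ j)%SET -> b k = b' k) ->
  AE A B s b = AE (A :\ i)%SET (B :\ j)%SET s' b'.
Proof.
move=> Os Ob iA jB sb hs hb; rewrite (AE_cancel_same Os Ob iA jB sb); apply: AE_local => //.
  by move=> k; rewrite !inE => /andP[_]; exact: Os.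
by move=> k; rewrite !inE => /andP[_]; exact: Ob.
Qed.

End Cancellation.

(** * Iterated logarithmic derivatives of A_E *)

Section LogarithmicDerivatives.
Variable R : realType.
Local Notation C := R[i].

Definition ld (V : lmodType C) (vs : seq V) (g : V -> C) : V -> C :=
  foldr (fun v h => fun x => dd h x v) g vs.

(** Modelled on [dlog]: the first direction gives F'/F, so no branch of the logarithm is chosen.
    Directions are arbitrary vectors in order to be pulled back along affine maps. *)
Definition dlg (V : lmodType C) (vs : seq V) (F : V -> C) : V -> C :=
  if vs is v :: ws then ld ws (fun x => dd F x v / F x) else fun=> 0.

Lemma dlogE n (W : {set 'I_n}) (F : ('I_n -> C) -> C) :
  dlog W F = dlg [seq pdir R i | i <- enum W] F.
Proof.
rewrite /dlog; case: (enum W) => [//|w ws] /=.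
elim: ws => [|v ws IH] /=; first by rewrite pderivE.
by rewrite pderivE IH.
Qed.

Section Pull.
Variables (V1 V2 : lmodType C) (phi : V1 -> V2) (l : V1 -> V2).

Lemma dd_pull (F : V2 -> C) v : (forall x t, phi (x + t *: v) = phi x + t *: l v) ->
  (fun x => dd (fun y => F (phi y)) x v) = (fun x => dd F (phi x) (l v)).
Proof.
move=> h; apply/funext => x; rewrite !dd.unlock.
by congr (derive1 _ _); apply/funext => t; rewrite h.
Qed.

Lemma ld_pull (F : V2 -> C) vs : (forall v, v \in vs -> forall x t, phi (x + t *: v) = phi x + t *: l v) ->
  ld vs (fun y => F (phi y)) = (fun x => ld (map l vs) F (phi x)).
Proof.
elim: vs => [//|v vs IH] h /=; rewrite IH; last by move=> u us; apply: h; rewrite inE us orbT.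
by rewrite (dd_pull (ld (map l vs) F)) //; apply: h; rewrite inE eqxx.
Qed.

Lemma dlg_pull (F : V2 -> C) vs : (forall v, v \in vs -> forall x t, phi (x + t *: v) = phi x + t *: l v) ->
  dlg vs (fun y => F (phi y)) = (fun x => dlg (map l vs) F (phi x)).
Proof.
case: vs => [//|v vs] h /=.
have -> : (fun x => dd (fun y => F (phi y)) x v / F (phi x)) =
   (fun x => (fun z => dd F z (l v) / F z) (phi x)).
  apply/funext => x; congr (_ / _).
  by have := @dd_pull F v (h v (mem_head _ _)) => /(congr1 (fun g => g x)).
by rewrite (ld_pull (fun z => dd F z (l v) / F z)) // => u us; apply: h; rewrite inE us orbT.
Qed.

End Pull.

Section Theory.
Variables (V : lmodType C) (N : V -> R) (NN : vnorm N).
Implicit Types (F g h : V -> C) (a x : V) (vs ws : seq V).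
Local Notation Q := (@Q R V N).
Local Notation near_at := (@near_at R V N).

Lemma ld_Q vs g a : Q g a -> Q (ld vs g) a.
Proof. by move=> h; elim: vs => [//|v vs IH] /=; apply: Q_dd. Qed.

Lemma ld_ext vs g h a : near_at a (fun x => g x = h x) -> Q g a -> near_at a (fun x => ld vs g x = ld vs h x).
Proof.
move=> e hg; elim: vs => [//|v vs IH] /=.
have := nearI (near_near NN IH) (Q_near NN (ld_Q vs hg)).
by apply: nearS => x [h1 h2]; apply: (dd_ext NN).
Qed.

Lemma ld_add vs g h a : Q g a -> Q h a ->
  near_at a (fun x => ld vs (fun x => g x + h x) x = ld vs g x + ld vs h x).
Proof.
move=> hg hh; elim: vs => [|v vs IH] /=; first exact: nearT.
have q1 := ld_Q vs hg; have q2 := ld_Q vs hh.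
have q0 := ld_Q vs (Q_add NN hg hh).
have := nearI (near_near NN IH) (nearI (Q_near NN q0) (nearI (Q_near NN q1) (Q_near NN q2))).
apply: nearS => x [h1 [h0 [h2 h3]]].
by rewrite (dd_ext NN v h1 h0) (dd_add NN).
Qed.

Lemma ld_opp vs g a : Q g a -> near_at a (fun x => ld vs (fun x => - g x) x = - ld vs g x).
Proof.
move=> hg; elim: vs => [|v vs IH] /=; first exact: nearT.
have q1 := ld_Q vs hg; have q0 := ld_Q vs (Q_opp NN hg).
have := nearI (near_near NN IH) (nearI (Q_near NN q0) (Q_near NN q1)).
apply: nearS => x [h1 [h0 h2]].
by rewrite (dd_ext NN v h1 h0) (dd_opp NN).
Qed.

Lemma dlg_Q vs F a : Q F a -> F a != 0 -> Q (dlg vs F) a.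
Proof.
move=> hF F0; case: vs => [|v vs]; first exact: Q_cst.
by apply: ld_Q; apply: (Q_div NN) => //; apply: Q_dd.
Qed.

Lemma dlg_ext vs F F' a : near_at a (fun x => F x = F' x) -> Q F a -> F a != 0 -> dlg vs F a = dlg vs F' a.
Proof.
move=> e hF F0; case: vs => [//|v vs] /=; apply: (near_here NN (P := fun x => ld vs _ x = ld vs _ x)).
apply: ld_ext; last by apply: (Q_div NN) => //; apply: Q_dd.
have := nearI (near_near NN e) (Q_near NN hF); apply: nearS => x [h1 h2].
by rewrite (dd_ext NN v h1 h2) (near_here NN h1).
Qed.

Lemma dlg_mul vs F F' a : Q F a -> F a != 0 -> Q F' a -> F' a != 0 ->
  dlg vs (fun x => F x * F' x) a = dlg vs F a + dlg vs F' a.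
Proof.
move=> q f0 q' f0'; case: vs => [|v vs] /=; first by rewrite addr0.
have qq : Q (fun x => dd F x v / F x) a by apply: (Q_div NN) => //; apply: Q_dd.
have qq' : Q (fun x => dd F' x v / F' x) a by apply: (Q_div NN) => //; apply: Q_dd.
rewrite -(near_here NN (ld_add vs qq qq')); apply: (near_here NN (P := fun x => ld vs _ x = ld vs _ x)).
have Qm : Q (fun x => F x * F' x) a by exact: Q_mul.
apply: ld_ext; last first.
  by apply: (Q_div NN) => //; [rewrite mulf_neq0|apply: Q_dd].
have := nearI (nearI (Q_near NN q) (Q_near NN q')) (nearI (Q_neq NN f0 q) (Q_neq NN f0' q')).
by apply: nearS => x [[h1 h2] [h3 h4]]; rewrite (dd_mul NN) //; field; rewrite h3 h4.
Qed.

Lemma dlg_inv vs F a : Q F a -> F a != 0 -> dlg vs (fun x => (F x)^-1) a = - dlg vs F a.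
Proof.
move=> q f0; case: vs => [|v vs] /=; first by rewrite oppr0.
have qq : Q (fun x => dd F x v / F x) a by apply: (Q_div NN) => //; apply: Q_dd.
rewrite -(near_here NN (ld_opp vs qq)); apply: (near_here NN (P := fun x => ld vs _ x = ld vs _ x)).
apply: ld_ext; last first.
  by apply: (Q_div NN); rewrite ?invr_eq0 //; [apply: Q_dd => //|]; apply: Q_inv.
have := nearI (Q_near NN q) (Q_neq NN f0 q).
by apply: nearS => x [h1 h3]; rewrite (dd_inv NN) //; field.
Qed.

Lemma dlg_cstM vs c F a : c != 0 -> Q F a -> F a != 0 -> dlg vs (fun x => c * F x) a = dlg vs F a.
Proof.
move=> c0 q f0; rewrite dlg_mul //; last exact: Q_cst.
suff -> : dlg vs (fun=> c) a = 0 by rewrite add0r.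
case: vs => [//|v vs] /=.
have -> : (fun x : V => dd (fun=> c) x v / c) = fun=> 0 by apply/funext => x; rewrite dd_cst mul0r.
elim: vs => [//|u vs IH] /=; have -> : ld vs (fun=> 0 : C) = fun=> 0; last by rewrite dd_cst.
elim: (vs) => [//|w ws IH'] /=; rewrite IH'; apply/funext => x; exact: dd_cst.
Qed.

Lemma ld_comm v vs g a : Q g a -> near_at a (fun x => dd (ld vs g) x v = ld vs (fun x => dd g x v) x).
Proof.
move=> hg; elim: vs => [|u vs IH] /=; first exact: nearT.
have q1 : Q (ld vs (fun x => dd g x v)) a by apply/ld_Q/Q_dd.
have q2 := ld_Q vs hg.
have := nearI (near_near NN IH) (Q_near NN q2).
apply: nearS => x [h1 h2].
rewrite (dd_sym NN) //; apply: (dd_ext NN) => //; exact: Q_dd.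
Qed.

Lemma ld_cat vs ws g : ld (vs ++ ws) g = ld vs (ld ws g).
Proof. by rewrite /ld foldr_cat. Qed.

Lemma ld_perm vs ws g a : perm_eq vs ws -> Q g a -> near_at a (fun x => ld vs g x = ld ws g x).
Proof.
move=> h q; elim: vs ws h => [|v vs IH] ws h.
  by move: h; rewrite perm_sym => /perm_nilP ->; exact: nearT.
have vw : v \in ws by rewrite -(perm_mem h) inE eqxx.
have [w1 [w2 ew]] : exists w1 w2, ws = w1 ++ v :: w2.
  by case/splitPr: vw => w1 w2; exists w1, w2.
have h' : perm_eq vs (w1 ++ w2).
  rewrite -(perm_cons v) perm_sym; apply: perm_trans (_ : perm_eq ws _); last by rewrite perm_sym.
  by rewrite perm_sym ew -[v :: w2]/([:: v] ++ w2) perm_catCA.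
have q1 := ld_Q vs q; have q2 := ld_Q w2 q.
have c1 := ld_comm v w1 q2.
have := nearI (near_near NN (IH _ h')) (nearI (Q_near NN q1) c1).
apply: nearS => x [h1 [h2 h3]] /=.
by rewrite ew ld_cat /= -h3 -ld_cat; apply: (dd_ext NN).
Qed.

(** Among the later directions the order is immaterial by symmetry of second derivatives; the first,
    which carries the quotient, is exchanged by d_w(d_u F / F) = d_u(d_w F / F). *)
Lemma dlg_perm vs ws F a : perm_eq vs ws -> Q F a -> F a != 0 -> near_at a (fun x => dlg vs F x = dlg ws F x).
Proof.
move=> h q f0.
have ql u : Q (fun x => dd F x u / F x) a by apply: (Q_div NN) => //; apply: Q_dd.
have comm u w : near_at a (fun x => dd (fun x => dd F x u / F x) x w = dd (fun x => dd F x w / F x) x u).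
  have := nearI (Q_near NN q) (Q_neq NN f0 q); apply: nearS => x [qx f0x].
  have qu := Q_dd NN u qx; have qw := Q_dd NN w qx; have qi := Q_inv NN f0x qx.
  by rewrite !(dd_mul NN) // !(dd_inv NN) // (dd_sym NN u w qx); field.
case: vs h => [|v vs] h; first by move: h; rewrite perm_sym => /perm_nilP ->; exact: nearT.
case: ws h => [|w ws] h; first by move/perm_nilP: h.
rewrite /=; have [e|vw] := eqVneq v w.
  by rewrite e in h *; apply: ld_perm => //; rewrite -(perm_cons w).
have wv : w \in vs by move: (perm_mem h w); rewrite !inE eqxx eq_sym (negPf vw).
have vw' : v \in ws by move: (perm_mem h v); rewrite !inE eqxx (negPf vw).
pose u := rem w vs.
have p1 : perm_eq vs (w :: u) by exact: perm_to_rem.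
have p2 : perm_eq ws (v :: u).
  rewrite -(perm_cons w); apply: perm_trans (_ : perm_eq (v :: vs) _); first by rewrite perm_sym.
  rewrite -(perm_cons v) in p1; apply: perm_trans p1 _.
  by rewrite -[w :: v :: u]/([:: w] ++ [:: v] ++ u) perm_sym perm_catCA.
have e1 := ld_perm p1 (ql v); have e2 := ld_perm p2 (ql w).
have e3 := ld_comm w u (ql v); have e4 := ld_comm v u (ql w).
have e5 := ld_ext u (comm v w) (Q_dd NN w (ql v)).
have := nearI (nearI e1 e2) (nearI (nearI e3 e4) e5).
by apply: nearS => x [[h1 h2] [[h3 h4] h5]]; rewrite h1 h2 /= h3 h4 h5.
Qed.

Lemma dlg_cons v vs ws F a : vs != [::] -> perm_eq ws (v :: vs) -> Q F a -> F a != 0 ->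
  dlg ws F a = dd (dlg vs F) a v.
Proof.
case: vs => [//|w vs] _ p q f0.
have p' : perm_eq ws (w :: v :: vs).
  by apply: perm_trans p _; rewrite -[w :: v :: vs]/([:: w] ++ [:: v] ++ vs) perm_sym perm_catCA.
by rewrite (near_here NN (dlg_perm p' q f0)).
Qed.

End Theory.
End LogarithmicDerivatives.

(** * Cancellation for the logarithmic derivatives of A_E *)

Section Psi.
Variables (R : realType) (n : nat).
Local Notation C := R[i].
Local Notation nm := (@normc R).
Local Notation nmo := (nm : R[i]^o -> R).
Local Notation I := 'I_n.
Let nmV := @nm_vnorm R.
Local Notation T := (I + I)%type.
Local Notation pnT := (@pnorm R (I + I)%type).
Let pV := @pnorm_vnorm R (I + I)%type.
Variables (zeta Zr : C -> C).
Hypothesis ZrQ : forall t, Q nmo Zr t.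
Hypothesis Zr0 : Zr 0 = 1.
Hypothesis zetaE : forall t, t != 0 -> zeta (1 + t) = Zr t / t.
Variables (E : weierstrass) (M : nat).
Variables (Omega : set C) (AE : AE_family R n).
Hypothesis oO : open Omega.
Hypothesis cO : connected Omega.
Hypothesis O0 : Omega 0.
Hypothesis hAE : is_AE zeta E M Omega AE.
Implicit Types (A B D W : {set I}) (z y : T -> C).

Let cancel := AE_cancel ZrQ Zr0 zetaE oO cO O0 hAE.
Let local_ := AE_local oO cO O0 hAE.

(* A_E as a function of the 2n variables (s, b): inl i stands for s i and inr j
   for b j. *)
Definition Ah A B (z : T -> C) : C := AE A B (z \o inl) (z \o inr).
Definition OmT A B (z : T -> C) : Prop :=
  (forall i, i \in A -> Omega (z (inl i))) /\ (forall j, j \in B -> Omega (z (inr j))).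
Definition edirs W : seq (T -> C) := [seq pdir R (inl i : T) | i <- enum W].
(* For W nonempty, the derivative of log A_E over the s i with i in W; the value at
   W = set0 is A_E itself, because both obey the same cancellation rules. *)
Definition Psi W A B (z : T -> C) : C :=
  if W == finset.set0 then Ah A B z else dlg (edirs W) (Ah A B) z.
Definition agree A B (z y : T -> C) : Prop :=
  (forall i, i \in A -> z (inl i) = y (inl i)) /\ (forall j, j \in B -> z (inr j) = y (inr j)).

Lemma Ah_Q A B z : OmT A B z -> Q pnT (Ah A B) z.
Proof.
move=> [h1 h2]; have := AE_Q hAE h1 h2.
by have -> : pt (fun i => z (inl i)) (fun j => z (inr j)) = z by apply/funext => -[].
Qed.

Lemma Omega_near (k : T) z : Omega (z k) -> near_at pnT z (fun y => Omega (y k)).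
Proof.
move=> Oz; have [r r0 h] : near_at nmo (z k) Omega by apply/nbhsCP; apply: open_nbhs_nbhs.
exists r => // y hy; apply: h; apply: le_lt_trans hy; exact: pnorm_coord (y - z) k.
Qed.

Lemma OmT_near A B z : OmT A B z -> near_at pnT z (OmT A B).
Proof.
move=> [h1 h2].
have n1 : near_at pnT z (fun y => forall i : I, i \in A -> Omega (y (inl i))).
  apply: near_all => i; case: (boolP (i \in A)) => iA; last exact: nearT.
  by apply: nearS (Omega_near (h1 i iA)) => y hy _.
have n2 : near_at pnT z (fun y => forall i : I, i \in B -> Omega (y (inr i))).
  apply: near_all => i; case: (boolP (i \in B)) => iA; last exact: nearT.
  by apply: nearS (Omega_near (h2 i iA)) => y hy _.
exact: nearI n1 n2.
Qed.

Lemma Ah_local A B z y : OmT A B z -> agree A B z y -> Ah A B z = Ah A B y.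
Proof. by move=> [h1 h2] [e1 e2]; apply: local_. Qed.

Lemma Ah_cancel A B i j z : OmT A B z -> i \in A -> j \in B -> z (inl i) = z (inr j) ->
  Ah A B z = Ah (A :\ i)%SET (B :\ j)%SET z.
Proof. by move=> [h1 h2] iA jB e; apply: cancel. Qed.

Lemma OmTS A B A' B' z : {subset A' <= A} -> {subset B' <= B} -> OmT A B z -> OmT A' B' z.
Proof. by move=> sA sB [h1 h2]; split=> i iS; [apply/h1/sA|apply/h2/sB]. Qed.

Lemma OmTD1 A B i j z : OmT A B z -> OmT (A :\ i)%SET (B :\ j)%SET z.
Proof. by apply: OmTS => k; rewrite inE => /andP[]. Qed.

Lemma Psi_Q W A B z : OmT A B z -> Ah A B z != 0 -> Q pnT (Psi W A B) z.
Proof.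
move=> h a0; rewrite /Psi; case: (W == finset.set0); first exact: Ah_Q.
by apply: (dlg_Q pV) => //; apply: Ah_Q.
Qed.

Lemma mem_edirs W v : v \in edirs W -> exists2 w, w \in W & v = pdir R (inl w : T).
Proof. by move=> /mapP[w]; rewrite mem_enum => wW ->; exists w. Qed.

(** The translation taking z to y moves only coordinates which A_E ignores, so A_E is invariant
    under it near z, and translations do not change directions. *)
Lemma Psi_local W A B z y : OmT A B z -> Ah A B z != 0 -> agree A B z y -> Psi W A B z = Psi W A B y.
Proof.
move=> h a0 e; rewrite /Psi; case: (W == finset.set0); first exact: Ah_local.
pose phi (x : T -> C) := x + (y - z).
have near_e : near_at pnT z (fun x => Ah A B x = Ah A B (phi x)).
  apply: nearS (OmT_near h) => x hx; apply: Ah_local => //.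
  case: e => e1 e2; split=> i iS; rewrite /phi.
    by rewrite -[RHS]/(x (inl i) + (y (inl i) - z (inl i))) e1 // subrr addr0.
  by rewrite -[RHS]/(x (inr i) + (y (inr i) - z (inr i))) e2 // subrr addr0.
rewrite (dlg_ext pV _ near_e) //; last exact: Ah_Q.
rewrite (@dlg_pull _ _ _ phi id) ?map_id; last by move=> v _ x t; rewrite /phi addrAC.
by rewrite /phi addrC subrK.
Qed.

(** The linear map [phi] puts b j in place of s i. Near z the smaller A_E is the pull-back of the
    larger one along it, and since i is not in W the map fixes all directions of differentiation. *)
Lemma Psi_cancel W A B i j z : OmT A B z -> Ah A B z != 0 -> i \in A -> i \notin W -> j \in B ->
  z (inl i) = z (inr j) -> Psi W A B z = Psi W (A :\ i)%SET (B :\ j)%SET z.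
Proof.
move=> h a0 iA iW jB e; rewrite /Psi; case: (W == finset.set0); first exact: Ah_cancel.
pose phi (x : T -> C) : T -> C := fun k => if k == inl i then x (inr j) else x k.
have phi_inl x k : phi x (inl k) = if k == i then x (inr j) else x (inl k) by rewrite /phi.
have near_e : near_at pnT z (fun x => Ah (A :\ i)%SET (B :\ j)%SET x = Ah A B (phi x)).
  apply: nearS (OmT_near h) => x hx.
  have hx' : OmT A B (phi x).
    case: hx => h1 h2; split=> k kS; last exact: h2.
    by rewrite phi_inl; case: eqP => _; [apply: h2|apply: h1].
  rewrite (Ah_cancel hx' iA jB) ?phi_inl ?eqxx //.
  apply: Ah_local; first exact: OmTD1.
  by split=> k; rewrite // phi_inl !inE => /andP[/negPf ->].
have zphi : phi z = z by apply/funext => -[k|k] //; rewrite phi_inl; case: eqP => [->|].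
have hz' := OmTD1 i j h.
rewrite (dlg_ext pV _ near_e); last 2 first.
- exact: Ah_Q.
- by rewrite -(Ah_cancel h iA jB e).
rewrite (@dlg_pull _ _ _ phi phi) ?zphi; last first.
  move=> v _ x t; apply/funext => k; change (phi (x + t *: v) k = phi x k + t * phi v k).
  by rewrite /phi; case: eqP.
congr (dlg _ _ _); rewrite -[LHS]map_id; apply/eq_in_map => v /mem_edirs [w wW ->].
apply/funext => -[k|k] //; rewrite phi_inl /pdir; case: (k =P i) => [->|] //=.
by case: eqP => // -[e']; rewrite e' wW in iW.
Qed.

(** For W empty [Psi] is A_E itself, whose derivative is its logarithmic derivative times A_E; hence
    the last factor. *)
Lemma Psi_deriv W A B v z : OmT A B z -> Ah A B z != 0 -> v \notin W ->
  dd (Psi W A B) z (pdir R (inl v : T)) =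
  Psi (v |: W)%SET A B z * (if W == finset.set0 then Ah A B z else 1).
Proof.
move=> h a0 vW; rewrite /Psi.
have -> : (v |: W)%SET == finset.set0 = false.
  by apply/negbTE/set0Pn; exists v; rewrite !inE eqxx.
case: eqP => [->|/eqP W0].
  by rewrite finset.setU0 /edirs enum_set1 /= divfK.
rewrite mulr1; symmetry; apply: (dlg_cons pV) => //; last exact: Ah_Q.
- rewrite /edirs -size_eq0 size_map size_eq0; apply: contraNneq W0 => e.
  by apply/eqP/setP => w; rewrite -mem_enum e in_nil inE.
have -> : pdir R (inl v : T) :: edirs W = [seq pdir R (inl i : T) | i <- v :: enum W] by [].
apply: perm_map; apply: uniq_perm; rewrite ?enum_uniq //=.
  by rewrite mem_enum vW enum_uniq.
by move=> w; rewrite !(inE, mem_enum).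
Qed.

Definition upd z (k : T) (c : C) : T -> C := fun m => if m == k then c else z m.

(** Symmetry in S: s al and s be are both given the same value as an auxiliary element b j, and
    either one can then be cancelled against it. *)
Lemma Psi_relabel_s W A B al be j z y : al \in A -> be \in A -> al != be -> al \notin W -> be \notin W ->
  j \in B -> OmT (A :\ be)%SET (B :\ j)%SET z -> Ah (A :\ be)%SET (B :\ j)%SET z != 0 ->
  y (inl be) = z (inl al) -> agree (A :\ al :\ be)%SET (B :\ j)%SET z y ->
  Psi W (A :\ be)%SET (B :\ j)%SET z = Psi W (A :\ al)%SET (B :\ j)%SET y.
Proof.
move=> aA bA ab aW bW jB h a0 e [e1 e2].
pose u := upd (upd z (inl be) (z (inl al))) (inr j) (z (inl al)).
have uj : u (inr j) = z (inl al) by rewrite /u /upd eqxx.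
have ub : u (inl be) = z (inl al) by rewrite /u /upd /= eqxx.
have ua : u (inl al) = z (inl al) by rewrite /u /upd /=; case: ifP.
have ag1 : agree (A :\ be)%SET (B :\ j)%SET z u.
  by split=> k; rewrite !inE /u /upd => /andP[/negPf k1 kS] /=; rewrite -[_ == _]/(k == _) k1.
have h' : OmT A B u.
  have Oa : Omega (z (inl al)) by apply: h.1; rewrite !inE ab.
  split=> k kS; rewrite /u /upd /=; case: eqP => // /eqP k1; [apply: h.1|apply: h.2].
    by rewrite !inE kS andbT; apply: contraNneq k1 => ->.
  by rewrite !inE kS andbT; apply: contraNneq k1 => ->.
have e3 : Ah A B u = Ah (A :\ be)%SET (B :\ j)%SET z.
  by rewrite (Ah_cancel h' bA jB) ?uj ?ub //; symmetry; exact: Ah_local.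
have u0 : Ah A B u != 0 by rewrite e3.
rewrite (Psi_local W h a0 ag1) -(Psi_cancel h' u0 bA bW jB) ?uj ?ub //.
rewrite (Psi_cancel h' u0 aA aW jB) ?uj ?ua //.
apply: Psi_local; first exact: OmTD1.
  by rewrite -(Ah_cancel h' aA jB) ?uj ?ua.
split=> k; last by move=> kB; rewrite -ag1.2 // e2.
rewrite !inE => /andP[ka kA]; have [->|kb] := eqVneq k be; first by rewrite ub e.
by rewrite -ag1.1 ?e1 // !inE ?kb ?ka.
Qed.

(** Symmetry in B, with an auxiliary element s i in the same role. *)
Lemma Psi_relabel_b W A B al be i z y : al \in B -> be \in B -> al != be -> i \in A -> i \notin W ->
  OmT (A :\ i)%SET (B :\ be)%SET z -> Ah (A :\ i)%SET (B :\ be)%SET z != 0 ->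
  y (inr be) = z (inr al) -> agree (A :\ i)%SET (B :\ al :\ be)%SET z y ->
  Psi W (A :\ i)%SET (B :\ be)%SET z = Psi W (A :\ i)%SET (B :\ al)%SET y.
Proof.
move=> aB bB ab iA iW h a0 e [e1 e2].
pose u := upd (upd z (inr be) (z (inr al))) (inl i) (z (inr al)).
have ui : u (inl i) = z (inr al) by rewrite /u /upd eqxx.
have ub : u (inr be) = z (inr al) by rewrite /u /upd /= eqxx.
have ua : u (inr al) = z (inr al) by rewrite /u /upd /=; case: ifP.
have ag1 : agree (A :\ i)%SET (B :\ be)%SET z u.
  by split=> k; rewrite !inE /u /upd => /andP[/negPf k1 kS] /=; rewrite -[_ == _]/(k == _) k1.
have h' : OmT A B u.
  have Oa : Omega (z (inr al)) by apply: h.2; rewrite !inE ab.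
  split=> k kS; rewrite /u /upd /=; case: eqP => // /eqP k1; [apply: h.1|apply: h.2].
    by rewrite !inE kS andbT; apply: contraNneq k1 => ->.
  by rewrite !inE kS andbT; apply: contraNneq k1 => ->.
have e3 : Ah A B u = Ah (A :\ i)%SET (B :\ be)%SET z.
  by rewrite (Ah_cancel h' iA bB) ?ui ?ub //; symmetry; exact: Ah_local.
have u0 : Ah A B u != 0 by rewrite e3.
rewrite (Psi_local W h a0 ag1) -(Psi_cancel h' u0 iA iW bB) ?ui ?ub //.
rewrite (Psi_cancel h' u0 iA iW aB) ?ui ?ua //.
apply: Psi_local; first exact: OmTD1.
  by rewrite -(Ah_cancel h' iA aB) ?ui ?ua.
split=> k; first by move=> kA; rewrite -ag1.1 // e1.
rewrite !inE => /andP[ka kB]; have [->|kb] := eqVneq k be; first by rewrite ub e.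
by rewrite -ag1.2 ?e2 // !inE ?kb ?ka.
Qed.

Lemma line_Q (F : (T -> C) -> C) z v : Q pnT F z -> Q nmo (fun h : R[i]^o => F (z + h *: v)) 0.
Proof.
move=> hF; apply: (Q_compn nmV (phi := fun h : R[i]^o => z + h *: v)); last by rewrite scale0r addr0.
move=> k; apply: (Q_add nmV); first exact: Q_cst.
by apply: (Q_mul nmV (F := fun h : R[i]^o => h : C)); [exact: Q_id|exact: Q_cst].
Qed.

Lemma line_near z v P : near_at pnT z P -> near_at nmo 0 (fun h : R[i]^o => P (z + h *: v)).
Proof.
move=> [r r0 h]; have [s s0 sv] := small_radius pV v r0; exists s => // t ht; apply: h.
rewrite addrAC subrr add0r (vnZ pV); apply: le_lt_trans sv.
by rewrite ler_wpM2r ?(vn_ge0 pV) // ltW // -[t]subr0.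
Qed.

Lemma line_eq (F G : (T -> C) -> C) z v y w : Q pnT F z ->
  near_at nmo 0 (fun h : R[i]^o => F (z + h *: v) = G (y + h *: w)) -> dd F z v = dd G y w.
Proof.
move=> hF e.
have pull (H : (T -> C) -> C) p d : dd (fun h : R[i]^o => H (p + h *: d)) 0 1 = dd H p d.
  have := @dd_pull _ _ _ (fun h : R[i]^o => p + h *: d) (fun c => c *: d) H 1 _.
  move=> /(_ _) /(congr1 (fun g => g 0)) -> //; first by rewrite scale0r addr0 scale1r.
  by move=> x t; rewrite scalerDl scalerA addrA.
by rewrite -pull -[RHS]pull; apply: (dd_ext nmV 1 e); exact: line_Q.
Qed.

Section Core.
Variables (W A : {set I}) (al be : I) (z0 z1 z2 : T -> C) (beta : C).
Hypothesis aA : al \in A.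
Hypothesis bA : be \in A.
Hypothesis ab : al != be.
Hypothesis aW : al \notin W.
Hypothesis bW : be \notin W.
Hypothesis h0 : OmT A A z0.
Hypothesis nz : Ah A A z0 != 0.
Hypothesis z0al : z0 (inl al) = beta.
Hypothesis z0br : z0 (inr be) = beta.
Hypothesis z0bl : z0 (inl be) = - beta.
Hypothesis z0ar : z0 (inr al) = - beta.
Hypothesis z1l : z1 (inl be) = beta.
Hypothesis z1r : z1 (inr be) = beta.
Hypothesis z1o : agree (A :\ al :\ be)%SET (A :\ al :\ be)%SET z0 z1.
Hypothesis z2l : z2 (inl be) = - beta.
Hypothesis z2r : z2 (inr be) = - beta.
Hypothesis z2o : agree (A :\ al :\ be)%SET (A :\ al :\ be)%SET z0 z2.

Let bal : (be == al) = false. Proof. by rewrite eq_sym; apply/negbTE. Qed.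

Lemma good_near v : near_at nmo 0 (fun h : R[i]^o => OmT A A (z0 + h *: v) /\ Ah A A (z0 + h *: v) != 0).
Proof.
apply: (@line_near z0 v (fun y => OmT A A y /\ Ah A A y != 0)); apply: nearI; first exact: OmT_near.
by apply: (Q_neq pV nz); exact: Ah_Q.
Qed.

Lemma ptE z v h k : (z + h *: v) k = z k + h * v k :> C.
Proof. by []. Qed.

(** While s al moves, s be and b al keep the common value -beta and cancel. What remains is s al =
    beta + h against b be = beta, and s al takes the name of s be, which is the configuration z1. *)
Lemma core1 : dd (Psi W A A) z0 (pdir R (inl al : T)) =
  dd (Psi W (A :\ al)%SET (A :\ al)%SET) z1 (pdir R (inl be : T)).
Proof.
apply: line_eq; first exact: Psi_Q.
apply: nearS (good_near (pdir R (inl al : T))) => h [hO hn].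
set y := z0 + _.
have yE k : y k = z0 k + h * (k == inl al)%:R by [].
have yb : y (inl be) = y (inr al) by rewrite !yE /= -[_ == _]/(be == al) bal z0bl z0ar.
rewrite (Psi_cancel hO hn bA bW aA yb).
apply: Psi_relabel_s => //.
- exact: OmTD1.
- by rewrite -(Ah_cancel hO bA aA yb).
- by rewrite !ptE /pdir !eqxx !mulr1 z1l z0al.
split=> k kS; rewrite !ptE /pdir /= ?mulr0 ?addr0.
  have := kS; rewrite !inE => /andP[kb /andP[ka _]].
  by rewrite -[inl k == inl al]/(k == al) -[inl k == inl be]/(k == be) (negPf ka) (negPf kb) !mulr0 !addr0 z1o.1.
have [->|kb] := eqVneq k be; first by rewrite z1r z0br.
by rewrite z1o.2 // !inE kb; move: kS; rewrite !inE => /andP[-> ->].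
Qed.

(** While s be moves, s al and b be keep the common value beta and cancel; b al takes the name of b
    be, which is the configuration z2. *)
Lemma core2 : dd (Psi W A A) z0 (pdir R (inl be : T)) =
  dd (Psi W (A :\ al)%SET (A :\ al)%SET) z2 (pdir R (inl be : T)).
Proof.
apply: line_eq; first exact: Psi_Q.
apply: nearS (good_near (pdir R (inl be : T))) => h [hO hn].
set y := z0 + _.
have yE k : y k = z0 k + h * (k == inl be)%:R by [].
have yb : y (inl al) = y (inr be) by rewrite !yE /= -[_ == _]/(al == be) (negPf ab) z0al z0br.
rewrite (Psi_cancel hO hn aA aW bA yb).
apply: Psi_relabel_b => //.
- exact: OmTD1.
- by rewrite -(Ah_cancel hO aA bA yb).
- by rewrite !ptE /pdir /= !mulr0 !addr0 z2r z0ar.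
split=> k kS; rewrite !ptE /pdir /= ?mulr0 ?addr0; last by rewrite z2o.2.
have [->|kb] := eqVneq k be; first by rewrite z2l z0bl.
by rewrite z2o.1 // !inE kb; move: kS; rewrite !inE => /andP[-> ->].
Qed.

(** When s be and b al move together they still cancel, and nothing left depends on the
    parameter. *)
Lemma core3 : dd (Psi W A A) z0 (pdir R (inl be : T) + pdir R (inr al : T)) = 0.
Proof.
rewrite -(dd_cst (Psi W (A :\ be)%SET (A :\ al)%SET z0) z0 0); apply: line_eq; first exact: Psi_Q.
apply: nearS (good_near (pdir R (inl be : T) + pdir R (inr al : T))) => h [hO hn].
set y := z0 + _.
have yE k : y k = z0 k + h * ((k == inl be)%:R + (k == inr al)%:R) by [].
have yb : y (inl be) = y (inr al) by rewrite !yE !eqxx /= addr0 add0r z0bl z0ar.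
rewrite (Psi_cancel hO hn bA bW aA yb); symmetry; apply: Psi_local; first exact: OmTD1.
  by rewrite -(Ah_cancel h0 bA aA) // z0bl z0ar.
split=> k; rewrite !inE => /andP[/negPf k1 _]; rewrite -/y yE /= -[_ == _]/(k == _) k1.
  by rewrite addr0 mulr0 addr0.
by rewrite add0r mulr0 addr0.
Qed.

(* Moving s al and moving b al (together with s be) leave A_E to a function in which
   al no longer occurs, by cancelling s be with b al or s al with b be. *)
Lemma Psi_core : dd (Psi W A A) z0 (pdir R (inr al : T) - pdir R (inl al : T)) =
  - (dd (Psi W (A :\ al)%SET (A :\ al)%SET) z1 (pdir R (inl be : T))
     + dd (Psi W (A :\ al)%SET (A :\ al)%SET) z2 (pdir R (inl be : T))).
Proof.
have hQ := Psi_Q W h0 nz.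
have := core3; rewrite (dd_addr pV) // core2 => /eqP; rewrite addrC addr_eq0 => /eqP e.
by rewrite (dd_addr pV) // e -[- pdir R (inl al)]scaleN1r (dd_scale pV) // core1; ring.
Qed.

End Core.
End Psi.

(** * The functions H~_D *)

Section HtildeFormula.
Variables (R : realType) (n : nat).
Local Notation C := R[i].
Local Notation nm := (@normc R).
Local Notation nmo := (nm : R[i]^o -> R).
Local Notation I := 'I_n.
Let nmV := @nm_vnorm R.
Local Notation T := (I + I)%type.
Local Notation pnT := (@pnorm R (I + I)%type).
Let pV := @pnorm_vnorm R (I + I)%type.
Variables (zeta Zr : C -> C).
Hypothesis ZrQ : forall t, Q nmo Zr t.
Hypothesis Zr0 : Zr 0 = 1.
Hypothesis zetaE : forall t, t != 0 -> zeta (1 + t) = Zr t / t.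

(* zeta (1 + t) is regular and nonzero at t. *)
Definition nice (t : C) : Prop := t != 0 /\ Zr t != 0.

Lemma nice_zeta t : nice t -> zeta (1 + t) != 0.
Proof. by move=> [t0 z0]; rewrite zetaE // mulf_neq0 ?invr_eq0. Qed.

Section ZetaQ.
Variables (V : lmodType C) (N : V -> R) (NN : vnorm N).

Lemma Q_zeta (G F : V -> C) a : (forall x, G x = 1 + F x) -> F a != 0 -> Q N F a ->
  Q N (fun x => zeta (G x)) a.
Proof.
move=> e f0 hF; apply: (@Q_ext _ _ _ NN (fun x => Zr (F x) / F x)).
  by apply: nearS (Q_neq NN f0 hF) => x hx; rewrite e zetaE.
by apply: (Q_div NN) => //; apply: (Q_comp NN).
Qed.

Lemma near_nice (F : V -> C) a : nice (F a) -> Q N F a -> near_at N a (fun x => nice (F x)).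
Proof.
move=> [f0 z0] hF; apply: (nearI (Q_neq NN f0 hF)).
exact: (Q_neq NN z0 (Q_comp NN hF (ZrQ _))).
Qed.

End ZetaQ.

Variables (E : weierstrass) (M : nat).
Hypothesis Mp : prime M.
Variables (Omega : set C) (AE : AE_family R n).
Hypothesis hAE : is_AE zeta E M Omega AE.
Hypothesis ON : forall z, Omega z -> Omega (- z).
Implicit Types (A B D W : {set I}).

(* A_{E,1} = diag * offdiag; diag carries the factors zeta(1 + s i + b i), i in D,
   which are singular at B = A but constant along the variables of W. *)
Definition diag A D (w : T -> C) : C :=
  \prod_(i in A) (if i \in D then zeta (1 + w (inl i) + w (inr i)) else 1).

Definition offdiag A D (w : T -> C) : C :=
  \prod_(i in A) \prod_(j in A | ~~ ((i == j) && (i \in D))) zeta (1 + w (inl i) + w (inr j))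
  / (sqrtZ_lt zeta A (w \o inl) * sqrtZ_le zeta A (w \o inr)).

Lemma AE1_diag A D s b : AE1 zeta A A s b = diag A D (pt s b) * offdiag A D (pt s b).
Proof.
rewrite /AE1 /YE invf_div /offdiag mulrA; congr (_ / _).
rewrite /Zz /diag -big_split; apply: eq_bigr => i iA /=; case: ifP => iD.
  rewrite (bigD1 i iA) /=; congr (_ * _); apply: eq_bigl => j.
  by rewrite andbT (eq_sym i j).
by rewrite mul1r; apply: eq_bigl => j; rewrite andbF andbT.
Qed.

(** Regularity at y of the factors of the contribution of one set D. Unlike [generic] it does not
    range over all D, so it can be established set by set near a collision. *)
Definition good A D (y : I -> C) : Prop :=
  [/\ forall i, i \in A -> Omega (y i),
      forall i j, i \in A -> j \in A -> nice (y i + y j) /\ nice (- y i - y j),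
      forall i j, i \in A -> j \in A -> i != j -> nice (y i - y j),
      forall i, i \in A -> V E M [set i]%SET y != 0 /\ V E M [set i]%SET (\- y) != 0
    & Ah AE A A (pt (flip D y) y) != 0].

Lemma good_flip A D y i j : good A D y -> i \in A -> j \in A -> i != j -> nice (flip D y i + flip D y j).
Proof.
move=> [_ h1 h2 _ _] iA jA ij; rewrite /flip; case: ifP => _; case: ifP => _.
- by have [] := h1 _ _ iA jA.
- by rewrite addrC; apply: h2 => //; rewrite eq_sym.
- exact: h2.
- by have [] := h1 _ _ iA jA.
Qed.

Lemma good_flipr A D y i j : good A D y -> i \in A -> j \in A -> ~~ ((i == j) && (i \in D)) ->
  nice (flip D y i + y j).
Proof.
move=> [_ h1 h2 _ _] iA jA; rewrite /flip; case: ifP => iD; last by have [] := h1 _ _ iA jA.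
by rewrite andbT => ij; rewrite addrC; apply: h2; rewrite // eq_sym.
Qed.

Lemma good_OmT A D y : good A D y -> OmT Omega A A (pt (flip D y) y).
Proof.
move=> [h _ _ _ _]; split=> i iA /=; last exact: h.
by rewrite /flip; case: ifP => _; [apply: ON|]; apply: h.
Qed.

Lemma Q_pnT (k : T) a : Q pnT (fun w => w k) a.
Proof. exact: Q_coord. Qed.

Lemma offdiag_Q A D y : good A D y ->
  Q pnT (offdiag A D) (pt (flip D y) y) /\ offdiag A D (pt (flip D y) y) != 0.
Proof.
move=> g; have qz (k l : T) a : a k + a l != 0 -> Q pnT (fun w => zeta (1 + w k + w l)) a.
  move=> h; apply: (Q_zeta pV (F := fun w : T -> C => w k + w l)) => [x||]; rewrite ?addrA //.
  by apply: (Q_add pV); exact: Q_pnT.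
have n1 i j : i \in A -> j \in A -> (i < j)%N -> nice (flip D y i + flip D y j).
  by move=> iA jA ij; apply: (good_flip g) => //; apply: contraTneq ij => ->; rewrite ltnn.
have n2 i j : i \in A -> j \in A -> nice (y i + y j).
  by move=> iA jA; case: g => _ h _ _ _; have [] := h _ _ iA jA.
have z1 : sqrtZ_lt zeta A (flip D y) != 0.
  by apply/prodf_neq0 => i iA; apply/prodf_neq0 => j /andP[jA ij]; rewrite -addrA; apply/nice_zeta/n1.
have z2 : sqrtZ_le zeta A y != 0.
  by apply/prodf_neq0 => i iA; apply/prodf_neq0 => j /andP[jA ij]; rewrite -addrA; apply/nice_zeta/n2.
split.
  apply: (Q_div pV); first by rewrite mulf_neq0.
    apply: (Q_prod pV) => i _ iA; apply: (Q_prod pV) => j _ /andP[jA ij]; apply: qz.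
    by have [] := good_flipr g iA jA ij.
  apply: (Q_mul pV); apply: (Q_prod pV) => i _ iA; apply: (Q_prod pV) => j _ /andP[jA ij].
    by apply: (qz (inl i) (inl j)); have [] := n1 i j iA jA ij.
  by apply: (qz (inr i) (inr j)); have [] := n2 i j iA jA.
rewrite /offdiag mulf_neq0 ?invr_eq0 ?mulf_neq0 //.
apply/prodf_neq0 => i iA; apply/prodf_neq0 => j /andP[jA ij]; rewrite -addrA; apply: nice_zeta.
exact: (good_flipr g).
Qed.

Definition AE3h A (w : T -> C) : C := AE3 E M A A (w \o inl) (w \o inr).

Lemma Vfactor_Q (V0 : lmodType C) (N : V0 -> R) (NN : vnorm N) (F : V0 -> C) a : Q N F a ->
  Q N (fun w => 1 - (lambda_p R E M)%:C * cpow M%:R (- (1 / 2%:R) - F w)) a.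
Proof.
move=> hF; apply: (Q_sub NN); first exact: Q_cst.
apply: (Q_mul NN); first exact: Q_cst.
by apply: (Q_cpow NN); apply: (Q_sub NN) => //; exact: Q_cst.
Qed.

Lemma V1E (i : I) (y : I -> C) : V E M [set i]%SET y = 1 - (lambda_p R E M)%:C * cpow M%:R (- (1 / 2%:R) - y i).
Proof. by rewrite /V finset.big_set1. Qed.

Lemma AE3h_Q A D y : good A D y ->
  Q pnT (AE3h A) (pt (flip D y) y) /\ AE3h A (pt (flip D y) y) != 0.
Proof.
move=> [_ _ _ g _].
have e w : AE3h A w = V E M A (w \o inr) / V E M A (w \o inl).
  by rewrite /AE3h /AE3 primes_prime // big_seq1.
have v1 : V E M A y != 0.
  by apply/prodf_neq0 => i iA; have [] := g i iA; rewrite V1E.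
have v2 : V E M A (flip D y) != 0.
  apply/prodf_neq0 => i iA; have [] := g i iA; rewrite !V1E /flip.
  by case: ifP.
have -> : AE3h A = fun w => V E M A (w \o inr) / V E M A (w \o inl) by apply/funext.
split; last by rewrite mulf_neq0 ?invr_eq0.
apply: (Q_div pV) => //; apply: (Q_prod pV) => i _ iA.
  by apply: (Vfactor_Q pV (F := fun w : T -> C => w (inr i))); exact: Q_pnT.
by apply: (Vfactor_Q pV (F := fun w : T -> C => w (inl i))); exact: Q_pnT.
Qed.

Lemma lim_dnbhs (g h : C -> C) : Q nmo h 0 -> near_at nmo 0 (fun e => e != 0 -> g e = h e) ->
  lim (g @ 0^') = h 0.
Proof.
move=> hQ [r r0 hr]; apply/cvg_lim => //; apply/cvgCP => e e0.
have [s s0 hs] := Q_cont nmV e0 hQ.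
apply/dnbhsCP; exists (Num.min r s); first by rewrite lt_min r0.
by move=> w w0; rewrite lt_min => /andP[wr ws]; rewrite hr //; exact: hs.
Qed.

(** The variables of W lie outside D, so differentiating in y' is differentiating along the
    s-variables. The second form freezes the entries of D, which makes [diag] a constant in y'. *)
Lemma dlg_flip (F : (T -> C) -> C) D W (y b : I -> C) : (forall w, w \in W -> w \notin D) ->
  dlog W (fun y' => F (pt (flip D y') b)) y = dlg (edirs R W) F (pt (flip D y) b) /\
  dlog W (fun y' => F (pt (fun i => if i \in D then - y i else y' i) b)) y =
    dlg (edirs R W) F (pt (flip D y) b).
Proof.
move=> WD; rewrite !dlogE.
have eD : edirs R W = map (fun v => pt v (fun=> 0)) [seq pdir R i | i <- enum W].
  rewrite /edirs -map_comp; apply: eq_map => i /=; apply/funext => -[k|k] //=.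
have wD v : v \in [seq pdir R i | i <- enum W] -> forall i, i \in D -> v i = 0.
  move=> /mapP[w]; rewrite mem_enum => wW -> i iD; rewrite /pdir.
  by case: eqP => // iw; move: (WD w wW); rewrite -iw iD.
split; rewrite eD.
  rewrite (@dlg_pull _ _ _ (fun y' => pt (flip D y') b) (fun v => pt v (fun=> 0))) //.
  move=> v /wD hv x t; apply/funext => -[k|k] /=.
    change ((if k \in D then - (x k + t * v k) else x k + t * v k) =
            (if k \in D then - x k else x k) + t * v k).
    by case: ifP => kD //; rewrite hv // mulr0 !addr0.
  change (b k = b k + t * 0); by rewrite mulr0 addr0.
rewrite (@dlg_pull _ _ _ (fun y' : I -> C => pt (fun i => if i \in D then - y i else y' i) b) (fun v => pt v (fun=> 0))) //.
move=> v /wD hv x t; apply/funext => -[k|k] /=.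
  change ((if k \in D then - y k else x k + t * v k) =
          (if k \in D then - y k else x k) + t * v k).
  by case: ifP => kD //; rewrite hv // mulr0 !addr0.
change (b k = b k + t * 0); by rewrite mulr0 addr0.
Qed.

(** At B = A + e with e nonzero the three factors multiply to A_E, so their logarithmic derivatives
    add up to that of A_E, which is regular at e = 0. *)
Lemma Htilde_formula A D W y : D \subset A -> W != finset.set0 -> W \subset (A :\: D)%SET ->
  good A D y ->
  Htilde zeta E M AE A D W y = HD zeta D W y + Psi AE W A A (pt (flip D y) y).
Proof.
move=> DA W0 WA g; have OT := good_OmT g.
have WD i : i \in W -> i \notin D by move=> /(fintype.subsetP WA); rewrite inE => /andP[].
rewrite /Htilde /Psi (negPf W0); congr (_ + _).
set s := flip D y; set w0 := pt s y.
pose v : T -> C := pt (fun=> 0) (fun=> 1).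
have wE e : w0 + e *: v = pt s (fun i => y i + e).
  apply/funext => -[k|k] /=; first by change (s k + e * 0 = s k); rewrite mulr0 addr0.
  by change (y k + e * 1 = y k + e); rewrite mulr1.
have w00 : w0 + 0 *: v = w0 by rewrite scale0r addr0.
have [qO nO] := offdiag_Q g; have [q3 n3] := AE3h_Q g.
have qA := Ah_Q hAE OT; have nA : Ah AE A A w0 != 0 by case: g.
have lineQ (F : (T -> C) -> C) : Q pnT F w0 -> F w0 != 0 ->
    Q nmo (fun e : R[i]^o => dlg (edirs R W) F (w0 + e *: v)) 0.
  by move=> qF nF; apply: line_Q; apply: (dlg_Q pV).
have nearL (F : (T -> C) -> C) : Q pnT F w0 -> F w0 != 0 ->
    near_at nmo 0 (fun e : R[i]^o => Q pnT F (w0 + e *: v) /\ F (w0 + e *: v) != 0).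
  move=> qF nF; apply: (@line_near _ _ w0 v (fun w => Q pnT F w /\ F w != 0)).
  exact: nearI (Q_near pV qF) (Q_neq pV nF qF).
have zn : near_at nmo 0 (fun e : R[i]^o => e != 0 -> zeta (1 + e) != 0).
  have : near_at nmo 0 (fun e : R[i]^o => Zr e != 0) by apply: (Q_neq nmV) => //; rewrite Zr0 oner_eq0.
  by apply: nearS => e ze e0; apply: nice_zeta.
have sD i : i \in D -> s i = - y i by move=> iD; rewrite /s /flip iD.
(* For i in D the argument is 1 - y i + (y i + e) = 1 + e, whatever the variables of W are. *)
have dgE e w : (forall i, i \in D -> w (inl i) = - y i) -> (forall i, w (inr i) = y i + e) ->
    diag A D w = \prod_(i in A) (if i \in D then zeta (1 + e) else 1).
  move=> h1 h2; apply: eq_bigr => i iA; case: ifP => // iD.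
  by rewrite h1 // h2; congr zeta; ring.
pose A1 (w : T -> C) := AE1 zeta A A (w \o inl) (w \o inr).
have ptE w : pt (w \o inl) (w \o inr) = w :> (T -> C) by apply/funext => -[].
have A1E w : A1 w = diag A D w * offdiag A D w by rewrite /A1 (AE1_diag A D) ptE.
have ad3 : AD (AE3 E M) A D W y = dlg (edirs R W) (AE3h A) w0.
  rewrite -[in RHS]w00; apply: (@lim_dnbhs _ (fun e => dlg (edirs R W) (AE3h A) (w0 + e *: v))); first exact: lineQ.
  apply: nearT => e _; rewrite wE; have [<- _] := @dlg_flip (AE3h A) D W y (fun i => y i + e) WD.
  by [].
have d1 e : e != 0 -> zeta (1 + e) != 0 -> Q pnT (offdiag A D) (w0 + e *: v) ->
    offdiag A D (w0 + e *: v) != 0 ->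
    dlg (edirs R W) A1 (w0 + e *: v) = dlg (edirs R W) (offdiag A D) (w0 + e *: v).
  move=> e0 ze qo no; rewrite wE.
  have [_ <-] := @dlg_flip A1 D W y (fun i => y i + e) WD.
  (* With D frozen, [diag] is this nonzero constant, which the logarithmic derivative drops. *)
  set c := \prod_(i in A) (if i \in D then zeta (1 + e) else 1).
  have c0 : c != 0 by apply/prodf_neq0 => i _; case: ifP; rewrite ?oner_eq0.
  rewrite -(dlg_cstM pV (edirs R W) c0) -?wE // wE.
  have [_ <-] := @dlg_flip (fun w => c * offdiag A D w) D W y (fun i => y i + e) WD.
  congr (dlog W _ y); apply/funext => y'; rewrite A1E; congr (_ * _).
  by apply: dgE => //= i ->.
have ad1 : AD (AE1 zeta) A D W y = dlg (edirs R W) (offdiag A D) w0.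
  rewrite -[in RHS]w00; apply: (@lim_dnbhs _ (fun e => dlg (edirs R W) (offdiag A D) (w0 + e *: v))); first exact: lineQ.
  apply: nearS (nearI zn (nearL _ qO nO)) => e [ze [qo no]] e0.
  rewrite -d1 //; last exact: ze.
  by rewrite wE; have [<- _] := @dlg_flip A1 D W y (fun i => y i + e) WD.
(* A_{E,2} is A_E divided by the other two factors, so their contributions return here with the
   opposite sign and cancel in the final sum. *)
have ad2 : AD (AE2 zeta E M AE) A D W y =
    dlg (edirs R W) (Ah AE A A) w0 - (dlg (edirs R W) (offdiag A D) w0 + dlg (edirs R W) (AE3h A) w0).
  rewrite -[in RHS]w00; apply: (@lim_dnbhs _ (fun e => dlg (edirs R W) (Ah AE A A) (w0 + e *: v)
    - (dlg (edirs R W) (offdiag A D) (w0 + e *: v) + dlg (edirs R W) (AE3h A) (w0 + e *: v)))).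
    by apply: (Q_sub nmV); [|apply: (Q_add nmV)]; apply: lineQ.
  apply: nearS (nearI zn (nearI (nearL _ qO nO) (nearI (nearL _ q3 n3) (nearL _ qA nA)))).
  move=> e [ze [[qo no] [[q3e n3e] [qAe nAe]]]] e0; have {}ze := ze e0.
  have dw : diag A D (w0 + e *: v) != 0.
    by rewrite wE (dgE e) //=; apply/prodf_neq0 => i _; case: ifP; rewrite ?oner_eq0.
  have qd1 : Q pnT (diag A D) (w0 + e *: v).
    apply: (Q_prod pV) => i _ iA; case iD: (i \in D); last exact: Q_cst.
    apply: (Q_zeta pV (F := fun w : T -> C => w (inl i) + w (inr i))) => [x||]; first by rewrite addrA.
      change ((w0 + e *: v) (inl i) + (w0 + e *: v) (inr i) != 0).
      by rewrite wE; change (s i + (y i + e) != 0); rewrite sD // addKr.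
    by apply: (Q_add pV); exact: Q_pnT.
  have A1f : A1 = fun w => diag A D w * offdiag A D w by apply/funext.
  have qA1 : Q pnT A1 (w0 + e *: v) by rewrite A1f; apply: (Q_mul pV).
  have nA1 : A1 (w0 + e *: v) != 0 by rewrite A1E mulf_neq0.
  rewrite -d1 //.
  rewrite -(dlg_mul pV) //.
  have qm : Q pnT (fun w => A1 w * AE3h A w) (w0 + e *: v) by apply: (Q_mul pV).
  have nm0 : A1 (w0 + e *: v) * AE3h A (w0 + e *: v) != 0 by rewrite mulf_neq0.
  rewrite -(dlg_inv pV) // -(dlg_mul pV) //; last 2 first.
  - exact: (Q_inv pV).
  - by rewrite invr_eq0.
  rewrite wE; pose A2 (w : T -> C) := Ah AE A A w * (A1 w * AE3h A w)^-1.
  by have [<- _] := @dlg_flip A2 D W y (fun i => y i + e) WD.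
by rewrite ad1 ad2 ad3; ring.
Qed.

End HtildeFormula.

(** * Sums over set partitions *)

Section PartitionSums.
Variables (I : finType) (F : comPzRingType).
Implicit Types (T B W : {set I}) (P : {set {set I}}) (h : {set I} -> F).

Definition PS T h : F := \sum_(P | finset.partition P T) \prod_(W in P) h W.

Lemma partition_block T B P : B != finset.set0 -> B \subset T ->
  finset.partition P (T :\: B) -> B \notin P /\ finset.partition (B |: P)%SET T.
Proof.
move=> B0 BT hP; have [/eqP cP tP nP] := and3P hP.
have BP : B \notin P.
  apply/negP => BP; have [x xB] := set0Pn _ B0.
  have : x \in finset.cover P by apply/finset.bigcupP; exists B.
  by rewrite cP inE xB.
split=> //; apply/and3P; split.
- rewrite /finset.cover big_setU1 //= -/(finset.cover P) cP; apply/eqP/setP => x; rewrite !inE.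
  by case: (boolP (x \in B)) => //= /(fintype.subsetP BT) ->.
- rewrite /finset.trivIset /finset.cover !big_setU1 //= -/(finset.cover P) (eqP tP) cP.
  suff -> : (B :|: T :\: B)%SET = T by rewrite -[X in _ == X](cardsID B T) (finset.setIidPr BT).
  by apply/setP => x; rewrite !inE; case: (boolP (x \in B)) => //= /(fintype.subsetP BT) ->.
- by rewrite !inE negb_or eq_sym B0.
Qed.

Lemma partition_unblock T B P : B \in P -> finset.partition P T ->
  finset.partition (P :\ B)%SET (T :\: B).
Proof.
move=> BP /and3P[/eqP cP tP nP]; apply/and3P; split.
- apply/eqP/setP => x; rewrite inE -cP; apply/finset.bigcupP/andP => [[W]|[xB /finset.bigcupP[W WP xW]]].
    rewrite !inE => /andP[WB WP] xW; split; last by apply/finset.bigcupP; exists W.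
    have /finset.trivIsetP /(_ _ _ WP BP WB) := tP.
    by rewrite disjoint_subset => /fintype.subsetP /(_ _ xW).
  by exists W => //; rewrite !inE WP andbT; apply: contraNneq xB => <-.
- by apply/finset.trivIsetP => W W'; rewrite !inE => /andP[_ h1] /andP[_ h2]; move/finset.trivIsetP: tP; apply.
- by rewrite !inE negb_and nP orbT.
Qed.

Lemma sum_block T B (G : {set {set I}} -> F) : B != finset.set0 -> B \subset T ->
  \sum_(P | finset.partition P T && (B \in P)) G P =
  \sum_(P | finset.partition P (T :\: B)) G (B |: P)%SET.
Proof.
move=> B0 BT; rewrite (reindex_onto (fun P => B |: P)%SET (fun P => P :\ B)%SET) /=; last first.
  by move=> P /andP[_ BP]; rewrite finset.setD1K.
apply: eq_bigl => P; apply/andP/idP => [[/andP[hP _] /eqP e]|hP].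
  by rewrite -e; apply: partition_unblock => //; rewrite !inE eqxx.
have [BP hP'] := partition_block B0 BT hP.
by rewrite hP' !inE eqxx /= setU1K.
Qed.

Lemma prod_block T B P h : B != finset.set0 -> B \subset T -> finset.partition P (T :\: B) ->
  \prod_(W in (B |: P)%SET) h W = h B * \prod_(W in P) h W.
Proof. by move=> B0 BT hP; have [BP _] := partition_block B0 BT hP; rewrite big_setU1. Qed.

Lemma PS_ext T h h' : (forall W, W != finset.set0 -> W \subset T -> h W = h' W) -> PS T h = PS T h'.
Proof.
move=> e; apply: eq_bigr => P /and3P[/eqP cP _ nP]; apply: eq_bigr => W WP; apply: e.
  by apply: contraNneq nP => <-.
by rewrite -cP; apply: (finset.bigcup_sup W).
Qed.

(** Partitions are sorted by the block which contains i. *)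
Lemma PS_U1 T i h : i \notin T ->
  PS (i |: T)%SET h = \sum_(B : {set I} | B \subset T) h (i |: B)%SET * PS (T :\: B) h.
Proof.
move=> iT; have -> : PS (i |: T)%SET h =
   \sum_(P | finset.partition P (i |: T)%SET) \sum_(W | (W \in P) && (i \in W)) \prod_(W in P) h W.
  apply: eq_bigr => P hP; have [/eqP cP tP nP] := and3P hP.
  rewrite [RHS](big_pred1 (finset.pblock P i)) // => W /=.
  have ic : i \in finset.cover P by rewrite cP !inE eqxx.
  apply/andP/eqP => [[WP iW]|->]; first by rewrite (def_pblock tP WP iW).
  by rewrite pblock_mem // mem_pblock.
rewrite (exchange_big_dep (fun W : {set I} => (i \in W) && (W \subset i |: T)%SET)) /=; last first.
  move=> P W hP /andP[WP ->] /=; case/and3P: hP => /eqP <- _ _; exact: (finset.bigcup_sup W).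
rewrite (reindex_onto (fun B => i |: B)%SET (fun W => W :\ i)%SET) /=; last first.
  by move=> W /andP[iW _]; rewrite finset.setD1K.
apply: eq_big => [B|B].
  rewrite !inE eqxx /=; apply/andP/idP => [[h1 /eqP <-]|BT].
    by rewrite subDset.
  have iB : i \notin B by apply: contra iT => /(fintype.subsetP BT).
  by rewrite finset.setUS // setU1K.
move=> /andP[/andP[_ BT] /eqP e].
have iB : i \notin B by rewrite -e !inE eqxx.
have B0 : (i |: B)%SET != finset.set0 by apply/set0Pn; exists i; rewrite !inE eqxx.
rewrite (eq_bigl (fun P => finset.partition P (i |: T)%SET && ((i |: B)%SET \in P))); last first.
  by move=> P; rewrite !inE eqxx andbT.
rewrite sum_block // big_distrr /=.
have -> : ((i |: T) :\: (i |: B) = T :\: B)%SET.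
  apply/setP => x; rewrite !inE; case: (eqVneq x i) => [->|] //=; by rewrite (negPf iT) andbF.
apply: eq_bigr => P hP; rewrite (@prod_block (i |: T)%SET) //.
suff -> : ((i |: T) :\: (i |: B) = T :\: B)%SET by [].
apply/setP => x; rewrite !inE; case: (eqVneq x i) => [->|] //=; by rewrite (negPf iT) andbF.
Qed.

(** The product rule for [PS], with g W the derivative of the differentiated block. The right side
    has the shape of [PS_U1] without the block {i} alone; at the collision that missing term comes
    from the factors in front of the partition sum. *)
Lemma PS_leibniz T h g :
  \sum_(P | finset.partition P T) \sum_(W in P) g W * \prod_(W' in (P :\ W)%SET) h W' =
  \sum_(W : {set I} | (W \subset T) && (W != finset.set0)) g W * PS (T :\: W) h.
Proof.
rewrite (exchange_big_dep (fun W : {set I} => (W \subset T) && (W != finset.set0))) /=; last first.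
  move=> P W /and3P[/eqP <- _ nP] WP; apply/andP; split; [exact: (finset.bigcup_sup W)|by apply: contraNneq nP => <-].
apply: eq_bigr => B /andP[BT B0]; rewrite sum_block // big_distrr /=.
apply: eq_bigr => P hP; have [BP _] := partition_block B0 BT hP.
by rewrite setU1K.
Qed.

End PartitionSums.

(** * Poles of the terms of J_E *)

Section Poles.
Variables (R : realType).
Local Notation C := R[i].
Local Notation nm := (@normc R).
Local Notation nmo := (nm : R[i]^o -> R).
Let nmV := @nm_vnorm R.
Implicit Types (f g h u : R[i]^o -> C) (a r l : R[i]^o).

Definition near' z0 (P : R[i]^o -> Prop) : Prop := near_at nmo z0 (fun z => z != z0 -> P z).

Lemma near'I z0 P P' : near' z0 P -> near' z0 P' -> near' z0 (fun z => P z /\ P' z).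
Proof. by move=> h1 h2; apply: nearS (nearI h1 h2) => z [k1 k2] zz; split; [exact: k1|exact: k2]. Qed.

Lemma near'S z0 P P' : (forall z, P z -> P' z) -> near' z0 P -> near' z0 P'.
Proof. by move=> h; apply: nearS => z k zz; apply/h/k. Qed.

Lemma near'W z0 P : near_at nmo z0 P -> near' z0 P.
Proof. by apply: nearS. Qed.

Lemma near'_all (T : finType) z0 (P : T -> R[i]^o -> Prop) :
  (forall i, near' z0 (P i)) -> near' z0 (fun z => forall i, P i z).
Proof. by move=> h; apply: nearS (near_all h) => z hz zz i; apply: hz. Qed.

(* A pole of order at most two at z0 with residue r. *)
Definition pol f z0 r : Prop := exists h : R[i]^o -> C,
  [/\ Q nmo h z0, near' z0 (fun z => f z = h z / (z - z0) ^+ 2) & dd h z0 1 = r].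

Lemma pol_residue f z0 r : pol f z0 r -> is_residue f z0 r.
Proof.
move=> [h [hQ [s s0 hs] <-]]; rewrite dd1E; apply: residue_double => //.
by apply/dnbhsCP; exists s => // w w0 ws; apply: hs.
Qed.

Lemma pol_ext f g z0 r : near' z0 (fun z => g z = f z) -> pol f z0 r -> pol g z0 r.
Proof.
move=> e [h [hQ hn hd]]; exists h; split=> //.
by apply: near'S (near'I e hn) => z [-> ->].
Qed.

Lemma pol_cst z0 : pol (fun=> 0) z0 0.
Proof.
exists (fun=> 0); split; [exact: Q_cst| |exact: dd_cst].
by apply: near'W; apply: nearT => z; rewrite mul0r.
Qed.

Lemma pol_add f g z0 r s : pol f z0 r -> pol g z0 s -> pol (fun z => f z + g z) z0 (r + s).
Proof.
move=> [h [hQ hn hd]] [k [kQ kn kd]]; exists (fun z => h z + k z); split.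
- exact: (Q_add nmV).
- by apply: near'S (near'I hn kn) => z [-> ->]; rewrite mulrDl.
- by rewrite (dd_add nmV) // hd kd.
Qed.

Lemma pol_cM c f z0 r : pol f z0 r -> pol (fun z => c * f z) z0 (c * r).
Proof.
move=> [h [hQ hn hd]]; exists (fun z => c * h z); split.
- by apply: (Q_mul nmV) => //; exact: Q_cst.
- by apply: near'S hn => z ->; rewrite mulrA.
- by rewrite (dd_mul nmV) // ?hd ?dd_cst ?mul0r ?addr0 //; exact: Q_cst.
Qed.

Lemma pol_sum (T : Type) (s : seq T) (P : pred T) (F : T -> R[i]^o -> C) (r : T -> C) z0 :
  (forall i, P i -> pol (F i) z0 (r i)) ->
  pol (fun z => \sum_(i <- s | P i) F i z) z0 (\sum_(i <- s | P i) r i).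
Proof.
move=> h; elim: s => [|i s IH].
  rewrite big_nil; apply: pol_ext (pol_cst z0); apply: near'W; apply: nearT => z; by rewrite big_nil.
rewrite big_cons; case Pi: (P i).
  by apply: pol_ext (pol_add (h i Pi) IH); apply: near'W; apply: nearT => z; rewrite big_cons Pi.
by apply: pol_ext IH; apply: near'W; apply: nearT => z; rewrite big_cons Pi.
Qed.

Lemma Q_idC a : Q nmo (fun z : R[i]^o => z : C) a.
Proof. exact: Q_id. Qed.

Lemma dd_id a : dd (fun z : R[i]^o => z : C) a 1 = 1.
Proof.
rewrite (@qd_dd _ _ _ nmV _ (fun _ v => v) a 1 1) ?subrr ?normc0 //.
by split=> // [x v _|x y _ _]; rewrite mul1r // subrr normc0 sqr_ge0.
Qed.

Lemma Q_affine (c e : C) a : Q nmo (fun z : R[i]^o => c * z + e) a.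
Proof.
apply: (Q_add nmV); last exact: Q_cst.
by apply: (Q_mul nmV (F' := fun z : R[i]^o => z : C)); [exact: Q_cst|exact: Q_idC].
Qed.

Lemma dd_affine (c e : C) a : dd (fun z : R[i]^o => c * z + e) a 1 = c.
Proof.
rewrite (dd_add nmV (F := fun z : R[i]^o => c * z)); last exact: Q_cst.
  rewrite dd_cst addr0 (dd_mul nmV (F' := fun z : R[i]^o => z : C)); [|exact: Q_cst|exact: Q_idC].
  by rewrite dd_id dd_cst mulr1 mul0r addr0.
by apply: (Q_mul nmV (F' := fun z : R[i]^o => z : C)); [exact: Q_cst|exact: Q_idC].
Qed.

Lemma pol1 u f z0 : Q nmo u z0 -> near' z0 (fun z => f z = u z / (z - z0)) -> pol f z0 (u z0).
Proof.
move=> uQ un; have sQ : Q nmo (fun z : R[i]^o => z - z0 : C) z0.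
  by apply: Q_ext (Q_affine 1 (- z0) z0) => //; apply: nearT => z; rewrite mul1r.
exists (fun z => (z - z0) * u z); split; first exact: (Q_mul nmV).
  case: un => r r0 hr; exists r => // z zr zz; rewrite (hr z zr zz).
  have zn : z - z0 != 0 by rewrite subr_eq0.
  by rewrite expr2 invfM mulrACA divff // mul1r.
rewrite (dd_mul nmV) // subrr mul0r add0r.
have -> : dd (fun z : R[i]^o => z - z0 : C) z0 1 = 1; last by rewrite mul1r.
rewrite -[RHS](dd_affine 1 (- z0) z0).
by apply: (dd_ext nmV) => //; apply: nearT => z; rewrite mul1r.
Qed.

(* f is regular and nonzero at a, with logarithmic derivative l there. *)
Definition ldr f a l : Prop := [/\ Q nmo f a, f a != 0 & dd f a 1 = l * f a].

Lemma ldr_ext f g a l : near_at nmo a (fun z => f z = g z) -> ldr f a l -> ldr g a l.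
Proof.
move=> e [q n d]; have fg := near_here nmV (P := fun z => f z = g z) e; split.
- apply: (Q_ext nmV) q; exact: e.
- by rewrite -fg.
- by rewrite -fg -d; symmetry; apply: (dd_ext nmV).
Qed.

Lemma ldr_mul f g a l m : ldr f a l -> ldr g a m -> ldr (fun z => f z * g z) a (l + m).
Proof.
move=> [fq fn fd] [gq gn gd]; split; [exact: (Q_mul nmV)|exact: mulf_neq0|].
by rewrite (dd_mul nmV) // fd gd; ring.
Qed.

Lemma ldr_cst (c : C) a : c != 0 -> ldr (fun=> c) a 0.
Proof. by move=> c0; split; [exact: Q_cst|exact: c0|rewrite dd_cst mul0r]. Qed.

Lemma ldr_inv f a l : ldr f a l -> ldr (fun z => (f z)^-1) a (- l).
Proof.
move=> [fq fn fd]; split; [exact: (Q_inv nmV)|by rewrite invr_eq0|].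
have q1 : Q nmo (fun z => (f z)^-1) a by exact: (Q_inv nmV).
have : dd (fun z => f z * (f z)^-1) a 1 = 0.
  rewrite -(dd_cst 1 a 1); apply: (dd_ext nmV); last exact: (Q_mul nmV).
  by apply: nearS (Q_neq nmV fn fq) => z zn; rewrite divff.
rewrite (dd_mul nmV) // fd mulfK // => /eqP; rewrite addr_eq0 => /eqP e.
by apply: (mulfI fn); rewrite e mulrCA mulfV // mulr1.
Qed.

Lemma ldr_div f g a l m : ldr f a l -> ldr g a m -> ldr (fun z => f z / g z) a (l - m).
Proof. by move=> hf hg; apply: ldr_mul => //; apply: ldr_inv. Qed.

Lemma ldr_prod (T : finType) (S : {set T}) (F : T -> R[i]^o -> C) (r : T -> C) a :
  (forall i, i \in S -> ldr (F i) a (r i)) ->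
  ldr (fun z => \prod_(i in S) F i z) a (\sum_(i in S) r i).
Proof.
move=> h; rewrite -big_filter.
apply: (@ldr_ext (fun z => \prod_(i <- [seq i <- index_enum T | i \in S]) F i z)).
  by apply: nearT => z; rewrite big_filter.
have {}h i : i \in [seq i <- index_enum T | i \in S] -> ldr (F i) a (r i).
  by rewrite mem_filter => /andP[iS _]; exact: h.
elim: [seq i <- index_enum T | i \in S] h => [|i s IH] h.
  rewrite big_nil; apply: ldr_ext (ldr_cst a (oner_neq0 _)); apply: nearT => z; by rewrite big_nil.
rewrite big_cons; apply: (@ldr_ext (fun z => F i z * \prod_(i <- s) F i z)).
  by apply: nearT => z; rewrite big_cons.
by apply: ldr_mul; [apply: h|apply: IH => j js; apply: h]; rewrite inE ?eqxx ?js ?orbT.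
Qed.

Lemma ldr_comp (g : C -> C) (c e : C) a : Q nmo g (c * a + e) -> g (c * a + e) != 0 ->
  ldr (fun z => g (c * z + e)) a (c * logder g (c * a + e)).
Proof.
move=> gq gn; have aq := Q_affine c e a; split=> //.
  exact: (Q_comp nmV (F := fun z : R[i]^o => c * z + e)).
rewrite (dd_comp nmV (F := fun z : R[i]^o => c * z + e)) // dd_affine /logder.
by rewrite mulrC -mulrA divfK.
Qed.

Lemma ldr_cpow (q : R) (c e : C) a : ldr (fun z => cpow q (c * z + e)) a (c * (ln q)%:C).
Proof.
have aq := Q_affine c e a; split; [exact: (Q_cpow nmV)|exact: cpow_neq0|].
by rewrite (dd_cpow nmV) // dd_affine; ring.
Qed.

End Poles.

(** * The logarithmic derivative of zeta near its pole *)

HB.lock Definition Lz (R : realType) (zeta : R[i] -> R[i]) (t : R[i]) : R[i] :=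
  logder zeta (1 + t).
HB.lock Definition L1 (R : realType) (zeta : R[i] -> R[i]) (t : R[i]) : R[i] :=
  derive1 (logder zeta) (1 + t).

Section LogDerivZeta.
Variables (R : realType).
Local Notation C := R[i].
Local Notation nm := (@normc R).
Local Notation nmo := (nm : R[i]^o -> R).
Let nmV := @nm_vnorm R.
Variables (zeta Zr : C -> C).
Hypothesis ZrQ : forall t, Q nmo Zr t.
Hypothesis zetaE : forall t, t != 0 -> zeta (1 + t) = Zr t / t.
Local Notation nice := (nice Zr).

Local Notation Lz := (Lz zeta).
Local Notation L1 := (L1 zeta).
(** The logarithmic derivative of t zeta(1 + t): the regular part of [Lz] at 0, where the polar part
    is -1/t. *)
Definition ell (t : C) : C := derive1 Zr t / Zr t.

Lemma Q_zeta1 (t : C) : t != 0 -> Q nmo zeta (1 + t).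
Proof.
move=> t0; have : Q nmo (fun u : R[i]^o => zeta (1 + (u - 1))) (1 + t).
  apply: (Q_zeta ZrQ zetaE nmV (F := fun u : R[i]^o => u - 1)) => //; first by rewrite addrAC subrr add0r.
  by apply: (Q_sub nmV); [exact: Q_idC|exact: Q_cst].
by apply: Q_ext => //; apply: nearT => u; congr zeta; rewrite addrC subrK.
Qed.

Lemma Zr_ldr t : Zr t != 0 -> ldr Zr t (ell t).
Proof. by move=> z; split=> //; rewrite dd1E /ell divfK. Qed.

Lemma id_ldr (t : C) : t != 0 -> ldr (fun z : R[i]^o => z : C) t t^-1.
Proof. by move=> t0; split; [exact: Q_idC|exact: t0|rewrite dd_id mulVf]. Qed.

Lemma dd_shift (g : C -> C) (t : C) : dd (fun u : R[i]^o => g (1 + u)) t 1 = derive1 g (1 + t).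
Proof.
rewrite -dd1E.
have := @dd_pull _ R[i]^o R[i]^o (fun u => 1 + u) id g 1 _.
by move=> /(_ (fun x t => addrA _ _ _)) /(congr1 (fun f => f t)).
Qed.

Lemma LzE t : nice t -> Lz t = ell t - t^-1.
Proof.
move=> [t0 z0]; have := ldr_div (Zr_ldr z0) (id_ldr t0) => -[_ nz e].
rewrite Lz.unlock /logder -dd_shift.
rewrite (dd_ext nmV (F := fun u : R[i]^o => zeta (1 + u)) (F' := fun u : R[i]^o => Zr u / u)).
- by rewrite e zetaE // mulfK.
- by apply: nearS (Q_neq nmV (F := fun z : R[i]^o => z : C) t0 (Q_idC t)) => u u0; rewrite zetaE.
- by apply: (Q_zeta ZrQ zetaE nmV (F := fun u : R[i]^o => u : C)) => //; exact: Q_idC.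
Qed.

Lemma ell_Q t : Zr t != 0 -> Q nmo ell t.
Proof.
move=> z0; apply: (Q_div nmV) => //.
by apply: (Q_ext nmV) (Q_dd nmV 1 (ZrQ t)); apply: nearT => u; rewrite dd1E.
Qed.

Lemma Lz_near t : nice t -> near_at nmo t (fun u => ell u - u^-1 = Lz u).
Proof.
by move=> h; apply: nearS (near_nice ZrQ nmV (F := fun u : R[i]^o => u : C) h (Q_idC t)) => u hu; rewrite LzE.
Qed.

Lemma Q_invC (t : C) : t != 0 -> Q nmo (fun u : R[i]^o => (u : C)^-1) t.
Proof. by move=> t0; apply: (Q_inv nmV (F := fun u : R[i]^o => u : C)) => //; exact: Q_idC. Qed.

Lemma Lz_Q t : nice t -> Q nmo Lz t.
Proof.
move=> h; apply: (Q_ext nmV) (Lz_near h) _; case: h => t0 z0.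
by apply: (Q_sub nmV); [exact: ell_Q|exact: Q_invC].
Qed.

Lemma L1_dd t : L1 t = dd Lz t 1.
Proof. by rewrite L1.unlock Lz.unlock -dd_shift. Qed.

Lemma L1_Q t : nice t -> Q nmo L1 t.
Proof. by move=> h; apply: (Q_ext nmV) (Q_dd nmV 1 (Lz_Q h)); apply: nearT => u; rewrite L1_dd. Qed.

Lemma L1E t : nice t -> L1 t = dd ell t 1 + (t ^+ 2)^-1.
Proof.
move=> h; have [t0 z0] := h; rewrite L1_dd -(dd_ext nmV 1 (Lz_near h)); last first.
  by apply: (Q_sub nmV); [exact: ell_Q|exact: Q_invC].
rewrite (dd_sub nmV); [|exact: ell_Q|exact: Q_invC].
have [_ _ ->] := ldr_inv (id_ldr t0); rewrite mulNr opprK.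
by rewrite expr2 invfM.
Qed.

Section Comp.
Variables (V : lmodType C) (N : V -> R) (NN : vnorm N).

Lemma Q_Lz (F : V -> C) a : nice (F a) -> Q N F a -> Q N (fun x => Lz (F x)) a.
Proof. by move=> h hF; apply: (Q_comp NN) => //; exact: Lz_Q. Qed.

Lemma Q_L1 (F : V -> C) a : nice (F a) -> Q N F a -> Q N (fun x => L1 (F x)) a.
Proof. by move=> h hF; apply: (Q_comp NN) => //; exact: L1_Q. Qed.

End Comp.

Lemma dd_Lz (c e a : C) : nice (c * a + e) -> dd (fun z : R[i]^o => Lz (c * z + e)) a 1 = c * L1 (c * a + e).
Proof.
move=> h; rewrite (dd_comp nmV (F := fun z : R[i]^o => c * z + e)).
- by rewrite dd_affine L1_dd dd1E mulrC.
- exact: Q_affine.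
- exact: Lz_Q.
Qed.

Lemma ldr_zeta (c e a : C) : nice (c * a + e) -> ldr (fun z : R[i]^o => zeta (1 + (c * z + e))) a (c * Lz (c * a + e)).
Proof.
move=> h; have [t0 z0] := h; rewrite Lz.unlock.
have hc := @ldr_comp R zeta c (1 + e) a; rewrite [c * a + (1 + e)]addrCA in hc.
have [q n d] : ldr (fun z => zeta (c * z + (1 + e))) a (c * logder zeta (1 + (c * a + e))).
  by apply: hc; [exact: Q_zeta1|exact: (nice_zeta zetaE)].
by apply: ldr_ext (And3 q n d); apply: nearT => z; rewrite addrCA.
Qed.

(** At the centre the affine function may vanish; it has no other zero, so a punctured neighbourhood
    avoids it and only the zeros of [Zr] must be excluded at z0. *)
Lemma near'_nice (c e z0 : C) : c != 0 -> Zr (c * z0 + e) != 0 ->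
  near' z0 (fun z : R[i]^o => nice (c * z + e)).
Proof.
move=> c0 z00; case: (eqVneq (c * z0 + e) 0) => [e0|ne]; last first.
  by apply: near'W; apply: (near_nice ZrQ nmV) => //; exact: Q_affine.
have := Q_neq nmV z00 (Q_comp nmV (F := fun z : R[i]^o => c * z + e) (Q_affine c e z0) (ZrQ _)).
apply: nearS => z hz zz; split=> //; apply: contraNneq zz => e1.
by apply/eqP/(mulfI c0)/(addIr e); rewrite e1 e0.
Qed.

End LogDerivZeta.

(** * The summands of J_E *)

Section Terms.
Variables (R : realType) (n : nat).
Local Notation C := R[i].
Local Notation nm := (@normc R).
Local Notation nmo := (nm : R[i]^o -> R).
Local Notation I := 'I_n.
Local Notation T := (I + I)%type.
Variables (zeta Zr : C -> C).
Hypothesis ZrQ : forall t, Q nmo Zr t.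
Hypothesis Zr0 : Zr 0 = 1.
Hypothesis zetaE : forall t, t != 0 -> zeta (1 + t) = Zr t / t.
Variables (E : weierstrass) (M : nat).
Hypothesis Mp : prime M.
Variables (Omega : set C) (AE : AE_family R n).
Hypothesis oO : open Omega.
Hypothesis cO : connected Omega.
Hypothesis O0 : Omega 0.
Hypothesis hAE : is_AE zeta E M Omega AE.
Hypothesis ON : forall z, Omega z -> Omega (- z).
Implicit Types (A B D W : {set I}) (x y : I -> C) (q : R).
Local Notation nice := (nice Zr).
Local Notation Lz := (Lz zeta).
Local Notation L1 := (L1 zeta).
Local Notation good := (good Zr E M Omega AE).

(** H_D of a singleton, with the value of its variable as a separate argument: elements of D can be
    peeled off while c stays fixed or moves. *)
Definition HDe D y (c : C) : C := \sum_(i in D) (Lz (c - y i) - Lz (c + y i)) - Lz (2 * c).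

Lemma HD1 D a y : HD zeta D [set a]%SET y = HDe D y (y a).
Proof.
by rewrite /HD enum_set1 /HDe Lz.unlock; congr (_ - _); apply: eq_bigr => i _; rewrite !addrA.
Qed.

Lemma pair_seq (a a' : I) (s : seq I) : perm_eq s [:: a; a'] -> s = [:: a; a'] \/ s = [:: a'; a].
Proof.
move=> h; case: s h (perm_size h) => [|b [|b' [|]]] // h _.
have bb : b \in [:: a; a'] by rewrite -(perm_mem h) inE eqxx.
move: bb h; rewrite !inE => /orP[]/eqP ->.
  rewrite perm_cons => /perm_mem /(_ b'); rewrite !inE eqxx => /esym/eqP ->; by left.
rewrite perm_sym -[[:: a; a']]/([:: a] ++ [:: a']) perm_catC /= perm_cons => /perm_mem /(_ a).
by rewrite !inE eqxx => /esym/eqP ->; right.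
Qed.

Lemma HD2 D a a' y : a != a' -> HD zeta D (a |: [set a'])%SET y = L1 (y a + y a').
Proof.
move=> aa; have : perm_eq (enum (a |: [set a'])%SET) [:: a; a'].
  apply: uniq_perm; rewrite ?enum_uniq //= ?inE ?aa // => k.
  by rewrite mem_enum !inE.
move=> /pair_seq; rewrite /HD L1.unlock => -[] ->; congr (derive1 _ _); first by rewrite addrA.
by rewrite addrAC addrA.
Qed.

Lemma HD3 D W y : (2 < #|W|)%N -> HD zeta D W y = 0.
Proof. by rewrite /HD cardE; case: (enum W) => [|? [|? [|? ?]]]. Qed.

Lemma HD0 D y : HD zeta D finset.set0 y = 0.
Proof. by rewrite /HD enum_set0. Qed.

Lemma small_set W : [\/ W = finset.set0, exists a, W = [set a]%SET,
   exists a a', a != a' /\ W = (a |: [set a'])%SET | (2 < #|W|)%N].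
Proof.
case E0 : #|W| => [|[|[|k]]]; last by constructor 4.
- by constructor 1; apply/eqP; rewrite -cards_eq0 E0.
- by constructor 2; apply/cards1P/eqP.
- constructor 3; have /cards2P[a [a' [aa ->]]] : #|W| == 2%N by apply/eqP.
  by exists a, a'.
Qed.

Lemma HDe_U1 D i y c : i \notin D -> HDe (i |: D)%SET y c = Lz (c - y i) - Lz (c + y i) + HDe D y c.
Proof. by move=> iD; rewrite /HDe big_setU1 //= addrA. Qed.

Lemma HDe_ext D y y' c : (forall i, i \in D -> y i = y' i) -> HDe D y c = HDe D y' c.
Proof. by move=> e; congr (_ - _); apply: eq_bigr => i /e ->. Qed.

Lemma HD_ext D W y y' : (forall i, i \in D -> y i = y' i) -> (forall i, i \in W -> y i = y' i) ->
  HD zeta D W y = HD zeta D W y'.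
Proof.
move=> hD hW; case: (small_set W) => [e|[a e]|[a [a' [aa e]]]|h]; try rewrite e in hW *.
- by rewrite !HD0.
- by rewrite !HD1 (HDe_ext _ hD) hW // !inE.
- by rewrite (HD2 _ _ aa) (HD2 _ _ aa) (hW a) ?(hW a') // !inE eqxx ?orbT.
- by rewrite !HD3.
Qed.

Section HDQ.
Variables (V : lmodType C) (N : V -> R) (NN : vnorm N).

Lemma HDe_Q D (y : V -> I -> C) (c : V -> C) a : (forall i, Q N (fun v => y v i) a) -> Q N c a ->
  (forall i, i \in D -> nice (c a - y a i) /\ nice (c a + y a i)) -> nice (2 * c a) ->
  Q N (fun v => HDe D (y v) (c v)) a.
Proof.
move=> yQ cQ h1 h2; apply: (Q_sub NN); last first.
  by apply: (Q_Lz ZrQ zetaE NN) => //; apply: (Q_mul NN) => //; exact: Q_cst.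
apply: (Q_sum NN) => i iD; have [? ?] := h1 i iD.
by apply: (Q_sub NN); apply: (Q_Lz ZrQ zetaE NN) => //; [apply: (Q_sub NN)|apply: (Q_add NN)].
Qed.

Lemma HD_Q D W (y : V -> I -> C) a : (forall i, Q N (fun v => y v i) a) ->
  (forall w, W = [set w]%SET -> (forall i, i \in D -> nice (y a w - y a i) /\ nice (y a w + y a i)) /\ nice (2 * y a w)) ->
  (forall w w', w != w' -> W = (w |: [set w'])%SET -> nice (y a w + y a w')) ->
  Q N (fun v => HD zeta D W (y v)) a.
Proof.
move=> yQ; have [->|[w ->]|[w [w' [ww ->]]]|h] := small_set W => h1 h2.
- by apply: (Q_ext NN) (Q_cst N 0 a); apply: nearT => v; rewrite HD0.
- have [k1 k2] := h1 w erefl.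
  by apply: (Q_ext NN) (@HDe_Q D y (fun v => y v w) a _ _ k1 k2) => //; apply: nearT => v; rewrite HD1.
- apply: (@Q_ext _ _ _ NN (fun v => L1 (y v w + y v w'))); first by apply: nearT => v; rewrite HD2.
  by apply: (Q_L1 ZrQ zetaE NN) => //; [exact: h2|exact: (Q_add NN)].
- by apply: (Q_ext NN) (Q_cst N 0 a); apply: nearT => v; rewrite HD3.
Qed.

End HDQ.

(* H~_D(W), by Htilde_formula. *)
Definition HS A D y W : C := HD zeta D W y + Psi AE W A A (pt (flip D y) y).

Lemma path_Q (V : lmodType C) (N : V -> R) (NN : vnorm N) D (y : V -> I -> C) a :
  (forall i, Q N (fun v => y v i) a) -> forall k : T, Q N (fun v => pt (flip D (y v)) (y v) k) a.
Proof.
move=> yQ [k|k] //=; rewrite /flip; case kD: (k \in D) => //.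
by apply: (Q_opp NN).
Qed.

Lemma Psi_path_Q (V : lmodType C) (N : V -> R) (NN : vnorm N) A D W (y : V -> I -> C) a :
  (forall i, Q N (fun v => y v i) a) -> OmT Omega A A (pt (flip D (y a)) (y a)) ->
  Ah AE A A (pt (flip D (y a)) (y a)) != 0 ->
  Q N (fun v => Psi AE W A A (pt (flip D (y v)) (y v))) a.
Proof.
move=> yQ hO hn; apply: (Q_compn NN (phi := fun v => pt (flip D (y v)) (y v))); first exact: path_Q.
exact: (Psi_Q hAE).
Qed.

Lemma Ah_reduce A B z : B \subset A -> OmT Omega A A z ->
  (forall i, i \in A -> i \notin B -> z (inl i) = z (inr i)) -> Ah AE A A z = Ah AE B B z.
Proof.
move: {2}#|A| (leqnn #|A|) => m; elim: m A => [|m IH] A cA BA hO e.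
  have -> : B = A; last by [].
  by apply/eqP; rewrite eqEcard BA (leq_trans cA).
case: (eqVneq A B) => [->//|AB].
have [i iA iB] : exists2 i, i \in A & i \notin B.
  by apply/subsetPn; apply: contra AB => AB; rewrite finset.eqEsubset AB.
rewrite (Ah_cancel ZrQ Zr0 zetaE oO cO O0 hAE hO iA iA (e i iA iB)).
apply: IH.
- by move: cA; rewrite (cardsD1 i) iA add1n ltnS.
- by rewrite finset.subsetD1 BA iB.
- exact: (OmTD1 i i hO).
- by move=> k; rewrite inE => /andP[_ kA]; exact: e.
Qed.

(** Outside D the entries of S and B coincide and cancel. The factor A_E(D,D,D) is thus the same
    function as the A_E(A,A,D) differentiated in H~_D. *)
Lemma Ah_flip A D y : D \subset A -> OmT Omega A A (pt (flip D y) y) ->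
  Ah AE A A (pt (flip D y) y) = AE D D (flip D y) y.
Proof.
move=> DA hO; rewrite (Ah_reduce DA hO) // => i _ iD /=.
by rewrite /flip (negPf iD).
Qed.

Lemma good_sub A B D y : D \subset B -> B \subset A -> good A D y -> good B D y.
Proof.
move=> DB /fintype.subsetP BA g; have hO := good_OmT ON g; case: g => h1 h2 h3 h4 h5; split.
- by move=> i /BA; exact: h1.
- by move=> i j /BA iA /BA jA; exact: h2.
- by move=> i j /BA iA /BA jA; exact: h3.
- by move=> i /BA; exact: h4.
- rewrite -(@Ah_reduce A B) //; first exact/fintype.subsetP.
  by move=> i _ iB; rewrite /= /flip; case: ifP => // /(fintype.subsetP DB) ib; rewrite ib in iB.
Qed.

Definition Pre q D y : C := cpow q (- 2 * \sum_(i in D) y i)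
  * (\prod_(i in D) (Gamma (1 - y i) / Gamma (1 + y i))) * sqrtZD zeta D y * (-1) ^+ #|D|.

(* Adjoining a variable c to D multiplies the factor in front of A_E by gfac, of
   which zfac c k is the contribution of the pair (c, k). *)
Definition zfac (c k : C) : C := zeta (1 + (- c - k)) * zeta (1 + (c + k)) /
  (zeta (1 + (- c + k)) * zeta (1 + (c - k))).

Definition gfac q D y (c : C) : C := - cpow q (- 2 * c) * (Gamma (1 - c) / Gamma (1 + c))
  * zeta (1 + 2 * c) * \prod_(k in D) zfac c (y k).

Lemma Zdag_U1 D i (s b : I -> C) : i \notin D -> Zdag zeta (i |: D)%SET s b =
  Zdag zeta D s b * \prod_(k in D) (zeta (1 + s i + b k) * zeta (1 + s k + b i)).
Proof.
move=> iD; rewrite /Zdag big_setU1 //= big_split /= [RHS]mulrC -mulrA; congr (_ * _).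
  apply: eq_bigl => j; rewrite !inE; case: (eqVneq j i) => [->|]; rewrite ?andbF ?andbT //=.
  by rewrite (negPf iD).
rewrite -big_split; apply: eq_bigr => k kD; have ki : k != i by apply: contraNneq iD => <-.
rewrite (bigD1 i) /=; last by rewrite !inE eqxx eq_sym ki.
congr (_ * _); apply: eq_bigl => j; rewrite !inE.
by case: (eqVneq j i) => [->|] /=; rewrite ?andbF ?andbT // (negPf iD).
Qed.

Lemma Pre_U1 q D i y : i \notin D -> Pre q (i |: D)%SET y = Pre q D y * gfac q D y (y i).
Proof.
move=> iD; rewrite /Pre big_setU1 //= big_setU1 //= cardsU1 iD /= exprS.
have iU : i \in (i |: D)%SET by rewrite !inE eqxx.
have -> : sqrtZD zeta (i |: D)%SET y = sqrtZD zeta D y * (zeta (1 + 2 * y i) * \prod_(k in D) zfac (y i) (y k)).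
  rewrite /sqrtZD (sqrtZ_ltD1 zeta (\- y) iU) (sqrtZ_leD1 zeta y iU) setU1K // Zdag_U1 //.
  have -> : \prod_(k in D) zfac (y i) (y k) =
     (\prod_(k in D) zeta (1 - y i - y k)) * (\prod_(k in D) zeta (1 + y i + y k)) /
     (\prod_(k in D) (zeta (1 + - y i + y k) * zeta (1 + - y k + y i))).
    rewrite -big_split -prodf_div; apply: eq_bigr => k _; rewrite /zfac /=.
    by rewrite !addrA; congr (_ / (_ * zeta _)); rewrite addrAC.
  have -> : 1 + 2 * y i = 1 + y i + y i by ring.
  by rewrite invfM /=; ring.
rewrite mulrDr cpowD /gfac; ring.
Qed.

Lemma Pre_ext q D y y' : (forall i, i \in D -> y i = y' i) -> Pre q D y = Pre q D y'.
Proof.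
move=> e; rewrite /Pre /sqrtZD; congr (_ * _ * (_ * _ / _) * _).
- by congr (cpow _ (_ * _)); apply: eq_bigr => i /e ->.
- by apply: eq_bigr => i /e ->.
- by apply: eq_bigr => i /e hi; apply: eq_bigr => j /andP[/e hj _]; rewrite /= hi hj.
- by apply: eq_bigr => i /e hi; apply: eq_bigr => j /andP[/e hj _]; rewrite /= hi hj.
- by apply: eq_bigr => i /e hi; apply: eq_bigr => j /andP[/e hj _]; rewrite /= hi hj.
Qed.

Definition Term q A D y : C := Pre q D y * Ah AE A A (pt (flip D y) y) * PS (A :\: D)%SET (HS A D y).

Lemma JE_Term omega X A B x : (forall D, D \subset A -> good A D x) ->
  JE zeta E M AE omega X A B x =
  \sum_(1 <= d < (Num.truncn X).+1 | fundamental d && (kronecker d%:Z (- M%:Z) * omega == 1))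
    (\prod_(j in B) logder (psi M omega d) (1 / 2%:R + x j))
    * \sum_(D : {set I} | D \subset A) Term (Num.sqrt M%:R * d%:R / (2 * pi)) A D x.
Proof.
move=> g; apply: eq_bigr => d _; congr (_ * _); apply: eq_bigr => D DA.
have gD := g D DA; rewrite /Term Ah_flip //; last exact: (good_OmT ON gD).
congr (_ * _); apply: PS_ext => W W0 WA.
exact: (Htilde_formula ZrQ Zr0 zetaE Mp hAE ON).
Qed.

Lemma generic_Zr A x (u v : C) : generic zeta E M AE Omega A x ->
  (u \in 0 :: [seq x i | i in A] ++ [seq - x i | i in A]) ->
  (v \in 0 :: [seq x i | i in A] ++ [seq - x i | i in A]) -> Zr (u + v) != 0.
Proof.
move=> [_ _ h _ _] hu hv; case: (eqVneq (u + v) 0) => [->|uv]; first by rewrite Zr0 oner_eq0.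
have := h u v hu hv uv; rewrite -addrA zetaE // mulf_eq0 negb_or => /andP[] //.
Qed.

Lemma generic_mem A x i : i \in A ->
  (x i \in 0 :: [seq x i | i in A] ++ [seq - x i | i in A]) /\
  (- x i \in 0 :: [seq x i | i in A] ++ [seq - x i | i in A]).
Proof.
move=> iA; rewrite !inE !mem_cat.
have -> : x i \in [seq x i | i in A] by apply/mapP; exists i; rewrite ?mem_enum.
have -> : - x i \in [seq - x i | i in A] by apply/mapP; exists i; rewrite ?mem_enum.
by rewrite !orbT.
Qed.

Lemma generic_nz A x i : generic zeta E M AE Omega A x -> i \in A -> x i != 0.
Proof. by move=> [h _ _ _ _] /h[_ /(_ 0)]; rewrite mulr0z. Qed.

Lemma generic_good A D x : generic zeta E M AE Omega A x -> D \subset A -> good A D x.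
Proof.
move=> g DA; have hZ u v := @generic_Zr A x u v g; have hm i := @generic_mem A x i.
have [h1 h2 h3 h4 h5] := g.
have hO : OmT Omega A A (pt (flip D x) x).
  split=> i iA /=; have [? _] := h1 i iA => //.
  by rewrite /flip; case: ifP => _ //; apply: ON.
split=> [i /h1[] //|i j iA jA|i j iA jA ij|//|].
- have [a1 a2] := hm i iA; have [b1 b2] := hm j jA.
  have ne : x i + x j != 0.
    case: (eqVneq i j) => [->|ij].
      by rewrite -mulr2n mulrn_eq0 /= (generic_nz g).
    by rewrite addr_eq0; have [] := h2 i j iA jA ij.
  split; split=> //; last 2 first.
  - by rewrite -opprD oppr_eq0.
  - exact: hZ.
  exact: hZ.
- have [a1 a2] := hm i iA; have [b1 b2] := hm j jA.
  by split; [rewrite subr_eq0; have [] := h2 i j iA jA ij|exact: hZ].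
- by rewrite Ah_flip //; exact: h5.
Qed.

End Terms.

(** * Moving one variable *)

Section Moving.
Variables (R : realType) (n : nat).
Local Notation C := R[i].
Local Notation nm := (@normc R).
Local Notation nmo := (nm : R[i]^o -> R).
Local Notation I := 'I_n.
Let nmV := @nm_vnorm R.
Local Notation T := (I + I)%type.
Variables (zeta Zr : C -> C).
Hypothesis ZrQ : forall t, Q nmo Zr t.
Hypothesis Zr0 : Zr 0 = 1.
Hypothesis zetaE : forall t, t != 0 -> zeta (1 + t) = Zr t / t.
Variables (E : weierstrass) (M : nat).
Variables (Omega : set C) (AE : AE_family R n).
Hypothesis oO : open Omega.
Hypothesis cO : connected Omega.
Hypothesis O0 : Omega 0.
Hypothesis hAE : is_AE zeta E M Omega AE.
Hypothesis ON : forall z, Omega z -> Omega (- z).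
Implicit Types (A B D W : {set I}) (x y : I -> C) (q : R).
Local Notation nice := (nice Zr).
Local Notation Lz := (Lz zeta).
Local Notation good := (good Zr E M Omega AE).
Local Notation HS := (HS zeta AE).
Local Notation Term := (Term zeta AE).
Local Notation Pre := (Pre zeta).
Local Notation Ahp A D y := (Ah AE A A (pt (flip D y) y)).

Definition setv x (al : I) (z : C) : I -> C := fun i => if i == al then z else x i.

Lemma setv1 x al z : setv x al z al = z. Proof. by rewrite /setv eqxx. Qed.
Lemma setvN x al z i : i != al -> setv x al z i = x i. Proof. by rewrite /setv => /negPf ->. Qed.

Lemma setv_Q x al i a : Q nmo (fun z : R[i]^o => setv x al z i) a.
Proof. by rewrite /setv; case: (i == al); [exact: Q_idC|exact: Q_cst]. Qed.

Lemma near_good A D al x z0 : al \in A -> good (A :\ al)%SET finset.set0 x -> Omega z0 ->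
  (forall k, k \in (A :\ al)%SET -> [/\ Zr (z0 + x k) != 0, Zr (- z0 - x k) != 0,
     Zr (z0 - x k) != 0 & Zr (x k - z0) != 0]) ->
  Zr (2 * z0) != 0 -> Zr (- 2 * z0) != 0 ->
  near' z0 (fun z : R[i]^o => V E M [set al]%SET (setv x al z) != 0 /\ V E M [set al]%SET (\- setv x al z) != 0) ->
  Ahp A D (setv x al z0) != 0 ->
  OmT Omega A A (pt (flip D (setv x al z0)) (setv x al z0)) /\
  near' z0 (fun z : R[i]^o => good A D (setv x al z)).
Proof.
move=> aA [g1 g2 g3 g4 _] Oz hz hz2 hzm2 hV hA.
have OmS z : Omega z -> forall i, i \in A -> Omega (setv x al z i).
  move=> Oz' i iA; case: (eqVneq i al) => [->|ia]; first by rewrite setv1.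
  by rewrite setvN //; apply: g1; rewrite !inE ia.
have OT z : Omega z -> OmT Omega A A (pt (flip D (setv x al z)) (setv x al z)).
  move=> Oz'; split=> i iA /=; last exact: OmS.
  by rewrite /flip; case: ifP => _; [apply: ON|]; apply: OmS.
have yQ i : Q nmo (fun z : R[i]^o => setv x al z i) z0 by exact: setv_Q.
split; first exact: OT.
have nO : near' z0 (fun z : R[i]^o => Omega z).
  by apply: near'W; apply/nbhsCP; apply: open_nbhs_nbhs.
have nA : near' z0 (fun z : R[i]^o => Ahp A D (setv x al z) != 0).
  apply: near'W; apply: (Q_neq nmV) => //.
  apply: (Q_compn nmV (phi := fun z : R[i]^o => pt (flip D (setv x al z)) (setv x al z))).
    exact: path_Q.
  by apply: (Ah_Q hAE); exact: OT.
have N c e (F : C -> C) : c != 0 -> (forall z, F z = c * z + e) -> Zr (F z0) != 0 ->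
    near' z0 (fun z : R[i]^o => nice (F z)).
  move=> c0 eF zF; rewrite eF in zF; have := near'_nice ZrQ c0 zF.
  by apply: near'S => z; rewrite eF.
have c1 : (1 : C) != 0 by exact: oner_neq0.
have cm1 : (-1 : C) != 0 by rewrite oppr_eq0.
have c2 : (2 : C) != 0 by rewrite pnatr_eq0.
have cm2 : (-2 : C) != 0 by rewrite oppr_eq0.
have nk : near' z0 (fun z : R[i]^o => forall k, k \in (A :\ al)%SET ->
    [/\ nice (z + x k), nice (- z - x k), nice (z - x k) & nice (x k - z)]).
  apply: near'_all => k; case: (boolP (k \in (A :\ al)%SET)) => kA; last first.
    by apply: near'W; apply: nearT.
  have [k1 k2 k3 k4] := hz k kA.
  have m1 := N 1 (x k) (fun z => z + x k) c1 (fun z => congr1 (+%R^~ (x k)) (esym (mul1r z))) k1.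
  have m2 := N (-1) (- x k) (fun z => - z - x k) cm1 (fun z => congr1 (+%R^~ (- x k)) (esym (mulN1r z))) k2.
  have m3 := N 1 (- x k) (fun z => z - x k) c1 (fun z => congr1 (+%R^~ (- x k)) (esym (mul1r z))) k3.
  have m4 : near' z0 (fun z : R[i]^o => nice (x k - z)).
    by apply: (N (-1) (x k) (fun z => x k - z)) => // z; rewrite mulN1r addrC.
  by apply: near'S (near'I (near'I m1 m2) (near'I m3 m4)) => z [[? ?] [? ?]] _.
have n2 : near' z0 (fun z : R[i]^o => nice (z + z) /\ nice (- z - z)).
  apply: near'I; first by apply: (N 2 0 (fun z => z + z)) => // [z|]; [ring|rewrite -mulr2n -mulr_natl].
  apply: (N (-2) 0 (fun z => - z - z)) => // [z|]; first by ring.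
  by have -> : - z0 - z0 = - 2 * z0 by ring.
apply: near'S (near'I (near'I nO nA) (near'I hV (near'I nk n2))).
move=> z [[Oz' Az] [[V1 V2] [hk [h2 h2']]]]; split=> //.
- exact: OmS.
- move=> i j iA jA.
  case: (eqVneq i al) => [->|ia]; case: (eqVneq j al) => [->|ja]; rewrite ?setv1 ?(setvN x z ia) ?(setvN x z ja) //.
  + by have [|? ? _ _] := hk j _; rewrite ?inE ?ja.
  + have [|? ? _ _] := hk i _; rewrite ?inE ?ia //.
    by split; [rewrite addrC|rewrite addrC].
  + by apply: g2; rewrite !inE ?ia ?ja.
- move=> i j iA jA ij.
  case: (eqVneq i al) => [ei|ia]; case: (eqVneq j al) => [ej|ja]; rewrite ?ei ?ej ?setv1 ?(setvN x z ia) ?(setvN x z ja) //.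
  + by rewrite ei ej eqxx in ij.
  + by have [|_ _ ? _] := hk j _; rewrite ?inE ?ja.
  + by have [|_ _ _ ?] := hk i _; rewrite ?inE ?ia.
  + by apply: g3; rewrite ?inE ?ia ?ja.
- move=> i iA; case: (eqVneq i al) => [->//|ia].
  have [] := g4 i _; first by rewrite !inE ia.
  by rewrite !V1E /= !setvN.
Qed.

(** For al outside D the entries s al = b al = z cancel for every z, so a block avoiding al does not
    depend on z. *)
Lemma HS_const A D al x z W : al \in A -> al \notin D -> al \notin W -> good A D (setv x al z) ->
  HS A D (setv x al z) W = HS (A :\ al)%SET D x W.
Proof.
move=> aA aD aW g; have hO := good_OmT ON g; have hn : Ahp A D (setv x al z) != 0 by case: g.
have e k : k \in (A :\ al)%SET -> setv x al z k = x k by rewrite !inE => /andP[ka _]; rewrite setvN.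
have ea : pt (flip D (setv x al z)) (setv x al z) (inl al) = pt (flip D (setv x al z)) (setv x al z) (inr al).
  by rewrite /= /flip (negPf aD).
have eH : HD zeta D W (setv x al z) = HD zeta D W x.
  by apply: HD_ext => i iS; rewrite setvN //; apply: contraTneq iS => ->.
suff eP : Psi AE W A A (pt (flip D (setv x al z)) (setv x al z)) =
    Psi AE W (A :\ al)%SET (A :\ al)%SET (pt (flip D x) x) by rewrite /HS eH eP.
rewrite (Psi_cancel ZrQ Zr0 zetaE oO cO O0 hAE hO hn aA aW aA ea).
apply: (Psi_local oO cO O0 hAE); first exact: OmTD1.
  by rewrite -(Ah_cancel ZrQ Zr0 zetaE oO cO O0 hAE hO aA aA ea).
by split=> k kA /=; rewrite /flip ?e.
Qed.

Lemma Ah_const A D al x z : al \in A -> al \notin D -> OmT Omega A A (pt (flip D (setv x al z)) (setv x al z)) ->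
  Ahp A D (setv x al z) = Ahp (A :\ al)%SET D x.
Proof.
move=> aA aD hO.
have e k : k \in (A :\ al)%SET -> setv x al z k = x k by rewrite !inE => /andP[ka _]; rewrite setvN.
rewrite (Ah_cancel ZrQ Zr0 zetaE oO cO O0 hAE hO aA aA) /=; last by rewrite /flip (negPf aD).
apply: (Ah_local oO cO O0 hAE); first exact: OmTD1.
by split=> k kA /=; rewrite /flip ?e.
Qed.

Lemma pol_Q (f : R[i]^o -> C) z0 : Q nmo f z0 -> pol f z0 0.
Proof.
move=> fQ; have := @pol1 _ (fun z : R[i]^o => (z - z0) * f z) f z0.
rewrite subrr mul0r; apply.
  apply: (Q_mul nmV) => //; apply: (Q_ext nmV) (Q_affine 1 (- z0) z0); apply: nearT => z.
  by rewrite mul1r.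
apply: nearT => z zz; have zn : z - z0 != 0 by rewrite subr_eq0.
by rewrite mulrAC divff // mul1r.
Qed.

(** For al outside D the front factor, A_E and all blocks avoiding al are constant in z; the whole
    dependence on z is in the block that contains al. *)
Lemma Term_out q A D al x z0 (r : {set I} -> C) : al \in A -> al \notin D ->
  near' z0 (fun z : R[i]^o => good A D (setv x al z)) ->
  (forall B, B \subset ((A :\ al) :\: D)%SET ->
     pol (fun z : R[i]^o => HS A D (setv x al z) (al |: B)%SET) z0 (r B)) ->
  pol (fun z : R[i]^o => Term q A D (setv x al z)) z0
    (Pre q D x * Ahp (A :\ al)%SET D x *
     \sum_(B : {set I} | B \subset ((A :\ al) :\: D)%SET)
        r B * PS (((A :\ al) :\: D) :\: B)%SET (HS (A :\ al)%SET D x)).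
Proof.
move=> aA aD hg hr; set T0 := ((A :\ al) :\: D)%SET.
have aT : al \notin T0 by rewrite !inE eqxx andbF.
have AD : (A :\: D)%SET = (al |: T0)%SET.
  by apply/setP => i; rewrite !inE; case: (eqVneq i al) => [->|] //=; rewrite aD.
apply: (@pol_ext _ (fun z => Pre q D x * Ahp (A :\ al)%SET D x * \sum_(B : {set I} | B \subset T0)
   PS (T0 :\: B)%SET (HS (A :\ al)%SET D x) * HS A D (setv x al z) (al |: B)%SET)); last first.
  apply: pol_cM; apply: pol_sum => B BT; rewrite mulrC; apply: pol_cM; exact: hr.
apply: near'S hg => z g; rewrite /Term (@Pre_ext _ _ _ _ _ _ x); last first.
  by move=> i iD; rewrite setvN //; apply: contraTneq iD => ->.
rewrite Ah_const //; last exact: good_OmT g.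
congr (_ * _); rewrite AD (PS_U1 _ aT); apply: eq_bigr => B BT; rewrite mulrC; congr (_ * _).
apply: PS_ext => W W0 WT; apply: HS_const => //.
by apply: contra aT => /(fintype.subsetP WT); rewrite !inE => /andP[].
Qed.

Lemma PS_Q (V : lmodType C) (N : V -> R) (NN : vnorm N) (T0 : {set I}) (h : V -> {set I} -> C) a :
  (forall W, W != finset.set0 -> W \subset T0 -> Q N (fun v => h v W) a) -> Q N (fun v => PS T0 (h v)) a.
Proof.
move=> hQ; apply: (Q_sum NN) => P /and3P[/eqP cP _ nP]; apply: (Q_prod NN) => W _ WP; apply: hQ.
  by apply: contraNneq nP => <-.
by rewrite -cP; apply: (finset.bigcup_sup W).
Qed.

Lemma HS_Q A D al x W z0 : OmT Omega A A (pt (flip D (setv x al z0)) (setv x al z0)) ->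
  Ahp A D (setv x al z0) != 0 ->
  (forall w, W = [set w]%SET -> (forall i, i \in D ->
     nice (setv x al z0 w - setv x al z0 i) /\ nice (setv x al z0 w + setv x al z0 i)) /\ nice (2 * setv x al z0 w)) ->
  (forall w w', w != w' -> W = (w |: [set w'])%SET -> nice (setv x al z0 w + setv x al z0 w')) ->
  Q nmo (fun z : R[i]^o => HS A D (setv x al z) W) z0.
Proof.
move=> hO hn h1 h2; apply: (Q_add nmV).
  by apply: (HD_Q ZrQ zetaE nmV (y := fun z : R[i]^o => setv x al z)) => // i; exact: setv_Q.
by apply: (Psi_path_Q hAE nmV) => // i; exact: setv_Q.
Qed.

(** The factor zeta(1 + 2c), singular at c = 0, is split off. What remains takes inverse values at c
    and -c ([gfac0_mulN]) and is -1 at c = 0 ([gfac0_0]). *)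
Definition gfac0 q D y (c : C) : C := - cpow q (- 2 * c) * (Gamma (1 - c) / Gamma (1 + c))
  * \prod_(k in D) zfac zeta c (y k).

Lemma gfacE q D y c : gfac zeta q D y c = gfac0 q D y c * zeta (1 + 2 * c).
Proof. by rewrite /gfac /gfac0; ring. Qed.

Lemma ldr_zetaF (F : C -> C) (c e a : C) : (forall z, F z = c * z + e) -> nice (F a) ->
  ldr (fun z : R[i]^o => zeta (1 + F z)) a (c * Lz (F a)).
Proof.
move=> eF; have -> : F = (fun z => c * z + e) by apply/funext.
move=> h; exact: (ldr_zeta ZrQ zetaE).
Qed.

Lemma ldr_zfac (c k : C) : nice (c + k) -> nice (- c - k) -> nice (c - k) -> nice (- c + k) ->
  ldr (fun z : R[i]^o => zfac zeta z k) c (Lz (c + k) - Lz (- c - k) + Lz (- c + k) - Lz (c - k)).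
Proof.
move=> h1 h2 h3 h4.
have l1 := @ldr_zetaF (fun z => z + k) 1 k c (fun z => congr1 (+%R^~ k) (esym (mul1r z))) h1.
have l2 := @ldr_zetaF (fun z => - z - k) (-1) (- k) c (fun z => congr1 (+%R^~ (- k)) (esym (mulN1r z))) h2.
have l3 := @ldr_zetaF (fun z => z - k) 1 (- k) c (fun z => congr1 (+%R^~ (- k)) (esym (mul1r z))) h3.
have l4 := @ldr_zetaF (fun z => - z + k) (-1) k c (fun z => congr1 (+%R^~ k) (esym (mulN1r z))) h4.
have := ldr_div (ldr_mul l2 l1) (ldr_mul l4 l3).
set u := (X in ldr _ _ X -> _); set v := (X in _ -> ldr _ _ X).
by have -> : u = v by rewrite /u /v; ring.
Qed.

(** The first three terms are psi'/psi(1/2 + c) for q = sqrt(M) d / (2 pi), by [psi_logder]. Being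
    even in c, they have the same value at the collision point -b as at b. *)
Lemma ldr_gfac0 q D y (c : C) :
  (forall k : nat, 1 - c + k%:R != 0) -> (forall k : nat, 1 + c + k%:R != 0) ->
  (forall k, k \in D -> [/\ nice (c + y k), nice (- c - y k), nice (c - y k) & nice (- c + y k)]) ->
  ldr (gfac0 q D y) c (- 2 * (ln q)%:C - logder (@Gamma R) (1 - c) - logder (@Gamma R) (1 + c)
    + \sum_(k in D) (Lz (c + y k) - Lz (- c - y k) + Lz (- c + y k) - Lz (c - y k))).
Proof.
move=> g1 g2 hk.
have m1 : (-1 : C) != 0 by rewrite oppr_eq0 oner_neq0.
have l0 := ldr_cst c m1.
have l1 := ldr_cpow q (-2) 0 c.
have e2 : -1 * c + 1 = 1 - c by rewrite mulN1r addrC.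
have e3 : 1 * c + 1 = 1 + c by rewrite mul1r addrC.
have l2 := @ldr_comp _ (@Gamma R) (-1) 1 c; rewrite e2 in l2.
have [_ n2] := Gamma_cvg g1; have {}l2 := l2 (Q_Gamma g1) n2.
have l3 := @ldr_comp _ (@Gamma R) 1 1 c; rewrite e3 in l3.
have [_ n3] := Gamma_cvg g2; have {}l3 := l3 (Q_Gamma g2) n3.
have l4 : ldr (fun z : R[i]^o => \prod_(k in D) zfac zeta z (y k)) c
    (\sum_(k in D) (Lz (c + y k) - Lz (- c - y k) + Lz (- c + y k) - Lz (c - y k))).
  by apply: (@ldr_prod _ _ D (fun k z => zfac zeta z (y k))) => k kD; have [] := hk k kD; exact: ldr_zfac.
have := ldr_mul (ldr_mul (ldr_mul l0 l1) (ldr_div l2 l3)) l4.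
set u := (X in ldr _ _ X -> _); set v := (X in _ -> ldr _ _ X).
have -> : u = v by rewrite /u /v; ring.
apply: ldr_ext; apply: nearT => z; rewrite /gfac0 addr0 mulN1r.
by rewrite [-1 * z]mulN1r [1 * z]mul1r ![_ + 1]addrC.
Qed.

(** be, with equal entries in S and B, cancels with itself, and al then takes its name. Used when D
    contains al but not be: the collision then looks like the point with beta replaced by -beta and
    be in D. *)
Lemma Psi_swap W A al be (z y : T -> C) : al \in A -> be \in A -> al != be -> al \notin W -> be \notin W ->
  OmT Omega A A z -> OmT Omega (A :\ al)%SET (A :\ al)%SET y -> Ah AE (A :\ al)%SET (A :\ al)%SET y != 0 ->
  z (inl be) = z (inr be) -> y (inl be) = z (inl al) -> y (inr be) = z (inr al) ->
  agree (A :\ al :\ be)%SET (A :\ al :\ be)%SET z y ->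
  Ah AE A A z != 0 /\ Psi AE W A A z = Psi AE W (A :\ al)%SET (A :\ al)%SET y.
Proof.
move=> aA bA ab aW bW hz hy ny zb e1 e2 [a1 a2].
have ba : be != al by rewrite eq_sym.
have C0 : (A :\ be :\ al = A :\ al :\ be)%SET by apply/setP => k; rewrite !inE andbCA.
have step W0 : al \notin W0 -> be \notin W0 ->
    Psi AE W0 (A :\ al)%SET (A :\ al)%SET y = Psi AE W0 (A :\ be)%SET (A :\ be)%SET z.
  move=> aW0 bW0; pose u : T -> C := fun k => match k with inl i => z (inl i) | inr i => y (inr i) end.
  have s1 W1 : al \notin W1 -> be \notin W1 ->
      Psi AE W1 (A :\ al)%SET (A :\ al)%SET y = Psi AE W1 (A :\ be)%SET (A :\ al)%SET u.
    move=> aW1 bW1; apply: (Psi_relabel_s ZrQ Zr0 zetaE oO cO O0 hAE bA aA ba bW1 aW1 aA hy ny); first by rewrite /u e1.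
    by rewrite C0; split=> k kS; rewrite /u // a1.
  have nu : Ah AE (A :\ be)%SET (A :\ al)%SET u != 0.
    have := s1 finset.set0; rewrite /Psi eqxx => <- //; by rewrite inE.
  have hu : OmT Omega (A :\ be)%SET (A :\ al)%SET u.
    split=> k kS /=; last exact: hy.2.
    by apply: hz.1; move: kS; rewrite inE => /andP[].
  rewrite (s1 W0 aW0 bW0).
  apply: (Psi_relabel_b ZrQ Zr0 zetaE oO cO O0 hAE bA aA ba bA bW0 hu nu); first by rewrite /u e2.
  by rewrite C0; split=> k kS; rewrite /u // a2.
have nz : Ah AE A A z != 0.
  rewrite (Ah_cancel ZrQ Zr0 zetaE oO cO O0 hAE hz bA bA zb).
  have := step finset.set0; rewrite /Psi eqxx => <- //; by rewrite inE.
split=> //; rewrite (step W aW bW).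
exact: (Psi_cancel ZrQ Zr0 zetaE oO cO O0 hAE hz nz bA bW bA zb).
Qed.

End Moving.

Lemma nonint_shift (R : realType) (b : R[i]) : (forall k : int, b != k%:~R) ->
  forall k : nat, 1 - b + k%:R != 0 /\ 1 + b + k%:R != 0.
Proof.
move=> hb k; split.
  have := hb (k.+1%:Z); apply: contra => /eqP e; apply/eqP.
  rewrite -pmulrn -nat1r; apply/eqP; rewrite -subr_eq0; apply/eqP.
  by rewrite -[RHS]oppr0 -[in RHS]e; ring.
have := hb (- k.+1%:Z); apply: contra => /eqP e; apply/eqP.
rewrite mulrNz -pmulrn -nat1r; apply/eqP; rewrite -subr_eq0; apply/eqP.
by rewrite -[RHS]e; ring.
Qed.

(** * Derivatives of partition sums and symmetries of the front factors *)

Section Pieces.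
Variables (R : realType) (n : nat).
Local Notation C := R[i].
Local Notation nm := (@normc R).
Local Notation nmo := (nm : R[i]^o -> R).
Local Notation I := 'I_n.
Local Notation T := (I + I)%type.
Variables (zeta Zr : C -> C).
Hypothesis ZrQ : forall t, Q nmo Zr t.
Hypothesis Zr0 : Zr 0 = 1.
Hypothesis zetaE : forall t, t != 0 -> zeta (1 + t) = Zr t / t.
Variables (E : weierstrass) (M : nat).
Variables (Omega : set C) (AE : AE_family R n).
Hypothesis oO : open Omega.
Hypothesis cO : connected Omega.
Hypothesis O0 : Omega 0.
Hypothesis hAE : is_AE zeta E M Omega AE.
Hypothesis ON : forall z, Omega z -> Omega (- z).
Implicit Types (A B D W : {set I}) (x y : I -> C) (q : R).
Local Notation nice := (nice Zr).
Local Notation good := (good Zr E M Omega AE).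
Local Notation HS := (HS zeta AE).
Local Notation Term := (Term zeta AE).
Local Notation Ahp A D y := (Ah AE A A (pt (flip D y) y)).

Lemma set1_U1 (B : {set I}) al w : al \notin B -> (al |: B)%SET = [set w]%SET -> w = al /\ B = finset.set0.
Proof.
move=> aB e; have : al \in [set w]%SET by rewrite -e !inE eqxx.
rewrite inE => /eqP wa.
split=> //; apply/setP => k; rewrite inE; apply/negP => kB.
have : k \in [set w]%SET by rewrite -e !inE kB orbT.
by rewrite inE -wa => /eqP ka; rewrite -ka kB in aB.
Qed.

Lemma set2_U1 (B : {set I}) al w w' : al \notin B -> w != w' -> (al |: B)%SET = (w |: [set w'])%SET ->
  (w = al /\ B = [set w']%SET) \/ (w' = al /\ B = [set w]%SET).
Proof.
move=> aB ww e; have BE : B = ((w |: [set w']) :\ al)%SET by rewrite -e setU1K.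
have : al \in (w |: [set w'])%SET by rewrite -e !inE eqxx.
rewrite !inE => /orP[]/eqP ea; [left|right]; split=> //; rewrite BE ea.
  by rewrite setU1K // inE.
by rewrite finset.setUC setU1K // inE eq_sym.
Qed.

Lemma dd_prod_set (V : lmodType C) (N : V -> R) (NN : vnorm N) (J : finType) (P : {set J})
    (F : J -> V -> C) a v : (forall i, i \in P -> Q N (F i) a) ->
  dd (fun x : V => \prod_(i in P) F i x) a v = \sum_(i in P) dd (F i) a v * \prod_(j in (P :\ i)%SET) F j a.
Proof.
move: {2}#|P| (leqnn #|P|) => m; elim: m P => [|m IH] P cP hQ; case: (set_0Vmem P) => [P0|[i iP]].
- rewrite P0 big_set0 -(dd_cst 1 a v); congr (dd _ a v); apply/funext => x; by rewrite big_set0.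
- by rewrite leqn0 cards_eq0 in cP; rewrite (eqP cP) inE in iP.
- rewrite P0 big_set0 -(dd_cst 1 a v); congr (dd _ a v); apply/funext => x; by rewrite big_set0.
have -> : (fun x : V => \prod_(i in P) F i x) = (fun x : V => F i x * \prod_(j in (P :\ i)%SET) F j x).
  by apply/funext => x; rewrite (big_setD1 i iP).
have hQ' j : j \in (P :\ i)%SET -> Q N (F j) a by rewrite !inE => /andP[_]; exact: hQ.
rewrite (dd_mul NN); [|exact: hQ|by apply: (Q_prod NN) => j _; exact: hQ'].
rewrite IH //; last by move: cP; rewrite (cardsD1 i) iP add1n ltnS.
rewrite [RHS](big_setD1 i iP) /= addrC; congr (_ + _).
rewrite big_distrr /=; apply: eq_bigr => j jP; rewrite mulrCA; congr (_ * _).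
have iPj : i \in (P :\ j)%SET by move: jP; rewrite !inE iP andbT eq_sym => /andP[].
rewrite [RHS](big_setD1 i iPj) /=; congr (_ * _); apply: eq_bigl => k.
by rewrite !inE andbCA.
Qed.

Lemma dd_PS (V : lmodType C) (N : V -> R) (NN : vnorm N) (T0 : {set I}) (h : V -> {set I} -> C) a v :
  (forall W, W != finset.set0 -> W \subset T0 -> Q N (fun x : V => h x W) a) ->
  dd (fun x : V => PS T0 (h x)) a v =
  \sum_(W : {set I} | (W \subset T0) && (W != finset.set0)) dd (fun x : V => h x W) a v * PS (T0 :\: W)%SET (h a).
Proof.
move=> hQ; have hP P W : finset.partition P T0 -> W \in P -> Q N (fun x : V => h x W) a.
  move=> /and3P[/eqP cP _ nP] WP; apply: hQ.
    by apply: contraNneq nP => <-.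
  by rewrite -cP; apply: (finset.bigcup_sup W).
rewrite -PS_leibniz /PS (dd_sum NN); last first.
  by move=> P hPT; apply: (Q_prod NN) => W _ WP; exact: hP WP.
apply: eq_bigr => P hPT; rewrite (dd_prod_set NN (F := fun W (x : V) => h x W)) // => W WP.
exact: hP WP.
Qed.

(** For al in D the path sets s al = -z and b al = z, so its velocity is the difference of the two
    directions. This is the direction treated in [Psi_core]. *)
Lemma dd_Psi_path A D W al x z0 : al \in D ->
  dd (fun z : R[i]^o => Psi AE W A A (pt (flip D (setv x al z)) (setv x al z))) z0 1 =
  dd (Psi AE W A A) (pt (flip D (setv x al z0)) (setv x al z0)) (pdir R (inr al : T) - pdir R (inl al : T)).
Proof.
move=> aD; pose phi (z : R[i]^o) := pt (flip D (setv x al z)) (setv x al z).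
have := @dd_pull _ R[i]^o _ phi (fun c => c *: (pdir R (inr al : T) - pdir R (inl al : T))) (Psi AE W A A) 1 _.
move=> /(_ _) /(congr1 (fun g => g z0)) -> //; first by rewrite scale1r.
move=> z t; rewrite scale1r; apply/funext => k.
change (phi (z + t * 1) k = phi z k + t * (pdir R (inr al : T) k - pdir R (inl al : T) k)).
rewrite mulr1; case: k => k; rewrite /phi /pdir /= /flip /setv.
  rewrite -[inl k == inl al]/(k == al).
  by case: (eqVneq k al) => [->|]; rewrite ?aD /=; [ring|case: ifP => _ _; ring].
rewrite -[inr k == inr al]/(k == al).
by case: (eqVneq k al) => _ /=; ring.
Qed.

(** Blocks containing al together with other variables are regular, so only the block {al}
    contributes to the residue. *)
Lemma Term_out_simple q A D al x z0 c : al \in A -> al \notin D ->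
  OmT Omega A A (pt (flip D (setv x al z0)) (setv x al z0)) -> Ahp A D (setv x al z0) != 0 ->
  near' z0 (fun z : R[i]^o => good A D (setv x al z)) ->
  (forall v, v \in ((A :\ al) :\: D)%SET -> nice (z0 + x v)) ->
  pol (fun z : R[i]^o => HS A D (setv x al z) [set al]%SET) z0 c ->
  pol (fun z : R[i]^o => Term q A D (setv x al z)) z0 (c * Term q (A :\ al)%SET D x).
Proof.
move=> aA aD hO hn hg hv hc.
have hr (B : {set I}) : B \subset ((A :\ al) :\: D)%SET ->
    pol (fun z : R[i]^o => HS A D (setv x al z) (al |: B)%SET) z0 (if B == finset.set0 then c else 0).
  move=> BT; case: eqP => [->|/eqP B0]; first by rewrite finset.setU0.
  have aB : al \notin B by apply/negP => /(fintype.subsetP BT); rewrite !inE eqxx andbF.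
  have vB v : v \in B -> v != al /\ nice (z0 + x v).
    move=> vB; split; first by apply: contraNneq aB => <-.
    by apply/hv/(fintype.subsetP BT).
  apply: pol_Q; apply: (HS_Q ZrQ zetaE hAE) => // [w e|w w' ww e].
    by have [_ e0] := set1_U1 aB e; rewrite e0 eqxx in B0.
  have [[ew eB]|[ew eB]] := set2_U1 aB ww e.
    have [va nv] := vB w' (eq_ind_r (fun S : {set I} => w' \in S) (set11 w') eB).
    by rewrite ew setv1 setvN.
  have [va nv] := vB w (eq_ind_r (fun S : {set I} => w \in S) (set11 w) eB).
  by rewrite ew setv1 setvN // addrC.
have := Term_out ZrQ Zr0 zetaE oO cO O0 hAE ON q aA aD hg hr.
rewrite (bigD1 finset.set0) ?finset.sub0set //= eqxx finset.setD0 [X in _ + X]big1 ?addr0; last first.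
  by move=> B /andP[_ /negPf ->]; rewrite mul0r.
by rewrite mulrCA.
Qed.

Lemma zfac_mulN (c k : C) : nice (c + k) -> nice (- c - k) -> nice (c - k) -> nice (- c + k) ->
  zfac zeta c k * zfac zeta (- c) k = 1.
Proof.
move=> /(nice_zeta zetaE) h1 /(nice_zeta zetaE) h2 /(nice_zeta zetaE) h3 /(nice_zeta zetaE) h4.
by rewrite /zfac opprK; field; rewrite h1 h2 h3 h4.
Qed.

Lemma zfac0 (k : C) : nice k -> nice (- k) -> zfac zeta 0 k = 1.
Proof.
move=> /(nice_zeta zetaE) h1 /(nice_zeta zetaE) h2.
by rewrite /zfac oppr0 !add0r [X in _ / X]mulrC divff // mulf_neq0.
Qed.

Lemma gfac0_mulN q D y (c : C) :
  (forall k : nat, 1 - c + k%:R != 0) -> (forall k : nat, 1 + c + k%:R != 0) ->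
  (forall k, k \in D -> [/\ nice (c + y k), nice (- c - y k), nice (c - y k) & nice (- c + y k)]) ->
  gfac0 zeta q D y c * gfac0 zeta q D y (- c) = 1.
Proof.
move=> /Gamma_cvg[_ g1] /Gamma_cvg[_ g2] hk; rewrite /gfac0 opprK.
set G1 := Gamma (1 - c) in g1 *; set G2 := Gamma (1 + c) in g2 *.
have e1 : (\prod_(k in D) zfac zeta c (y k)) * (\prod_(k in D) zfac zeta (- c) (y k)) = 1.
  by rewrite -big_split big1 // => k kD; have [] := hk k kD; exact: zfac_mulN.
have e2 : cpow q (-2 * c) * cpow q (-2 * - c) = 1.
  by rewrite -cpowD mulrN subrr cpow0.
have e3 : G1 / G2 * (G2 / G1) = 1 by field; rewrite g1.
move: e1 e2 e3; set a := \prod_(k in D) _; set b := \prod_(k in D) _.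
set p := cpow q _; set r := cpow q _; set u := G1 / G2; set v := G2 / G1 => e1 e2 e3.
transitivity ((p * r) * (u * v) * (a * b)); first by ring.
by rewrite e1 e2 e3 !mulr1.
Qed.

Lemma gfac0_0 q D y : (forall k, k \in D -> nice (y k) /\ nice (- y k)) -> gfac0 zeta q D y 0 = -1.
Proof.
move=> hk; rewrite /gfac0 mulr0 cpow0 subr0 addr0.
have /Gamma_cvg[_ g1] : forall k : nat, (1 : C) + k%:R != 0.
  by move=> k; rewrite nat1r pnatr_eq0.
rewrite divff // big1 ?mulr1 // => k kD; have [] := hk k kD; exact: zfac0.
Qed.

Lemma gfac_ext q D y y' c : (forall i, i \in D -> y i = y' i) -> gfac zeta q D y c = gfac zeta q D y' c.
Proof. by move=> e; congr (_ * _); apply: eq_bigr => i /e ->. Qed.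

End Pieces.

(** * The residue at the collision of al with minus be *)

Section Collision.
Variables (R : realType) (n : nat).
Local Notation C := R[i].
Local Notation nm := (@normc R).
Local Notation nmo := (nm : R[i]^o -> R).
Local Notation I := 'I_n.
Let nmV := @nm_vnorm R.
Variables (zeta Zr : C -> C).
Hypothesis ZrQ : forall t, Q nmo Zr t.
Hypothesis Zr0 : Zr 0 = 1.
Hypothesis zetaE : forall t, t != 0 -> zeta (1 + t) = Zr t / t.
Variables (E : weierstrass) (M : nat).
Variables (Omega : set C) (AE : AE_family R n).
Hypothesis oO : open Omega.
Hypothesis cO : connected Omega.
Hypothesis O0 : Omega 0.
Hypothesis hAE : is_AE zeta E M Omega AE.
Hypothesis ON : forall z, Omega z -> Omega (- z).
Implicit Types (A B D W : {set I}) (x y : I -> C) (q : R).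
Local Notation nice := (nice Zr).
Local Notation Lz := (Lz zeta).
Local Notation L1 := (L1 zeta).
Local Notation ell := (ell Zr).
Local Notation good := (good Zr E M Omega AE).
Local Notation HS := (HS zeta AE).
Local Notation HDe := (HDe zeta).
Local Notation Term := (Term zeta AE).
Local Notation Pre := (Pre zeta).
Local Notation Ahp A D y := (Ah AE A A (pt (flip D y) y)).
Local Notation vals A x := (0 :: [seq x i | i in A] ++ [seq - x i | i in A]).
Local Notation Vfac c := (1 - (lambda_p R E M)%:C * cpow M%:R (- (1 / 2%:R) - c)).

Lemma near_generic A D al x z0 : al \in A -> generic zeta E M AE Omega (A :\ al)%SET x ->
  z0 \in vals (A :\ al)%SET x -> - z0 \in vals (A :\ al)%SET x -> Omega z0 ->
  near' z0 (fun z : R[i]^o => Vfac z != 0 /\ Vfac (- z) != 0) ->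
  Ahp A D (setv x al z0) != 0 ->
  near' z0 (fun z : R[i]^o => good A D (setv x al z)).
Proof.
move=> aA g z0v z0v' Oz hV hA.
have hZ u v := @generic_Zr _ _ _ _ Zr0 zetaE E M Omega AE (A :\ al)%SET x u v g.
have hm i := @generic_mem _ _ (A :\ al)%SET x i.
have hk k : k \in (A :\ al)%SET -> [/\ Zr (z0 + x k) != 0, Zr (- z0 - x k) != 0,
    Zr (z0 - x k) != 0 & Zr (x k - z0) != 0].
  by move=> kA; have [h1 h2] := hm k kA; split; apply: hZ.
have h2 : Zr (2 * z0) != 0 by rewrite mulr2n mulrDl mul1r hZ.
have hm2 : Zr (- 2 * z0) != 0 by rewrite mulNr mulr2n mulrDl mul1r opprD hZ.
have hV' : near' z0 (fun z : R[i]^o => V E M [set al]%SET (setv x al z) != 0 /\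
    V E M [set al]%SET (\- setv x al z) != 0).
  by apply: near'S hV => z; rewrite !V1E /= setv1.
by have [] := near_good ZrQ oO hAE ON aA
  (generic_good ZrQ Zr0 zetaE oO cO O0 hAE ON g (finset.sub0set _)) Oz hk h2 hm2 hV' hA.
Qed.

Variables (A : {set I}) (al be : I) (x : I -> C) (q : R).
Hypothesis aA : al \in A.
Hypothesis bA : be \in A.
Hypothesis ab : al != be.
Hypothesis gx : generic zeta E M AE Omega (A :\ al)%SET x.
Hypothesis gx' : generic zeta E M AE Omega (A :\ al)%SET (flip [set be]%SET x).

Local Notation A1 := (A :\ al)%SET.
Local Notation A2 := (A :\ al :\ be)%SET.
Local Notation b := (x be).
Local Notation z0 := (- x be).
Local Notation y := (setv x al).
Local Notation x' := (flip [set be]%SET x).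

Let ba : be != al. Proof. by rewrite eq_sym. Qed.
Let bA1 : be \in A1. Proof. by rewrite !inE ba. Qed.
Let A2P k : k \in A2 -> [/\ k != al, k != be, k \in A & k \in A1].
Proof. by rewrite !inE => /and3P[kb ka kA]; split; rewrite // ka. Qed.
Let gg D : D \subset A1 -> good A1 D x.
Proof. exact: (generic_good ZrQ Zr0 zetaE oO cO O0 hAE ON gx). Qed.
Let gg' D : D \subset A1 -> good A1 D x'.
Proof. exact: (generic_good ZrQ Zr0 zetaE oO cO O0 hAE ON gx'). Qed.
Let yb z : y z be = b. Proof. by rewrite setvN. Qed.
Let y2 z k : k \in A2 -> y z k = x k. Proof. by case/A2P => *; rewrite setvN. Qed.
Let x'b : x' be = - b. Proof. by rewrite /flip inE eqxx. Qed.
Let x'2 k : k \in A2 -> x' k = x k.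
Proof. by case/A2P => _ kb _ _; rewrite /flip inE (negPf kb). Qed.

Let nadd i j : i \in A1 -> j \in A1 -> nice (x i + x j) /\ nice (- x i - x j).
Proof. by have [_ h _ _ _] := gg (finset.sub0set _); exact: h. Qed.
Let nsub i j : i \in A1 -> j \in A1 -> i != j -> nice (x i - x j).
Proof. by have [_ _ h _ _] := gg (finset.sub0set _); exact: h. Qed.

Let nk k : k \in A2 -> [/\ nice (b + x k), nice (- b - x k), nice (b - x k) & nice (- b + x k)].
Proof.
move=> /A2P[_ kb _ kA]; have [h1 h2] := nadd bA1 kA; split=> //.
  by apply: nsub; rewrite // eq_sym.
by rewrite addrC; apply: nsub.
Qed.

Let nk' k : k \in A2 -> [/\ nice (- b + x k), nice (- - b - x k), nice (- b - x k) & nice (- - b + x k)].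
Proof. by move=> /nk[? ? ? ?]; rewrite opprK. Qed.

Let nb2 : nice (2 * b) /\ nice (2 * - b).
Proof.
have [h1 h2] := nadd bA1 bA1.
by split; [have -> : 2 * b = b + b by ring|have -> : 2 * - b = - b - b by ring].
Qed.

(** At the collision only the pair al, be can produce an argument at the pole of zeta. *)
Let N0 i j : i \in A -> j \in A -> i != j -> (i \in A2) || (j \in A2) ->
  nice (y z0 i + y z0 j) /\ nice (y z0 i - y z0 j).
Proof.
move=> iA jA ij h; case: (eqVneq i al) => [ei|ia]; case: (eqVneq j al) => [ej|ja].
- by rewrite ei ej eqxx in ij.
- have jA2 : j \in A2 by move: h; rewrite ei !inE eqxx /= andbF.
  by have [? ? ? ?] := nk jA2; rewrite ei setv1 setvN.
- have iA2 : i \in A2 by move: h; rewrite ej !inE eqxx !andbF orbF.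
  by have [? ? ? ?] := nk iA2; rewrite ej setv1 setvN // opprK addrC [x i + _]addrC.
- by have iA1 : i \in A1; rewrite ?inE ?ia //; have jA1 : j \in A1; rewrite ?inE ?ja //;
  rewrite !setvN //; split; [have [] := nadd iA1 jA1|apply: nsub].
Qed.

Let N2 i : i \in A -> nice (2 * y z0 i).
Proof.
move=> iA; case: (eqVneq i al) => [->|ia]; first by rewrite setv1; case: nb2.
have iA1 : i \in A1 by rewrite !inE ia.
by rewrite setvN //; have [h _] := nadd iA1 iA1; have -> : 2 * x i = x i + x i by ring.
Qed.

Let gam (k : nat) : 1 - b + k%:R != 0 /\ 1 + b + k%:R != 0.
Proof.
have [h _ _ _ _] := gx; have [_ hb] := h be bA1; exact: nonint_shift.
Qed.

Let Ob : Omega b. Proof. by have [h _ _ _ _] := gx; have [] := h be bA1. Qed.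

Let OT D : OmT Omega A A (pt (flip D (y z0)) (y z0)).
Proof.
have OmS i : i \in A -> Omega (y z0 i).
  move=> iA; case: (eqVneq i al) => [->|ia]; first by rewrite setv1; exact: ON.
  by rewrite setvN //; have [h _ _ _ _] := gx; have [] := h i _; rewrite // !inE ia.
split=> i iA /=; last exact: OmS.
by rewrite /flip; case: ifP => _; [apply: ON|]; apply: OmS.
Qed.

Let hV : near' z0 (fun z : R[i]^o => Vfac z != 0 /\ Vfac (- z) != 0).
Proof.
have [_ _ _ h _] := gx; have [v1 v2] := h be bA1.
rewrite !V1E /= in v1 v2.
apply: near'W; apply: nearI.
  apply: (Q_neq nmV); first exact: v2.
  by apply: (Vfactor_Q E M nmV (F := fun z : R[i]^o => z : C)); exact: Q_idC.
apply: (Q_neq nmV); first by rewrite opprK.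
apply: (Vfactor_Q E M nmV (F := fun z : R[i]^o => - z : C)).
by apply: (Q_opp nmV); exact: Q_idC.
Qed.

Let NG D : Ahp A D (y z0) != 0 -> near' z0 (fun z : R[i]^o => good A D (y z)).
Proof.
have [m1 m2] := generic_mem x bA1; move=> hA.
apply: near_generic => //; [by rewrite opprK|exact: ON].
Qed.

Let notA2 w : w \in A -> w \notin A2 -> w = al \/ w = be.
Proof.
by move=> wA; rewrite !inE wA andbT negb_and !negbK => /orP[/eqP ->|/eqP ->]; [right|left].
Qed.

(** The possibly singular blocks are {al, be}, through [L1] at 1 + t, and the singletons {al} and
    {be} when D meets {al, be}, through [Lz] at t or -t. *)
Let HSreg D W : D \subset A -> W \subset (A :\: D)%SET -> Ahp A D (y z0) != 0 ->
  (forall w, W = [set w]%SET -> (w \in A2) || (D \subset A2)) -> W != (al |: [set be])%SET ->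
  Q nmo (fun z : R[i]^o => HS A D (y z) W) z0.
Proof.
move=> DA WA hA h1 hW; apply: (HS_Q ZrQ zetaE hAE) => // [w e|w w' ww e].
  have : w \in (A :\: D)%SET by apply: (fintype.subsetP WA); rewrite e inE.
  rewrite inE => /andP[wD wA]; split; last exact: N2.
  move=> i iD; have iA := fintype.subsetP DA i iD.
  have wi : w != i by apply: contraNneq wD => ->.
  have [p m] : nice (y z0 w + y z0 i) /\ nice (y z0 w - y z0 i); last by split.
  apply: N0 => //; case/orP: (h1 w e) => [-> //|DA2].
  by rewrite (fintype.subsetP DA2 i iD) orbT.
have wA : w \in A.
  by have : w \in (A :\: D)%SET; [apply: (fintype.subsetP WA); rewrite e !inE eqxx|rewrite inE => /andP[]].
have wA' : w' \in A.
  by have : w' \in (A :\: D)%SET; [apply: (fintype.subsetP WA); rewrite e !inE eqxx orbT|rewrite inE => /andP[]].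
have [] // := @N0 w w' wA wA' ww _; apply/norP; case=> /(notA2 wA) c /(notA2 wA') c'.
case/eqP: hW; rewrite e; case: c => ew; case: c' => ew'; rewrite ew ew' // in ww *.
- by rewrite eqxx in ww.
- by rewrite finset.setUC.
- by rewrite eqxx in ww.
Qed.

Let subA1 (D0 : {set I}) : D0 \subset A2 -> D0 \subset A1.
Proof. by move=> h; apply/fintype.subsetP => k /(fintype.subsetP h) /A2P[]. Qed.
Let subA (D0 : {set I}) : D0 \subset A2 -> D0 \subset A.
Proof. by move=> h; apply/fintype.subsetP => k /(fintype.subsetP h) /A2P[]. Qed.
Let alN (D0 : {set I}) : D0 \subset A2 -> al \notin D0.
Proof. by move=> h; apply/negP => /(fintype.subsetP h) /A2P[]; rewrite eqxx. Qed.
Let beN (D0 : {set I}) : D0 \subset A2 -> be \notin D0.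
Proof. by move=> h; apply/negP => /(fintype.subsetP h) /A2P[]; rewrite eqxx. Qed.

Let zzE (z : C) : z - z0 = z + b. Proof. by rewrite opprK. Qed.

Let ellQ (c : C) : Q nmo (fun z : R[i]^o => ell (c * (z + b))) z0.
Proof.
have -> : (fun z : R[i]^o => ell (c * (z + b))) = (fun z => ell (c * z + c * b)).
  by apply/funext => z; rewrite mulrDr.
apply: (Q_comp nmV (F := fun z : R[i]^o => c * z + c * b)); first exact: Q_affine.
by apply: (ell_Q ZrQ); rewrite -mulrDr addNr mulr0 Zr0 oner_neq0.
Qed.

Let near_t : near' z0 (fun z : R[i]^o => nice (z + b)).
Proof.
have h : Zr (1 * z0 + b) != 0 by rewrite mul1r addNr Zr0 oner_neq0.
by apply: near'S (near'_nice ZrQ (oner_neq0 _) h) => z; rewrite mul1r.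
Qed.

Let pol_inv : pol (fun z : R[i]^o => (z + b)^-1) z0 1.
Proof.
apply: (@pol1 _ (fun=> 1)); first exact: Q_cst.
by apply: near'W; apply: nearT => z; rewrite zzE mul1r.
Qed.

(** Only the block {al, be} is singular, and [L1] t = 1/t^2 + regular has no term in 1/t. Everything
    multiplying it is constant in z, so the double pole leaves no residue. *)
Lemma case_none D0 : D0 \subset A2 -> near' z0 (fun z : R[i]^o => good A D0 (y z)) /\ pol (fun z : R[i]^o => Term q A D0 (y z)) z0 0.
Proof.
move=> DA2; have aD := alN DA2.
have hA : Ahp A D0 (y z0) != 0.
  rewrite (Ah_const ZrQ Zr0 zetaE oO cO O0 hAE) //.
  by have [_ _ _ _] := gg (subA1 DA2).
split; first exact: NG.
have hr (B : {set I}) : B \subset (A1 :\: D0)%SET ->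
    pol (fun z : R[i]^o => HS A D0 (y z) (al |: B)%SET) z0 0.
  move=> BT; have aB : al \notin B by apply/negP => /(fintype.subsetP BT); rewrite !inE eqxx andbF.
  case: (eqVneq B [set be]%SET) => [->|Bb]; last first.
    apply: pol_Q; apply: HSreg => //; [exact: subA| | |].
    - apply/fintype.subsetP => k; rewrite !inE => /orP[/eqP ->|/(fintype.subsetP BT)]; first by rewrite aD.
      by rewrite !inE => /and3P[-> _ ->].
    - by move=> w _; rewrite DA2 orbT.
    - by apply: contraNneq Bb => e; rewrite -(setU1K aB) e setU1K // inE.
  have p2 : pol (fun z : R[i]^o => ((z + b) ^+ 2)^-1) z0 0.
    exists (fun=> 1); split; [exact: Q_cst| |exact: dd_cst].
    by apply: near'W; apply: nearT => z; rewrite zzE mul1r.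
  have pr : pol (fun z : R[i]^o => dd ell (z + b) 1 + Psi AE (al |: [set be])%SET A A (pt (flip D0 (y z)) (y z))) z0 0.
    apply: pol_Q; apply: (Q_add nmV); last by apply: (Psi_path_Q hAE nmV) => // i; exact: setv_Q.
    have -> : (fun z : R[i]^o => dd ell (z + b) 1) = (fun z => (fun u => dd ell u 1) (1 * z + b)).
      by apply/funext => z; rewrite mul1r.
    apply: (Q_comp nmV (F := fun z : R[i]^o => 1 * z + b) (g := fun u : R[i]^o => dd ell u 1)); first exact: Q_affine.
    by apply: (Q_dd nmV); apply: (ell_Q ZrQ); rewrite mul1r addNr Zr0 oner_neq0.
  rewrite -[0]addr0; apply: pol_ext (pol_add p2 pr); apply: near'S near_t => z hz.
  by rewrite /HS HD2 // setv1 yb (L1E ZrQ zetaE hz) addrCA addrA.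
have := Term_out ZrQ Zr0 zetaE oO cO O0 hAE ON q aA aD (NG hA) hr.
by rewrite big1 ?mulr0 // => B _; rewrite mul0r.
Qed.

Let HDe0Q D0 (c : R[i]^o -> C) : D0 \subset A2 -> Q nmo c z0 -> c z0 = b \/ c z0 = - b ->
  Q nmo (fun z : R[i]^o => HDe D0 (y z) (c z)) z0.
Proof.
move=> DA2 cQ hc; apply: (HDe_Q ZrQ zetaE nmV (y := fun z : R[i]^o => y z)) => //.
- by move=> i; exact: setv_Q.
- move=> i /(fintype.subsetP DA2) iA; rewrite y2 //; have [? ? ? ?] := nk iA.
  by case: hc => ->.
- by case: hc => ->; case: nb2.
Qed.

(** The summand of be in H_D({al}) is Lz(z - b) - Lz(z + b), and -Lz(t) = 1/t - ell(t) has residue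
    1. *)
Lemma case_be D0 : D0 \subset A2 ->
  near' z0 (fun z : R[i]^o => good A (be |: D0)%SET (y z)) /\ 
  pol (fun z : R[i]^o => Term q A (be |: D0)%SET (y z)) z0 (Term q A1 (be |: D0)%SET x).
Proof.
move=> DA2; set D := (be |: D0)%SET.
have aD : al \notin D by rewrite !inE negb_or ab alN.
have DA1 : D \subset A1.
  by apply/fintype.subsetP => k; rewrite !inE => /orP[/eqP ->|/(fintype.subsetP DA2)/A2P[-> _ -> _] //]; rewrite ba.
have hA : Ahp A D (y z0) != 0.
  by rewrite (Ah_const ZrQ Zr0 zetaE oO cO O0 hAE) //; have [_ _ _ _] := gg DA1.
split; first exact: NG.
rewrite -[Term q A1 D x]mul1r.
apply: (Term_out_simple ZrQ Zr0 zetaE oO cO O0 hAE ON) => //; first exact: NG.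
  move=> v; rewrite !inE negb_or => /and3P[/andP[vb _] va vA].
  have vA2 : v \in A2 by rewrite !inE vb va.
  by have [? ? ? ?] := nk vA2.
have pr : pol (fun z : R[i]^o => (- ell (1 * (z + b)) + Lz (z - b) + HDe D0 (y z) z)
    + Psi AE [set al]%SET A A (pt (flip D (y z)) (y z))) z0 0.
  apply: pol_Q; apply: (Q_add nmV); last by apply: (Psi_path_Q hAE nmV) => // i; exact: setv_Q.
  apply: (Q_add nmV); last by apply: HDe0Q => //; [exact: Q_idC|right].
  apply: (Q_add nmV); first by apply: (Q_opp nmV); exact: ellQ.
  apply: (Q_Lz ZrQ zetaE nmV (F := fun z : R[i]^o => z - b)); first by have [] := nadd bA1 bA1.
  by apply: (Q_sub nmV); [exact: Q_idC|exact: Q_cst].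
rewrite -[1]addr0; apply: pol_ext (pol_add pol_inv pr); apply: near'S near_t => z hz.
rewrite /HS HD1 setv1 /D HDe_U1 ?beN // yb (LzE ZrQ zetaE hz) mul1r; ring.
Qed.

Let subAU (D0 : {set I}) : D0 \subset A2 -> (be |: D0)%SET \subset A1.
Proof.
move=> h; apply/fintype.subsetP => k; rewrite !inE => /orP[/eqP ->|/(fintype.subsetP h)/A2P[-> _ -> _] //].
by rewrite ba.
Qed.

Let PreE (D0 : {set I}) z : D0 \subset A2 ->
  Pre q (al |: D0)%SET (y z) = Pre q D0 x * gfac zeta q D0 x z.
Proof.
move=> h; have e i : i \in D0 -> y z i = x i by move=> /(fintype.subsetP h); exact: y2.
by rewrite (Pre_U1 _ _ _ (alN h)) setv1 (Pre_ext _ _ e) (gfac_ext _ _ _ e).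
Qed.

Let gfk' (D0 : {set I}) : D0 \subset A2 -> forall k, k \in D0 ->
  [/\ nice (- b + x k), nice (- - b - x k), nice (- b - x k) & nice (- - b + x k)].
Proof. by move=> h k /(fintype.subsetP h); exact: nk'. Qed.

Let ldr_g (D0 : {set I}) : D0 \subset A2 -> ldr (gfac0 zeta q D0 x) z0 _ :=
  fun h => ldr_gfac0 ZrQ zetaE q (fun k => etrans (congr1 (fun c => 1 + c + k%:R != 0) (opprK b)) (gam k).2)
   (fun k => (gam k).1) (gfk' h).

(** The summand of al in H_D({be}) is Lz(b - z) - Lz(b + z), again with residue 1. The cofactor
    depends on z and is evaluated at z = -b, where al plays the part that be has in D at the flipped
    point x'. *)
Lemma case_al D0 : D0 \subset A2 ->
  near' z0 (fun z : R[i]^o => good A (al |: D0)%SET (y z)) /\ 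
  pol (fun z : R[i]^o => Term q A (al |: D0)%SET (y z)) z0 (Term q A1 (be |: D0)%SET x').
Proof.
move=> DA2; set D := (al |: D0)%SET; set D' := (be |: D0)%SET.
have aD0 := alN DA2; have bD0 := beN DA2.
have aD : al \in D by rewrite !inE eqxx.
have bD : be \notin D by rewrite !inE negb_or ba.
have DA : D \subset A.
  by apply/fintype.subsetP => k; rewrite !inE => /orP[/eqP -> //|/(fintype.subsetP DA2)/A2P[]].
pose T0 := (A2 :\: D0)%SET.
have T02 k : k \in T0 -> k \in A2 by rewrite inE => /andP[].
have aT : al \notin T0 by rewrite !inE eqxx /= !andbF.
have bT : be \notin T0 by rewrite !inE eqxx /= !andbF.
have g' := gg' (subAU DA2).
have swap W : al \notin W -> be \notin W -> Ahp A D (y z0) != 0 /\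
    Psi AE W A A (pt (flip D (y z0)) (y z0)) = Psi AE W A1 A1 (pt (flip D' x') x').
  move=> aW bW; apply: (Psi_swap ZrQ Zr0 zetaE oO cO O0 hAE aA bA ab aW bW).
  - exact: OT.
  - exact: (good_OmT ON g').
  - by case: g'.
  - by rewrite /= /flip (negPf bD).
  - by rewrite /= /flip !inE !eqxx /= setv1.
  - by rewrite /= x'b setv1.
  split=> k kA; have [ka kb _ _] := A2P kA; rewrite /= ?y2 ?x'2 //.
  by rewrite /flip !inE (negPf ka) (negPf kb) /= y2 // x'2.
have n0 : forall B : {set I}, B = finset.set0 -> al \notin B /\ be \notin B by move=> B ->; rewrite !inE.
have [hA _] := swap finset.set0 (n0 _ erefl).1 (n0 _ erefl).2.
split; first exact: NG.
have ADE : (A :\: D)%SET = (be |: T0)%SET.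
  apply/setP => k; rewrite !inE; case: (eqVneq k be) => [->|kb] /=; first by rewrite negb_or ba bD0.
  by case: (eqVneq k al) => [->|] //=; rewrite ?andbF.
have regQ W : W \subset (A :\: D)%SET -> W != [set be]%SET -> Q nmo (fun z : R[i]^o => HS A D (y z) W) z0.
  move=> WA Wb; apply: HSreg => //.
    move=> w e; have : w \in (A :\: D)%SET by apply: (fintype.subsetP WA); rewrite e inE.
    rewrite ADE !inE => /orP[/eqP wb|/and4P[_ -> -> ->] //].
    by rewrite e wb eqxx in Wb.
  apply/eqP => e; have : al \in (A :\: D)%SET by apply: (fintype.subsetP WA); rewrite e !inE eqxx.
  by rewrite inE aD.
pose reg z := - ell (1 * (z + b)) + Lz (b - z) + HDe D0 (y z) b + Psi AE [set be]%SET A A (pt (flip D (y z)) (y z)).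
have qreg : Q nmo reg z0.
  apply: (Q_add nmV); last by apply: (Psi_path_Q hAE nmV) => // i; exact: setv_Q.
  apply: (Q_add nmV); last by apply: (HDe0Q (c := fun=> b)) => //; [exact: Q_cst|left].
  apply: (Q_add nmV); first by apply: (Q_opp nmV); exact: ellQ.
  apply: (Q_Lz ZrQ zetaE nmV (F := fun z : R[i]^o => b - z)).
    by rewrite opprK; have [] := nadd bA1 bA1.
  by apply: (Q_sub nmV); [exact: Q_cst|exact: Q_idC].
have tQ : Q nmo (fun z : R[i]^o => z + b) z0 by apply: (Q_add nmV); [exact: Q_idC|exact: Q_cst].
(* The block containing be, multiplied by t = z + b. At t = 0 it is 1 for the block {be} and 0 for
   all larger ones. *)
pose u (B : {set I}) z := if B == finset.set0 then 1 + (z + b) * reg z else (z + b) * HS A D (y z) (be |: B)%SET.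
have uQ (B : {set I}) : B \subset T0 -> Q nmo (u B) z0.
  move=> BT; rewrite /u; case: eqP => [_|/eqP B0].
    by apply: (Q_add nmV); [exact: Q_cst|apply: (Q_mul nmV)].
  have bB : be \notin B by apply: contra bT => /(fintype.subsetP BT).
  apply: (Q_mul nmV) => //; apply: regQ; first by rewrite ADE finset.setUS.
  apply: contraNneq B0 => e; apply/eqP; by have [] := set1_U1 bB e.
pose K z := Pre q D0 x * (gfac0 zeta q D0 x z * zeta (1 + 2 * z)) * Psi AE finset.set0 A A (pt (flip D (y z)) (y z))
  * \sum_(B : {set I} | B \subset T0) u B z * PS (T0 :\: B)%SET (HS A D (y z)).
have KQ : Q nmo K z0.
  apply: (Q_mul nmV); first apply: (Q_mul nmV); first apply: (Q_mul nmV); first exact: Q_cst.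
  - apply: (Q_mul nmV); first by have [] := ldr_g DA2.
    apply: (Q_zeta ZrQ zetaE nmV (F := fun z : R[i]^o => 2 * z)) => //; first by case: nb2 => _ [].
    by apply: (Q_mul nmV); [exact: Q_cst|exact: Q_idC].
  - by apply: (Psi_path_Q hAE nmV) => // i; exact: setv_Q.
  apply: (Q_sum nmV) => B BT; apply: (Q_mul nmV); first exact: uQ.
  apply: (PS_Q nmV) => W W0 WT; have WT0 : W \subset T0 by exact: (fintype.subset_trans WT (finset.subsetDl _ _)).
  apply: regQ; first by rewrite ADE; exact: (fintype.subset_trans WT0 (finset.subsetUr _ _)).
  apply: contraNneq bT => e; apply: (fintype.subsetP WT0); by rewrite e inE.
have -> : Term q A1 D' x' = K z0.
  have T1 : (A1 :\: D')%SET = T0.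
    apply/setP => k; rewrite !inE; case: (eqVneq k be) => [->|] //=; by rewrite ?andbF.
  have e i : i \in D0 -> x' i = x i by move=> /(fintype.subsetP DA2); exact: x'2.
  rewrite /Term /K T1 (Pre_U1 _ _ _ bD0) x'b (Pre_ext _ _ e) (gfac_ext _ _ _ e) gfacE.
  have [_ eA] := swap finset.set0 (n0 _ erefl).1 (n0 _ erefl).2.
  rewrite eA {1}/Psi eqxx; congr (_ * _).
  rewrite (bigD1 finset.set0) ?finset.sub0set //= [X in _ + X]big1 ?addr0; last first.
    by move=> B /andP[_ /negPf B0]; rewrite /u B0 addNr !mul0r.
  rewrite /u eqxx addNr mul0r addr0 mul1r finset.setD0.
  apply: PS_ext => W W0 WT.
  have aW : al \notin W by apply: contra aT => /(fintype.subsetP WT).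
  have bW : be \notin W by apply: contra bT => /(fintype.subsetP WT).
  have [_ eP] := swap W aW bW.
  suff eH : HD zeta D' W x' = HD zeta D W (y z0) by rewrite /HS eP eH.
  have wy w : w \in W -> x' w = y z0 w.
    by move=> /(fintype.subsetP WT)/T02 wA; rewrite x'2 // y2.
  have ed i : i \in D0 -> x' i = y z0 i.
    by move=> /(fintype.subsetP DA2) iA; rewrite x'2 // y2.
  have [e0|[w e0]|[w [w' [ww e0]]]|h] := small_set W; [by rewrite e0 (HD0 zeta D' x') (HD0 zeta D (y z0))| | |by rewrite (HD3 zeta D' x' h) (HD3 zeta D (y z0) h)].
    have wW : w \in W by rewrite e0 inE.
    by rewrite e0 (HD1 zeta D' w x') (HD1 zeta D w (y z0)) /D /D' (HDe_U1 _ _ _ bD0) (HDe_U1 _ _ _ aD0) x'b setv1 -(wy w wW) (HDe_ext zeta _ ed).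
  by rewrite e0 (HD2 zeta D' x' ww) (HD2 zeta D (y z0) ww) (wy w) ?(wy w') // e0 !inE eqxx ?orbT.
apply: pol1 => //; apply: near'S (near'I near_t (NG hA)) => z [hz g].
rewrite zzE /Term PreE // gfacE /K {1}/Psi eqxx -[RHS]mulrA; congr (_ * _).
rewrite ADE (PS_U1 _ bT) big_distrl /=; apply: eq_bigr => B BT; rewrite mulrAC; congr (_ * _).
have t0 : z + b != 0 by case: hz.
rewrite /u; case: eqP => [->|_]; last by rewrite mulrAC divff // mul1r.
rewrite finset.setU0 /HS HD1 yb /D HDe_U1 // setv1 [b + z]addrC (LzE ZrQ zetaE hz) /reg mul1r.
rewrite -/D; move: t0 (ell _) (Lz _) (HDe _ _ _) (Psi _ _ _ _ _) => t0 v1 v2 v3 v4.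
by move: (z + b) t0 => t t0; field.
Qed.

Section Both.
Variable D0 : {set I}.
Hypothesis DA2 : D0 \subset A2.
Local Notation D := (al |: (be |: D0))%SET.
Local Notation T0 := (A2 :\: D0)%SET.
Local Notation P0 := (pt (flip D (y z0)) (y z0)).
Local Notation H := (HS A2 D0 x).

Let aD0 := alN DA2.
Let bD0 := beN DA2.
Let T02 k : k \in T0 -> k \in A2. Proof. by rewrite inE => /andP[]. Qed.
Let aT : al \notin T0. Proof. by rewrite !inE eqxx /= !andbF. Qed.
Let bT : be \notin T0. Proof. by rewrite !inE eqxx /= !andbF. Qed.
Let aD : al \in D. Proof. by rewrite !inE eqxx. Qed.
Let bD : be \in D. Proof. by rewrite !inE eqxx orbT. Qed.
Let abD : al \notin (be |: D0)%SET. Proof. by rewrite !inE negb_or ab. Qed.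
Let C0 : (A :\ be :\ al = A2)%SET. Proof. by apply/setP => k; rewrite !inE andbCA. Qed.
Let g1 := gg (subA1 DA2).
Let g2 := gg' (subA1 DA2).

Let P0_al : P0 (inl al) = b. Proof. by rewrite /= /flip aD setv1 opprK. Qed.
Let P0_be : P0 (inl be) = - b. Proof. by rewrite /= /flip bD yb. Qed.
Let P0_ral : P0 (inr al) = - b. Proof. by rewrite /= setv1. Qed.
Let P0_rbe : P0 (inr be) = b. Proof. by rewrite /= yb. Qed.
Let P0_agree (w : I -> C) : (forall k, k \in A2 -> w k = x k) -> agree A2 A2 P0 (pt (flip D0 w) w).
Proof.
move=> e; split=> k kA; have [ka kb _ _] := A2P kA; rewrite /= ?y2 ?e //.
by rewrite /flip !inE (negPf ka) (negPf kb) /= y2 // e.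
Qed.

(** s al = b be and s be = b al at the collision, so both indices disappear from A_E. *)
Let red0 : Ah AE A A P0 = Ahp A2 D0 x.
Proof.
rewrite (Ah_cancel ZrQ Zr0 zetaE oO cO O0 hAE (OT D) aA bA) ?P0_al ?P0_rbe //.
have h' := OmTD1 al be (OT D).
have aAb : al \in (A :\ be)%SET by rewrite !inE ab.
rewrite (Ah_cancel ZrQ Zr0 zetaE oO cO O0 hAE h' bA1 aAb) ?P0_be ?P0_ral // C0.
apply: (Ah_local oO cO O0 hAE); last exact: P0_agree.
by have := OmTD1 be al h'; rewrite C0.
Qed.

Let redw (w : I -> C) : good A1 D0 w -> (forall k, k \in A2 -> w k = x k) ->
  Ahp A1 D0 w = Ahp A2 D0 x.
Proof.
move=> g e; have hO := good_OmT ON g.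
rewrite (Ah_cancel ZrQ Zr0 zetaE oO cO O0 hAE hO bA1 bA1) /=; last by rewrite /flip (negPf bD0).
apply: (Ah_local oO cO O0 hAE); first exact: (OmTD1 be be hO).
by split=> k kA; rewrite /= /flip e.
Qed.

Let n2 : Ahp A2 D0 x != 0. Proof. by rewrite -(redw g1) //; case: g1. Qed.
Let n0 : Ah AE A A P0 != 0. Proof. by rewrite red0. Qed.

Let PsiP0 W : al \notin W -> be \notin W -> Psi AE W A A P0 = Psi AE W A2 A2 (pt (flip D0 x) x).
Proof.
move=> aW bW.
have e1 : Psi AE W A A P0 = Psi AE W A1 (A :\ be)%SET P0.
  by apply: (Psi_cancel ZrQ Zr0 zetaE oO cO O0 hAE (OT D) n0 aA aW bA); rewrite P0_al P0_rbe.
have h' := OmTD1 al be (OT D).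
have aAb : al \in (A :\ be)%SET by rewrite !inE ab.
have n' : Ah AE A1 (A :\ be)%SET P0 != 0.
  by rewrite -(Ah_cancel ZrQ Zr0 zetaE oO cO O0 hAE (OT D) aA bA) ?n0 // P0_al P0_rbe.
have e2 : Psi AE W A1 (A :\ be)%SET P0 = Psi AE W A2 (A :\ be :\ al)%SET P0.
  by apply: (Psi_cancel ZrQ Zr0 zetaE oO cO O0 hAE h' n' bA1 bW aAb); rewrite P0_be P0_ral.
rewrite C0 in e2.
have h2 : OmT Omega A2 A2 P0 by have := OmTD1 be al h'; rewrite C0.
rewrite e1 e2; apply: (Psi_local oO cO O0 hAE W h2); last exact: P0_agree.
rewrite (Ah_local oO cO O0 hAE h2 (P0_agree (fun _ _ => erefl))); exact: n2.
Qed.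

Let Psiw W (w : I -> C) : good A1 D0 w -> (forall k, k \in A2 -> w k = x k) -> be \notin W ->
  Psi AE W A1 A1 (pt (flip D0 w) w) = Psi AE W A2 A2 (pt (flip D0 x) x).
Proof.
move=> g e bW; have hO := good_OmT ON g; have nw : Ahp A1 D0 w != 0 by case: g.
have eb : pt (flip D0 w) w (inl be) = pt (flip D0 w) w (inr be) by rewrite /= /flip (negPf bD0).
rewrite (Psi_cancel ZrQ Zr0 zetaE oO cO O0 hAE hO nw bA1 bW bA1 eb).
apply: (Psi_local oO cO O0 hAE W); first exact: (OmTD1 be be hO).
  by rewrite -(Ah_cancel ZrQ Zr0 zetaE oO cO O0 hAE hO bA1 bA1 eb).
by split=> k kA; rewrite /= /flip e.
Qed.

Let WN W : W \subset T0 -> al \notin W /\ be \notin W.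
Proof.
by move=> WT; split; [apply: contra aT|apply: contra bT] => /(fintype.subsetP WT).
Qed.

Let D02 i : i \in D0 -> i \in A2. Proof. exact: (fintype.subsetP DA2). Qed.

Let HSw W (w : I -> C) : good A1 D0 w -> (forall k, k \in A2 -> w k = x k) -> W \subset T0 ->
  HS A1 D0 w W = H W.
Proof.
move=> g e WT; have [_ bW] := WN WT.
have e1 : HD zeta D0 W w = HD zeta D0 W x.
  apply: HD_ext => i; first by move=> /D02; exact: e.
  by move=> /(fintype.subsetP WT)/T02; exact: e.
by rewrite /HS (Psiw g e bW) e1.
Qed.

Let HDe_both (c z : C) : HDe D (y z) c = Lz (c - z) - Lz (c + z) + (Lz (c - b) - Lz (c + b) + HDe D0 x c).
Proof.
rewrite (HDe_U1 _ _ _ abD) setv1 (HDe_U1 _ _ _ bD0) yb.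
by rewrite (@HDe_ext _ _ zeta D0 (y z) x) // => i /D02; exact: y2.
Qed.

Let HD_y0 W : W \subset T0 -> HD zeta D W (y z0) = HD zeta D0 W x.
Proof.
move=> WT.
have wy w : w \in W -> y z0 w = x w by move=> /(fintype.subsetP WT)/T02; exact: y2.
have [e0|[w e0]|[w [w' [ww e0]]]|h] := small_set W.
- by rewrite e0 (HD0 zeta D0 x) (HD0 zeta D (y z0)).
- have wW : w \in W by rewrite e0 inE.
  (* At z = -b the summands of al and be in H_D({w}) are opposite. *)
  rewrite e0 (HD1 zeta D w (y z0)) (HD1 zeta D0 w x) (wy w wW) HDe_both opprK.
  by move: (Lz _) (Lz _) (HDe _ _ _) => v1 v2 v3; ring.
- by rewrite e0 (HD2 zeta D0 x ww) (HD2 zeta D (y z0) ww) (wy w) ?(wy w') // e0 !inE eqxx ?orbT.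
- by rewrite (HD3 zeta D (y z0) h) (HD3 zeta D0 x h).
Qed.

Let HS_y0 W : W \subset T0 -> HS A D (y z0) W = H W.
Proof.
by move=> WT; have [aW bW] := WN WT; rewrite /HS (PsiP0 aW bW) HD_y0.
Qed.

(** For W = {w} the derivative of Lz(x w - z) - Lz(x w + z) at z = -b is -L1(x w + b) - L1(x w - b),
    that is minus H of the pairs be, w at x and at x'. For larger W both sides vanish, H being
    constant in z on pairs and 0 on three or more elements. *)
Let dd_HD W : W \subset T0 -> W != finset.set0 ->
  Q nmo (fun z : R[i]^o => HD zeta D W (y z)) z0 ->
  dd (fun z : R[i]^o => HD zeta D W (y z)) z0 1 = - (HD zeta D0 (be |: W)%SET x + HD zeta D0 (be |: W)%SET x').
Proof.
move=> WT W0 WQ; have [_ bW] := WN WT.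
have wy w z : w \in W -> y z w = x w by move=> /(fintype.subsetP WT)/T02; exact: y2.
have [e0|[w e0]|[w [w' [ww e0]]]|h] := small_set W; first by exfalso; rewrite e0 eqxx in W0.
- have wW : w \in W by rewrite e0 inE.
  have wA := T02 (fintype.subsetP WT w wW); have [ka kb _ _] := A2P wA.
  have bw : be != w by rewrite eq_sym.
  have [k1 k2 k3 k4] := nk wA.
  have m1 : nice (-1 * z0 + x w) by rewrite mulN1r opprK.
  have m2 : nice (1 * z0 + x w) by rewrite mul1r.
  rewrite e0 (HD2 zeta D0 x bw) (HD2 zeta D0 x' bw) x'b (x'2 wA).
  have q1 := Q_Lz ZrQ zetaE nmV (F := fun z : R[i]^o => -1 * z + x w) m1 (Q_affine _ _ _).
  have q2 := Q_Lz ZrQ zetaE nmV (F := fun z : R[i]^o => 1 * z + x w) m2 (Q_affine _ _ _).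
  rewrite (dd_ext nmV (F' := fun z : R[i]^o => (Lz (-1 * z + x w) - Lz (1 * z + x w))
     + (Lz (x w - b) - Lz (x w + b) + HDe D0 x (x w)))); last 2 first.
  + apply: nearT => z; rewrite (HD1 zeta D w (y z)) (wy w z wW) HDe_both mulN1r mul1r.
    by rewrite ![x w + _]addrC.
  + by rewrite -e0.
  rewrite (dd_add nmV); [|exact: (Q_sub nmV)|exact: Q_cst].
  rewrite (dd_sub nmV) // dd_cst addr0 (dd_Lz ZrQ zetaE m1) (dd_Lz ZrQ zetaE m2).
  by rewrite !mulN1r !mul1r opprK opprD.
- have c3 : (2 < #|(be |: W)%SET|)%N by rewrite cardsU1 bW e0 cards2 ww.
  rewrite (HD3 zeta D0 x c3) (HD3 zeta D0 x' c3) addr0 oppr0.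
  rewrite -(dd_cst (L1 (x w + x w')) z0 1); apply: (dd_ext nmV) => //; apply: nearT => z.
  by rewrite e0 (HD2 zeta D (y z) ww) (wy w z) ?(wy w' z) // e0 !inE eqxx ?orbT.
have c3 : (2 < #|(be |: W)%SET|)%N by rewrite cardsU1 bW; apply: leq_trans h _; exact: leq_addl.
rewrite (HD3 zeta D0 x c3) (HD3 zeta D0 x' c3) addr0 oppr0.
rewrite -(dd_cst 0 z0 1); apply: (dd_ext nmV) => //; apply: nearT => z.
by rewrite (HD3 zeta D (y z) h).
Qed.

Let dd_Psi W : al \notin W -> be \notin W ->
  dd (fun z : R[i]^o => Psi AE W A A (pt (flip D (y z)) (y z))) z0 1 =
  - (Psi AE (be |: W)%SET A1 A1 (pt (flip D0 x) x) + Psi AE (be |: W)%SET A1 A1 (pt (flip D0 x') x'))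
  * (if W == finset.set0 then Ahp A2 D0 x else 1).
Proof.
move=> aW bW; rewrite (dd_Psi_path AE A W x z0 aD).
have a1 : agree A2 A2 P0 (pt (flip D0 x) x) by apply: P0_agree.
have a2 : agree A2 A2 P0 (pt (flip D0 x') x') by apply: P0_agree.
rewrite (Psi_core ZrQ Zr0 zetaE oO cO O0 hAE aA bA ab aW bW (OT D) n0 P0_al P0_rbe P0_be P0_ral
   (z1 := pt (flip D0 x) x) (z2 := pt (flip D0 x') x')) //; last 2 first.
- by rewrite /= /flip (negPf bD0).
- by rewrite /= /flip (negPf bD0) inE eqxx.
rewrite (Psi_deriv hAE (good_OmT ON g1)) //; last by case: g1.
rewrite (Psi_deriv hAE (good_OmT ON g2)) //; last by case: g2.
by rewrite (redw g1) // (redw g2) // -mulrDl mulNr.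
Qed.

Let DA : D \subset A.
Proof.
by apply/fintype.subsetP => k; rewrite !inE => /or3P[/eqP -> //|/eqP -> //|/(fintype.subsetP DA2)/A2P[]].
Qed.

Let ADE : (A :\: D)%SET = T0.
Proof.
apply/setP => k; rewrite !inE.
by case: (k == al); case: (k == be); rewrite ?andbF.
Qed.

Let HSQ W : W \subset T0 -> Q nmo (fun z : R[i]^o => HS A D (y z) W) z0.
Proof.
move=> WT; apply: HSreg => //; first by rewrite ADE.
  by move=> w e; rewrite (T02 (fintype.subsetP WT w _)) // e inE.
by apply/eqP => e; have [] := WN WT; rewrite e !inE eqxx.
Qed.

Let PsiQ W : Q nmo (fun z : R[i]^o => Psi AE W A A (pt (flip D (y z)) (y z))) z0.
Proof. by apply: (Psi_path_Q hAE nmV) => // i; exact: setv_Q. Qed.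

(** Differentiating a block in z adjoins be to it, at x and at x', with a minus sign. In the product
    rule this yields the partitions in which be joins an existing block. *)
Let dd_HS W : W \subset T0 -> W != finset.set0 ->
  dd (fun z : R[i]^o => HS A D (y z) W) z0 1 = - (HS A1 D0 x (be |: W)%SET + HS A1 D0 x' (be |: W)%SET).
Proof.
move=> WT W0; have [aW bW] := WN WT.
have q1 : Q nmo (fun z : R[i]^o => HD zeta D W (y z)) z0.
  apply: (Q_ext nmV) (Q_sub nmV (HSQ WT) (PsiQ W)); apply: nearT => z; exact: addrK.
rewrite (dd_add nmV) // (dd_HD WT W0 q1) (dd_Psi aW bW) (negPf W0) mulr1 /HS.
move: (HD _ _ _ x) (HD _ _ _ x') (Psi _ _ _ _ (pt _ x)) (Psi _ _ _ _ (pt _ x')) => v1 v2 v3 v4.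
by ring.
Qed.

Let bal_D0 k : k \in D0 -> [/\ nice (b + x k), nice (- b - x k), nice (b - x k) & nice (- b + x k)].
Proof. by move=> /D02; exact: nk. Qed.

Let A1T (w : I -> C) : good A1 D0 w -> (forall k, k \in A2 -> w k = x k) ->
  Term q A1 D0 w = Pre q D0 x * Ahp A2 D0 x *
    \sum_(B : {set I} | B \subset T0) HS A1 D0 w (be |: B)%SET * PS (T0 :\: B)%SET H.
Proof.
move=> g e; rewrite /Term (redw g e) (@Pre_ext _ _ _ _ D0 w x) => [|i /D02]; last exact: e.
have -> : (A1 :\: D0)%SET = (be |: T0)%SET.
  apply/setP => k; rewrite !inE; case: (eqVneq k be) => [->|] //=.
  by rewrite bD0 ba bA.
congr (_ * _); rewrite (PS_U1 _ bT); apply: eq_bigr => B BT; congr (_ * _).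
apply: PS_ext => W W0 WT; apply: HSw => //.
exact: (fintype.subset_trans WT (finset.subsetDl _ _)).
Qed.

Let sum_T0 (f : {set I} -> C) : \sum_(B : {set I} | B \subset T0) f B * PS (T0 :\: B)%SET H =
  f finset.set0 * PS T0 H + \sum_(W : {set I} | (W \subset T0) && (W != finset.set0)) f W * PS (T0 :\: W)%SET H.
Proof. by rewrite (bigD1 finset.set0) ?finset.sub0set //= finset.setD0. Qed.

(** The contribution is -Pre(D0) kk F G / t^2 with kk = 1 at the collision, so the residue is
    -Pre(D0) times (kk' F G + F' G + F G'). Here kk' gives psi'/psi and the H-part of the new block
    {be}, F' the A_E-part of that block, and G' the blocks to which be is adjoined. *)
Lemma case_both : near' z0 (fun z : R[i]^o => good A D (y z)) /\ 
  pol (fun z : R[i]^o => Term q A D (y z)) z0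
  (Term q A1 D0 x + Term q A1 D0 x'
   - (- 2 * (ln q)%:C - logder (@Gamma R) (1 - b) - logder (@Gamma R) (1 + b)) * Term q A2 D0 x).
Proof.
split; first exact: (NG n0).
set ps := _ - _ - _.
have gb : (forall k : nat, 1 - b + k%:R != 0) /\ (forall k : nat, 1 + b + k%:R != 0).
  by split=> k; have [] := gam k.
have [nb nb'] := nb2.
have [hbb hbb'] := nadd bA1 bA1.
have [_ gn _] := ldr_gfac0 ZrQ zetaE q gb.1 gb.2 bal_D0.
pose c0 := gfac0 zeta q D0 x b * zeta (1 + 2 * b).
have c00 : c0 != 0 by apply: mulf_neq0 => //; exact: (nice_zeta zetaE).
have Zr00 : Zr 0 != 0 by rewrite Zr0 oner_neq0.
have l1 := @ldr_comp _ Zr (-1) (- b) z0.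
have e1 : -1 * z0 - b = 0 by rewrite mulN1r opprK subrr.
rewrite e1 in l1; have {}l1 := l1 (ZrQ 0) Zr00.
have l2 := @ldr_comp _ Zr 1 b z0.
have e2 : 1 * z0 + b = 0 by rewrite mul1r addNr.
rewrite e2 in l2; have {}l2 := l2 (ZrQ 0) Zr00.
have l3 := ldr_cst z0 c00.
have l4 := ldr_g DA2.
have l5 := @ldr_zetaF _ _ _ ZrQ zetaE (fun z => 2 * z) 2 0 z0 (fun z => esym (addr0 _)) nb'.
have m6 : nice (- z0 + b) by rewrite opprK.
have l6 := @ldr_zetaF _ _ _ ZrQ zetaE (fun z => - z + b) (-1) b z0
  (fun z => congr1 (+%R^~ b) (esym (mulN1r z))) m6.
have l7 := @ldr_zetaF _ _ _ ZrQ zetaE (fun z => z - b) 1 (- b) z0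
  (fun z => congr1 (+%R^~ (- b)) (esym (mul1r z))) hbb'.
have [kQ _ kd] := ldr_mul (ldr_mul l1 l2) (ldr_div (ldr_mul (ldr_mul l3 l4) l5) (ldr_mul l6 l7)).
set kk := (fun z : R[i]^o => _) in kQ kd.
have kk1 : kk z0 = 1.
  (* The powers of q and the Gamma factors cancel through gfac0(b) gfac0(-b) = 1; the values zeta(1
     + 2b) and zeta(1 - 2b) occur once above and once below. *)
  rewrite /kk e1 e2 Zr0 !mul1r /c0 opprK.
  have := gfac0_mulN zetaE q gb.1 gb.2 bal_D0.
  have -> : 2 * b = b + b by ring.
  have -> : 2 * - b = - b - b by ring.
  have := nice_zeta zetaE hbb; have := nice_zeta zetaE hbb'.
  move: (zeta _) (zeta _) (gfac0 _ _ _ _ _) (gfac0 _ _ _ _ _) => v1 v2 v3 v4 h1 h2 e.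
  transitivity (v4 * v3 * (v1 / v1) * (v2 / v2)); last by rewrite e !divff // !mulr1.
  by rewrite invfM; ring.
(* H is written as HS minus [Psi]: the [Psi] terms then cancel those of F', and complete functions
   HS remain. *)
have kd1 : dd kk z0 1 = ps - HS A1 D0 x [set be]%SET - HS A1 D0 x' [set be]%SET
    + Psi AE [set be]%SET A1 A1 (pt (flip D0 x) x) + Psi AE [set be]%SET A1 A1 (pt (flip D0 x') x').
  have kd' := kd; rewrite -/(kk z0) kk1 mulr1 in kd'; rewrite kd' /HS.
  rewrite (HD1 zeta D0 be x) (HD1 zeta D0 be x') x'b.
  rewrite (@HDe_ext _ _ zeta D0 x' x) => [|i /D02]; last exact: x'2.
  move: (Psi _ _ _ _ (pt _ x)) (Psi _ _ _ _ (pt _ x')) => v1 v2.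
  have -> : \sum_(k in D0) (Lz (z0 + x k) - Lz (- z0 - x k) + Lz (- z0 + x k) - Lz (z0 - x k)) =
      - (\sum_(k in D0) (Lz (b - x k) - Lz (b + x k)) + \sum_(k in D0) (Lz (z0 - x k) - Lz (z0 + x k))).
    rewrite -big_split -sumrN; apply: eq_bigr => k _; rewrite opprK /=.
    by move: (Lz _) (Lz _) (Lz _) (Lz _) => w1 w2 w3 w4; ring.
  rewrite /ps /HDe !opprK.
  have -> : 2 * b = b + b by ring.
  have -> : 2 * - b = - b - b by ring.
  move: (\sum_(k in D0) _) (\sum_(k in D0) _) (logder Zr 0) (logder (@Gamma R) _) (logder (@Gamma R) _) => w1 w2 w3 w4 w5.
  by move: (Lz (b + b)) (Lz (- b - b)) ((ln q)%:C) => w6 w7 w8; ring.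
pose F (z : R[i]^o) := Psi AE finset.set0 A A (pt (flip D (y z)) (y z)).
pose G (z : R[i]^o) := PS T0 (HS A D (y z)).
have FQ : Q nmo F z0 := PsiQ finset.set0.
have GQ : Q nmo G z0 by apply: (PS_Q nmV) => W W0 WT; exact: HSQ.
have F0 : F z0 = Ahp A2 D0 x by rewrite /F /Psi eqxx red0.
have G0 : G z0 = PS T0 H by apply: PS_ext => W _; exact: HS_y0.
have dF : dd F z0 1 = - (Psi AE [set be]%SET A1 A1 (pt (flip D0 x) x)
    + Psi AE [set be]%SET A1 A1 (pt (flip D0 x') x')) * Ahp A2 D0 x.
  have /WN[aW bW] : finset.set0 \subset T0 by exact: finset.sub0set.
  by rewrite /F (dd_Psi aW bW) eqxx finset.setU0.
have dG : dd G z0 1 = \sum_(W : {set I} | (W \subset T0) && (W != finset.set0))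
    - (HS A1 D0 x (be |: W)%SET + HS A1 D0 x' (be |: W)%SET) * PS (T0 :\: W)%SET H.
  rewrite (dd_PS nmV (h := fun z : R[i]^o => HS A D (y z))) => [|W W0 WT]; last exact: HSQ.
  apply: eq_bigr => W /andP[WT W0]; rewrite dd_HS //; congr (_ * _).
  apply: PS_ext => W' _ WT'; apply: HS_y0.
  exact: (fintype.subset_trans WT' (finset.subsetDl _ _)).
have FGQ : Q nmo (fun z => F z * G z) z0 by apply: (Q_mul nmV).
(* The sign comes from zeta(1 + t) zeta(1 - t) = -Zr(t) Zr(-t) / t^2. *)
exists (fun z => - (Pre q D0 x) * (kk z * (F z * G z))); split.
- by apply: (Q_mul nmV); [exact: Q_cst|apply: (Q_mul nmV)].
- apply: near'S near_t => z [t0 _].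
  have yD i : i \in D0 -> y z i = x i by move=> /D02; exact: y2.
  rewrite zzE /Term (Pre_U1 _ _ _ abD) (Pre_U1 _ _ _ bD0) yb setv1 (Pre_ext _ _ yD) (gfac_ext _ _ _ yD).
  rewrite ADE gfacE /F /G {1}/Psi eqxx.
  have -> : gfac zeta q (be |: D0)%SET (y z) z = gfac0 zeta q D0 x z * zeta (1 + 2 * z) * zfac zeta z b.
    rewrite /gfac (big_setU1 _ bD0) yb /= /gfac0.
    have -> : \prod_(k in D0) zfac zeta z (y z k) = \prod_(k in D0) zfac zeta z (x k).
      by apply: eq_bigr => k /yD ->.
    move: (cpow _ _) (Gamma _ / _) (zeta _) (zfac _ _ _) (\prod_(k in D0) _) => w1 w2 w3 w4 w5.
    by ring.
  have tm : - z - b != 0 by rewrite -opprD oppr_eq0.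
  rewrite /zfac /kk /c0 (zetaE t0) (zetaE tm).
  rewrite mulN1r mul1r.
  move: (PS _ _) (Ah _ _ _ _) (gfac0 _ _ _ _ _) (gfac0 _ _ _ _ _) => w1 w2 w3 w4.
  rewrite !invfM; move: (zeta _)^-1 (zeta _)^-1 (zeta _) (zeta _) (Pre _ _ _) => w5 w6 w7 w8 w9.
  have -> : - z - b = - (z + b) by rewrite opprD.
  move: (z + b) t0 (Zr _) => t t0 w10; move: (Zr _) => w11.
  by field.
rewrite (dd_mul nmV); [|exact: Q_cst|exact: (Q_mul nmV)].
rewrite dd_cst mul0r addr0 (dd_mul nmV) // (dd_mul nmV) // kk1 kd1 dF dG F0 G0.
rewrite (A1T g1) // (A1T g2) // !sum_T0 !finset.setU0 /Term.
have -> : \sum_(W : {set I} | (W \subset T0) && (W != finset.set0))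
    - (HS A1 D0 x (be |: W)%SET + HS A1 D0 x' (be |: W)%SET) * PS (T0 :\: W)%SET H =
  - (\sum_(W : {set I} | (W \subset T0) && (W != finset.set0)) HS A1 D0 x (be |: W)%SET * PS (T0 :\: W)%SET H
   + \sum_(W : {set I} | (W \subset T0) && (W != finset.set0)) HS A1 D0 x' (be |: W)%SET * PS (T0 :\: W)%SET H).
  by rewrite -big_split -sumrN; apply: eq_bigr => W _; rewrite /= mulNr mulrDl.
move: (\sum_(W | _) _) (\sum_(W | _) _) => s1 s2.
move: (PS _ _) (Pre _ _ _) (Psi _ _ _ _ (pt _ x)) (Psi _ _ _ _ (pt _ x')) => w1 w2 w3 w4.
move: (HS _ _ x _) (HS _ _ x' _) (Ah _ _ _ _) => w5 w6 w7.
by ring.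
Qed.

End Both.
End Collision.

(** * The residue at 0 *)

Section AtZero.
Variables (R : realType) (n : nat).
Local Notation C := R[i].
Local Notation nm := (@normc R).
Local Notation nmo := (nm : R[i]^o -> R).
Local Notation I := 'I_n.
Let nmV := @nm_vnorm R.
Variables (zeta Zr : C -> C).
Hypothesis ZrQ : forall t, Q nmo Zr t.
Hypothesis Zr0 : Zr 0 = 1.
Hypothesis zetaE : forall t, t != 0 -> zeta (1 + t) = Zr t / t.
Variables (E : weierstrass) (M : nat).
Hypothesis Mp : prime M.
Variables (Omega : set C) (AE : AE_family R n).
Hypothesis oO : open Omega.
Hypothesis cO : connected Omega.
Hypothesis O0 : Omega 0.
Hypothesis hAE : is_AE zeta E M Omega AE.
Hypothesis ON : forall z, Omega z -> Omega (- z).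
Implicit Types (A B D W : {set I}) (x y : I -> C) (q : R).
Local Notation nice := (nice Zr).
Local Notation Lz := (Lz zeta).
Local Notation ell := (ell Zr).
Local Notation good := (good Zr E M Omega AE).
Local Notation HS := (HS zeta AE).
Local Notation HDe := (HDe zeta).
Local Notation Term := (Term zeta AE).
Local Notation Pre := (Pre zeta).
Local Notation Ahp A D y := (Ah AE A A (pt (flip D y) y)).
Local Notation Vfac c := (1 - (lambda_p R E M)%:C * cpow M%:R (- (1 / 2%:R) - c)).

(** [generic] constrains the other variables only. If zeros of V accumulated at 0, V would vanish
    near 0, but it is nonzero at every positive real. *)
Lemma Vfac_near0 : near' 0 (fun z : R[i]^o => Vfac z != 0 /\ Vfac (- z) != 0).
Proof.
have VQ a : Q nmo (fun z : R[i]^o => Vfac z) a.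
  by apply: (Vfactor_Q E M nmV (F := fun z : R[i]^o => z : C)); exact: Q_idC.
have [r r0 hr] : near' 0 (fun z : R[i]^o => Vfac z != 0).
  apply: contrapT => no.
  have [r r0 hr] : near_at nmo 0 (fun z : R[i]^o => Vfac z = 0).
    apply: (isolated_zero (VQ 0)) => e e0; apply: contrapT => no'; apply: no.
    exists e => // z ze z0; apply/eqP => vz; apply: no'; by exists z.
  have t0 : 0 < r / 2 by rewrite divr_gt0.
  have := Vfactor_neq0 E Mp t0; rewrite hr ?eqxx // subr0 nm_real gtr0_norm //.
  by rewrite gtr_pMr // invf_lt1 // ltr1n.
exists r => // z zr z0; split; first exact: hr.
by apply: hr; rewrite ?oppr_eq0 // subr0 nmN -[z]subr0.
Qed.

Variables (A : {set I}) (al : I) (x : I -> C) (q : R).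
Hypothesis aA : al \in A.
Hypothesis gx : generic zeta E M AE Omega (A :\ al)%SET x.
Local Notation A1 := (A :\ al)%SET.
Local Notation y := (setv x al).

Let gg D : D \subset A1 -> good A1 D x.
Proof. exact: (generic_good ZrQ Zr0 zetaE oO cO O0 hAE ON gx). Qed.

Let A1P k : k \in A1 -> k != al /\ k \in A.
Proof. by rewrite !inE => /andP[]. Qed.

Let n1 k : k \in A1 -> nice (x k) /\ nice (- x k).
Proof.
move=> kA; have k0 := generic_nz gx kA; have [m1 m2] := generic_mem x kA.
have m0 : 0 \in 0 :: [seq x i | i in A1] ++ [seq - x i | i in A1] by rewrite inE eqxx.
have h1 := generic_Zr Zr0 zetaE gx m0 m1; have h2 := generic_Zr Zr0 zetaE gx m0 m2.
by rewrite !add0r in h1 h2; split; split; rewrite ?oppr_eq0.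
Qed.

Let OT D : OmT Omega A A (pt (flip D (y 0)) (y 0)).
Proof.
have OmS i : i \in A -> Omega (y 0 i).
  move=> iA; case: (eqVneq i al) => [->|ia]; first by rewrite setv1.
  by rewrite setvN //; have [h _ _ _ _] := gx; have [] := h i _; rewrite // !inE ia.
split=> i iA /=; last exact: OmS.
by rewrite /flip; case: ifP => _; [apply: ON|]; apply: OmS.
Qed.

Let NG D : Ahp A D (y 0) != 0 -> near' 0 (fun z : R[i]^o => good A D (y z)).
Proof.
have m0 : 0 \in 0 :: [seq x i | i in A1] ++ [seq - x i | i in A1] by rewrite inE eqxx.
move=> hA; apply: (near_generic ZrQ Zr0 zetaE oO cO O0 hAE ON aA gx m0) => //; first by rewrite oppr0.
exact: Vfac_near0.
Qed.

Let n2z : near' 0 (fun z : R[i]^o => nice (2 * z)).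
Proof.
have c2 : (2 : C) != 0 by rewrite pnatr_eq0.
have h : Zr (2 * 0 + 0) != 0 by rewrite mulr0 addr0 Zr0 oner_neq0.
by apply: near'S (near'_nice ZrQ c2 h) => z; rewrite addr0.
Qed.

Let comp2 (g : C -> C) : Q nmo g 0 -> Q nmo (fun z : R[i]^o => g (2 * z)) 0.
Proof.
move=> gQ; apply: (Q_comp nmV (F := fun z : R[i]^o => 2 * z)); last by rewrite mulr0.
by apply: (Q_mul nmV (F' := fun z : R[i]^o => z : C)); [exact: Q_cst|exact: Q_idC].
Qed.

Let Zr00 : Zr 0 != 0. Proof. by rewrite Zr0 oner_neq0. Qed.

(** The pole is in H_D({al}): -Lz(2z) = 1/(2z) - ell(2z), with residue 1/2. *)
Lemma zero_out D0 : D0 \subset A1 -> near' 0 (fun z : R[i]^o => good A D0 (y z)) /\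
  pol (fun z : R[i]^o => Term q A D0 (y z)) 0 (2^-1 * Term q A1 D0 x).
Proof.
move=> DA1; have aD : al \notin D0 by apply/negP => /(fintype.subsetP DA1)/A1P[]; rewrite eqxx.
have hA : Ahp A D0 (y 0) != 0.
  by rewrite (Ah_const ZrQ Zr0 zetaE oO cO O0 hAE) //; have [_ _ _ _] := gg DA1.
split; first exact: NG.
apply: (Term_out_simple ZrQ Zr0 zetaE oO cO O0 hAE ON) => //; first exact: NG.
  by move=> v; rewrite inE add0r => /andP[_ /n1[]].
have pr : pol (fun z : R[i]^o => \sum_(i in D0) (Lz (1 * z - x i) - Lz (1 * z + x i)) - ell (2 * z)
    + Psi AE [set al]%SET A A (pt (flip D0 (y z)) (y z))) 0 0.
  apply: pol_Q; apply: (Q_add nmV); last by apply: (Psi_path_Q hAE nmV) => // i; exact: setv_Q.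
  apply: (Q_sub nmV); last by apply: comp2; exact: (ell_Q ZrQ).
  apply: (Q_sum nmV) => i /(fintype.subsetP DA1)/n1[k1 k2].
  apply: (Q_sub nmV).
    by apply: (Q_Lz ZrQ zetaE nmV (F := fun z : R[i]^o => 1 * z - x i)); [rewrite mulr0 add0r|exact: Q_affine].
  by apply: (Q_Lz ZrQ zetaE nmV (F := fun z : R[i]^o => 1 * z + x i)); [rewrite mulr0 add0r|exact: Q_affine].
have pi : pol (fun z : R[i]^o => 2^-1 * (z : C)^-1) 0 (2^-1 * 1).
  apply: pol_cM; apply: (@pol1 _ (fun=> 1)); first exact: Q_cst.
  by apply: near'W; apply: nearT => z; rewrite subr0 mul1r.
rewrite -[2^-1]mulr1 -[X in pol _ _ X]addr0; apply: pol_ext (pol_add pi pr); apply: near'S n2z => z hz.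
rewrite /HS (HD1 zeta D0 al (y z)) setv1.
have -> : HDe D0 (y z) z = \sum_(i in D0) (Lz (1 * z - x i) - Lz (1 * z + x i)) - Lz (2 * z).
  congr (_ - _); apply: eq_bigr => i /(fintype.subsetP DA1)/A1P[ia _].
  by rewrite setvN // mul1r.
rewrite (LzE ZrQ zetaE hz) invfM.
by move: (\sum_(i in D0) _) (ell _) (Psi _ _ _ _ _) (2^-1 / _) => w1 w2 w3 w4; ring.
Qed.

(** The pole is in the front factor: zeta(1 + 2z) = Zr(2z) / (2z), multiplied by gfac0 = -1 at 0. At
    z = 0 the sign change of al has no effect, so all other factors reduce to those without al. *)
Lemma zero_in D0 : D0 \subset A1 -> near' 0 (fun z : R[i]^o => good A (al |: D0)%SET (y z)) /\
  pol (fun z : R[i]^o => Term q A (al |: D0)%SET (y z)) 0 (- 2^-1 * Term q A1 D0 x).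
Proof.
move=> DA1; set D := (al |: D0)%SET.
have aD0 : al \notin D0 by apply/negP => /(fintype.subsetP DA1)/A1P[]; rewrite eqxx.
have aD : al \in D by rewrite !inE eqxx.
have eal : pt (flip D (y 0)) (y 0) (inl al) = pt (flip D (y 0)) (y 0) (inr al).
  by rewrite /= /flip aD setv1 oppr0.
have ag : agree A1 A1 (pt (flip D (y 0)) (y 0)) (pt (flip D0 x) x).
  split=> k kA; have [ka _] := A1P kA; rewrite /= ?setvN //.
  by rewrite /flip !inE (negPf ka) /= setvN.
have h1 := OmTD1 al al (OT D).
have eA : Ahp A D (y 0) = Ahp A1 D0 x.
  rewrite (Ah_cancel ZrQ Zr0 zetaE oO cO O0 hAE (OT D) aA aA eal).
  exact: (Ah_local oO cO O0 hAE h1 ag).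
have hA : Ahp A D (y 0) != 0 by rewrite eA; have [_ _ _ _] := gg DA1.
split; first exact: NG.
have eP W : al \notin W -> Psi AE W A A (pt (flip D (y 0)) (y 0)) = Psi AE W A1 A1 (pt (flip D0 x) x).
  move=> aW; rewrite (Psi_cancel ZrQ Zr0 zetaE oO cO O0 hAE (OT D) hA aA aW aA eal).
  apply: (Psi_local oO cO O0 hAE W h1 _ ag).
  by rewrite -(Ah_cancel ZrQ Zr0 zetaE oO cO O0 hAE (OT D) aA aA eal).
have TE : (A :\: D)%SET = (A1 :\: D0)%SET.
  by apply/setP => k; rewrite !inE negb_or; case: (k == al); rewrite ?andbF.
have TA k : k \in (A1 :\: D0)%SET -> k \in A1 by rewrite inE => /andP[].
have [_ gA gS _ _] := gg (finset.sub0set A1).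
have HQ W : W \subset (A1 :\: D0)%SET -> Q nmo (fun z : R[i]^o => HS A D (y z) W) 0.
  move=> WT; have wA w : w \in W -> [/\ w \in A1, w \notin D0 & y 0 w = x w].
    move=> /(fintype.subsetP WT); rewrite inE => /andP[wD wA]; split=> //.
    by have [wa _] := A1P wA; rewrite setvN.
  apply: (HS_Q ZrQ zetaE hAE) => // [w e|w w' ww e].
    have [wA1 wD ->] : [/\ w \in A1, w \notin D0 & y 0 w = x w] by apply: wA; rewrite e inE.
    split; last by have [h _] := gA w w wA1 wA1; have -> : 2 * x w = x w + x w by ring.
    move=> i; rewrite !inE => /orP[/eqP ->|iD].
      by rewrite setv1 subr0 addr0; have [] := n1 wA1.
    have iA := fintype.subsetP DA1 i iD; have [ia _] := A1P iA; rewrite setvN //.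
    split; last by have [] := gA w i wA1 iA.
    by apply: gS => //; apply: contraNneq wD => ->.
  have [wA1 _ ->] : [/\ w \in A1, w \notin D0 & y 0 w = x w] by apply: wA; rewrite e !inE eqxx.
  have [wA1' _ ->] : [/\ w' \in A1, w' \notin D0 & y 0 w' = x w'] by apply: wA; rewrite e !inE eqxx orbT.
  by have [] := gA w w' wA1 wA1'.
have H0 W : W \subset (A1 :\: D0)%SET -> HS A D (y 0) W = HS A1 D0 x W.
  move=> WT.
  have aW : al \notin W by apply/negP => /(fintype.subsetP WT)/TA/A1P[]; rewrite eqxx.
  have wy w : w \in W -> y 0 w = x w by move=> /(fintype.subsetP WT)/TA/A1P[wa _]; rewrite setvN.
  suff eH : HD zeta D W (y 0) = HD zeta D0 W x by rewrite /HS (eP W aW) eH.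
  have [e0|[w e0]|[w [w' [ww e0]]]|h] := small_set W.
  - by rewrite e0 (HD0 zeta D0 x) (HD0 zeta D (y 0)).
  - have wW : w \in W by rewrite e0 inE.
    (* al enters H_D({w}) through Lz(c - 0) - Lz(c + 0) = 0. *)
    rewrite e0 (HD1 zeta D w (y 0)) (HD1 zeta D0 w x) (wy w wW) /D (HDe_U1 _ _ _ aD0) setv1 subr0 addr0.
    rewrite subrr add0r; apply: HDe_ext => i /(fintype.subsetP DA1)/A1P[ia _].
    by rewrite setvN.
  - by rewrite e0 (HD2 zeta D0 x ww) (HD2 zeta D (y 0) ww) (wy w) ?(wy w') // e0 !inE eqxx ?orbT.
  - by rewrite (HD3 zeta D (y 0) h) (HD3 zeta D0 x h).
have nD k : k \in D0 -> nice (x k) /\ nice (- x k) by move=> /(fintype.subsetP DA1)/n1.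
have ga (k : nat) : 1 - 0 + k%:R != 0 :> C by rewrite subr0 nat1r pnatr_eq0.
have ga' (k : nat) : 1 + 0 + k%:R != 0 :> C by rewrite addr0 nat1r pnatr_eq0.
have nD4 k : k \in D0 -> [/\ nice (0 + x k), nice (- 0 - x k), nice (0 - x k) & nice (- 0 + x k)].
  by move=> /nD[? ?]; rewrite oppr0 !add0r.
have [gQ _ _] := ldr_gfac0 ZrQ zetaE q ga ga' nD4.
pose G (z : R[i]^o) := PS (A1 :\: D0)%SET (HS A D (y z)).
pose F (z : R[i]^o) := Psi AE finset.set0 A A (pt (flip D (y z)) (y z)).
pose u (z : R[i]^o) := Pre q D0 x * 2^-1 * (gfac0 zeta q D0 x z * Zr (2 * z)) * F z * G z.
have uQ : Q nmo u 0.
  apply: (Q_mul nmV); last by apply: (PS_Q nmV) => W _; exact: HQ.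
  apply: (Q_mul nmV); last by apply: (Psi_path_Q hAE nmV) => // i; exact: setv_Q.
  apply: (Q_mul nmV); first exact: Q_cst.
  by apply: (Q_mul nmV) => //; apply: comp2.
have -> : - 2^-1 * Term q A1 D0 x = u 0.
  rewrite /u /F /G /Term (gfac0_0 zetaE q nD) mulr0 Zr0 {1}/Psi eqxx eA.
  rewrite (@PS_ext _ _ _ (HS A D (y 0)) (HS A1 D0 x)) => [|W _]; last exact: H0.
  by move: (Pre _ _ _) (Ah _ _ _ _) (PS _ _) => w1 w2 w3; ring.
apply: pol1 => //; apply: near'S n2z => z hz.
have yD i : i \in D0 -> y z i = x i by move=> /(fintype.subsetP DA1)/A1P[ia _]; rewrite setvN.
rewrite subr0 /Term TE (Pre_U1 _ _ _ aD0) setv1 (Pre_ext _ _ yD) (gfac_ext _ _ _ yD) gfacE.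
have [t0 _] := hz; rewrite (zetaE t0) /u /F /G {1}/Psi eqxx invfM.
by move: (Pre _ _ _) (Ah _ _ _ _) (PS _ _) (gfac0 _ _ _ _ _) (Zr _) (2^-1) (z^-1) => w1 w2 w3 w4 w5 w6 w7; ring.
Qed.

End AtZero.

(** * Assembling the residues *)

Lemma sum_subsets (F : zmodType) (T : finType) (S : {set T}) (a : T) (f : {set T} -> F) : a \in S ->
  \sum_(D : {set T} | D \subset S) f D =
  \sum_(D : {set T} | D \subset (S :\ a)%SET) (f D + f (a |: D)%SET).
Proof.
move=> aS; rewrite big_split /= (bigID (fun D : {set T} => a \in D)) /= addrC; congr (_ + _).
  by apply: eq_bigl => D; rewrite finset.subsetD1.
rewrite (reindex_onto (fun D => a |: D)%SET (fun D => D :\ a)%SET) /=; last first.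
  by move=> D /andP[_ aD]; rewrite finset.setD1K.
apply: eq_bigl => D; rewrite !inE eqxx andbT finset.subsetD1 finset.subUset finset.sub1set aS /=.
apply/andP/andP => [[DS /eqP e]|[DS aD]]; split=> //; last by rewrite setU1K.
by rewrite -e !inE eqxx.
Qed.

Lemma subset_ind1 (T : finType) (S : {set T}) (a : T) (P : {set T} -> Prop) :
  (forall D : {set T}, D \subset (S :\ a)%SET -> P D /\ P (a |: D)%SET) ->
  forall D : {set T}, D \subset S -> P D.
Proof.
move=> h D DS; have [h1 h2] : P (D :\ a)%SET /\ P (a |: (D :\ a))%SET.
  by apply: h; apply: finset.setSD.
case: (boolP (a \in D)) => aD; first by rewrite -(finset.setD1K aD).
by have -> : D = (D :\ a)%SET; [apply/setP => k; rewrite !inE; case: eqP => // ->; apply/negbTE|].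
Qed.

(** For the d in the sum the sign in front of psi is 1. The base of the power is 1/q, whose
    logarithm gives the term -2 log q; the two Gamma quotients contribute at 1 - b and 1 + b. *)
Lemma psi_logder (R : realType) (M d : nat) (omega : int) (b : R[i]) : (0 < M)%N -> (0 < d)%N ->
  kronecker d%:Z (- M%:Z) * omega = 1 ->
  (forall k : nat, 1 - b + k%:R != 0) -> (forall k : nat, 1 + b + k%:R != 0) ->
  logder (psi M omega d) (1 / 2%:R + b) =
  - 2 * (ln (Num.sqrt M%:R * d%:R / (2 * pi) : R))%:C
  - logder (@Gamma R) (1 - b) - logder (@Gamma R) (1 + b).
Proof.
move=> M0 d0 kro g1 g2; set s0 := 1 / 2%:R + b; set q := _ / (2 * pi).
have n2 : (2 : R[i]) != 0 by rewrite pnatr_eq0.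
have q0 : 0 < q.
  by rewrite divr_gt0 ?mulr_gt0 ?sqrtr_gt0 ?ltr0n ?pi_gt0.
have l1 := ldr_cpow (2 * pi / (Num.sqrt M%:R * d%:R)) 2 (-1) s0.
have e2 : -1 * s0 + 3%:R / 2%:R = 1 - b by rewrite /s0; field.
have e3 : 1 * s0 + 1 / 2%:R = 1 + b by rewrite /s0; field.
have [_ n2'] := Gamma_cvg g1; have [_ n3'] := Gamma_cvg g2.
have l2 := @ldr_comp R (@Gamma R) (-1) (3%:R / 2%:R) s0.
rewrite e2 in l2; have {}l2 := l2 (Q_Gamma g1) n2'.
have l3 := @ldr_comp R (@Gamma R) 1 (1 / 2%:R) s0.
rewrite e3 in l3; have {}l3 := l3 (Q_Gamma g2) n3'.
have l0 := ldr_div (ldr_mul l1 l2) l3.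
have e : near_at (@normc R : R[i]^o -> R) s0 (fun z : R[i]^o =>
    cpow (2 * pi / (Num.sqrt M%:R * d%:R)) (2 * z - 1) * Gamma (-1 * z + 3%:R / 2%:R)
    / Gamma (1 * z + 1 / 2%:R) = psi M omega d z).
  by apply: nearT => z; rewrite /psi kro mulr1z mulN1r [- z + _]addrC !mul1r.
have [_ np dp] := ldr_ext e l0.
rewrite /logder -[derive1 (psi _ _ _) s0]dd1E dp mulfK // !mulN1r mul1r.
have -> : 2 * pi / (Num.sqrt M%:R * d%:R) = q^-1 by rewrite /q invf_div.
by rewrite lnV ?posrE // rmorphN mulrN mulNr.
Qed.

Lemma fundamental_gt0 d : fundamental d -> (0 < d)%N.
Proof. by case: d. Qed.

Lemma pol_sum0 (R : realType) (T : Type) (s : seq T) (P : pred T) (F : T -> R[i]^o -> R[i]) (z0 : R[i]^o) :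
  (forall i, P i -> pol (F i) z0 0) -> pol (fun z => \sum_(i <- s | P i) F i z) z0 0.
Proof. by move=> h; have := pol_sum s (r := fun=> 0) h; rewrite big1. Qed.

Theorem theorem5p4 (R : realType) (E : weierstrass) (M : nat) (omega : int)
    (X : R) (zeta : R[i] -> R[i]) (n : nat) (Omega : set R[i])
    (AE : AE_family R n) :
  prime_conductor E M ->
  is_root_number R E M omega ->
  is_riemann_zeta zeta ->
  open Omega -> connected Omega -> Omega 0 ->
  (forall z, Omega z -> Omega (- z)) ->
  is_AE zeta E M Omega AE ->
  let J := JE zeta E M AE omega X in
  (forall (A : {set 'I_n}) (al be : 'I_n) (x : 'I_n -> R[i]),
     al \in A -> be \in A -> al != be ->
     generic zeta E M AE Omega (A :\ al)%SET x ->
     generic zeta E M AE Omega (A :\ al)%SET (flip [set be]%SET x) ->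
     is_residue (fun z => J A finset.set0 [eta x with al |-> z]) (- x be)
       (J (A :\ al)%SET finset.set0 x
        + J (A :\ al)%SET finset.set0 (flip [set be]%SET x)
        - J (A :\ al :\ be)%SET [set be]%SET x)) /\
  (forall (A : {set 'I_n}) (al : 'I_n) (x : 'I_n -> R[i]),
     al \in A ->
     generic zeta E M AE Omega (A :\ al)%SET x ->
     is_residue (fun z => J A finset.set0 [eta x with al |-> z]) 0 0).
Proof.
move=> [Mp _ _ _] _ hzeta oO cO O0 ON hAE J.
have [Zr [ZrQ Zr0 zetaE]] := zeta_laurent hzeta.
have JT := JE_Term ZrQ Zr0 zetaE Mp oO cO O0 hAE ON omega X.
have gg A x D := @generic_good _ _ _ _ ZrQ Zr0 zetaE E M Omega AE oO cO O0 hAE ON A D x.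
have near_sub (T : finType) (z0 : R[i]^o) (S : {set T}) (P : {set T} -> R[i]^o -> Prop) :
    (forall D : {set T}, D \subset S -> near' z0 (P D)) ->
    near' z0 (fun z => forall D : {set T}, D \subset S -> P D z).
  move=> h; apply: near'_all => D; case: (boolP (D \subset S)) => DS.
    by apply: near'S (h D DS) => z hz _.
  by apply: near'W; apply: nearT.
pose q (d : nat) : R := Num.sqrt M%:R * d%:R / (2 * pi).
split=> [A al be x aA bA ab gx gx'|A al x aA gx]; apply: pol_residue; last first.
  have hall (D : {set 'I_n}) : D \subset A -> near' 0 (fun z : R[i]^o => good Zr E M Omega AE A D (setv x al z)).
    move: D; apply: (subset_ind1 (a := al)) => D DA1.
    (* Only the regularity off the pole is used here and it does not involve q, so the value 1 is
       arbitrary. *)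
    have [h1 _] := zero_out ZrQ Zr0 zetaE Mp oO cO O0 hAE ON 1 aA gx DA1.
    by have [h2 _] := zero_in ZrQ Zr0 zetaE Mp oO cO O0 hAE ON 1 aA gx DA1.
  apply: (@pol_ext _ (fun z : R[i]^o =>
     \sum_(1 <= d < (Num.truncn X).+1 | fundamental d && (kronecker d%:Z (- M%:Z) * omega == 1))
     \sum_(D : {set 'I_n} | D \subset (A :\ al)%SET)
       (Term zeta AE (q d) A D (setv x al z) + Term zeta AE (q d) A (al |: D)%SET (setv x al z)))).
    apply: near'S (near_sub _ _ _ _ hall) => z hz; rewrite -[LHS]/(J A finset.set0 (setv x al z)) /J JT //.
    by apply: eq_bigr => d _; rewrite big_set0 mul1r (sum_subsets _ aA).
  apply: pol_sum0 => d _; apply: pol_sum0 => D DA1.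
  have [_ h1] := zero_out ZrQ Zr0 zetaE Mp oO cO O0 hAE ON (q d) aA gx DA1.
  have [_ h2] := zero_in ZrQ Zr0 zetaE Mp oO cO O0 hAE ON (q d) aA gx DA1.
  (* The residues 1/2 and -1/2 multiply the same summand. *)
  by have := pol_add h1 h2; rewrite -mulrDl subrr mul0r.
have bA1 : be \in (A :\ al)%SET by rewrite !inE eq_sym ab.
have cn d D DA2 := @case_none _ _ _ _ ZrQ Zr0 zetaE E M Omega AE oO cO O0 hAE ON A al be x (q d) aA bA ab gx D DA2.
have cb d D DA2 := @case_be _ _ _ _ ZrQ Zr0 zetaE E M Omega AE oO cO O0 hAE ON A al be x (q d) aA bA ab gx D DA2.
have ca d D DA2 := @case_al _ _ _ _ ZrQ Zr0 zetaE E M Omega AE oO cO O0 hAE ON A al be x (q d) aA bA ab gx gx' D DA2.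
have cc d D DA2 := @case_both _ _ _ _ ZrQ Zr0 zetaE E M Omega AE oO cO O0 hAE ON A al be x (q d) aA bA ab gx gx' D DA2.
have hall (D : {set 'I_n}) : D \subset A -> near' (- x be) (fun z : R[i]^o => good Zr E M Omega AE A D (setv x al z)).
  move: D; apply: (subset_ind1 (a := al)) => D.
  move: D; apply: (subset_ind1 (a := be)) => D DA2.
  have [h1 _] := cn 1%N D DA2; have [h2 _] := cb 1%N D DA2.
  by have [h3 _] := ca 1%N D DA2; have [h4 _] := cc 1%N D DA2.
have [gA _ _ _ _] := gx; have [_ hb] := gA be bA1.
have gb : (forall k : nat, 1 - x be + k%:R != 0) /\ (forall k : nat, 1 + x be + k%:R != 0).
  by split=> k; have [] := nonint_shift hb k.
(* The subsets of A are grouped by their trace on {al, be}: each D avoiding both brings four sets,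
   one for each of the four cases. *)
apply: (@pol_ext _ (fun z : R[i]^o =>
     \sum_(1 <= d < (Num.truncn X).+1 | fundamental d && (kronecker d%:Z (- M%:Z) * omega == 1))
     \sum_(D : {set 'I_n} | D \subset (A :\ al :\ be)%SET)
       ((Term zeta AE (q d) A D (setv x al z) + Term zeta AE (q d) A (al |: D)%SET (setv x al z)) +
        (Term zeta AE (q d) A (be |: D)%SET (setv x al z) + Term zeta AE (q d) A (al |: (be |: D))%SET (setv x al z))))).
  apply: near'S (near_sub _ _ _ _ hall) => z hz; rewrite -[LHS]/(J A finset.set0 (setv x al z)) /J JT //.
  by apply: eq_bigr => d _; rewrite big_set0 mul1r (sum_subsets _ aA) (sum_subsets _ bA1).
rewrite /J !JT; last 3 first.
- move=> D DA2; have DA1 := fintype.subset_trans DA2 (subD1set _ be).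
  exact: (good_sub ZrQ Zr0 zetaE oO cO O0 hAE ON DA2 (subD1set _ be) (gg _ _ _ gx DA1)).
- by move=> D; exact: gg.
- by move=> D; exact: gg.
rewrite -big_split -sumrB; apply: pol_sum => d /andP[fd /eqP kr].
rewrite !big_set0 finset.big_set1 (psi_logder (prime_gt0 Mp) (fundamental_gt0 fd) kr gb.1 gb.2).
rewrite !mul1r !(sum_subsets _ bA1) big_distrr.
rewrite -big_split -sumrB; apply: pol_sum => D DA2.
have [_ h1] := cn d D DA2; have [_ h2] := cb d D DA2.
have [_ h3] := ca d D DA2; have [_ h4] := cc d D DA2.
have := pol_add (pol_add h1 h3) (pol_add h2 h4).
set r := (X in pol _ _ X -> _); set r' := (X in _ -> pol _ _ X).
suff -> : r = r' by [].
rewrite /r /r' /=; move: (Term _ _ _ _ _ _) (Term _ _ _ _ _ _) (Term _ _ _ _ _ _) (Term _ _ _ _ _ _) (Term _ _ _ _ _ _) => w1 w2 w3 w4 w5.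
by ring.
Qed.
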